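(* Let $\ell\geq5$ be prime, $r$ an integer with $\gcd(r,24)=1$, $k\in\frac12\mathbb Z$, and $f=\sum a(n)q^{n/24}\in S_k(1,\nu_\eta^r)$ with $f\not\equiv0\pmod\ell$. Fix $\varepsilon\in\{\pm1\}$. Let $S$ be the set of primes $p$ such that (i) $f\,|\,U_p\equiv c_p\,f\,|\,V_p\pmod\ell$ for some $c_p\in\mathcal O_\ell$ with $c_p\not\equiv0\pmod\ell$, and (ii) $f\equiv\sum_{\left(\frac np\right)=\varepsilon}a(n)q^{n/24}+\sum_n a(p^2n)q^{p^2n/24}\pmod\ell$. Then at least one of the following holds: (1) $S$ has density zero in the set of primes; (2) $\#\{n\leq X: a(n)\not\equiv0\pmod\ell\}\ll\sqrt X\log X$, and $f\,|\,T_{Q^2}\equiv0\pmod\ell$ for all primes $Q\equiv-1\pmod\ell$.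
   Context: Let $q=e^{2\pi i\tau}$, $\eta(\tau)=q^{1/24}\prod_{n\ge1}(1-q^n)$, and $\nu_\eta$ the multiplier with $\eta(\gamma\tau)=\nu_\eta(\gamma)(c\tau+d)^{1/2}\eta(\tau)$ on $\mathrm{SL}_2(\mathbb Z)$. $S_k(1,\nu_\eta^r)$ is the space of holomorphic cusp forms $f$ with $f(\gamma\tau)=\nu_\eta(\gamma)^r(c\tau+d)^kf(\tau)$ for all $\gamma=\begin{pmatrix}a&b\\c&d\end{pmatrix}\in\mathrm{SL}_2(\mathbb Z)$ and with coefficients in $\mathcal O_\ell$, the ring of algebraic numbers integral at all primes above $\ell$; they have expansions $\sum_{n\equiv r\,(24)}a(n)q^{n/24}$. Congruence mod $\ell$ is coefficientwise in $\mathcal O_\ell$. $f|U_m=\sum a(mn)q^{n/24}$, $f|V_m=\sum a(n)q^{mn/24}$. For primes $Q\ge5$, $f|T_{Q^2}=\sum\left(a(Q^2n)+Q^{k-\frac32}\left(\frac{-1}{Q}\right)^{k-\frac12}\left(\frac{12n}{Q}\right)a(n)+Q^{2k-2}a\left(\frac n{Q^2}\right)\right)q^{n/24}$ with $a(x)=0$ for $x\notin\mathbb Z$. Density zero means $\#\{p\in S:p\le X\}/\#\{p\text{ prime}:p\le X\}\to0$. *)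

(* Defs.v *)
From HB Require Import structures.
From mathcomp Require Import all_boot all_order all_algebra.
From mathcomp Require Import all_classical all_reals all_analysis.
From mathcomp Require Import complex.
Set Implicit Arguments. Unset Strict Implicit. Unset Printing Implicit Defensive.
Import Order.TTheory GRing.Theory Num.Theory.
Import numFieldNormedType.Exports.
Local Open Scope ring_scope.

Section ModForms.
Variable R : realType.
Local Notation C := (R[i]).

Definition cexp (z : C) : C :=
  Complex (expR (complex.Re z) * cos (complex.Im z))
          (expR (complex.Re z) * sin (complex.Im z)).

Definition qpow24 (n : nat) (tau : C) : C :=
  cexp (Complex 0 (2 * pi * n%:R / 24%:R) * tau).

(* principal branch of the square root (argument in (-pi/2, pi/2]) *)
Definition psqrt (z : C) : C :=
  if complex.Im z < 0 then - sqrtC z else sqrtC z.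

Definition eta (tau : C) : C :=
  qpow24 1 tau *
  limn ((fun N : nat => \prod_(1 <= n < N.+1) (1 - qpow24 (24 * n) tau))
          : nat -> (C : numFieldType)).

Definition upper (tau : C) : Prop := 0 < complex.Im tau.

Definition SL2Z (a b c d : int) : Prop := a * d - b * c = 1.

Definition moebius (a b c d : int) (tau : C) : C :=
  (a%:~R * tau + b%:~R) / (c%:~R * tau + d%:~R).

Definition qseries (a : nat -> C) (tau : C) : C :=
  limn ((fun N : nat => \sum_(n < N) a n * qpow24 n tau)
          : nat -> (C : numFieldType)).

(* O_ell : algebraic numbers integral at every prime above ell, i.e. the
   integral closure of Z_(ell) : roots of monic polynomials over Q whose
   coefficients have denominators prime to ell. *)
Definition in_Oell (ell : nat) (x : C) : Prop :=
  exists p : {poly rat},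
    p \is monic /\ (forall i, ~~ (ell%:Z %| denq p`_i)%Z) /\
    root (map_poly (fun q : rat => ratr q : C) p) x.

Definition congl (ell : nat) (x y : C) : Prop := in_Oell ell ((x - y) / ell%:R).

Definition congf (ell : nat) (a b : nat -> C) : Prop :=
  forall n, congl ell (a n) (b n).

(* S_k(1, nu_eta^r), with k = k2/2.  f = sum_{n>=1} a(n) q^{n/24}
   (cusp form: no constant term / no negative exponents); the q-series
   converges on the upper half plane; the transformation law holds with
   nu_eta(gamma) := eta(gamma tau) / ((c tau + d)^{1/2} eta(tau)) and
   (c tau + d)^k := ((c tau + d)^{1/2})^{2k} (principal branch);
   coefficients in O_ell. *)
Definition cusp_form (ell : nat) (k2 r : int) (a : nat -> C) : Prop :=
  [/\ a 0%N = 0,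
      (forall n, in_Oell ell (a n)),
      (forall tau, upper tau ->
         cvgn ((fun N : nat => \sum_(n < N) a n * qpow24 n tau)
                 : nat -> (C : numFieldType))) &
      (forall (A B Cc D : int) tau, SL2Z A B Cc D -> upper tau ->
         qseries a (moebius A B Cc D tau) =
         (eta (moebius A B Cc D tau) /
            (psqrt (Cc%:~R * tau + D%:~R) * eta tau)) ^ r *
         psqrt (Cc%:~R * tau + D%:~R) ^ k2 * qseries a tau)].

(* Legendre symbol (n / p) via Euler's criterion (meaningful for odd primes p) *)
Definition legendre (n : int) (p : nat) : int :=
  if (p%:Z %| n)%Z then 0
  else if (p%:Z %| n ^+ ((p.-1) %/ 2)%N - 1)%Z then 1 else -1.

Definition Uop (m : nat) (a : nat -> C) : nat -> C := fun n => a (m * n)%N.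
Definition Vop (m : nat) (a : nat -> C) : nat -> C :=
  fun n => if (m %| n)%N then a (n %/ m)%N else 0.

(* Hecke operator T_{Q^2} on S_k(1, nu_eta^r), k = k2/2:
   Q^{k-3/2} := sqrt(Q)^{2k-3},  (-1/Q)^{k-1/2} := sqrt((-1/Q))^{2k-1} *)
Definition Top (Q : nat) (k2 : int) (a : nat -> C) : nat -> C := fun n =>
  a (Q ^ 2 * n)%N
  + psqrt (Q%:R) ^ (k2 - 3) * psqrt ((legendre (-1) Q)%:~R) ^ (k2 - 1)
      * (legendre (12 * n%:Z) Q)%:~R * a n
  + (Q%:R : C) ^ (k2 - 2) * (if (Q ^ 2 %| n)%N then a (n %/ Q ^ 2)%N else 0).

Local Open Scope classical_set_scope.
Definition density_zero (S : nat -> Prop) : Prop :=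
  (fun X : nat =>
     ((\sum_(p < X.+1 | prime p && `[< S p >]) 1)%N%:R /
      (\sum_(p < X.+1 | prime p) 1)%N%:R : R)%R) @ \oo --> (0 : R).

End ModForms.

(* Main.v *)
(** Call n in the support if a(n) is nonzero modulo ell. The proof distinguishes whether the squarefree kernels of the support form a finite set.

If they do not, choose n_1, ..., n_j in the support, each with a new prime in its kernel. Condition (ii) prescribes (n_i/p) for all large p in S, so p lies in a proportion 2^-j of the residue classes of a fixed modulus; a Selberg-type sieve in these classes, compared with Chebyshev's lower bound, shows that S has upper density O(2^-j) for every j.

If they do, every n in the support is t m^2 with t from a finite set, whence the counting bound. Let Q = -1 mod ell be prime. By reciprocity there is P, prime to Q, such that (n/QP) is never -1 on the support, so the part of f where this symbol is -1 vanishes modulo ell. This part is a combination of translates f(tau + 24 b/QP). Multiplied by a power of eta, it is a modular form of integral weight on Gamma_0((QP)^2), and its vanishing modulo ell is carried from the cusp infinity to the cusp 0 by taking a trace to level one and applying Sturm's bound modulo ell. At the cusp 0 the coefficient of index Q^2 n involves only a(Q^2 n) and a(n), and evaluating Gauss sums gives (n/P) a(n) = K a(Q^2 n) modulo ell with K such that the three terms of T_(Q^2) f cancel.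

The behaviour of eta at the cusps is obtained from Poisson summation for the Gaussian and Euler's pentagonal number theorem. *)

(* All functions are handled through absolutely convergent expansions over [R[i]] with coefficients
   in [O_ell], at every cusp. The obstacle is the passage from infinity to 0. The trace to level one
   is controlled only up to the first exponent where the cusp 0 contributes, short of the Sturm
   bound of its weight, so the weight has to drop. For squarefree M there is an eta quotient of
   level M^2 and positive weight whose zeros all lie at infinity. Dividing by a high power of it
   lowers the weight at will and costs only poles at infinity, where the form is already 0 modulo
   [ell]; powers of Delta, neutral for Sturm's bound, clear the poles. The coefficients at 0 then
   fall one by one.

   The multiplier of eta on Gamma_0(M^2) is not computed: a continuous function whose 24th power is
   constant is constant, and the remaining constants are forced because the exponents of eta are
   squares.

   If Q divides n exactly once, one P only ties a(Q^2 n) to a(n); two choices with opposite symbols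
   (Q/P) give opposite signs, so a(Q^2 n) vanishes. *)
From HB Require Import structures.
From mathcomp Require Import all_boot all_order all_algebra.
From mathcomp Require Import all_classical all_reals all_analysis.
From mathcomp Require Import complex ring lra zify.
From mathcomp Require finfield.
Require Import Defs.
Set Implicit Arguments. Unset Strict Implicit. Unset Printing Implicit Defensive.
Import Order.TTheory GRing.Theory Num.Theory.
Import numFieldNormedType.Exports.
Local Open Scope ring_scope.
Local Notation Im := complex.Im.
Local Notation Re := complex.Re.
Local Notation "x %:C" := (real_complex _ x) : ring_scope.

(** * Moduli and limits of complex sequences *)

Section CNorm.
Variable R : realType.
Local Notation C := (R[i]).
Implicit Types (x y z : C).
(** The norm of [R[i]] is valued in [R[i]]; a modulus in [R] leaves every estimate to real
    arithmetic. *)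
Definition nm (z : C) : R := Normc.normc z.
Lemma nm_norm z : `|z| = (nm z)%:C%C. Proof. by []. Qed.
Lemma nmM x y : nm (x * y) = nm x * nm y. Proof. exact: Normc.normcM. Qed.
Lemma nmD x y : nm (x + y) <= nm x + nm y. Proof. exact: le_normcD. Qed.
Lemma nmN x : nm (- x) = nm x. Proof. exact: normcN. Qed.
Lemma nm0 : nm 0 = 0. Proof. exact: Normc.normc0. Qed.
Lemma nm1 : nm 1 = 1. Proof. exact: Normc.normc1. Qed.
Lemma nmV x : nm x^-1 = (nm x)^-1. Proof. exact: Normc.normcV. Qed.
Lemma nm_ge0 x : 0 <= nm x. Proof. by case: x => a b; rewrite sqrtr_ge0. Qed.
Lemma nm_eq0 x : (nm x == 0) = (x == 0).
Proof. by apply/eqP/eqP => [/Normc.eq0_normc //|->]; rewrite nm0. Qed.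
Lemma nm_gt0 x : (0 < nm x) = (x != 0).
Proof. by rewrite lt0r nm_eq0 nm_ge0 andbT. Qed.
Lemma nmBC x y : nm (x - y) = nm (y - x). Proof. by rewrite -nmN opprB. Qed.
Lemma nmB x y : nm (x - y) <= nm x + nm y.
Proof. by rewrite -(nmN y) nmD. Qed.
Lemma nmBD y x z : nm (x - z) <= nm (x - y) + nm (y - z).
Proof. by apply: le_trans (nmD _ _); rewrite addrA subrK. Qed.
Lemma nmX x n : nm (x ^+ n) = nm x ^+ n.
Proof. by elim: n => [|n IH]; rewrite ?expr0 ?nm1 // !exprS nmM IH. Qed.
Lemma nm_real (a : R) : nm a%:C%C = `|a|.
Proof. by rewrite /nm /= expr0n addr0 sqrtr_sqr. Qed.
Lemma nm_nat n : nm n%:R = n%:R.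
Proof.
have -> : (n%:R : C) = (n%:R : R)%:C%C by rewrite rmorph_nat.
by rewrite nm_real ger0_norm.
Qed.
Lemma nm_sum I (r : seq I) (P : pred I) (F : I -> C) :
  nm (\sum_(i <- r | P i) F i) <= \sum_(i <- r | P i) nm (F i).
Proof.
elim/big_rec2: _ => [|i y z _ H]; first by rewrite nm0.
by apply: le_trans (nmD _ _) _; rewrite lerD2l.
Qed.
Lemma nm_prod I (r : seq I) (P : pred I) (F : I -> C) :
  nm (\prod_(i <- r | P i) F i) = \prod_(i <- r | P i) nm (F i).
Proof. by apply: (big_morph _ nmM nm1). Qed.
Lemma Re_nm x : `|Re x| <= nm x.
Proof.
case: x => a b; rewrite /nm /= -sqrtr_sqr ler_wsqrtr // lerDl; exact: sqr_ge0.
Qed.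
Lemma Im_nm x : `|Im x| <= nm x.
Proof.
case: x => a b; rewrite /nm /= -sqrtr_sqr ler_wsqrtr // lerDr; exact: sqr_ge0.
Qed.
Lemma nm_ReIm x : nm x <= `|Re x| + `|Im x|.
Proof.
have nc (r : R) : nm (Complex r 0) = `|r| by rewrite /nm /= expr0n addr0 sqrtr_sqr.
have ni (r : R) : nm (Complex 0 r) = `|r| by rewrite /nm /= expr0n add0r sqrtr_sqr.
rewrite -nc -(ni (Im x)); apply: le_trans (nmD _ _).
by case: x => a b; simpc.
Qed.
Lemma nm2 x : nm x ^+ 2 = Re x ^+ 2 + Im x ^+ 2.
Proof. by case: x => a b; rewrite /nm /= sqr_sqrtr // addr_ge0 ?sqr_ge0. Qed.
(** Convergence with a real epsilon; [cv_cvgE] links it to the filter limits of the statement. *)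
Definition cv (u : nat -> C) (l : C) : Prop :=
  forall e : R, 0 < e -> exists N, forall n, (N <= n)%N -> nm (u n - l) < e.
Lemma cv_cst c : cv (fun=> c) c.
Proof. by move=> e e0; exists 0%N => n _; rewrite subrr nm0. Qed.
Lemma cv_eq u v l : (forall n, u n = v n) -> cv u l -> cv v l.
Proof. by move=> H cu e /cu [N HN]; exists N => n; rewrite -H; apply: HN. Qed.
Lemma cvD u v l m : cv u l -> cv v m -> cv (fun n => u n + v n) (l + m).
Proof.
move=> cu cv' e e0; have e2 : 0 < e / 2 by rewrite divr_gt0.
have [N HN] := cu _ e2; have [M HM] := cv' _ e2.
exists (maxn N M) => n; rewrite geq_max => /andP[/HN H1 /HM H2].
rewrite opprD addrACA [e]splitr; apply: le_lt_trans (nmD _ _) _.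
exact: ltrD.
Qed.
Lemma cvZ c u l : cv u l -> cv (fun n => c * u n) (c * l).
Proof.
move=> cu e e0; have k0 : 0 < nm c + 1 by rewrite ltr_wpDl ?nm_ge0.
have [N HN] := cu (e / (nm c + 1)) (divr_gt0 e0 k0).
exists N => n /HN; rewrite ltr_pdivlMr // -mulrBr nmM; apply: le_lt_trans.
by rewrite mulrC ler_wpM2l ?nm_ge0 // lerDl.
Qed.
Lemma cvN u l : cv u l -> cv (fun n => - u n) (- l).
Proof. by move/(cvZ (-1)); rewrite mulN1r; apply: cv_eq => n; rewrite mulN1r. Qed.
Lemma cvB u v l m : cv u l -> cv v m -> cv (fun n => u n - v n) (l - m).
Proof. by move=> cu cv'; apply: cvD => //; apply: cvN. Qed.
Lemma cv_bound u l : cv u l -> exists2 B, 0 < B & forall n, nm (u n) <= B.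
Proof.
move=> /(_ 1 ltr01) [N HN].
exists (nm l + 1 + \sum_(n < N) nm (u n)) => [|n].
  rewrite ltr_pwDl ?sumr_ge0 // => [|i _]; rewrite ?nm_ge0 //.
  by rewrite ltr_wpDl ?nm_ge0.
case: (ltnP n N) => h.
  rewrite (bigD1 (Ordinal h)) //= addrCA lerDl !addr_ge0 ?nm_ge0 //.
  by apply: sumr_ge0 => i _; apply: nm_ge0.
rewrite -[u n](subrK l) -[leLHS]addr0 lerD ?sumr_ge0 // => [|i _]; rewrite ?nm_ge0 //.
by apply: le_trans (nmD _ _) _; rewrite addrC lerD2l ltW // HN.
Qed.
Lemma cvM u v l m : cv u l -> cv v m -> cv (fun n => u n * v n) (l * m).
Proof.
move=> cu cv'; have [B B0 HB] := cv_bound cv' => e e0.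
have k0 : 0 < nm l + 1 by rewrite ltr_wpDl ?nm_ge0.
have [N HN] := cu (e / 2 / B) (divr_gt0 (divr_gt0 e0 (ltr0Sn _ 1)) B0).
have [M HM] := cv' (e / 2 / (nm l + 1)) (divr_gt0 (divr_gt0 e0 (ltr0Sn _ 1)) k0).
exists (maxn N M) => n; rewrite geq_max => /andP[/HN H1 /HM H2].
have -> : u n * v n - l * m = (u n - l) * v n + l * (v n - m) by ring.
apply: le_lt_trans (nmD _ _) _; rewrite [e]splitr !nmM; apply: ltr_leD.
  rewrite ltr_pdivlMr // in H1; apply: le_lt_trans H1.
  by rewrite ler_wpM2l ?nm_ge0.
rewrite ltr_pdivlMr // in H2; apply: le_trans (ltW H2).
by rewrite mulrC ler_wpM2l ?nm_ge0 // lerDl.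
Qed.
Lemma cv_uniq u l m : cv u l -> cv u m -> l = m.
Proof.
move=> cu cu'; apply/eqP; rewrite -subr_eq0 -nm_eq0; apply/negP => /negP H.
have H0 : 0 < nm (l - m) by rewrite lt0r H nm_ge0.
have := cvB cu cu' H0 => -[N] /(_ N (leqnn _)).
by rewrite subrr sub0r nmN ltxx.
Qed.
Lemma cv_shift u l k : cv u l -> cv (fun n => u (n + k)%N) l.
Proof. by move=> cu e /cu [N HN]; exists N => n h; apply: HN; apply: leq_trans h (leq_addr _ _). Qed.
Lemma cv_sub (f : nat -> nat) u l : (forall n, (n <= f n)%N) -> cv u l -> cv (fun n => u (f n)) l.
Proof. by move=> hf cu e /cu [N HN]; exists N => n h; apply: HN; apply: leq_trans (hf n). Qed.
Lemma cv_le u l B : cv u l -> (forall n, nm (u n) <= B) -> nm l <= B.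
Proof.
move=> cu H; apply/ler_addgt0Pl => e /cu [N /(_ N (leqnn _)) HN].
rewrite -[l](subrK (u N)); apply: le_trans (nmD _ _) _.
by rewrite lerD // nmBC ltW.
Qed.
Lemma cv_sum (I : eqType) (r : seq I) (u : I -> nat -> C) (l : I -> C) :
  (forall i, i \in r -> cv (u i) (l i)) -> cv (fun n => \sum_(i <- r) u i n) (\sum_(i <- r) l i).
Proof.
elim: r => [|i r IH] H.
  by rewrite big_nil; apply: cv_eq (cv_cst 0) => n; rewrite big_nil.
rewrite big_cons; apply: cv_eq (cvD (H i _) (IH _)) => [n||j jr].
- by rewrite big_cons.
- exact: mem_head.
- by apply: H; rewrite inE jr orbT.
Qed.
Lemma cv0_maj (f : nat -> C) (g : nat -> R) l :
  (forall n, nm (f n - l) <= g n) -> (forall e : R, 0 < e -> exists N, forall n, (N <= n)%N -> g n < e) ->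
  cv f l.
Proof. by move=> H G e /G [N HN]; exists N => n /HN; apply: le_lt_trans. Qed.
Local Open Scope classical_set_scope.
Lemma cv_cvgE (u : nat -> C) (l : C) :
  cv u l <-> ((u : nat -> (C : numFieldType)) @ \oo --> (l : (C : numFieldType))).
Proof.
split=> [cu|/cvgrPdist_lt cu e e0].
  apply/cvgrPdist_lt => e e0.
  have er : e = (Re e)%:C%C by rewrite RRe_real // gtr0_real.
  have e0' : 0 < Re e by move: e0; rewrite er ltcR.
  have [N HN] := cu _ e0'; exists N => // n /= /HN.
  by rewrite nm_norm er ltcR nmBC.
have [|N _ HN] := cu e%:C%C; first by rewrite ltcR.
by exists N => n /HN; rewrite nm_norm ltcR nmBC.
Qed.
Lemma cv_lim (u : nat -> C) (l : C) : cv u l -> limn (u : nat -> (C : numFieldType)) = l.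
Proof. by move/cv_cvgE; apply: cvg_lim; apply: norm_hausdorff. Qed.
Lemma cvgn_cv (u : nat -> C) :
  cvgn (u : nat -> (C : numFieldType)) -> cv u (limn (u : nat -> (C : numFieldType))).
Proof. by move=> H; apply/cv_cvgE. Qed.
Lemma cvR_cvgE (u : nat -> R) (l : R) :
  cv (fun n => (u n)%:C%C) l%:C%C <-> u @ \oo --> l.
Proof.
split=> [cu|/cvgrPdist_lt cu e e0].
  apply/cvgrPdist_lt => e /cu [N HN]; exists N => // n /= /HN.
  by rewrite -rmorphB nm_real distrC.
have [N _ HN] := cu e e0; exists N => n /HN.
by rewrite -rmorphB nm_real distrC.
Qed.
Lemma cv_ReIm (u : nat -> C) (a b : R) : (fun n => Re (u n)) @ \oo --> a ->
  (fun n => Im (u n)) @ \oo --> b -> cv u (Complex a b).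
Proof.
move=> /cvgrPdist_lt H1 /cvgrPdist_lt H2 e e0; have e2 : 0 < e / 2 by rewrite divr_gt0.
have [N _ HN] := H1 _ e2; have [M _ HM] := H2 _ e2.
exists (maxn N M) => n; rewrite geq_max => /andP[/HN /= h1 /HM /= h2].
apply: le_lt_trans (nm_ReIm _) _; rewrite distrC in h1; rewrite distrC in h2.
by case: (u n) h1 h2 => c d /= h1 h2; rewrite [e]splitr; apply: ltrD.
Qed.
Lemma natC0 n : (0 < n)%N -> (n%:R : C) != 0. Proof. by rewrite pnatr_eq0 -lt0n. Qed.
End CNorm.
Ltac nn := repeat first [ assumption | apply: ltW; assumption | exact: nm_ge0 | exact: normr_ge0 | exact: sqr_ge0
  | exact: expR_ge0 | exact: pi_ge0 | exact: ler0n | exact: ler01 | apply: mulr_ge0 | apply: addr_ge0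
  | rewrite invr_ge0 | apply: exprn_ge0 ].

(** * Absolutely convergent series *)

Section Series.
Variable R : realType.
Local Notation C := (R[i]).
Implicit Types (u v : nat -> C) (f g : nat -> R).
(** For nonnegative terms this is summability, stated without a limit. *)
Definition bsum f := exists B, forall N, \sum_(n < N) f n <= B.
Definition asum u := bsum (fun n => nm (u n)).
Local Notation psum u := (fun N => \sum_(n < N) u n).
Lemma bsum_le f g : (forall n, f n <= g n) -> bsum g -> bsum f.
Proof. by move=> H [B HB]; exists B => N; apply: le_trans (HB N); apply: ler_sum. Qed.
Lemma bsumD f g : bsum f -> bsum g -> bsum (fun n => f n + g n).
Proof. by move=> [B HB] [B' HB']; exists (B + B') => N; rewrite big_split; apply: lerD. Qed.
Lemma bsumZ (c : R) f : 0 <= c -> bsum f -> bsum (fun n => c * f n).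
Proof. by move=> c0 [B HB]; exists (c * B) => N; rewrite -mulr_sumr ler_wpM2l. Qed.
Lemma bsum_shift f k : (forall n, 0 <= f n) -> bsum f -> bsum (fun n => f (n + k)%N).
Proof.
move=> f0 [B HB]; exists B => N; apply: le_trans (HB (N + k)%N).
rewrite addnC big_split_ord /= ler_wpDl ?sumr_ge0 //.
by apply: ler_sum => i _; rewrite addnC.
Qed.
Lemma bsum_unshift f k : (forall n, 0 <= f n) -> bsum (fun n => f (n + k)%N) -> bsum f.
Proof.
move=> f0 [B HB]; exists (\sum_(n < k) f n + B) => N.
have : \sum_(n < N) f n <= \sum_(n < N + k) f n.
  by rewrite big_split_ord /= lerDl sumr_ge0.
move/le_trans; apply; rewrite addnC big_split_ord /= lerD2l; apply: le_trans (HB N).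
by apply: ler_sum => i _; rewrite addnC.
Qed.
(** Otherwise disjoint blocks of sum at least [e] could be strung together until they exceed the
    bound [B]. *)
Lemma bsum_tail f : (forall n, 0 <= f n) -> bsum f -> forall e : R, 0 < e ->
  exists N, forall M, \sum_(N <= n < M) f n < e.
Proof.
move=> f0 [B HB] e e0; apply/not_existsP => H.
have H' N : exists M, (N <= M)%N && (e <= \sum_(N <= n < M) f n).
  have /existsNP [M /negP] := H N; rewrite -leNgt => h.
  exists M; rewrite h andbT leqNgt; apply/negP => MN.
  by move: h; rewrite big_geq ?(ltnW MN) // leNgt e0.
have K k : exists M, e *+ k <= \sum_(n < M) f n.
  elim: k => [|k [M HM]]; first by exists 0%N; rewrite big_ord0.
  have [M' /andP[MM' h]] := H' M; exists M'.
  rewrite -(big_mkord predT f) (@big_cat_nat _ _ _ M) //= big_mkord mulrSr.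
  exact: lerD.
have [k hk] : exists k, B < e *+ k.
  exists (Num.bound (`|B| / e)); rewrite -mulr_natr mulrC -ltr_pdivrMr //.
  apply: le_lt_trans (archi_boundP _); last by rewrite divr_ge0 // ltW.
  by rewrite ler_pM2r ?invr_gt0 // ler_norm.
have [M hM] := K k; have := le_trans hM (HB M); by rewrite leNgt hk.
Qed.
Lemma asum_bsum u f : (forall n, nm (u n) <= f n) -> bsum f -> asum u.
Proof. exact: bsum_le. Qed.
Lemma asumD u v : asum u -> asum v -> asum (fun n => u n + v n).
Proof. by move=> hu hv; apply: bsum_le (bsumD hu hv) => n; apply: nmD. Qed.
Lemma asumZ c u : asum u -> asum (fun n => c * u n).
Proof. by move=> /(bsumZ (nm_ge0 c)); apply: bsum_le => n; rewrite nmM. Qed.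
Lemma asum_eq u v : (forall n, u n = v n) -> asum u -> asum v.
Proof. by move=> H; apply: bsum_le => n; rewrite H. Qed.
Lemma asum_fin u N : (forall n, (N <= n)%N -> u n = 0) -> asum u.
Proof.
move=> H; exists (\sum_(n < N) nm (u n)) => M.
case: (leqP M N) => [MN|/ltnW NM].
  rewrite -(big_mkord predT (fun n => nm (u n))) -[leRHS](big_mkord predT (fun n => nm (u n))).
  by rewrite (@big_cat_nat _ _ _ M _ N) //= lerDl sumr_ge0 // => i _; apply: nm_ge0.
rewrite -(big_mkord predT (fun n => nm (u n))) (@big_cat_nat _ _ _ N) //= big_mkord.
by rewrite [X in _ + X]big_nat_cond [X in _ + X]big1 ?addr0 // => i /andP[/andP[h _] _]; rewrite H ?nm0.
Qed.
(** Assembled from real and imaginary parts, so that convergence is inherited from absolutely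
    convergent real series; meaningful under [asum u]. *)
Definition tsum u : C := Complex (limn (fun N => \sum_(n < N) Re (u n)))
                                 (limn (fun N => \sum_(n < N) Im (u n))).
Lemma sumRe (N : nat) (u : 'I_N -> C) : Re (\sum_(n < N) u n) = \sum_(n < N) Re (u n).
Proof. by apply: (big_morph (@Re R)) => // -[a b] [c d]. Qed.
Lemma sumIm (N : nat) (u : 'I_N -> C) : Im (\sum_(n < N) u n) = \sum_(n < N) Im (u n).
Proof. by apply: (big_morph (@Im R)) => // -[a b] [c d]. Qed.
Lemma tsumP u : asum u -> cv (psum u) (tsum u).
Proof.
move=> hu.
have K (p : C -> R) : (forall z, `|p z| <= nm z) -> cvgn (fun N => \sum_(n < N) p (u n)).
  move=> hp; have -> : (fun N => \sum_(n < N) p (u n)) = series (fun n => p (u n)).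
    by apply/funext => N; rewrite /series /= big_mkord.
  apply: normed_cvg; apply: (@nondecreasing_is_cvgn _ (fun N => \sum_(0 <= k < N) `|p (u k)|)) => [m n mn|].
    by rewrite (@big_cat_nat _ _ _ m _ n) //= lerDl sumr_ge0.
  have [B HB] := hu; exists B => _ [N _ <-]; rewrite big_mkord.
  by apply: le_trans (HB N); apply: ler_sum.
apply: cv_ReIm.
  by under eq_fun do rewrite sumRe; apply: K; apply: Re_nm.
by under eq_fun do rewrite sumIm; apply: K; apply: Im_nm.
Qed.
Lemma tsum_uniq u l : asum u -> cv (psum u) l -> tsum u = l.
Proof. by move=> hu; apply: cv_uniq; apply: tsumP. Qed.
Lemma tsum_eq u v : (forall n, u n = v n) -> tsum u = tsum v.
Proof. by move=> /funext ->. Qed.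
Lemma tsumD u v : asum u -> asum v -> tsum (fun n => u n + v n) = tsum u + tsum v.
Proof.
move=> hu hv; apply: tsum_uniq; first exact: asumD.
by apply: cv_eq (cvD (tsumP hu) (tsumP hv)) => n; rewrite big_split.
Qed.
Lemma tsumZ c u : asum u -> tsum (fun n => c * u n) = c * tsum u.
Proof.
move=> hu; apply: tsum_uniq; first exact: asumZ.
by apply: cv_eq (cvZ c (tsumP hu)) => n; rewrite mulr_sumr.
Qed.
Lemma tsum0 : tsum (fun=> 0) = 0.
Proof.
apply: tsum_uniq; first by apply: (@asum_fin _ 0).
by apply: cv_eq (cv_cst 0) => n; rewrite big1.
Qed.
Lemma tsum_fin u N : (forall n, (N <= n)%N -> u n = 0) -> tsum u = \sum_(n < N) u n.
Proof.
move=> H; apply: tsum_uniq; first exact: asum_fin H.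
move=> e e0; exists N => n nN; rewrite -(subnKC nN) big_split_ord /= addrAC subrr add0r big1 ?nm0 //.
by move=> i _; rewrite H // leq_addr.
Qed.
Lemma asum_sum I (r : seq I) (F : I -> nat -> C) : (forall i, asum (F i)) ->
  asum (fun n => \sum_(i <- r) F i n).
Proof.
move=> H; elim: r => [|i r IH]; first by apply: (@asum_fin _ 0) => n _; rewrite big_nil.
by apply: asum_eq (asumD (H i) IH) => n; rewrite big_cons.
Qed.
Lemma tsum_sum I (r : seq I) (F : I -> nat -> C) : (forall i, asum (F i)) ->
  tsum (fun n => \sum_(i <- r) F i n) = \sum_(i <- r) tsum (F i).
Proof.
move=> H; elim: r => [|i r IH].
  by rewrite big_nil -[RHS]tsum0; apply: tsum_eq => n; rewrite big_nil.
rewrite big_cons -IH -tsumD //; last exact: asum_sum.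
by apply: tsum_eq => n; rewrite big_cons.
Qed.
Lemma nm_tsum u f B : (forall n, nm (u n) <= f n) -> (forall N, \sum_(n < N) f n <= B) -> nm (tsum u) <= B.
Proof.
move=> h H; apply: (cv_le (tsumP _)) => [|N]; first by exists B => N; apply: le_trans (H N); apply: ler_sum.
by apply: le_trans (nm_sum _ _ _) (le_trans _ (H N)); apply: ler_sum.
Qed.
Lemma asum_shift u k : asum u -> asum (fun n => u (n + k)%N).
Proof. by apply: (@bsum_shift (fun n => nm (u n))) => n; apply: nm_ge0. Qed.
Lemma tsum_split u k : asum u -> tsum u = \sum_(n < k) u n + tsum (fun n => u (n + k)%N).
Proof.
move=> hu; apply: tsum_uniq => //.
have := cvD (cv_cst (\sum_(n < k) u n)) (tsumP (asum_shift k hu)) => H e /H [N HN].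
exists (N + k)%N => n hn; have kn : (k <= n)%N by apply: leq_trans hn; rewrite leq_addl.
have := HN (n - k)%N; rewrite leq_subRL // addnC => /(_ hn); congr (nm (_ - _) < _).
rewrite -[in RHS](subnKC kn) big_split_ord /=; congr (_ + _).
by apply: eq_bigr => i _; rewrite addnC.
Qed.
(* Tannery's theorem *)
Lemma tannery (U : nat -> nat -> C) u f : (forall n, 0 <= f n) -> bsum f ->
  (forall k n, nm (U k n) <= f n) -> (forall n, cv (fun k => U k n) (u n)) ->
  cv (fun k => tsum (U k)) (tsum u).
Proof.
move=> f0 bf Uf cU; have uf n : nm (u n) <= f n by apply: (cv_le (cU n)).
move=> e e0; have e3 : 0 < e / 4 by rewrite divr_gt0.
have [N HN] := bsum_tail f0 bf e3.
have [K HK] := @cv_sum R _ (index_iota 0 N) (fun n k => U k n) u (fun i _ => cU i) _ e3.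
exists K => k /HK; rewrite !big_mkord => h.
have tl v : (forall n, nm (v n) <= f n) -> nm (tsum (fun n => v (n + N)%N)) <= e / 4.
  move=> vf; apply: (@nm_tsum _ (fun n => f (n + N)%N)) => // M; apply: ltW.
  by have := HN (M + N)%N; rewrite -{1}(add0n N) big_addn addnK big_mkord.
have aU : asum (U k) by apply: bsum_le bf.
have au : asum u by apply: bsum_le bf.
rewrite (tsum_split N aU) (tsum_split N au) opprD addrACA.
have -> : e = e / 4 + (e / 4 + (e / 4 + e / 4)) by field.
apply: le_lt_trans (nmD _ _) _; apply: ltr_leD => //.
apply: le_trans (nmB _ _) _; apply: lerD; first exact: tl.
by apply: le_trans (tl _ uf) _; rewrite lerDl ltW.
Qed.
Definition conv u v n : C := \sum_(i < n.+1) u i * v (n - i)%N.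
Lemma psum_conv u v N :
  \sum_(n < N) conv u v n = \sum_(i < N) u i * \sum_(j < N - i) v j.
Proof.
elim: N => [|N IH]; first by rewrite !big_ord0.
rewrite big_ord_recr IH /= /conv big_ord_recr /= subnn [in RHS]big_ord_recr /= subSnn.
rewrite big_ord1 addrA -big_split; congr (_ + _); apply: eq_bigr => i _ /=.
by rewrite subSn ?(ltnW (ltn_ord i)) // big_ord_recr mulrDr.
Qed.
Lemma asum_conv u v : asum u -> asum v -> asum (conv u v).
Proof.
move=> [A HA] [B HB].
have B0 : 0 <= B by have := HB 0%N; rewrite big_ord0.
exists (A * B) => N.
(* The moduli are recast as complex numbers so that [psum_conv] applies to them too. *)
have K n : nm (conv u v n) <= Re (conv (fun n => (nm (u n))%:C%C) (fun n => (nm (v n))%:C%C) n).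
  rewrite /conv sumRe; apply: le_trans (nm_sum _ _ _) _; apply: ler_sum => i _.
  by rewrite nmM /= mulr0 subr0.
apply: (le_trans (ler_sum _ (fun (i : 'I_N) _ => K i))); rewrite -sumRe psum_conv.
have -> : \sum_(i < N) (nm (u i))%:C%C * \sum_(j < N - i) (nm (v j))%:C%C =
   (\sum_(i < N) nm (u i) * \sum_(j < N - i) nm (v j))%:C%C.
  by rewrite rmorph_sum; apply: eq_bigr => i _; rewrite rmorphM rmorph_sum.
rewrite /=; apply: le_trans (_ : (\sum_(i < N) nm (u i)) * B <= _).
  by rewrite mulr_suml; apply: ler_sum => i _; apply: ler_wpM2l; [apply: nm_ge0 | apply: HB].
by rewrite ler_wpM2r.
Qed.
(* Mertens: the partial sums of the Cauchy product are sums over i of u i * V (N - i), so Tannery applies. *)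
Lemma tsum_conv u v : asum u -> asum v -> tsum (conv u v) = tsum u * tsum v.
Proof.
move=> hu hv; apply: tsum_uniq; first exact: asum_conv.
have [B HB] := hv; have B0 : 0 <= B by have := HB 0%N; rewrite big_ord0.
pose U N i := if (i < N)%N then u i * \sum_(j < N - i) v j else 0.
have -> : tsum u * tsum v = tsum (fun i => u i * tsum v).
  by rewrite mulrC -tsumZ //; apply: tsum_eq => n; rewrite mulrC.
apply: (@cv_eq _ (fun N => tsum (U N))) => [N|].
  rewrite psum_conv (@tsum_fin _ N) => [|n]; first by apply: eq_bigr => i _; rewrite /U ltn_ord.
  by rewrite /U ltnNge => ->.
apply: (@tannery _ _ (fun n => B * nm (u n))) => [n||N n|n].
- by rewrite mulr_ge0 ?nm_ge0.
- exact: bsumZ.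
- rewrite /U; case: ifP => _; last by rewrite nm0 mulr_ge0 ?nm_ge0.
  rewrite nmM mulrC ler_wpM2r ?nm_ge0 //; apply: le_trans (nm_sum _ _ _) (HB _).
- have := cvZ (u n) (tsumP hv) => H e /H [M HM]; exists (M + n.+1)%N => k hk.
  have nk : (n < k)%N by apply: leq_trans hk; rewrite leq_addl.
  by rewrite /U nk; apply: HM; rewrite leq_subRL ?(ltnW nk) // addnC (leq_trans _ hk) // leq_add2l.
Qed.
Lemma bigord_mul (V : nmodType) (F : nat -> V) (L N : nat) :
  \sum_(m < N * L) F m = \sum_(n < N) \sum_(j < L) F (n * L + j)%N.
Proof.
elim: N => [|N IH]; first by rewrite mul0n !big_ord0.
by rewrite mulSnr big_split_ord /= IH big_ord_recr.
Qed.
Lemma asum_sec u L j : (0 < L)%N -> (j < L)%N -> asum u -> asum (fun n => u (n * L + j)%N).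
Proof.
move=> L0 jL [B HB]; exists B => N; apply: le_trans (HB (N * L)%N).
rewrite (bigord_mul (fun n => nm (u n))); apply: ler_sum => n _.
by rewrite (bigD1 (Ordinal jL)) //= lerDl sumr_ge0 // => i _; apply: nm_ge0.
Qed.
Lemma tsum_sec u L : (0 < L)%N -> asum u -> tsum u = \sum_(j < L) tsum (fun n => u (n * L + j)%N).
Proof.
move=> L0 hu; rewrite -tsum_sum => [|j]; last exact: asum_sec.
symmetry; apply: tsum_uniq; first by apply: asum_sum => j; apply: asum_sec.
apply: cv_eq (cv_sub (f := fun n => (n * L)%N) _ (tsumP hu)) => [n|n]; last exact: leq_pmulr.
by rewrite bigord_mul.
Qed.
Lemma geo_le (r : R) N : 0 <= r < 1 -> \sum_(n < N) r ^+ n <= (1 - r)^-1.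
Proof.
move=> /andP[r0 r1]; have d0 : 0 < 1 - r by rewrite subr_gt0.
have E : (1 - r) * (\sum_(n < N) r ^+ n) = 1 - r ^+ N by rewrite -opprB mulNr -subrX1 opprB.
by rewrite -[leRHS]mulr1 ler_pdivlMl // E gerBl exprn_ge0.
Qed.
Lemma bsum_geo (r : R) : 0 <= r < 1 -> bsum (fun n => r ^+ n).
Proof. by move=> h; exists (1 - r)^-1 => N; exact: geo_le. Qed.
End Series.

(** * The complex exponential *)

Section CExp.
Variable R : realType.
Local Notation C := (R[i]).
Implicit Types (z w : C).
Lemma cexpD z w : cexp (z + w) = cexp z * cexp w.
Proof.
case: z w => a b [c d]; rewrite /cexp /= expRD cosD sinD; simpc.
by congr (_ +i* _)%C; ring.
Qed.
Lemma cexp0 : cexp (0 : C) = 1.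
Proof. by rewrite /cexp /= expR0 cos0 sin0 !mul1r. Qed.
Lemma nm_cexp z : nm (cexp z) = expR (Re z).
Proof.
apply/eqP; rewrite -(eqrXn2 (n := 2)) ?nm_ge0 ?expR_ge0 // nm2 /=.
by rewrite !exprMn -mulrDr cos2Dsin2 mulr1.
Qed.
Lemma cexp_neq0 z : cexp z != 0.
Proof. by rewrite -nm_gt0 nm_cexp expR_gt0. Qed.
Lemma cexpN z : cexp (- z) = (cexp z)^-1.
Proof. by apply: (mulfI (cexp_neq0 z)); rewrite -cexpD subrr cexp0 divff ?cexp_neq0. Qed.
Lemma cexpX z n : cexp (z *+ n) = cexp z ^+ n.
Proof. by elim: n => [|n IH]; rewrite ?mulr0n ?cexp0 // mulrS cexpD IH exprS. Qed.
Lemma sin_le_abs (x : R) : `|sin x| <= `|x|.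
Proof.
wlog x0 : x / 0 < x => [H|].
  case: (ltgtP x 0) => [x0|x0|->]; [|exact: H|by rewrite sin0 normr0].
  by have := H (- x); rewrite sinN !normrN; apply; rewrite oppr_gt0.
have [|c _] := @MVT R sin cos 0 x x0 (fun y _ => is_derive_sin y).
  by apply: continuous_subspaceT; apply: continuous_sin.
rewrite sin0 !subr0 => ->; rewrite normrM ler_piMl // cos_max //.
Qed.
Lemma cos_le_abs (x : R) : `|cos x - 1| <= `|x|.
Proof.
have -> : cos x - 1 = - (sin (x / 2) ^+ 2 *+ 2).
  by rewrite {1}(_ : x = (x / 2) *+ 2) ?cos_mulr2n ?cos2sin2; [ring | rewrite -mulr_natr; field].
have h1 := sin_le_abs (x / 2); have h2 := sin_max (x / 2).
rewrite normrM normfV (ger0_norm (ler0n _ 2)) in h1.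
rewrite normrN normrMn normrX -[_ *+ 2]mulr_natr; set t := `|sin _| in h1 h2 *.
have t0 : 0 <= t by apply: normr_ge0.
have : t ^+ 2 <= t by rewrite expr2 ler_piMr.
lra.
Qed.
Lemma sin_sub_abs (x : R) : `|sin x - x| <= x ^+ 2.
Proof.
wlog x0 : x / 0 < x => [H|].
  case: (ltgtP x 0) => [x0|x0|->]; [|exact: H|by rewrite sin0 subr0 normr0 expr0n].
  by have := H (- x); rewrite sinN -opprD normrN sqrrN; apply; rewrite oppr_gt0.
have [|c /itvP c01] := @MVT R sin cos 0 x x0 (fun y _ => is_derive_sin y).
  by apply: continuous_subspaceT; apply: continuous_sin.
rewrite sin0 !subr0 => ->; rewrite -[X in _ - X]mul1r -mulrBl normrM (gtr0_norm x0) expr2 ler_pM2r //.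
by apply: le_trans (cos_le_abs _) _; rewrite gtr0_norm ?ltW ?c01.
Qed.
Lemma exp_le_abs (x : R) : `|expR x - 1| <= `|x| * expR `|x|.
Proof.
have h1 := expR_ge1Dx x; have h2 := expR_ge1Dx (- x).
have hx := expR_gt0 x; rewrite expRN in h2.
case: (leP 0 x) => x0.
  rewrite !ger0_norm ?subr_ge0 // ?(le_trans _ h1) ?lerDl //.
  by have := ler_wpM2r (ltW hx) h2; rewrite mulVf ?gt_eqF //; lra.
rewrite !ltr0_norm // ?subr_lt0 ?expR_lt1 //.
have : 1 <= expR (- x) by rewrite -expR0 ler_expR oppr_ge0 ltW.
nra.
Qed.
Lemma exp_sub_abs (x : R) : `|expR x - 1 - x| <= x ^+ 2 * expR `|x|.
Proof.
suff K : exists2 c, `|c| <= `|x| & expR x - 1 = expR c * x.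
  have [c hc E] := K; rewrite E -[X in _ - X]mul1r -mulrBl normrM.
  apply: le_trans (ler_wpM2r (normr_ge0 _) (exp_le_abs c)) _.
  rewrite -(real_normK (num_real x)) expr2 (mulrAC `|x|) ler_wpM2r //.
  by rewrite ler_pM ?expR_ge0 // ler_expR.
case: (ltgtP x 0) => [x0|x0|->]; last by exists 0 => //; rewrite expR0 subrr mulr0.
  have [|c /itvP c01] := @MVT R expR expR x 0 x0 (fun y _ => is_derive_expR y).
    by apply: continuous_subspaceT; apply: continuous_expR.
  rewrite expR0 sub0r => E; exists c; first by rewrite !ltr0_norm ?c01 // lerN2 ltW ?c01.
  by rewrite -opprB E mulrN opprK.
have [|c /itvP c01] := @MVT R expR expR 0 x x0 (fun y _ => is_derive_expR y).
  by apply: continuous_subspaceT; apply: continuous_expR.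
by rewrite expR0 subr0 => E; exists c => //; rewrite !gtr0_norm ?c01 // ltW ?c01.
Qed.
Lemma cexp_lin w : nm (cexp w - 1 - w) <= 6 * nm w ^+ 2 * expR (nm w).
Proof.
case: w => a b; set w := Complex a b; have ha := Re_nm w; have hb := Im_nm w.
rewrite /= in ha hb; set N := nm w in ha hb *; have N0 : 0 <= N := nm_ge0 w.
apply: le_trans (nm_ReIm _) _; rewrite /=.
have EN : expR `|a| <= expR N by rewrite ler_expR.
have E1 : 1 <= expR N by rewrite -expR0 ler_expR.
have X1 : `|expR a - 1| <= N * expR N by apply: le_trans (exp_le_abs _) _; rewrite ler_pM ?expR_ge0.
have X2 : `|expR a - 1 - a| <= N ^+ 2 * expR N.
  apply: le_trans (exp_sub_abs _) _; rewrite ler_pM ?expR_ge0 ?sqr_ge0 //.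
  by rewrite -[a ^+ 2]real_normK ?num_real // ler_sqr // nnegrE.
have Y1 := cos_le_abs b; have Y2 := sin_sub_abs b; have Y3 := sin_le_abs b.
have b2 : b ^+ 2 <= N ^+ 2 by rewrite -[b ^+ 2]real_normK ?num_real // ler_sqr // nnegrE.
have Y4 : `|cos b - 1| <= N ^+ 2.
  have -> : cos b - 1 = - (sin (b / 2) ^+ 2 *+ 2).
    by rewrite {1}(_ : b = (b / 2) *+ 2) ?cos_mulr2n ?cos2sin2; [ring | rewrite -mulr_natr; field].
  rewrite normrN ger0_norm ?mulrn_wge0 ?sqr_ge0 // -mulr_natr -[X in X * _]real_normK ?num_real //.
  have h1 := sin_le_abs (b / 2); rewrite normrM normfV (ger0_norm (ler0n _ 2)) in h1.
  set t := `|sin _| in h1 *; have t0 : 0 <= t by apply: normr_ge0.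
  have tb : t <= N / 2 by apply: le_trans h1 _; rewrite ler_pM2r.
  have : t ^+ 2 <= (N / 2) ^+ 2 by rewrite ler_sqr ?nnegrE // divr_ge0.
  by rewrite exprMn; have := sqr_ge0 N; lra.
have -> : expR a * cos b - 1 - a = (expR a - 1 - a) + (expR a - 1) * (cos b - 1) + (cos b - 1) by ring.
have -> : expR a * sin b - 0 - b = (expR a - 1) * sin b + (sin b - b) by ring.
have Z x : `|x| <= N -> `|(expR a - 1) * x| <= N ^+ 2 * expR N.
  rewrite normrM (_ : N ^+ 2 * _ = (N * expR N) * N) ?expr2; last by ring.
  by move=> h; rewrite ler_pM.
have Z1 := Z _ (le_trans Y1 hb); have Z2 := Z _ (le_trans Y3 hb).
have N2 : N ^+ 2 <= N ^+ 2 * expR N by rewrite ler_peMr ?sqr_ge0.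
have T1 := ler_normD (expR a - 1 - a + (expR a - 1) * (cos b - 1)) (cos b - 1).
have T2 := ler_normD (expR a - 1 - a) ((expR a - 1) * (cos b - 1)).
have T3 := ler_normD ((expR a - 1) * sin b) (sin b - b).
apply: le_trans (lerD T1 T3) _; rewrite -mulrA.
apply: le_trans (lerD (lerD T2 (lexx _)) (lexx _)) _.
apply: le_trans (lerD (lerD (lerD X2 Z1) (le_trans Y4 N2)) (lerD Z2 (le_trans Y2 (le_trans b2 N2)))) _.
move: (N ^+ 2 * expR N) (mulr_ge0 (sqr_ge0 N) (expR_ge0 N)) => E ?; lra.
Qed.
Lemma cexp_lip w : nm (cexp w - 1) <= 7 * nm w * expR (2 * nm w).
Proof.
rewrite -[_ - 1](subrK w); apply: le_trans (nmD _ _) _.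
apply: le_trans (lerD (cexp_lin w) (lexx _)) _; have N0 := nm_ge0 w; set N := nm w in N0 *.
have E1 : 1 <= expR N by rewrite -expR0 ler_expR.
have EN : N <= expR N by apply: le_trans (expR_ge1Dx _); rewrite lerDr.
have -> : expR (2 * N) = expR N * expR N by rewrite -expRD; congr expR; ring.
have : N ^+ 2 * expR N <= N * (expR N * expR N) by rewrite expr2 -mulrA ler_wpM2l // ler_wpM2r // expR_ge0.
have : N <= N * (expR N * expR N) by rewrite ler_peMr // (le_trans E1) // ler_peMr // expR_ge0.
lra.
Qed.
(* [ee z] is the normalised exponential exp (2 pi i z) *)
Definition ee z : C := cexp (Complex 0 (2 * pi) * z).
Lemma eeD z w : ee (z + w) = ee z * ee w. Proof. by rewrite /ee mulrDr cexpD. Qed.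
Lemma ee0 : ee 0 = 1. Proof. by rewrite /ee mulr0 cexp0. Qed.
Lemma ee_neq0 z : ee z != 0. Proof. exact: cexp_neq0. Qed.
Lemma eeN z : ee (- z) = (ee z)^-1. Proof. by rewrite /ee mulrN cexpN. Qed.
Lemma eeB z w : ee (z - w) = ee z / ee w. Proof. by rewrite eeD eeN. Qed.
Lemma eeMn z n : ee (n%:R * z) = ee z ^+ n.
Proof. by rewrite /ee -cexpX [n%:R * z]mulr_natl mulrnAr. Qed.
Lemma nm_ee z : nm (ee z) = expR (- (2 * pi * Im z)).
Proof. by rewrite nm_cexp; case: z => a b /=; rewrite mul0r sub0r. Qed.
Lemma nm_eeR (a : R) : nm (ee a%:C%C) = 1.
Proof. by rewrite nm_ee /= mulr0 oppr0 expR0. Qed.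
Lemma ee1 : ee 1 = 1.
Proof.
rewrite /ee mulr1 /cexp /= expR0 !mul1r.
have -> : 2 * pi = pi *+ 2 :> R by rewrite mulr_natl.
by rewrite cos2pi sin2pi.
Qed.
Lemma ee_nat n : ee n%:R = 1. Proof. by rewrite -[n%:R]mulr1 eeMn ee1 expr1n. Qed.
Lemma ee_int (n : int) : ee n%:~R = 1.
Proof. by case: n => n; rewrite ?NegzE ?rmorphN ?eeN -?pmulrn ee_nat ?invr1. Qed.
Lemma eeDint z (n : int) : ee (z + n%:~R) = ee z. Proof. by rewrite eeD ee_int mulr1. Qed.
Lemma qpow24E n (tau : C) : qpow24 n tau = ee (tau / 24%:R) ^+ n.
Proof.
rewrite -eeMn /qpow24 /ee; congr cexp.
have -> : (Complex 0 (2 * pi * n%:R / 24%:R) : C) = Complex 0 (2 * pi) * (n%:R / 24%:R)%:C%C.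
  by simpc; rewrite ?mul0r ?mulr0 mulrA.
rewrite rmorphM fmorphV !rmorph_nat; by ring.
Qed.
Lemma ee_eq1 (a : R) : 0 < a < 1 -> ee a%:C%C != 1.
Proof.
move=> /andP[a0 a1]; apply/eqP => H.
have : cos (2 * pi * a) = 1.
  by move: H; rewrite /ee /cexp; simpc; rewrite ?mul0r ?mulr0 ?subr0 ?add0r expR0 !mul1r => -[].
have -> : 2 * pi * a = (pi * a) *+ 2 by rewrite -[RHS]mulr_natr; ring.
rewrite cos_mulr2n cos2sin2 => h.
have : 0 < sin (pi * a).
  by rewrite sin_gt0_pi // mulr_gt0 ?pi_gt0 //= gtr_pMr ?pi_gt0.
nra.
Qed.
Lemma ee_frac_eq1 (L j : nat) : (0 < j < L)%N -> ee (j%:R / L%:R) != 1.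
Proof.
move=> /andP[j0 jL]; have L0 : (0 < L)%N by apply: leq_ltn_trans jL.
have -> : (j%:R / L%:R : C) = (j%:R / L%:R : R)%:C%C by rewrite rmorphM fmorphV !rmorph_nat.
by apply: ee_eq1; rewrite divr_gt0 ?ltr0n //= ltr_pdivrMr ?ltr0n // mul1r ltr_nat.
Qed.
Lemma sum_ee (L : nat) (j : int) : (0 < L)%N ->
  \sum_(k < L) ee (k%:R * (j%:~R / L%:R)) = if (L%:Z %| j)%Z then L%:R else 0.
Proof.
move=> L0; under eq_bigr do rewrite eeMn.
have L0C : (L%:R : C) != 0 by exact: natC0.
case: ifP => [/dvdzP[q ->]|H].
  have -> : ((q * L%:Z)%:~R / L%:R : C) = q%:~R by rewrite rmorphM /= -pmulrn mulfK.
  by under eq_bigr do rewrite ee_int expr1n; rewrite sumr_const card_ord.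
have E : ee (j%:~R / L%:R) = ee ((`|(j %% L)%Z|%N)%:R / L%:R).
  have h := divz_eq j L; rewrite {1}h rmorphD rmorphM /= mulrDl -pmulrn mulfK // addrC eeDint.
  by rewrite -{1}(gez0_abs (modz_ge0 j _)) -?pmulrn ?eqz_nat -?lt0n.
set x := ee _ in E *; have x1 : x != 1.
  rewrite E ee_frac_eq1 // lt0n absz_eq0 -ltz_nat gez0_abs ?modz_ge0 ?eqz_nat -?lt0n //.
  by rewrite ltz_mod ?eqz_nat -?lt0n // andbT; apply: contraFneq H => h; apply/dvdz_mod0P.
apply: (mulfI (x := x - 1)); first by rewrite subr_eq0.
rewrite -subrX1 mulr0 /x -eeMn mulrC divfK // ee_int subrr //.
Qed.
(** Over n steps of length 1/n the quadratic parts add up to A/n, so only the part proportional to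
    [h] survives. Differentiating Riemann sums of mesh [h] in a parameter is thus replaced by
    estimating increments. *)
Lemma small_steps (P : R -> C) (A h d0 : R) : 0 <= A -> 0 <= h -> 0 < d0 ->
  (forall s d, 0 <= s -> 0 <= d -> s + d <= 1 -> d <= d0 -> nm (P (s + d) - P s) <= A * (d ^+ 2 + d * h)) ->
  nm (P 1 - P 0) <= A * h.
Proof.
move=> A0 h0 d00 H; apply/ler_addgt0Pl => e e0.
pose n := (Num.bound ((A + 1) / e) + Num.bound d0^-1)%N.+1.
have nA : A / n%:R <= e.
  rewrite ler_pdivrMr // mulrC -ler_pdivrMr // /n -natr1 natrD.
  have h1 : (A + 1) / e < (Num.bound ((A + 1) / e))%:R by apply: archi_boundP; rewrite divr_ge0 ?addr_ge0 // ltW.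
  apply: le_trans (_ : (A + 1) / e <= _); first by rewrite ler_pM2r ?invr_gt0 // lerDl.
  by apply: le_trans (ltW h1) _; rewrite -addrA lerDl addr_ge0.
have nd : n%:R^-1 <= d0.
  rewrite -[d0]invrK lef_pV2 ?posrE ?invr_gt0 // /n -natr1 natrD.
  have := archi_boundP (_ : 0 <= d0^-1); rewrite invr_ge0 ltW // => /(_ isT) /ltW /le_trans; apply.
  by rewrite addrAC lerDr addr_ge0.
have K (m : nat) : (m <= n)%N -> nm (P (m%:R / n%:R) - P 0) <= m%:R * (A * (n%:R^-1 ^+ 2 + n%:R^-1 * h)).
  elim: m => [|m IH] mn; first by rewrite !mul0r subrr nm0.
  apply: le_trans (nmBD (P (m%:R / n%:R)) _ _) _; rewrite -natr1 [in leRHS]mulrDl mul1r addrC.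
  apply: lerD; first exact: IH (ltnW mn).
  by rewrite mulrDl mul1r; apply: H; rewrite ?divr_ge0 ?invr_ge0 // -{2}[n%:R^-1]mul1r -mulrDl ler_pdivrMr // mul1r natr1 ler_nat.
have := K n (leqnn _); rewrite divff ?gt_eqF // => /le_trans; apply.
have -> : n%:R * (A * (n%:R^-1 ^+ 2 + n%:R^-1 * h)) = A / n%:R + A * h by field; rewrite gt_eqF.
by rewrite lerD2r.
Qed.
End CExp.

(** * Sums over the integers and Gaussian domination *)

Section ZSum.
Variable R : realType.
Local Notation C := (R[i]).
Implicit Types (u v : int -> C).
Definition zas u := asum (fun n : nat => u n%:Z) /\ asum (fun n : nat => u (- n.+1%:Z)).
Definition zs u : C := tsum (fun n : nat => u n%:Z) + tsum (fun n : nat => u (- n.+1%:Z)).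
Lemma zas_eq u v : (forall m, u m = v m) -> zas u -> zas v.
Proof. by move=> /funext ->. Qed.
Lemma zs_eq u v : (forall m, u m = v m) -> zs u = zs v.
Proof. by move=> /funext ->. Qed.
Lemma zasD u v : zas u -> zas v -> zas (fun m => u m + v m).
Proof. by move=> [? ?] [? ?]; split; apply: asumD. Qed.
Lemma zasZ c u : zas u -> zas (fun m => c * u m).
Proof. by move=> [? ?]; split; apply: asumZ. Qed.
Lemma zsD u v : zas u -> zas v -> zs (fun m => u m + v m) = zs u + zs v.
Proof. by move=> [? ?] [? ?]; rewrite /zs !tsumD // addrACA. Qed.
Lemma zsZ c u : zas u -> zs (fun m => c * u m) = c * zs u.
Proof. by move=> [? ?]; rewrite /zs !tsumZ // mulrDr. Qed.
Lemma zs_sum I (r : seq I) (F : I -> int -> C) : (forall i, zas (F i)) ->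
  zs (fun m => \sum_(i <- r) F i m) = \sum_(i <- r) zs (F i).
Proof.
move=> H; rewrite /zs big_split; congr (_ + _); rewrite -tsum_sum // => i; by case: (H i).
Qed.
Lemma zas_shift u : zas u -> zas (fun m => u (m + 1)).
Proof.
move=> [h1 h2]; split.
  by apply: asum_eq (asum_shift 1 h1) => n; rewrite PoszD.
apply: (@bsum_unshift _ (fun n : nat => nm (u (- n.+1%:Z + 1))) 1) => [n|]; first exact: nm_ge0.
by apply: bsum_le h2 => n; rewrite (_ : - (n + 1).+1%:Z + 1 = - n.+1%:Z) //; lia.
Qed.
Lemma zs_shift u : zas u -> zs (fun m => u (m + 1)) = zs u.
Proof.
move=> hu; have [h1 h2] := hu; have [h3 h4] := zas_shift hu.
rewrite /zs (tsum_split 1 h4) big_ord1 (tsum_split 1 h1) big_ord1 /=.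
have -> : - 1%:Z + 1 = 0%:Z by lia.
have -> : tsum (fun n : nat => u (n%:Z + 1)) = tsum (fun n : nat => u (n + 1)%N%:Z).
  by apply: tsum_eq => n; rewrite PoszD.
have -> : tsum (fun n : nat => u (- (n + 1).+1%:Z + 1)) = tsum (fun n : nat => u (- n.+1%:Z)).
  by apply: tsum_eq => n; congr u; lia.
by rewrite addrCA addrA.
Qed.
Lemma zs_sec u (L : nat) : (0 < L)%N -> zas u ->
  zs u = \sum_(j < L) zs (fun m => u (m * L%:Z + j%:Z)).
Proof.
move=> L0 [h1 h2]; rewrite /zs (tsum_sec L0 h1) (tsum_sec L0 h2) big_split /=; congr (_ + _).
rewrite (reindex_inj rev_ord_inj); apply: eq_bigr => j _ /=; apply: tsum_eq => n; congr u.
have := ltn_ord j; nia.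
Qed.
Lemma zas_sec u (L : nat) j : (0 < L)%N -> (j < L)%N -> zas u -> zas (fun m => u (m * L%:Z + j%:Z)).
Proof.
move=> L0 jL [h1 h2]; split; first exact: asum_sec h1.
have jL' : (L - j.+1 < L)%N by rewrite ltn_subrL L0.
by apply: asum_eq (asum_sec L0 jL' h2) => n; congr u; nia.
Qed.
Definition xi (h : R) (m : int) : R := h * m%:~R.
(** The bound is uniform in the mesh: with r = e^(-h), r (1 + h) <= 1 gives h <= (1 - r)(1 + h), so
    h times the geometric sum is at most 1 + h. *)
Lemma hexp (h : R) N : 0 < h <= 1 -> \sum_(n < N) h * expR (- (h * n%:R)) <= 2.
Proof.
move=> /andP[h0 h1]; pose r := expR (- h).
have r1 : r * (1 + h) <= 1.
  have := ler_wpM2l (expR_ge0 (- h)) (expR_ge1Dx h).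
  by rewrite -expRD addNr expR0.
have E : (1 - r) * (\sum_(n < N) r ^+ n) = 1 - r ^+ N by rewrite -opprB mulNr -subrX1 opprB.
have -> : \sum_(n < N) h * expR (- (h * n%:R)) = h * \sum_(n < N) r ^+ n.
  by rewrite mulr_sumr; apply: eq_bigr => n _; rewrite -expRM_natr mulNr.
have S0 : 0 <= \sum_(n < N) r ^+ n by apply: sumr_ge0 => i _; rewrite exprn_ge0 ?expR_ge0.
have rN : 0 <= r ^+ N by rewrite exprn_ge0 ?expR_ge0.
set S := \sum_(n < N) _ in E S0 *.
have : h <= (1 - r) * (1 + h) by nra.
move=> hr; have := ler_wpM2r S0 hr; nra.
Qed.
Lemma zs_bound (h K : R) u : 0 < h <= 1 -> 0 <= K ->
  (forall m, nm (u m) <= K * (h * expR (- `|xi h m|))) -> zas u /\ nm (zs u) <= 4 * K.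
Proof.
move=> hh K0 H; have h0 : 0 < h by case/andP: hh.
have B N : \sum_(n < N) K * (h * expR (- (h * n%:R))) <= 2 * K.
  by rewrite -mulr_sumr mulrC ler_wpM2r // hexp.
have H1 (n : nat) : nm (u n%:Z) <= K * (h * expR (- (h * n%:R))).
  by apply: le_trans (H _) _; rewrite /xi -pmulrn ger0_norm // mulr_ge0 // ltW.
have H2 (n : nat) : nm (u (- n.+1%:Z)) <= K * (h * expR (- (h * n%:R))).
  apply: le_trans (H _) _; rewrite /xi mulrNz mulrN normrN -pmulrn ger0_norm; last by rewrite mulr_ge0 // ltW.
  by rewrite !ler_wpM2l ?(ltW h0) // ler_expR lerN2 ler_pM2l // ler_nat.
split; first by split; [apply: asum_bsum H1 _ | apply: asum_bsum H2 _]; exists (2 * K).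
apply: le_trans (nmD _ _) _; have -> : 4 * K = 2 * K + 2 * K by ring.
by apply: lerD; [apply: nm_tsum H1 _ | apply: nm_tsum H2 _].
Qed.
(** The sixth power leaves room for a prefactor of degree two times the square of another one, as in
    [gdom]. It is absorbed by e^(6t), and completing the square gives the constant. *)
Lemma gauss_dom (a c : R) : 0 < a -> exists2 K, 0 <= K &
  forall t, 0 <= t -> (1 + t) ^+ 6 * expR (c * (1 + t) - a * t ^+ 2) <= K * expR (- t).
Proof.
move=> a0; exists (expR (c + (c + 7) ^+ 2 / (4 * a))); first exact: expR_ge0.
move=> t t0; have : (1 + t) ^+ 6 <= expR (6 * t).
  by rewrite (_ : 6 * t = t *+ 6) -?expRM_natl ?mulr_natl // ?lerXn2r ?nnegrE ?expR_ge0 ?expR_ge1Dx ?addr_ge0 // -mulr_natl expRM_natl lerXn2r ?nnegrE ?expR_ge0 ?expR_ge1Dx ?addr_ge0.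
move=> h; apply: le_trans (ler_wpM2r (expR_ge0 _) h) _; rewrite -!expRD ler_expR.
have -> : c + (c + 7) ^+ 2 / (4 * a) - t = 6 * t + (c * (1 + t) - a * t ^+ 2) + a * (t - (c + 7) / (2 * a)) ^+ 2.
  by field; rewrite gt_eqF.
by rewrite lerDl mulr_ge0 ?sqr_ge0 ?ltW.
Qed.
(** The constant is fixed before the mesh, the weight [g], the prefactor [p] and the perturbation
    [w]. The second half says that replacing [g] by [g] times e^w agrees with its linearisation up
    to a quadratic error, summed over all nodes. *)
Lemma gdom (a c C0 : R) : 0 < a -> 0 <= c -> 0 <= C0 -> exists2 A, 0 <= A &
  forall (h : R) (g p : int -> C), 0 < h <= 1 ->
  (forall m, nm (g m) <= C0 * expR (- (a * xi h m ^+ 2))) ->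
  (forall m, nm (p m) <= c * (1 + `|xi h m|) ^+ 2) ->
  (zas (fun m => h%:C%C * (g m * p m)) /\ nm (zs (fun m => h%:C%C * (g m * p m))) <= A) /\
  forall (q : R) (w : int -> C), 0 <= q ->
  (forall m, nm (w m) <= q * (c * (1 + `|xi h m|) ^+ 2)) ->
  (forall m, nm (w m) <= c * (1 + `|xi h m|) + a / 2 * xi h m ^+ 2) ->
  zas (fun m => h%:C%C * (g m * p m * (cexp (w m) - 1 - w m))) /\
  nm (zs (fun m => h%:C%C * (g m * p m * (cexp (w m) - 1 - w m)))) <= A * q ^+ 2.
Proof.
move=> a0 c0 C00; have a2 : 0 < a / 2 by rewrite divr_gt0.
have [K K0 HK] := gauss_dom c a2.
pose A1 := C0 * c * K; pose A2 := 6 * (C0 * c ^+ 3 * K).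
have A10 : 0 <= A1 by rewrite !mulr_ge0.
have A20 : 0 <= A2 by rewrite !mulr_ge0 ?exprn_ge0.
exists (4 * (A1 + A2)) => [|h g p hh Hg Hp]; first by rewrite mulr_ge0 ?addr_ge0.
have h0 : 0 < h by case/andP: hh.
have nh : nm h%:C%C = h by rewrite nm_real gtr0_norm.
have pw (t : R) k : 0 <= t -> (k <= 6)%N -> (1 + t) ^+ k <= (1 + t) ^+ 6.
  by move=> t0 k6; rewrite ler_weXn2l // lerDl.
split=> [|q w q0 Hw1 Hw2].
  have [|z1 z2] := @zs_bound h A1 (fun m => h%:C%C * (g m * p m)) hh A10.
    move=> m; set t := `|xi h m|; have t0 : 0 <= t by apply: normr_ge0.
    rewrite !nmM nh [leRHS]mulrCA ler_wpM2l ?(ltW h0) //.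
    apply: le_trans (ler_pM (nm_ge0 _) (nm_ge0 _) (Hg m) (Hp m)) _.
    rewrite -(real_normK (num_real (xi h m))) -/t.
    rewrite (_ : C0 * _ * _ = C0 * c * ((1 + t) ^+ 2 * expR (- (a * t ^+ 2)))); last by ring.
    rewrite /A1 -(mulrA (C0 * c)) ler_wpM2l ?mulr_ge0 //.
    apply: le_trans (HK t t0); rewrite ler_pM ?exprn_ge0 ?expR_ge0 ?pw ?addr_ge0 // ler_expR.
    have := sqr_ge0 t; have : 0 <= c * (1 + t) by rewrite mulr_ge0 ?addr_ge0.
    by nra.
  by split=> //; apply: le_trans z2 _; rewrite ler_pM2l // lerDl.
have B0 : 0 <= A2 * q ^+ 2 by rewrite mulr_ge0 ?sqr_ge0.
have [|z1 z2] := @zs_bound h (A2 * q ^+ 2) (fun m => h%:C%C * (g m * p m * (cexp (w m) - 1 - w m))) hh B0.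
  move=> m; set t := `|xi h m|; have t0 : 0 <= t by apply: normr_ge0.
  rewrite nmM nh [leRHS]mulrCA ler_wpM2l ?(ltW h0) // !nmM.
  apply: le_trans (ler_pM _ (nm_ge0 _) (ler_pM (nm_ge0 _) (nm_ge0 _) (Hg m) (Hp m)) (cexp_lin _)) _.
    by rewrite mulr_ge0 ?nm_ge0.
  move: (Hw1 m) (Hw2 m); rewrite -(real_normK (num_real (xi h m))) -/t => w1 w2.
  have E1 : expR (nm (w m)) <= expR (c * (1 + t) + a / 2 * t ^+ 2) by rewrite ler_expR.
  have E2 : nm (w m) ^+ 2 <= (q * (c * (1 + t) ^+ 2)) ^+ 2.
    by rewrite lerXn2r ?nnegrE ?nm_ge0 // !mulr_ge0 ?exprn_ge0 ?addr_ge0.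
  apply: le_trans (_ : C0 * expR (- (a * t ^+ 2)) * (c * (1 + t) ^+ 2) *
     (6 * (q * (c * (1 + t) ^+ 2)) ^+ 2 * expR (c * (1 + t) + a / 2 * t ^+ 2)) <= _).
    by rewrite ler_wpM2l ?mulr_ge0 ?exprn_ge0 ?addr_ge0 ?expR_ge0 // ler_pM ?mulr_ge0 ?exprn_ge0 ?nm_ge0 ?expR_ge0 // ler_wpM2l.
  have -> : C0 * expR (- (a * t ^+ 2)) * (c * (1 + t) ^+ 2) *
     (6 * (q * (c * (1 + t) ^+ 2)) ^+ 2 * expR (c * (1 + t) + a / 2 * t ^+ 2)) =
     6 * (C0 * c ^+ 3) * q ^+ 2 * ((1 + t) ^+ 6 * expR (c * (1 + t) - a / 2 * t ^+ 2)).
    rewrite (_ : expR (c * (1 + t) - a / 2 * t ^+ 2) = expR (- (a * t ^+ 2)) * expR (c * (1 + t) + a / 2 * t ^+ 2)); first by ring.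
    by rewrite -expRD; congr expR; field.
  apply: le_trans (ler_wpM2l _ (HK t t0)) _; first by rewrite !mulr_ge0 ?exprn_ge0.
  by rewrite /A2 le_eqVlt; apply/orP; left; apply/eqP; ring.
by split=> //; apply: le_trans z2 _; rewrite mulrA ler_wpM2r ?sqr_ge0 // ler_pM2l // lerDr.
Qed.
End ZSum.

(** * Riemann sums of complex Gaussians *)

Section Gauss.
Variable R : realType.
Local Notation C := (R[i]).
Local Notation ipi := (Complex 0 pi : C).
(* the Gaussian exp (pi i s (x - k/s)^2) *)
Definition gau (s : C) (k x : R) : C := cexp (ipi * s * (x%:C - k%:C / s) ^+ 2).
Lemma nm_ipi : nm ipi = pi.
Proof. by rewrite /nm /= expr0n add0r sqrtr_sqr ger0_norm // pi_ge0. Qed.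
Lemma nm_gau (s : C) (k k1 x : R) : 0 < Im s -> `|k| <= k1 ->
  nm (gau s k x) <= expR (pi * k1 ^+ 2 * nm s^-1) * expR (- (pi * Im s * x ^+ 2)).
Proof.
move=> s0 kk; have s1 : s != 0 by apply: contraTneq s0 => ->; rewrite ltxx.
rewrite nm_cexp -expRD ler_expR.
have -> : ipi * s * (x%:C - k%:C / s) ^+ 2 = ipi * (s * (x ^+ 2)%:C - (2 * k * x)%:C + (k ^+ 2)%:C / s).
  have -> : (2 * k * x)%:C = 2 * k%:C * x%:C by rewrite !rmorphM rmorph_nat.
  by rewrite !rmorphXn /=; field.
set z := _ / s; have zk : - Im z <= k1 ^+ 2 * nm s^-1.
  apply: le_trans (ler_norm _) _; rewrite normrN; apply: le_trans (Im_nm _) _.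
  rewrite nmM nm_real ler_wpM2r ?nm_ge0 // normrX lerXn2r ?nnegrE //; exact: le_trans kk.
have -> : Re (ipi * (s * (x ^+ 2)%:C - (2 * k * x)%:C + z)) =
    - (pi * Im s * x ^+ 2) + pi * (- Im z).
  by move: z zk => -[z1 z2] _; case: (s) => a b /=; ring.
by rewrite addrC lerD2r -mulrA ler_pM2l ?pi_gt0.
Qed.
Lemma gau_step_k (s : C) (k d x : R) : s != 0 ->
  gau s (k + d) x = gau s k x * cexp (- (2 * ipi * d%:C * (x%:C - k%:C / s)) + ipi * (d ^+ 2)%:C / s).
Proof. by move=> s0; rewrite /gau -cexpD; congr cexp; rewrite !(rmorphD, rmorphXn) /=; field. Qed.
Lemma gau_step_x (s : C) (k d x : R) :
  gau s k (x + d) = gau s k x * cexp (2 * ipi * s * d%:C * (x%:C - k%:C / s) + ipi * s * (d ^+ 2)%:C).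
Proof. by rewrite /gau -cexpD; congr cexp; rewrite !(rmorphD, rmorphXn) /=; ring. Qed.
Lemma gau_step_s (s d : C) (x : R) :
  gau (s + d) 0 x = gau s 0 x * cexp (ipi * d * (x ^+ 2)%:C).
Proof. by rewrite /gau -cexpD; congr cexp; rewrite !mul0r !subr0 rmorphXn /=; ring. Qed.
Lemma gau_ee (s : C) (k x : R) : s != 0 ->
  gau s 0 x * ee (- (k * x)%:C) = cexp (- (ipi * (k ^+ 2)%:C / s)) * gau s k x.
Proof.
move=> s0; rewrite /gau /ee -!cexpD; congr cexp; rewrite rmorphXn rmorphM /=.
rewrite (_ : Complex 0 (2 * pi) = 2 * ipi); first by field.
by rewrite -(rmorph_nat (real_complex R)); simpc.
Qed.
Lemma nm_C (r : R) : 0 <= r -> nm r%:C = r. Proof. by move=> r0; rewrite nm_real ger0_norm. Qed.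
Lemma xi1 h m : xi h (m + 1) = xi h m + h :> R.
Proof. by rewrite /xi rmorphD mulrDr mulr1. Qed.
(** Moving the centre k/s of the Gaussian changes its Riemann sums by O(h) only, a contour shift in
    discrete form. The derivative in k is a multiple of the first moment [S1], and [S1] is O(h)
    because the sum is invariant under a shift by one node. *)
Lemma gau_shift (s : C) (k1 : R) : 0 < Im s -> exists2 A, 0 <= A & forall h : R, 0 < h <= 1 ->
  nm (zs (fun m => h%:C * gau s k1 (xi h m)) - zs (fun m => h%:C * gau s 0 (xi h m))) <= A * h.
Proof.
move=> s0; have s1 : s != 0 by apply: contraTneq s0 => ->; rewrite ltxx.
have pi0 : 0 < (pi : R) := pi_gt0 R.
have ns : 0 < nm s by rewrite nm_gt0.
have ni0 := nm_ge0 s^-1; set ni := nm s^-1 in ni0 *.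
pose c0 := 1 + `|k1| * ni; have c00 : 1 <= c0 by rewrite lerDl mulr_ge0.
pose c := c0 + 2 * pi * `|k1| * c0 + pi * k1 ^+ 2 * ni + 2 * pi * nm s * c0 + pi * nm s + 1.
have t1 : 0 <= 2 * pi * `|k1| * c0 by nn; apply: le_trans c00.
have t2 : 0 <= pi * k1 ^+ 2 * ni by nn.
have t3 : 0 <= 2 * pi * nm s * c0 by nn; apply: le_trans c00.
have t4 : 0 <= pi * nm s by nn.
have cc : 0 <= c by rewrite /c; lra.
have a0 : 0 < pi * Im s by rewrite mulr_gt0.
have [A A0 HA] := gdom a0 cc (expR_ge0 (pi * `|k1| ^+ 2 * ni)).
pose A' := A * (2 * pi * `|k1| * (1 + (2 * pi * nm s)^-1) + pi * k1 ^+ 2 * ni + 1).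
have A'0 : 0 <= A' by rewrite /A'; nn.
exists A' => // h hh; have [h0 h1] := andP hh.
have := @small_steps R (fun t => zs (fun m => h%:C * gau s (t * k1) (xi h m))) A' h 1 A'0 (ltW h0) ltr01.
rewrite mul1r mul0r; apply => t d t0 d0 td d1.
have tk : `|t * k1| <= `|k1| by rewrite normrM ler_piMl // ger0_norm //; lra.
rewrite mulrDl; set k := t * k1 in tk *; set del := d * k1.
pose g m := gau s k (xi h m); pose X m : C := (xi h m)%:C - k%:C / s.
have Hg m : nm (g m) <= expR (pi * `|k1| ^+ 2 * ni) * expR (- (pi * Im s * xi h m ^+ 2)).
  exact: nm_gau.
have HX m : nm (X m) <= c0 * (1 + `|xi h m|).
  apply: le_trans (nmB _ _) _; rewrite nmM !nm_real -/ni.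
  have := ler_wpM2r ni0 tk; have := normr_ge0 (xi h m); have : 0 <= `|k1| * ni by rewrite mulr_ge0.
  rewrite /c0; nra.
have sq m : 1 + `|xi h m| <= (1 + `|xi h m|) ^+ 2 by rewrite expr2 ler_peMr ?addr_ge0 // lerDl.
have T0 m : 1 <= 1 + `|xi h m| by rewrite lerDl.
have P1 m : nm (1 : C) <= c * (1 + `|xi h m|) ^+ 2.
  rewrite nm1; have := sq m; have := T0 m; have : 1 <= c by rewrite /c; lra.
  nra.
have PX m : nm (X m) <= c * (1 + `|xi h m|) ^+ 2.
  apply: le_trans (HX m) _; apply: ler_pM; [by apply: le_trans c00|by nn|by rewrite /c; lra|exact: sq].
have [[z0 n0] E1] := HA h g (fun=> 1) hh Hg P1.
have [[zX nX] _] := HA h g X hh Hg PX.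
pose w m := - (2 * ipi * del%:C * X m) + ipi * (del ^+ 2)%:C / s.
pose w' m := 2 * ipi * s * h%:C * X m + ipi * s * (h ^+ 2)%:C.
have n2i : nm (2 * ipi) = 2 * pi by rewrite nmM nm_nat nm_ipi.
have Hw m : nm (w m) <= d * (c * (1 + `|xi h m|)).
  apply: le_trans (nmD _ _) _; rewrite nmN nmM (nmM (2 * ipi)) n2i !(nmM (_ * _) _) nmM nm_ipi -/ni !nm_real.
  rewrite normrX /del normrM (ger0_norm d0) exprMn real_normK ?num_real //.
  have B1 : 2 * pi * (d * `|k1|) * nm (X m) <= 2 * pi * (d * `|k1|) * (c0 * (1 + `|xi h m|)) by apply: ler_wpM2l => //; nn.
  have dd : d ^+ 2 <= d by rewrite expr2 ler_piMr.
  have B2 : pi * (d ^+ 2 * k1 ^+ 2) * ni <= d * (pi * k1 ^+ 2 * ni).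
    by rewrite (_ : pi * _ * ni = d ^+ 2 * (pi * k1 ^+ 2 * ni)) ?ler_wpM2r //; ring.
  apply: le_trans (lerD B1 B2) _.
  rewrite (_ : _ + _ = d * (2 * pi * `|k1| * c0 * (1 + `|xi h m|) + pi * k1 ^+ 2 * ni)); last by ring.
  rewrite ler_wpM2l // /c; have := T0 m; nra.
have Hw' m : nm (w' m) <= h * (c * (1 + `|xi h m|)).
  apply: le_trans (nmD _ _) _; rewrite !nmM nm_nat nm_ipi !nm_real (gtr0_norm h0) (gtr0_norm (exprn_gt0 _ h0)).
  have B1 : 2 * pi * nm s * h * nm (X m) <= 2 * pi * nm s * h * (c0 * (1 + `|xi h m|)) by apply: ler_wpM2l => //; nn.
  have dd : h ^+ 2 <= h by rewrite expr2 ler_piMr // ltW.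
  have B2 := ler_wpM2l t4 dd.
  apply: le_trans (lerD B1 B2) _.
  rewrite (_ : _ + _ = h * (2 * pi * nm s * c0 * (1 + `|xi h m|) + pi * nm s)); last by ring.
  rewrite ler_wpM2l ?(ltW h0) // /c; have := T0 m; nra.
have up (q : R) (v : int -> C) m : 0 <= q <= 1 -> nm (v m) <= q * (c * (1 + `|xi h m|)) ->
   nm (v m) <= q * (c * (1 + `|xi h m|) ^+ 2) /\ nm (v m) <= c * (1 + `|xi h m|) + pi * Im s / 2 * xi h m ^+ 2.
  move=> /andP[q0 q1] hv; split; first by apply: le_trans hv _; rewrite !ler_wpM2l.
  apply: le_trans hv _; apply: le_trans (_ : c * (1 + `|xi h m|) <= _).
    by apply: ler_piMl => //; nn.
  by rewrite lerDl; nn.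
have d01 : 0 <= d <= 1 by rewrite d0 /=; lra.
have h01 : 0 <= h <= 1 by rewrite ltW.
have [zE nE] := E1 d w d0 (fun m => (up d w m d01 (Hw m)).1) (fun m => (up d w m d01 (Hw m)).2).
have [zE' nE'] := E1 h w' (ltW h0) (fun m => (up h w' m h01 (Hw' m)).1) (fun m => (up h w' m h01 (Hw' m)).2).
set S0 := zs (fun m => h%:C * (g m * 1)) in n0.
set S1 := zs (fun m => h%:C * (g m * X m)) in nX.
set SE := zs (fun m => h%:C * (g m * 1 * (cexp (w m) - 1 - w m))) in nE.
set SE' := zs (fun m => h%:C * (g m * 1 * (cexp (w' m) - 1 - w' m))) in nE'.
have D1 : zs (fun m => h%:C * gau s (k + del) (xi h m)) =
    S0 + ((- (2 * ipi * del%:C) * S1) + (ipi * (del ^+ 2)%:C / s * S0 + SE)).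
  rewrite -!zsZ // -!zsD //; try by repeat apply: zasD => //; apply: zasZ.
  by apply: zs_eq => m; rewrite gau_step_k // -/(X m) -/(w m) -/(g m) /w; ring.
(* Shifting the index by one changes nothing; expanding the shifted summand expresses [S1] through
   terms of order h. *)
have D2 : S0 = S0 + (2 * ipi * s * h%:C * S1 + (ipi * s * (h ^+ 2)%:C * S0 + SE')).
  rewrite -[LHS]zs_shift // -!zsZ // -!zsD //; try by repeat apply: zasD => //; apply: zasZ.
  by apply: zs_eq => m; rewrite /g xi1 gau_step_x -/(X m) -/(w' m) -/(g m) /w'; ring.
have -> : zs (fun m => h%:C * gau s k (xi h m)) = S0 by apply: zs_eq => m; rewrite mulr1.
have h1C : h%:C != 0 :> C by rewrite fmorph_eq0 gt_eqF.
have ip0 : ipi != 0 by rewrite -nm_eq0 nm_ipi gt_eqF.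
have E2 : S1 = - ((h / 2)%:C * S0) - SE' / (2 * ipi * s * h%:C).
  have : 2 * ipi * s * h%:C * S1 + (ipi * s * (h ^+ 2)%:C * S0 + SE') = 0.
    by apply: (addrI S0); rewrite -D2 addr0.
  move/eqP; rewrite addr_eq0 => /eqP E; apply: (mulfI (x := 2 * ipi * s * h%:C)).
    by rewrite !mulf_neq0 // pnatr_eq0.
  have -> : (h / 2)%:C = h%:C / 2 by rewrite rmorphM fmorphV rmorph_nat.
  by rewrite E rmorphXn /=; field; rewrite h1C s1 ip0.
have S1b : nm S1 <= h * A * (1 + (2 * pi * nm s)^-1).
  rewrite E2; apply: le_trans (nmB _ _) _; rewrite nmN !nmM nmV !nmM nm_nat nm_ipi (nm_C (ltW h0)) nm_real gtr0_norm ?divr_gt0 //.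
  apply: le_trans (lerD (ler_wpM2l _ n0) (ler_wpM2r _ nE')) _; try by nn.
  have aux (p n : R) : 0 < p -> 0 < n -> h / 2 * A + A * h ^+ 2 / (2 * p * n * h) = h * A * (2^-1 + (2 * p * n)^-1).
    by move=> p0 n0'; field; rewrite !gt_eqF.
  rewrite aux //.
  by rewrite ler_wpM2l ?mulr_ge0 ?(ltW h0) // lerD2r invf_le1 // ler1n.
rewrite D1 addrAC subrr add0r; apply: le_trans (nmD _ _) _; apply: le_trans (lerD (lexx _) (nmD _ _)) _.
rewrite !nmM nmN nmM n2i nm_ipi -/ni !nm_real normrX /del normrM (ger0_norm d0) exprMn real_normK ?num_real //.
apply: le_trans (lerD (ler_wpM2l _ S1b) (lerD (ler_wpM2l _ n0) nE)) _; try by nn.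
rewrite /A' -subr_ge0 (_ : _ - _ = A * (2 * pi * `|k1| * (1 + (2 * pi * nm s)^-1) * d ^+ 2 + (pi * k1 ^+ 2 * ni + 1) * (d * h))); last by ring.
by nn.
Qed.
End Gauss.

Section GaussJ.
Variable R : realType.
Local Notation C := (R[i]).
Local Notation ipi := (Complex 0 pi : C).
Local Notation gI h s := (zs (fun m => (h : R)%:C * gau s 0 (xi h m))).
(** With x = d N / n this bounds n times the two terms of (1 - x/2)^2 (1 + x) - 1 = x^3/4 - 3 x^2/4,
    which has no linear term because I(s)^2 s is stationary. *)
Lemma J_aux (d N y n : R) : 0 <= d -> d <= 1 -> 0 <= N -> 0 < y -> y <= n ->
  (d * N) ^+ 3 / (4 * n ^+ 2) + 3 * (d * N) ^+ 2 / (4 * n) <= (3 / 4 * N ^+ 2 / y + N ^+ 3 / (4 * y ^+ 2)) * d ^+ 2.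
Proof.
move=> d0 d1 N0 y0 yn; have n0 : 0 < n := lt_le_trans y0 yn.
have i : n^-1 <= y^-1 by rewrite lef_pV2 ?posrE.
have A1 : 3 / 4 * N ^+ 2 * d ^+ 2 * n^-1 <= 3 / 4 * N ^+ 2 * d ^+ 2 * y^-1 by apply: ler_wpM2l => //; nn.
have A2 : N ^+ 3 / 4 * d ^+ 2 * (n^-1 ^+ 2 * d) <= N ^+ 3 / 4 * d ^+ 2 * (y^-1 ^+ 2 * 1).
  apply: ler_wpM2l; first by nn.
  by apply: ler_pM => //; nn; rewrite lerXn2r ?nnegrE //; nn.
have -> : (d * N) ^+ 3 / (4 * n ^+ 2) + 3 * (d * N) ^+ 2 / (4 * n) =
  N ^+ 3 / 4 * d ^+ 2 * (n^-1 ^+ 2 * d) + 3 / 4 * N ^+ 2 * d ^+ 2 * n^-1 by field; rewrite gt_eqF.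
apply: le_trans (lerD A2 A1) _; rewrite le_eqVlt; apply/orP; left; apply/eqP; by field; rewrite gt_eqF.
Qed.
(* Summation by parts on x g gives M0 + 2 pi i s M2 = O(h), which is the differential equation I' = - I / (2 s). *)
Lemma gau_J (s0 s1 : C) : 0 < Im s0 -> 0 < Im s1 -> exists2 A, 0 <= A &
  forall h : R, 0 < h <= 1 -> nm (gI h s1 ^+ 2 * s1 - gI h s0 ^+ 2 * s0) <= A * h.
Proof.
move=> i0 i1; have pi0 : 0 < (pi : R) := pi_gt0 R.
pose y := Num.min (Im s0) (Im s1); have y0 : 0 < y by rewrite lt_min i0.
pose D := s1 - s0; have D0 := nm_ge0 D; set N := nm D in D0.
pose S := nm s0 + N; have S0 : 0 <= S by rewrite addr_ge0 ?nm_ge0.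
pose c := 1 + pi * N + 2 * pi * S + pi * S.
have t1 : 0 <= pi * N by nn.
have t2 : 0 <= pi * S by nn.
have c1 : 1 <= c by rewrite /c; lra.
have cc : 0 <= c by apply: le_trans c1.
have a0 : 0 < pi * y by rewrite mulr_gt0.
have [A A0 HA] := gdom a0 cc ler01.
pose B1 := (4 * pi * S + 2) / (2 * y); have B10 : 0 <= B1 by rewrite /B1; nn.
pose B3 := A * (N * B1 + 1); have B30 : 0 <= B3 by rewrite /B3; nn.
pose B2 := 2 * (A * (1 + N / (2 * y))) + 2 * B3; have B20 : 0 <= B2 by rewrite /B2; nn.
pose A' := A ^+ 2 * (3 / 4 * N ^+ 2 / y + N ^+ 3 / (4 * y ^+ 2)) + B2 * S * B3.
have A'0 : 0 <= A' by rewrite /A'; nn.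
exists A' => // h hh; have [h0 h1] := andP hh.
(* This limit on the step keeps the perturbation below half of the Gaussian decay, as [Hw2]
   requires. *)
have d00 : 0 < Num.min 1 (y / (2 * (N + 1))) by rewrite lt_min ltr01 divr_gt0 // mulr_gt0 // ltr_wpDl.
have := @small_steps R (fun t => gI h (s0 + t%:C * D) ^+ 2 * (s0 + t%:C * D)) A' h _ A'0 (ltW h0) d00.
rewrite mul1r mul0r addr0 [s0 + D]addrC subrK; apply => t d t0 d0 td.
rewrite le_min => /andP[d1 dy].
rewrite rmorphD mulrDl addrA; set s := s0 + t%:C * D; set del : C := d%:C * D.
have t1' : t <= 1 by lra.
have ys : y <= Im s.
  have -> : Im s = (1 - t) * Im s0 + t * Im s1.
    by rewrite /s /D; case: (s0) (s1) => [a b] [a' b'] /=; ring.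
  have y1 : y <= Im s0 by rewrite ge_min lexx.
  have y2 : y <= Im s1 by rewrite ge_min lexx orbT.
  nra.
have yn : y <= nm s by apply: le_trans (Im_nm s); apply: le_trans ys (ler_norm _).
have ns0 : 0 < nm s := lt_le_trans y0 yn.
have sS : nm s <= S.
  apply: le_trans (nmD _ _) _; rewrite lerD2l nmM nm_C // ler_piMl //.
have sS' : nm (s + del) <= S.
  rewrite /s /del -addrA -mulrDl -rmorphD; apply: le_trans (nmD _ _) _; rewrite lerD2l nmM nm_C ?addr_ge0 // ler_piMl //.
have s10 : s != 0 by rewrite -nm_gt0; apply: lt_le_trans yn.
have nd : nm del = d * N by rewrite nmM nm_C.
pose g m := gau s 0 (xi h m); pose X m : C := (xi h m)%:C.
have Hg m : nm (g m) <= 1 * expR (- (pi * y * xi h m ^+ 2)).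
  apply: le_trans (@nm_gau R s 0 0 (xi h m) _ _) _; rewrite ?normr0 ?(lt_le_trans y0) //.
  rewrite expr0n mulr0 mul0r expR0 !mul1r ler_expR lerN2 ler_wpM2r ?sqr_ge0 // ler_pM2l //.
have T0 m : 1 <= 1 + `|xi h m| by rewrite lerDl.
have sq m : 1 + `|xi h m| <= (1 + `|xi h m|) ^+ 2 by rewrite expr2 ler_peMr ?addr_ge0.
have sq1 m : (1 + `|xi h m|) ^+ 2 <= c * (1 + `|xi h m|) ^+ 2 by rewrite ler_peMl ?sqr_ge0.
have nX m : nm (X m) = `|xi h m| by rewrite nm_real.
have P0 m : nm (1 : C) <= c * (1 + `|xi h m|) ^+ 2.
  by rewrite nm1; apply: le_trans (sq1 m); apply: le_trans (sq m).
have PX m : nm (X m) <= c * (1 + `|xi h m|) ^+ 2.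
  by rewrite nX; apply: le_trans (sq1 m); apply: le_trans (sq m); rewrite lerDr.
have PXX m : nm (X m ^+ 2) <= c * (1 + `|xi h m|) ^+ 2.
  by rewrite nmX nX; apply: le_trans (sq1 m); rewrite lerXn2r ?nnegrE ?addr_ge0 // lerDr.
have [[z0 n0] E0] := HA h g (fun=> 1) hh Hg P0.
have [[z1 n1] E1] := HA h g X hh Hg PX.
have [[z2 n2] _] := HA h g (fun m => X m ^+ 2) hh Hg PXX.
pose w m := ipi * del * (xi h m ^+ 2)%:C.
pose w' m := 2 * ipi * s * h%:C * X m + ipi * s * (h ^+ 2)%:C.
have nw m : nm (w m) = d * (pi * N * xi h m ^+ 2).
  by rewrite /w (nmM (ipi * del)) (nmM ipi) nd nm_ipi nm_C ?sqr_ge0 //; ring.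
have Hw1 m : nm (w m) <= d * (c * (1 + `|xi h m|) ^+ 2).
  rewrite nw ler_wpM2l // -(real_normK (num_real (xi h m))) ler_pM ?sqr_ge0 //.
    by move: t1 t2; rewrite /c; clear; lra.
  by rewrite lerXn2r ?nnegrE ?addr_ge0 // lerDr.
have Hw2 m : nm (w m) <= c * (1 + `|xi h m|) + pi * y / 2 * xi h m ^+ 2.
  rewrite nw; apply: le_trans (_ : pi * y / 2 * xi h m ^+ 2 <= _); last by rewrite lerDr; nn.
  rewrite mulrA ler_wpM2r ?sqr_ge0 // mulrCA -mulrA ler_wpM2l ?pi_ge0 //.
  apply: le_trans (ler_wpM2r D0 dy) _; rewrite -mulrA ler_wpM2l ?(ltW y0) //.
  by rewrite invfM -mulrA ler_piMr // mulrC ler_pdivrMr ?mul1r ?lerDl // ltr_wpDl.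
have Hw' m : nm (w' m) <= h * (c * (1 + `|xi h m|)).
  apply: le_trans (nmD _ _) _; rewrite !nmM nm_nat nm_ipi !nm_real (gtr0_norm h0) (gtr0_norm (exprn_gt0 _ h0)).
  have dd : h ^+ 2 <= h by rewrite expr2 ler_piMr // ltW.
  have F1 : 2 * pi * nm s * h * `|xi h m| <= 2 * pi * S * h * `|xi h m| by rewrite !ler_wpM2r ?(ltW h0) // ler_wpM2l //; nn.
  have F2 : pi * nm s * h ^+ 2 <= pi * S * h by rewrite ler_pM //; nn; rewrite ler_wpM2l //; nn.
  apply: le_trans (lerD F1 F2) _.
  rewrite (_ : _ + _ = h * (2 * pi * S * `|xi h m| + pi * S)); last by ring.
  rewrite ler_wpM2l ?(ltW h0) // /c; have := T0 m; move: t1 t2; clear; nra.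
have U1 m : nm (w' m) <= h * (c * (1 + `|xi h m|) ^+ 2).
  by apply: le_trans (Hw' m) _; rewrite !ler_wpM2l // ltW.
have U2 m : nm (w' m) <= c * (1 + `|xi h m|) + pi * y / 2 * xi h m ^+ 2.
  apply: le_trans (Hw' m) _; apply: le_trans (_ : c * (1 + `|xi h m|) <= _).
    by apply: ler_piMl => //; nn.
  by rewrite lerDl; nn.
have [zE nE] := E0 d w d0 Hw1 Hw2.
have [zE0 nE0] := E0 h w' (ltW h0) U1 U2.
have [zE1 nE1] := E1 h w' (ltW h0) U1 U2.
set M0 := zs (fun m => h%:C * (g m * 1)) in n0.
set M1 := zs (fun m => h%:C * (g m * X m)) in n1.
set M2 := zs (fun m => h%:C * (g m * X m ^+ 2)) in n2.
set SE := zs (fun m => h%:C * (g m * 1 * (cexp (w m) - 1 - w m))) in nE.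
set SE0 := zs (fun m => h%:C * (g m * 1 * (cexp (w' m) - 1 - w' m))) in nE0.
set SE1 := zs (fun m => h%:C * (g m * X m * (cexp (w' m) - 1 - w' m))) in nE1.
have F1 : gI h (s + del) = M0 + (ipi * del * M2 + SE).
  rewrite -!zsZ // -!zsD //; try by repeat apply: zasD => //; apply: zasZ.
  by apply: zs_eq => m; rewrite gau_step_s -/(w m) -/(g m) /w (rmorphXn (real_complex R)) /= -/(X m); ring.
have F2 : M1 = M1 + (2 * ipi * s * h%:C * M2 + (ipi * s * (h ^+ 2)%:C * M1 + (SE1 +
   (h%:C * M0 + (2 * ipi * s * h%:C * h%:C * M1 + (ipi * s * (h ^+ 2)%:C * h%:C * M0 + h%:C * SE0)))))).
  rewrite -[LHS]zs_shift // -!zsZ // -!zsD //; try by repeat apply: zasD => //; apply: zasZ.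
  apply: zs_eq => m; rewrite /g /X xi1 gau_step_x mul0r subr0 rmorphD /= -/(X m) -/(w' m) -/(g m) /w'.
  by ring.
have -> : gI h s = M0 by apply: zs_eq => m; rewrite mulr1.
have h1C : h%:C != 0 :> C by rewrite fmorph_eq0 gt_eqF.
have ip0 : ipi != 0 by rewrite -nm_eq0 nm_ipi gt_eqF.
pose r := 3 * ipi * s * h%:C * M1 + SE1 / h%:C + ipi * s * (h ^+ 2)%:C * M0 + SE0.
pose rho := - r / (2 * s).
have E2 : ipi * M2 = - M0 / (2 * s) + rho.
  have /esym/eqP := addrI _ (etrans (addr0 M1) F2).
  rewrite addr_eq0 => /eqP E; apply: (mulfI (x := 2 * s * h%:C)); first by rewrite !mulf_neq0 // pnatr_eq0.
  rewrite (_ : 2 * s * h%:C * (ipi * M2) = 2 * ipi * s * h%:C * M2); last by ring.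
  by rewrite E /rho /r (rmorphXn (real_complex R)) /=; field; rewrite h1C s10.
have nr : nm r <= h * A * (4 * pi * S + 2).
  apply: le_trans (nmD _ _) _; apply: le_trans (lerD (nmD _ _) (lexx _)) _.
  apply: le_trans (lerD (lerD (nmD _ _) (lexx _)) (lexx _)) _.
  rewrite !nmM nmV nm_nat nm_ipi !nm_C ?sqr_ge0 ?(ltW h0) //.
  have dd : h ^+ 2 <= h by rewrite expr2 ler_piMr // ltW.
  have G1 : 3 * pi * nm s * h * nm M1 <= 3 * pi * S * h * A by rewrite !ler_pM //; nn.
  have G2 : nm SE1 / h <= A * h by rewrite ler_pdivrMr // -mulrA -expr2.
  have G3 : pi * nm s * h ^+ 2 * nm M0 <= pi * S * h * A by rewrite !ler_pM //; nn.
  have G4 : nm SE0 <= A * h by apply: le_trans nE0 _; rewrite ler_wpM2l.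
  apply: le_trans (lerD (lerD (lerD G1 G2) G3) G4) _.
  by rewrite le_eqVlt; apply/orP; left; apply/eqP; ring.
have nrho : nm rho <= h * A * B1.
  rewrite nmM nmN nmV nmM nm_nat /B1 [leRHS]mulrA ler_pM //; nn.
  by rewrite lef_pV2 ?posrE ?mulr_gt0 // ler_pM2l.
pose e := del * rho + SE.
have ne : nm e <= B3 * (d ^+ 2 + d * h).
  apply: le_trans (nmD _ _) _; rewrite nmM nd.
  apply: le_trans (lerD (ler_wpM2l _ nrho) nE) _; first by nn.
  rewrite /B3 -subr_ge0 (_ : _ - _ = A * (N * B1 * d ^+ 2 + d * h)); last by ring.
  by nn.
have ne2 : nm e <= 2 * B3.
  apply: le_trans ne _; rewrite mulrC ler_wpM2r //.
  have : d ^+ 2 <= 1 by rewrite expr_le1.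
  have : d * h <= 1 by rewrite mulr_ile1 ?(ltW h0).
  by clear; lra.
pose u := M0 * (1 - del / (2 * s)).
have nu : nm u <= A * (1 + N / (2 * y)).
  rewrite nmM ler_pM ?nm_ge0 //; apply: le_trans (nmB _ _) _; rewrite nm1 lerD2l nmM nmV nmM nm_nat nd.
  rewrite ler_pM //; nn; first by rewrite ler_piMl.
  by rewrite lef_pV2 ?posrE ?mulr_gt0 // ler_pM2l.
have F3 : M0 + (ipi * del * M2 + SE) = u + e.
  have -> : M0 + (ipi * del * M2 + SE) = M0 + (del * (ipi * M2) + SE) by ring.
  by rewrite E2 /u /e; field.
rewrite F1 F3 (_ : (u + e) ^+ 2 * (s + del) - M0 ^+ 2 * s =
   M0 ^+ 2 * (del ^+ 3 / (4 * s ^+ 2) - 3 * del ^+ 2 / (4 * s)) + (2 * u + e) * (s + del) * e); last first.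
  by rewrite /u; field.
have yi : (nm s)^-1 <= y^-1 by rewrite lef_pV2 ?posrE.
have K1 : nm (del ^+ 3 / (4 * s ^+ 2) - 3 * del ^+ 2 / (4 * s)) <= (3 / 4 * N ^+ 2 / y + N ^+ 3 / (4 * y ^+ 2)) * d ^+ 2.
  apply: le_trans (nmB _ _) _; rewrite (nmM (del ^+ 3)) (nmM (3 * del ^+ 2)) (nmM 3 (del ^+ 2)) !nmV (nmM 4 (s ^+ 2)) (nmM 4 s) !nmX !nm_nat nd.
  exact: J_aux.
have K2 : nm (2 * u + e) <= B2.
  by apply: le_trans (nmD _ _) _; rewrite nmM nm_nat lerD // ler_pM2l.
apply: le_trans (nmD _ _) _; rewrite (nmM (M0 ^+ 2)) nmX (nmM _ e) (nmM (2 * u + e)).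
have M02 : nm M0 ^+ 2 <= A ^+ 2 by rewrite lerXn2r ?nnegrE ?nm_ge0.
apply: le_trans (lerD (ler_pM _ _ M02 K1) (ler_pM _ _ (ler_pM _ _ K2 sS') ne)) _; try by nn.
rewrite /A' -subr_ge0 (_ : _ - _ = A ^+ 2 * (3 / 4 * N ^+ 2 / y + N ^+ 3 / (4 * y ^+ 2)) * (d * h)); last by ring.
by nn.
Qed.
Lemma sin_ge8 (u : R) : 0 <= u <= pi / 2 -> u / 8 <= sin u.
Proof.
move=> /andP[u0 u1]; have h := pihalf_lt2 R; have p1 := pihalf_ge1 R.
have K (v : R) : 0 <= v <= 1 / 2 -> v / 2 <= sin v.
  move=> /andP[v0 v1]; have := sin_sub_abs v; rewrite ler_norml => /andP[+ _].
  have : v ^+ 2 <= v / 2 by rewrite expr2; apply: ler_wpM2l => //; lra.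
  by lra.
case: (leP u (1 / 2)) => uu; first by apply: le_trans (K u _); [lra | rewrite u0].
apply: le_trans (_ : 1 / 4 <= _); first by lra.
apply: le_trans (_ : sin (1 / 2) <= _); first by apply: le_trans (K _ _); lra.
by apply: ltW; rewrite ltr_sin // in_itv /=; apply/andP; split; lra.
Qed.
Lemma nm_ee_sub1 (t : R) : `|t| <= 1 / 2 -> t ^+ 2 / 4 <= nm (ee t%:C - 1) ^+ 2.
Proof.
move=> ht; rewrite nm2 /ee /cexp /=; have pi0 := pi_ge2 R.
rewrite !mul0r !mulr0 subr0 add0r subr0 expR0 !mul1r.
rewrite (_ : 2 * pi * t = (pi * t) *+ 2); last by rewrite -[RHS]mulr_natr; ring.
have -> : (cos (pi * t *+ 2) - 1) ^+ 2 + sin (pi * t *+ 2) ^+ 2 = 4 * sin (pi * t) ^+ 2.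
  rewrite sin_mulr2n cos_mulr2n; have := cos2Dsin2 (pi * t) => E.
  rewrite -mulr_natr -[cos _ * sin _ *+ 2]mulr_natr.
  have -> : cos (pi * t) ^+ 2 = 1 - sin (pi * t) ^+ 2 by rewrite -E addrK.
  rewrite (_ : ((cos _ * _) * _) ^+ 2 = 4 * (cos (pi * t) ^+ 2 * sin (pi * t) ^+ 2)); last by ring.
  have -> : cos (pi * t) ^+ 2 = 1 - sin (pi * t) ^+ 2 by rewrite -E addrK.
  by ring.
have -> : sin (pi * t) ^+ 2 = sin (pi * `|t|) ^+ 2.
  by case: (leP 0 t) => t0; [rewrite ger0_norm | rewrite ltr0_norm // mulrN sinN sqrrN].
have tt := normr_ge0 t; rewrite -(real_normK (num_real t)).
have S := @sin_ge8 (pi * `|t|).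
have : pi * `|t| / 8 <= sin (pi * `|t|) by apply: S; apply/andP; split; nra.
move=> S1; have : `|t| / 4 <= sin (pi * `|t|) by nra.
move=> S2; have : (`|t| / 4) ^+ 2 <= sin (pi * `|t|) ^+ 2 by rewrite lerXn2r ?nnegrE ?divr_ge0 // (le_trans _ S2) // divr_ge0.
by rewrite exprMn; nra.
Qed.
(** Summation by parts twice: multiplying by om + 1/om - 2, of modulus at least (k h)^2 / 4, moves a
    second difference onto the Gaussian, where the linear terms cancel and O(h^2) remains. The
    condition 2|k| <= L keeps k h within half a period, where that lower bound holds. *)
Lemma gau_decay (s : C) : 0 < Im s -> exists2 A, 0 <= A & forall (L : nat) (k : int),
  (0 < L)%N -> (2 * `|k| <= L)%N -> k != 0 ->
  zas (fun m => (L%:R^-1)%:C * (gau s 0 (xi L%:R^-1 m) * ee (- (k%:~R * xi L%:R^-1 m)%:C))) /\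
  nm (zs (fun m => (L%:R^-1)%:C * (gau s 0 (xi L%:R^-1 m) * ee (- (k%:~R * xi L%:R^-1 m)%:C)))) <= A / (k%:~R ^+ 2).
Proof.
move=> s0; have pi0 : 0 < (pi : R) := pi_gt0 R.
have t2 : 0 <= pi * nm s by nn.
pose c := 1 + 2 * (pi * nm s) + pi * nm s; have c1 : 1 <= c by rewrite /c; lra.
have cc : 0 <= c by apply: le_trans c1.
have a0 : 0 < pi * Im s by rewrite mulr_gt0.
have [A A0 HA] := gdom a0 cc ler01.
exists (4 * (2 * pi * nm s * A + 2 * A)) => [|L k L0 kL k0]; first by nn.
set h : R := L%:R^-1; have h0 : 0 < h by rewrite invr_gt0 ltr0n.
have h1 : h <= 1 by rewrite invf_le1 ?ltr0n // ler1n.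
have hh : 0 < h <= 1 by rewrite h0.
pose g m := gau s 0 (xi h m); pose X m : C := (xi h m)%:C; pose e m := ee (- (k%:~R * xi h m)%:C).
have Hg m : nm (g m) <= 1 * expR (- (pi * Im s * xi h m ^+ 2)).
  apply: le_trans (@nm_gau R s 0 0 (xi h m) _ _) _; rewrite ?normr0 //.
  by rewrite expr0n mulr0 mul0r expR0 !mul1r.
have T0 m : 1 <= 1 + `|xi h m| by rewrite lerDl.
have sq m : 1 + `|xi h m| <= (1 + `|xi h m|) ^+ 2 by rewrite expr2 ler_peMr ?addr_ge0.
have sq1 m : (1 + `|xi h m|) ^+ 2 <= c * (1 + `|xi h m|) ^+ 2 by rewrite ler_peMl ?sqr_ge0.
have Pe m : nm (e m) <= c * (1 + `|xi h m|) ^+ 2.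
  by rewrite /e -rmorphN nm_eeR; apply: le_trans (sq1 m); apply: le_trans (sq m).
have [[z0 n0] E0] := HA h g e hh Hg Pe.
pose w (b : R) m := 2 * ipi * s * (b * h)%:C * X m + ipi * s * (h ^+ 2)%:C.
have Hw b m : `|b| = 1 -> nm (w b m) <= h * (c * (1 + `|xi h m|)).
  move=> b1; apply: le_trans (nmD _ _) _; rewrite !nmM nm_nat nm_ipi !nm_real normrM b1 mul1r (gtr0_norm h0) (gtr0_norm (exprn_gt0 _ h0)).
  have dd : h ^+ 2 <= h by rewrite expr2 ler_piMr // ltW.
  apply: le_trans (lerD (lexx _) (ler_wpM2l t2 dd)) _.
  rewrite (_ : _ + _ = h * (2 * (pi * nm s) * `|xi h m| + pi * nm s)); last by ring.
  rewrite ler_wpM2l ?(ltW h0) // /c; have := T0 m; nra.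
have U1 b m : `|b| = 1 -> nm (w b m) <= h * (c * (1 + `|xi h m|) ^+ 2).
  by move=> b1; apply: le_trans (Hw b m b1) _; rewrite !ler_wpM2l // ltW.
have U2 b m : `|b| = 1 -> nm (w b m) <= c * (1 + `|xi h m|) + pi * Im s / 2 * xi h m ^+ 2.
  move=> b1; apply: le_trans (Hw b m b1) _; apply: le_trans (_ : c * (1 + `|xi h m|) <= _).
    by apply: ler_piMl => //; nn.
  by rewrite lerDl; nn.
have b1 : `|1 : R| = 1 := normr1 R; have b2 : `|-1 : R| = 1 by rewrite normrN.
have [zP nP] := E0 h (w 1) (ltW h0) (fun m => U1 1 m b1) (fun m => U2 1 m b1).
have [zM nM] := E0 h (w (-1)) (ltW h0) (fun m => U1 (-1) m b2) (fun m => U2 (-1) m b2).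
split; first exact: z0.
set S := zs (fun m => h%:C * (g m * e m)) in n0.
set SP := zs (fun m => h%:C * (g m * e m * (cexp (w 1 m) - 1 - w 1 m))) in nP.
set SM := zs (fun m => h%:C * (g m * e m * (cexp (w (-1) m) - 1 - w (-1) m))) in nM.
pose om := ee (k%:~R * h)%:C; have om0 : om != 0 by apply: ee_neq0.
pose u m := h%:C * (g m * e m); pose v m := h%:C * (gau s 0 (xi h m - h) * e m).
have e1 m : e (m + 1) = e m / om.
  by rewrite /e xi1 mulrDr rmorphD opprD eeD (eeN (k%:~R * h)%:C).
have sh m : v (m + 1) = om^-1 * u m.
  by rewrite /v /u e1 xi1 addrK -/(g m); ring.
have zv : zas v.
  have zv' : zas (fun m => u m + (2 * ipi * s * (-1 * h)%:C * (h%:C * (g m * e m * X m)) + (ipi * s * (h ^+ 2)%:C * u m + h%:C * (g m * e m * (cexp (w (-1) m) - 1 - w (-1) m))))).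
    have Pg m : nm (e m * X m) <= c * (1 + `|xi h m|) ^+ 2.
      rewrite nmM /e -rmorphN nm_eeR mul1r nm_real; apply: le_trans (sq1 m); apply: le_trans (sq m); by rewrite lerDr.
    have [[zg _] _] := HA h g (fun m => e m * X m) hh Hg Pg.
    apply: zasD => //; apply: zasD; last by apply: zasD => //; apply: zasZ.
    by apply: zasZ; apply: zas_eq zg => m; ring.
  apply: zas_eq zv' => m; rewrite /v gau_step_x mul0r subr0 -/(g m) /u.
  have -> : 2 * ipi * s * (- h)%:C * X m + ipi * s * ((- h) ^+ 2)%:C = w (-1) m by rewrite /w mulN1r sqrrN.
  by rewrite /w; ring.
have Ev : zs v = om^-1 * S by rewrite -[LHS]zs_shift // -zsZ //; apply: zs_eq => m; rewrite sh.
pose v' m := h%:C * (gau s 0 (xi h m + h) * e m).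
have sh' m : v' m = om * u (m + 1).
  by rewrite /v' /u e1 /g xi1; field.
have Ev' : zs v' = om * S.
  by rewrite -[S](@zs_shift R u z0) -(zsZ om (zas_shift z0)); apply: zs_eq.
have zv' : zas v' by apply: zas_eq (zasZ om (zas_shift z0)) => m; rewrite sh'.
have E : (om + om^-1 - 2) * S = 2 * ipi * s * (h ^+ 2)%:C * S + (SP + SM).
  have -> : (om + om^-1 - 2) * S = zs v' + (zs v + (-2) * S) by rewrite Ev Ev'; ring.
  rewrite -!zsZ // -!zsD //; try by repeat apply: zasD => //; apply: zasZ.
  apply: zs_eq => m; rewrite /v /v' !gau_step_x mul0r subr0 -/(g m).
  have -> : 2 * ipi * s * (- h)%:C * (xi h m)%:C + ipi * s * ((- h) ^+ 2)%:C = w (-1) m by rewrite /w mulN1r sqrrN.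
  have -> : 2 * ipi * s * h%:C * (xi h m)%:C + ipi * s * (h ^+ 2)%:C = w 1 m by rewrite /w mul1r.
  by rewrite /w mulN1r mul1r rmorphN; ring.
have nom : nm (om + om^-1 - 2) = nm (om - 1) ^+ 2.
  have -> : om + om^-1 - 2 = (om - 1) ^+ 2 / om by field.
  by rewrite nmM nmV /om nm_eeR invr1 mulr1 nmX.
have kh : `|k%:~R * h| <= 1 / 2.
  rewrite normrM (gtr0_norm h0) ler_pdivrMr ?ltr0n // mulrAC ler_pdivlMr // mul1r mulrC.
  by rewrite -intr_norm -natr_absz -natrM ler_nat.
have lo := nm_ee_sub1 kh.
have kk : 0 < k%:~R ^+ 2 :> R by rewrite exprn_even_gt0 // intr_eq0.
have up : nm ((om + om^-1 - 2) * S) <= h ^+ 2 * (2 * pi * nm s * A + 2 * A).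
  rewrite E; apply: le_trans (nmD _ _) _; apply: le_trans (lerD (lexx _) (nmD _ _)) _.
  rewrite !nmM nm_nat nm_ipi nm_C ?sqr_ge0 //.
  have G : 2 * pi * nm s * h ^+ 2 * nm S <= 2 * pi * nm s * h ^+ 2 * A by rewrite ler_wpM2l //; nn.
  apply: le_trans (lerD G (lerD nP nM)) _; by rewrite le_eqVlt; apply/orP; left; apply/eqP; ring.
rewrite nmM nom in up; rewrite ler_pdivlMr // mulrC.
have h2 : 0 < h ^+ 2 by rewrite exprn_gt0.
rewrite -(ler_pM2l h2); apply: le_trans (_ : 4 * (nm (om - 1) ^+ 2 * nm S) <= _); last by move: up; clear; lra.
rewrite !mulrA ler_wpM2r ?nm_ge0 //; move: lo; by rewrite exprMn -/om; clear; lra.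
Qed.
End GaussJ.

(** * Euler's pentagonal number theorem and the expansion of 1/eta *)

Section EtaSeries.
Variable R : realType.
Local Notation C := (R[i]).
Implicit Types (x tau : C).
(** The even quadratic character (12/n), through which eta is the theta series of chi12(m)
    q^(m^2/24). *)
Definition chi12 (n : nat) : int :=
  if (n %% 12 \in [:: 1; 11])%N then 1 else if (n %% 12 \in [:: 5; 7])%N then -1 else 0.
Definition eulp x N := \prod_(i < N) (1 - x ^+ i.+1).
Lemma eulp_rec x N : eulp x N.+1 = eulp x N * (1 - x ^+ N.+1).
Proof. by rewrite /eulp big_ord_recr. Qed.
(* Shanks' finite form of the pentagonal number theorem *)
Definition shq x n s := \prod_(s <= i < n) (1 - x ^+ i.+1).
Definition sht x n s := (-1) ^+ s * shq x n s * x ^+ (s * n + 'C(s.+1, 2)).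
Definition shanks x n := \sum_(s < n.+1) sht x n s.
Lemma sht_tel x n s : (s < n)%N -> sht x n s.+1 * (x ^+ s.+1 - 1) = sht x n s * x ^+ (n + s.+1).
Proof.
move=> sn; rewrite /sht [in RHS]/shq big_ltn // -/(shq x n s.+1) exprS.
have -> : (s.+1 * n + 'C(s.+2, 2) = s * n + 'C(s.+1, 2) + (n + s.+1))%N.
  by rewrite [in LHS]binS bin1 mulSn; lia.
by rewrite exprD; ring.
Qed.
(** Passing from n to n + 1 multiplies the term of index s by x^s (1 - x^(n+1)). By [sht_tel] these
    corrections telescope, and two new pentagonal powers remain. *)
Lemma shanks_rec x n : shanks x n.+1 = shanks x n +
  (-1) ^+ n.+1 * (x ^+ (n ^ 2 + 'C(n.+1, 2) + (n + n.+1)) + x ^+ (n.+1 ^ 2 + 'C(n.+2, 2))).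
Proof.
have K m : (m <= n)%N -> \sum_(s < m.+1) sht x n s * (x ^+ s - 1) = \sum_(s < m) sht x n s * x ^+ (n + s.+1).
  elim: m => [|m IH] mn; first by rewrite big_ord1 big_ord0 expr0 subrr mulr0.
  by rewrite big_ord_recr /= IH ?(ltnW mn) // sht_tel // [RHS]big_ord_recr.
have E s : (s <= n)%N -> sht x n.+1 s = sht x n s + sht x n s * (x ^+ s - 1) - sht x n s * x ^+ (n + s.+1).
  move=> sn; rewrite /sht /shq big_nat_recr //= mulnS (addnC s) -addnA (addnC s) addnA exprD.
  by rewrite (_ : n + s.+1 = n.+1 + s)%N ?exprD; [ring | lia].
rewrite {1}/shanks big_ord_recr /= (eq_bigr (fun s : 'I_n.+1 => sht x n s + sht x n s * (x ^+ s - 1) - sht x n s * x ^+ (n + s.+1))); last first.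
  by move=> s _; apply: E; rewrite -ltnS.
rewrite sumrB big_split /= K // -/(shanks x n) [\sum_(i < n.+1) _ * x ^+ (n + i.+1)]big_ord_recr /=.
have D m : sht x m m = (-1) ^+ m * x ^+ (m ^ 2 + 'C(m.+1, 2)).
  by rewrite /sht /shq big_geq // mulr1 mulnn.
by rewrite !D exprS (exprD x (n ^ 2 + _)); ring.
Qed.
Lemma expR_prod_bound (r : R) N : 0 <= r < 1 -> \prod_(i < N) (1 - r ^+ i.+1)^-1 <= expR ((1 - r)^-1 ^+ 2).
Proof.
move=> /andP[r0 r1]; have d0 : 0 < 1 - r by rewrite subr_gt0.
apply: le_trans (_ : \prod_(i < N) expR (r ^+ i.+1 / (1 - r)) <= _).
  apply: ler_prod => i _; have ri : r ^+ i.+1 <= r by rewrite exprS ler_piMr // exprn_ile1 // ltW.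
  have p0 : 0 < 1 - r ^+ i.+1 by rewrite subr_gt0 (le_lt_trans ri).
  rewrite invr_ge0 ltW //=; apply: le_trans (_ : 1 + r ^+ i.+1 / (1 - r ^+ i.+1) <= _).
    by rewrite le_eqVlt; apply/orP; left; apply/eqP; field; rewrite gt_eqF.
  apply: le_trans (_ : 1 + r ^+ i.+1 / (1 - r) <= _); last exact: expR_ge1Dx.
  by rewrite lerD2l ler_wpM2l ?exprn_ge0 // lef_pV2 ?posrE // lerD2l lerN2.
rewrite -expR_sum ler_expR -mulr_suml expr2 ler_wpM2r ?invr_ge0 ?(ltW d0) //.
apply: le_trans (geo_le N _); last by rewrite r0.
by apply: ler_sum => i _; rewrite exprS ler_piMl ?exprn_ge0 // ltW.
Qed.
(** The term s = 0 is the Euler product itself; every other term carries at least x^n. *)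
Lemma shanks_tail x n : nm x < 1 ->
  nm (shanks x n - eulp x n) <= nm x ^+ n * (expR ((1 - nm x)^-1 ^+ 2) / (1 - nm x)).
Proof.
move=> x1; have r0 := nm_ge0 x; set r := nm x in x1 r0 *.
have d0 : 0 < 1 - r by rewrite subr_gt0.
rewrite /shanks big_ord_recl {1}/sht /shq expr0 mul1r mul0n bin_small // expr0 mulr1 big_mkord addrAC -/(eulp x n) subrr add0r.
apply: le_trans (nm_sum _ _ _) _.
have Q s : nm (shq x n s) <= expR ((1 - r)^-1 ^+ 2).
  apply: le_trans (@expR_prod_bound r n _); last by rewrite r0.
  rewrite /shq nm_prod; case: (leqP s n) => sn; last first.
    rewrite big_geq ?(ltnW sn) //; elim/big_ind: _ => // [a b a1 b1|i _]; first by rewrite mulr_ege1.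
    have ri : r ^+ i.+1 <= r by rewrite exprS ler_piMr // exprn_ile1 // ltW.
    by rewrite invf_ge1 ?subr_gt0 ?(le_lt_trans ri) // gerBl exprn_ge0.
  rewrite -[X in _ <= X](big_mkord predT (fun i => (1 - r ^+ i.+1)^-1)) [X in _ <= X](@big_cat_nat _ _ _ s) //=.
  have T i : 0 < 1 - r ^+ i.+1.
    by rewrite subr_gt0; apply: le_lt_trans (x1); rewrite exprS ler_piMr // exprn_ile1 // ltW.
  rewrite -[leLHS]mul1r; apply: ler_pM => //.
  - by apply: prodr_ge0 => i _; apply: nm_ge0.
  - by elim/big_ind: _ => // [a b a1 b1|i _]; [rewrite mulr_ege1 | rewrite invf_ge1 // gerBl exprn_ge0].
  - apply: ler_prod => i _; rewrite nm_ge0 /=; apply: le_trans (nmB _ _) _; rewrite nm1 nmX -/r.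
    rewrite -[(_)^-1]mul1r ler_pdivlMr //; have := sqr_ge0 (r ^+ i.+1); nra.
apply: le_trans (_ : \sum_(i < n) expR ((1 - r)^-1 ^+ 2) * (r ^+ n * r ^+ i) <= _).
  apply: ler_sum => i _; rewrite /sht (nmM (_ * _)) (nmM (_ ^+ _)) !nmX nmN nm1 expr1n mul1r lift0 -/r.
  apply: ler_pM; rewrite ?nm_ge0 ?exprn_ge0 // -exprD ler_wiXn2l ?(ltW x1) //.
  rewrite mulSn -addnA leq_add2l; apply: leq_trans (leq_addl _ _).
  by rewrite binS bin1; lia.
rewrite -mulr_sumr -mulr_sumr mulrCA ler_wpM2l ?exprn_ge0 // ler_wpM2l ?expR_ge0 //.
by apply: geo_le; rewrite r0.
Qed.
Lemma cv_geo0 (r : R) : 0 <= r < 1 -> forall e : R, 0 < e -> exists N, forall n, (N <= n)%N -> r ^+ n < e.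
Proof.
move=> h e e0; have [|N HN] := bsum_tail _ (bsum_geo h) e0; first by move=> n; rewrite exprn_ge0 //; case/andP: h.
exists N => n Nn; apply: le_lt_trans (HN n.+1); rewrite big_nat_recr //= lerDr sumr_ge0 // => i _.
by rewrite exprn_ge0 //; case/andP: h.
Qed.
Lemma cv_shanks x : nm x < 1 -> cv (fun n => shanks x n - eulp x n) 0.
Proof.
move=> x1; have r01 : 0 <= nm x < 1 by rewrite nm_ge0.
set K := expR ((1 - nm x)^-1 ^+ 2) / (1 - nm x).
have K0 : 0 < K by rewrite divr_gt0 ?expR_gt0 ?subr_gt0.
apply: (@cv0_maj R _ (fun n => nm x ^+ n * K)) => [n|e e0]; first by rewrite subr0 shanks_tail.
have [N HN] := cv_geo0 r01 (divr_gt0 e0 K0).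
by exists N => n /HN; rewrite ltr_pdivlMr.
Qed.
(* X * shanks (X^24) n is the partial sum of sum chi12(m) X^(m^2) *)
Lemma shanks_chi12 (X : C) n : X * shanks (X ^+ 24) n = \sum_(m < 6 * n + 2) (chi12 m)%:~R * X ^+ (m ^ 2).
Proof.
elim: n => [|n IH].
  rewrite muln0 /shanks big_ord1 /sht /shq big_geq // !expr0 !mul1r !big_ord_recl big_ord0 /=.
  by rewrite /chi12 /= mul0r add0r addr0 mul1r mulr1 expr1.
rewrite shanks_rec mulrDr IH (_ : 6 * n.+1 + 2 = (6 * n + 2) + 6)%N; last by lia.
rewrite [RHS]big_split_ord /=; congr (_ + _).
have c0 k : (k %% 12 \notin [:: 1; 11; 5; 7])%N -> chi12 k = 0.
  by rewrite !inE !negb_or /chi12 !inE => /and4P[/negPf -> /negPf -> /negPf -> /negPf ->].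
have Z (k : nat) : (k \in [:: 0; 1; 2; 4])%N -> ((chi12 (6 * n + 2 + k))%:~R : C) = 0.
  move=> hk; rewrite c0 //; have := divn_eq n 2; have := ltn_mod n 2.
  by case: (n %% 2)%N => [|[|//]] _ -> {IH}; move: hk; rewrite !inE => /or4P[] /eqP ->; apply/negP => /or4P[] /eqP; lia.
rewrite !big_ord_recl big_ord0 /= /bump /=.
rewrite (Z 0%N) // (Z 1%N) // (Z 2%N) // (Z 4%N) // !mul0r !add0r addr0.
have B m : (2 * 'C(m.+1, 2) = m.+1 * m)%N by elim: m => // m IHm; rewrite binS bin1 mulnDr IHm; lia.
have S : ((chi12 (6 * n + 2 + 3))%:~R : C) = (-1) ^+ n.+1 /\ ((chi12 (6 * n + 2 + 5))%:~R : C) = (-1) ^+ n.+1.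
  have := divn_eq n 2; have := ltn_mod n 2; case: (n %% 2)%N => [|[|//]] _ -> {IH}.
    rewrite addn0 -[(-1) ^+ _]signr_odd /= oddM andbF expr1 /chi12.
    have -> : ((6 * (n %/ 2 * 2) + 2 + 3) %% 12 = 5)%N by lia.
    by have -> : ((6 * (n %/ 2 * 2) + 2 + 5) %% 12 = 7)%N by lia.
  rewrite -[(-1) ^+ _]signr_odd addn1 /= oddM andbF /= expr0 /chi12.
  have -> : ((6 * (n %/ 2 * 2).+1 + 2 + 3) %% 12 = 11)%N by lia.
  by have -> : ((6 * (n %/ 2 * 2).+1 + 2 + 5) %% 12 = 1)%N by lia.
rewrite S.1 S.2 mulrCA mulrDr -!exprM -!exprS -mulrDr; congr (_ * (_ + _)); congr (_ ^+ _).
  by have := B n; rewrite -!mulnn; nia.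
by have := B n.+1; rewrite -!mulnn; nia.
Qed.
Lemma nm_ee_lt1 tau (n : nat) : upper tau -> (0 < n)%N -> nm (ee (tau / n%:R)) < 1.
Proof.
rewrite /upper => t0 n0; rewrite nm_ee expR_lt1 oppr_lt0 !mulr_gt0 ?pi_gt0 //.
have -> : (n%:R : C)^-1 = (n%:R^-1 : R)%:C%C by rewrite fmorphV rmorph_nat.
by case: tau t0 => a b /= b0; rewrite mulr0 add0r mulr_gt0 // invr_gt0 ltr0n.
Qed.
Lemma asum_chi (X : C) (c : nat -> int) : nm X < 1 -> (forall n, `|c n| <= 1) ->
  asum (fun m => (c m)%:~R * X ^+ (m ^ 2)).
Proof.
move=> X1 hc; apply: (@asum_bsum R _ (fun m => nm X ^+ m)) => [m|]; last by apply: bsum_geo; rewrite nm_ge0.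
have -> : ((c m)%:~R : C) = ((c m)%:~R : R)%:C%C by rewrite rmorph_int.
rewrite nmM nmX nm_real -intr_norm; apply: le_trans (_ : 1 * nm X ^+ (m ^ 2) <= _).
  by rewrite ler_wpM2r ?exprn_ge0 ?nm_ge0 // (ler_int R _ 1).
by rewrite mul1r ler_wiXn2l ?nm_ge0 ?(ltW X1) //; case: m => // m; rewrite -mulnn leq_pmulr.
Qed.
Lemma chi12_le1 n : `|chi12 n| <= 1. Proof. by rewrite /chi12; case: ifP => //; case: ifP. Qed.
Lemma cv_subinf u (l : C) (f : nat -> nat) v :
  cv u l -> (forall n, (n <= f n)%N) -> (forall n, u (f n) = v n) -> cv v l.
Proof. by move=> cu hf H; apply: cv_eq (cv_sub hf cu) => n; rewrite H. Qed.
Lemma eta_cv tau : upper tau -> let X := ee (tau / 24%:R) in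
  cv (fun n => X * eulp (X ^+ 24) n) (tsum (fun m => (chi12 m)%:~R * X ^+ (m ^ 2))).
Proof.
move=> t0 X; have X1 : nm X < 1 by apply: nm_ee_lt1.
have X241 : nm (X ^+ 24) < 1 by rewrite nmX exprn_ilt1 ?nm_ge0.
have := cvZ X (cv_shanks X241); rewrite mulr0 => c1.
have c2 := tsumP (asum_chi X1 chi12_le1).
have c3 : cv (fun n => X * shanks (X ^+ 24) n) (tsum (fun m => (chi12 m)%:~R * X ^+ (m ^ 2))).
  apply: (cv_subinf (f := fun n => (6 * n + 2)%N) c2) => [n|n]; first by lia.
  by rewrite -shanks_chi12.
by have := cvB c3 c1; rewrite subr0; apply: cv_eq => n; ring.
Qed.
Lemma eta_chi tau : upper tau ->
  eta tau = tsum (fun m => (chi12 m)%:~R * ee (tau / 24%:R) ^+ (m ^ 2)).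
Proof.
move=> t0; have c := eta_cv t0; rewrite /eta qpow24E expr1; set X := ee _ in c *.
have X0 : X != 0 by apply: ee_neq0.
have -> : (fun N : nat => \prod_(1 <= n < N.+1) (1 - qpow24 (24 * n) tau)) = eulp (X ^+ 24).
  apply/funext => N; rewrite /eulp big_add1 big_mkord; apply: eq_bigr => i _.
  by rewrite qpow24E -/X exprM.
have c' : cv (eulp (X ^+ 24)) (X^-1 * tsum (fun m => (chi12 m)%:~R * X ^+ (m ^ 2))).
  by apply: cv_eq (cvZ X^-1 c) => n; rewrite mulKf.
by rewrite (cv_lim c') mulVKf.
Qed.
(** Coefficients of the inverse of the first N Euler factors: partitions of n into parts at most N.
    They show that 1/eta has integral coefficients. *)
Fixpoint part (N n : nat) : nat :=
  if N is N'.+1 then \sum_(i < n.+1) part N' i * (N %| n - i)%N else (n == 0)%N.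
Lemma part_stable N n : (n <= N)%N -> part N.+1 n = part N n.
Proof.
move=> nN; rewrite /= big_ord_recr /= subnn dvdn0 muln1 big1 // => i _.
rewrite gtnNdvd ?muln0 // ?subn_gt0 // ltnS; apply: leq_trans nN; exact: leq_subr.
Qed.
Lemma part_mono N n : (part N n <= part N.+1 n)%N.
Proof. by rewrite /= big_ord_recr /= subnn dvdn0 muln1 leq_addl. Qed.
Lemma partE N n : (n <= N)%N -> part N n = part n n.
Proof.
move=> nN; rewrite -(subnKC nN); elim: (N - n)%N => [|k IH]; first by rewrite addn0.
by rewrite addnS part_stable ?leq_addr.
Qed.
Lemma part_le N n : (part N n <= part n n)%N.
Proof.
case: (leqP n N) => [/partE -> //|/ltnW Nn].
have K k : (part N n <= part (N + k) n)%N.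
  by elim: k => [|k IH]; rewrite ?addn0 // addnS (leq_trans IH) // part_mono.
by have := K (n - N)%N; rewrite subnKC.
Qed.
Lemma geo_cv x : nm x < 1 -> asum (fun n => x ^+ n) /\ tsum (fun n => x ^+ n) * (1 - x) = 1.
Proof.
move=> x1; have r01 : 0 <= nm x < 1 by rewrite nm_ge0.
have a : asum (fun n => x ^+ n) by apply: asum_bsum (bsum_geo r01) => n; rewrite nmX.
split=> //; have E : tsum (fun n => x ^+ (n + 1)) = x * tsum (fun n => x ^+ n).
  by rewrite -tsumZ //; apply: tsum_eq => n; rewrite addn1 exprS.
have : tsum (fun n => x ^+ n) = 1 + x * tsum (fun n => x ^+ n) by rewrite {1}(tsum_split 1 a) big_ord1 expr0 E.
by set S := tsum _ => H; rewrite mulrBr mulr1 {1}H; ring.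
Qed.
Lemma sparse_geo x N : nm x < 1 -> asum (fun n => (N.+1 %| n)%:R * x ^+ n) /\
  tsum (fun n => (N.+1 %| n)%:R * x ^+ n) * (1 - x ^+ N.+1) = 1.
Proof.
move=> x1; have r01 : 0 <= nm x < 1 by rewrite nm_ge0.
have a : asum (fun n => (N.+1 %| n)%:R * x ^+ n).
  apply: asum_bsum (bsum_geo r01) => n; rewrite nmM nmX nm_nat.
  by case: (dvdn _ _); rewrite ?mul1r ?mul0r ?exprn_ge0 ?nm_ge0.
split=> //; have xN : nm (x ^+ N.+1) < 1 by rewrite nmX exprn_ilt1 ?nm_ge0.
have [aN EN] := geo_cv xN; rewrite -[RHS]EN; congr (_ * _).
rewrite (tsum_sec (ltn0Sn N) a) big_ord_recl [X in _ + X]big1 ?addr0 => [|j _].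
  by apply: tsum_eq => n; rewrite addn0 dvdn_mull // mul1r -exprM mulnC.
rewrite -[RHS](tsum0 R); apply: tsum_eq => n.
by rewrite dvdn_addr ?dvdn_mull // gtnNdvd ?mul0r // lift0 ltnS.
Qed.
Lemma part_gf x N : nm x < 1 -> asum (fun n => (part N n)%:R * x ^+ n) /\
  tsum (fun n => (part N n)%:R * x ^+ n) * eulp x N = 1.
Proof.
move=> x1; elim: N => [|N [a E]].
  split; first by apply: (@asum_fin _ _ 1) => -[//|n] _; rewrite mul0r.
  by rewrite (@tsum_fin _ _ 1) => [|[//|n] _]; rewrite ?big_ord1 ?mul0r // /eulp big_ord0 expr0 !mulr1.
have [aN EN] := sparse_geo N x1.
have H n : conv (fun n => (part N n)%:R * x ^+ n) (fun n => (N.+1 %| n)%:R * x ^+ n) n = (part N.+1 n)%:R * x ^+ n.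
  rewrite /= natr_sum mulr_suml; apply: eq_bigr => i _; rewrite natrM mulrACA -exprD subnKC //.
  by rewrite -ltnS.
split; first by apply: asum_eq H (asum_conv a aN).
rewrite -(tsum_eq H) tsum_conv // eulp_rec.
by rewrite mulrACA E EN mulr1.
Qed.
(** For n < K the numbers [part n n] and [part K n] agree, so the partial sum up to K is at most the
    full series of the K-th finite product, whose value is bounded uniformly in K. *)
Lemma bsum_part (r : R) : 0 <= r < 1 -> bsum (fun n => (part n n)%:R * r ^+ n).
Proof.
move=> r01; exists (expR ((1 - r)^-1 ^+ 2)) => K; apply: le_trans (@expR_prod_bound r K r01).
have [r0 r1] := andP r01; have nr : nm r%:C%C = r by rewrite nm_real ger0_norm.
have [|a E] := @part_gf r%:C%C K; first by rewrite nr.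
have T i : 0 < 1 - r ^+ i.+1.
  by rewrite subr_gt0; apply: le_lt_trans (r1); rewrite exprS ler_piMr // exprn_ile1 // ltW.
have e0 : eulp r%:C%C K = (\prod_(i < K) (1 - r ^+ i.+1))%:C%C.
  by rewrite rmorph_prod; apply: eq_bigr => i _; rewrite rmorphB rmorph1 rmorphXn.
have p0 : 0 < \prod_(i < K) (1 - r ^+ i.+1) by apply: prodr_gt0.
have E' : tsum (fun n => (part K n)%:R * r%:C%C ^+ n) = (\prod_(i < K) (1 - r ^+ i.+1)^-1)%:C%C.
  have e1 : eulp r%:C%C K != 0 by rewrite e0 fmorph_eq0 gt_eqF.
  by apply: (mulIf e1); rewrite E prodfV e0 -rmorphM mulVf ?gt_eqF.
have P0 : 0 <= \prod_(i < K) (1 - r ^+ i.+1)^-1 by apply: prodr_ge0 => i _; rewrite invr_ge0 ltW.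
rewrite -lecR -E' rmorph_sum /=.
have -> : \sum_(n < K) ((part n n)%:R * r ^+ n)%:C%C = \sum_(n < K) (part K n)%:R * r%:C%C ^+ n.
  by apply: eq_bigr => i _; rewrite rmorphM rmorph_nat rmorphXn (partE (ltnW (ltn_ord i))).
rewrite (tsum_split K a) lerDl.
have ge0 (u : nat -> C) : asum u -> (forall n, 0 <= u n) -> 0 <= tsum u.
  move=> au u0; have cu := tsumP au.
  have Re0 n : 0 <= Re (u n) /\ Im (u n) = 0 by have := u0 n; rewrite lecE => /andP[/eqP /= -> ->].
  rewrite lecE /=; apply/andP; split.
    by apply/eqP; rewrite (_ : (fun N => _) = fun=> 0) ?lim_cst //; apply/funext => N; rewrite big1 // => i _; case: (Re0 i).
  apply: limr_ge; last by apply: nearW => N; rewrite sumr_ge0 // => i _; case: (Re0 i).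
  have : cv (fun N => (\sum_(n < N) Re (u n))%:C%C) (Re (tsum u))%:C%C.
    move=> e /cu [M HM]; exists M => n /HM; apply: le_lt_trans; rewrite -rmorphB nm_real -sumRe -(raddfB (@Re R)).
    exact: Re_nm.
  by move/cvR_cvgE => cc; apply/cvg_ex; exists (Re (tsum u)).
apply: (ge0 (fun n => (part K (n + K))%:R * r%:C%C ^+ (n + K))) => [|n].
  exact: (asum_shift K a).
by rewrite mulr_ge0 ?exprn_ge0 // lecR.
Qed.
Lemma eulp_inv x : nm x < 1 -> asum (fun n => (part n n)%:R * x ^+ n) /\
  cv (fun N => (eulp x N)^-1) (tsum (fun n => (part n n)%:R * x ^+ n)).
Proof.
move=> x1; have r01 : 0 <= nm x < 1 by rewrite nm_ge0.
have b := bsum_part r01; have M n k : nm ((part k n)%:R * x ^+ n) <= (part n n)%:R * nm x ^+ n.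
  by rewrite nmM nm_nat nmX ler_wpM2r ?exprn_ge0 ?nm_ge0 // ler_nat part_le.
split; first by apply: asum_bsum b => n; apply: M.
apply: (@cv_eq _ (fun N => tsum (fun n => (part N n)%:R * x ^+ n))) => [N|].
  have [_ E] := part_gf N x1; have e0 : eulp x N != 0.
    by apply/eqP => e0; move: E; rewrite e0 mulr0 => /esym/eqP; rewrite oner_eq0.
  by apply: (mulIf e0); rewrite E mulVf.
apply: (tannery _ b) => [n|k n|n]; rewrite ?mulr_ge0 ?exprn_ge0 ?nm_ge0 //.
by move=> e e0; exists n => k nk; rewrite (partE nk) subrr nm0.
Qed.
Lemma eta_inv tau : upper tau -> let X := ee (tau / 24%:R) in
  asum (fun n => (part n n)%:R * X ^+ (24 * n)) /\
  eta tau * (X^-1 * tsum (fun n => (part n n)%:R * X ^+ (24 * n))) = 1.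
Proof.
move=> t0 X; have X1 : nm X < 1 by apply: nm_ee_lt1.
have X241 : nm (X ^+ 24) < 1 by rewrite nmX exprn_ilt1 ?nm_ge0.
have [a c] := eulp_inv X241.
have E n : (part n n)%:R * (X ^+ 24) ^+ n = (part n n)%:R * X ^+ (24 * n) by rewrite -exprM.
split; first by apply: asum_eq a.
rewrite -(tsum_eq E); have c1 := cvM (eta_cv t0) (cvZ X^-1 c); rewrite -(eta_chi t0) -/X in c1.
apply: (cv_uniq c1); apply: cv_eq (cv_cst 1) => n; rewrite mulrACA mulfV ?ee_neq0 // mul1r mulfV //.
have [_ EN] := part_gf n X241; apply/eqP => e0; move: EN; rewrite e0 mulr0 => /esym/eqP; by rewrite oner_eq0.
Qed.
Lemma eta_neq0 tau : upper tau -> eta tau != 0.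
Proof.
by move=> /eta_inv [_ E]; apply/eqP => e0; move: E; rewrite e0 mul0r => /esym/eqP; rewrite oner_eq0.
Qed.
End EtaSeries.

(** * Poisson summation for the Gaussian *)

Section Poisson.
Variable R : realType.
Local Notation C := (R[i]).
Local Notation "x %:C" := (real_complex R x) : ring_scope.
Local Notation ipi := (Complex 0 pi : C).
Lemma period_shift (f : int -> C) (M : nat) (t : int) : (forall x, f (x + M%:Z) = f x) ->
  \sum_(x < M) f (x%:Z + t) = \sum_(x < M) f x%:Z.
Proof.
move=> Hf; case: M Hf => [|M] Hf; first by rewrite !big_ord0.
have S1 (g : int -> C) : (forall x, g (x + M.+1%:Z) = g x) -> \sum_(x < M.+1) g (x%:Z + 1) = \sum_(x < M.+1) g x%:Z.
  move=> Hg; rewrite big_ord_recr big_ord_recl /= addrC; congr (_ + _).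
    by rewrite -[RHS]Hg; congr g; lia.
  by apply: eq_bigr => i _; congr g; rewrite /bump; lia.
elim/int_rec: t => [|n IH|n IH].
- by apply: eq_bigr => i _; rewrite addr0.
- rewrite -IH -(S1 (fun x => f (x + n%:Z))) => [|x]; last by rewrite addrAC Hf.
  by apply: eq_bigr => i _; congr f; lia.
- rewrite -IH -(S1 (fun x => f (x - n.+1%:Z))) => [|x]; last by rewrite addrAC Hf.
  by apply: eq_bigr => i _; congr f; lia.
Qed.
(** Residues are written as a x + b y, so that no modular inverse enters the summand. *)
Lemma crt_sum (f : nat -> C) (a b : nat) : (0 < a)%N -> (0 < b)%N -> coprime a b ->
  (forall x, f (x + a * b)%N = f x) -> \sum_(j < a * b) f j = \sum_(x < b) \sum_(y < a) f (a * x + b * y)%N.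
Proof.
move=> a0 b0 cab Hf; rewrite pair_big /=.
have Hm n : f (n %% (a * b))%N = f n.
  rewrite {2}(divn_eq n (a * b)); elim: (n %/ _)%N => [|k IH]; first by rewrite mul0n.
  by rewrite mulSn -addnA addnC Hf.
have ab0 : (0 < a * b)%N by rewrite muln_gt0 a0.
pose h (p : 'I_b * 'I_a) : 'I_(a * b) := Ordinal (ltn_pmod (a * p.1 + b * p.2) ab0).
have hi : injective h.
  move=> [x y] [x' y'] /(congr1 val) /= /eqP E.
  have K (c d u u' w w' : nat) : coprime c d -> (u < d)%N -> (u' < d)%N -> (c * u + d * w == c * u' + d * w' %[mod d])%N -> u = u'.
    move=> cd; rewrite !(addnC (c * _)%N) !(mulnC d) !modnMDl => l1 l2 /eqP E'.
    wlog le : u u' l1 l2 E' / (u <= u')%N => [W|].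
      by case/orP: (leq_total u u') => l; [apply: W | apply/esym; apply: W].
    have : (d %| c * (u' - u))%N by rewrite mulnBr -eqn_mod_dvd ?leq_mul // E'.
    rewrite Gauss_dvdr 1?coprime_sym // => /dvdn_leq Hd; case: (posnP (u' - u)%N) => [?|p]; [lia | have := Hd p; lia].
  have Eb : (a * x + b * y == a * x' + b * y' %[mod b])%N.
    by rewrite -(modn_dvdm _ (dvdn_mull a (dvdnn b))) (eqP E) modn_dvdm // dvdn_mull.
  have Ea : (b * y + a * x == b * y' + a * x' %[mod a])%N.
    by rewrite !(addnC (b * _)%N) -(modn_dvdm _ (dvdn_mulr b (dvdnn a))) (eqP E) modn_dvdm // dvdn_mulr.
  by congr pair; apply: val_inj; [apply: (K a b) Eb | apply: (K b a) Ea]; rewrite // coprime_sym.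
have hb : bijective h by apply: inj_card_bij => //; rewrite card_prod !card_ord mulnC.
by rewrite (reindex h (onW_bij _ hb)) /=; apply: eq_bigr => p _; rewrite Hm.
Qed.
Lemma gau_bound (s : C) (k : R) : 0 < Im s -> exists2 B, 0 <= B & forall h : R, 0 < h <= 1 ->
  zas (fun m => h%:C * gau s k (xi h m)) /\ nm (zs (fun m => h%:C * gau s k (xi h m))) <= B.
Proof.
move=> s0; have a0 : 0 < pi * Im s by rewrite mulr_gt0 ?pi_gt0.
have [A A0 HA] := gdom a0 ler01 (expR_ge0 (pi * `|k| ^+ 2 * nm s^-1)).
exists A => // h hh; have [||[z n] _] := HA h (fun m => gau s k (xi h m)) (fun=> 1) hh.
- by move=> m; apply: nm_gau.
- by move=> m; rewrite nm1 mul1r exprn_ege1 // lerDl.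
by split; [apply: zas_eq z => m; rewrite mulr1 | move: n; under zs_eq do rewrite mulr1].
Qed.
Lemma bsum_inv2 : bsum (fun n => (n.+1%:R : R) ^- 2).
Proof.
exists 2 => N; apply: le_trans (_ : 2 * (1 - N.+1%:R^-1) <= _); last first.
  by rewrite ler_piMr // gerBl invr_ge0.
elim: N => [|N IH]; first by rewrite big_ord0 invr1 subrr mulr0.
rewrite big_ord_recr /=; apply: le_trans (lerD IH (lexx _)) _.
have a0 : 0 < N.+1%:R :> R by rewrite ltr0n.
rewrite -[N.+2%:R]natr1; have a1 : 1 <= N.+1%:R :> R by rewrite ler1n.
move: (N.+1%:R) a0 a1 => a a0 a1; rewrite -subr_ge0 (_ : _ - _ = (a - 1) / (a ^+ 2 * (a + 1))); last first.
  by field; rewrite (gt_eqF a0) gt_eqF ?addr_gt0.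
by apply: divr_ge0; [rewrite subr_ge0 | nn].
Qed.
(* [gph s x] periodises the Gaussian; [gI s L] is a Riemann sum with step 1/L of its integral *)
Definition gph (s : C) (x : R) : C := zs (fun m => gau s 0 (m%:~R + x)).
Definition gI (s : C) (L : nat) : C := zs (fun m => (L%:R^-1)%:C * gau s 0 (xi L%:R^-1 m)).
Definition gM (s : C) (L : nat) (k : int) : C :=
  zs (fun m => (L%:R^-1)%:C * (gau s 0 (xi L%:R^-1 m) * ee (- (k%:~R * xi L%:R^-1 m)%:C))).
Lemma invL01 (L : nat) : (0 < L)%N -> 0 < (L%:R^-1 : R) <= 1.
Proof. by move=> L0; rewrite invr_gt0 ltr0n L0 invf_le1 ?ltr0n // ler1n. Qed.
Lemma gMe (s : C) L (k : int) : 0 < Im s -> (0 < L)%N ->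
  zas (fun m => (L%:R^-1)%:C * (gau s 0 (xi L%:R^-1 m) * ee (- (k%:~R * xi L%:R^-1 m)%:C))) /\
  gM s L k = cexp (- (ipi * (k%:~R ^+ 2)%:C / s)) * zs (fun m => (L%:R^-1)%:C * gau s k%:~R (xi L%:R^-1 m)).
Proof.
move=> s0 L0; have s1 : s != 0 by apply: contraTneq s0 => ->; rewrite ltxx.
have [B _ /(_ _ (invL01 L0)) [z _]] := gau_bound k%:~R s0.
have E m : cexp (- (ipi * (k%:~R ^+ 2)%:C / s)) * ((L%:R^-1)%:C * gau s k%:~R (xi L%:R^-1 m)) =
   (L%:R^-1)%:C * (gau s 0 (xi L%:R^-1 m) * ee (- (k%:~R * xi L%:R^-1 m)%:C)).
  by rewrite (gau_ee k%:~R (xi L%:R^-1 m) s1); ring.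
by split; [apply: zas_eq E (zasZ _ z) | rewrite /gM -zsZ //; apply: zs_eq => m; rewrite E].
Qed.
(** Grouping the nodes by residue modulo L turns the frequency-k Riemann sum into the discrete
    Fourier coefficient of the periodised Gaussian, since the phase depends only on the residue. *)
Lemma gM_dft (s : C) L (k : int) : 0 < Im s -> (0 < L)%N ->
  gM s L k = (L%:R^-1)%:C * \sum_(i < L) gph s (i%:R / L%:R) * ee (- (k%:~R * (i%:R / L%:R))%:C).
Proof.
move=> s0 L0; have [z _] := gMe k s0 L0; rewrite /gM (zs_sec L0 z) mulr_sumr; apply: eq_bigr => i _.
have L1 : (L%:R : R) != 0 by rewrite pnatr_eq0 -lt0n.
have X m : xi L%:R^-1 (m * L%:Z + i%:Z) = m%:~R + i%:R / L%:R :> R.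
  by rewrite /xi rmorphD rmorphM /= -!pmulrn mulrDr mulrC mulfK // mulrC.
have zi := zas_sec L0 (ltn_ord i) z.
have E m : ee (- (k%:~R * (i%:R / L%:R))%:C) * ((L%:R^-1)%:C * gau s 0 (m%:~R + i%:R / L%:R)) =
  (L%:R^-1)%:C * (gau s 0 (xi L%:R^-1 (m * L%:Z + i%:Z)) * ee (- (k%:~R * xi L%:R^-1 (m * L%:Z + i%:Z))%:C)).
  rewrite X mulrDr rmorphD opprD eeD.
  have -> : - (k%:~R * m%:~R)%:C = ((- (k * m))%:~R : C) by rewrite rmorphN rmorphM rmorphM !rmorph_int.
  by rewrite ee_int; ring.
have E0 : ee (- (k%:~R * (i%:R / L%:R))%:C) != 0 by apply: ee_neq0.
have zg : zas (fun m => gau s 0 (m%:~R + i%:R / L%:R)).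
  apply: zas_eq (zasZ (ee (- (k%:~R * (i%:R / L%:R))%:C) * (L%:R^-1)%:C)^-1 zi) => m /=.
  by rewrite -E [X in _ * X]mulrA mulKf // mulf_neq0 // fmorph_eq0 invr_eq0.
rewrite /gph (mulrC _ (ee _)) mulrA -zsZ //; apply: zs_eq => m; rewrite -E; ring.
Qed.
(** Exact finite Fourier inversion. The frequencies run from -N to N - 1, with L = 2N, because
    [gau_decay] controls only 2|k| <= L. *)
Lemma gM_inv (s : C) N (i : nat) : 0 < Im s -> (i < N.*2)%N ->
  gph s (i%:R / N.*2%:R) = \sum_(n < N) (gM s N.*2 n%:Z * ee (n%:R * (i%:R / N.*2%:R)) +
      gM s N.*2 (- n.+1%:Z) * ee (- (n.+1%:R * (i%:R / N.*2%:R)))).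
Proof.
set L := N.*2 => s0 iL; have L0 : (0 < L)%N by apply: leq_ltn_trans iL.
have L1 : (L%:R : C) != 0 by exact: natC0.
pose u (k : int) := gM s L k * ee (k%:~R * (i%:R / L%:R)).
have -> : \sum_(n < N) (gM s L n%:Z * ee (n%:R * (i%:R / L%:R)) + gM s L (- n.+1%:Z) * ee (- (n.+1%:R * (i%:R / L%:R)))) =
   \sum_(k < L) u (k%:Z - N%:Z).
  rewrite /L -addnn big_split_ord big_split /= [LHS]addrC; congr (_ + _); last first.
    by apply: eq_bigr => n _; rewrite /u /L addnn (_ : (N + n)%N%:Z - N%:Z = n%:Z) //; lia.
  rewrite [RHS](reindex_inj rev_ord_inj); apply: eq_bigr => n _ /=; rewrite /u /L addnn -mulNr.
  rewrite (_ : (N - n.+1)%N%:Z - N%:Z = - n.+1%:Z); last by have := ltn_ord n; lia.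
  by rewrite mulrNz.
have toC (r : nat) : ((r%:R / L%:R : R)%:C) = r%:R / L%:R by rewrite rmorphM fmorphV !rmorph_nat.
have E k : u k = \sum_(j < L) L%:R^-1 * gph s (j%:R / L%:R) * ee (k%:~R * ((i%:Z - j%:Z)%:~R / L%:R)).
  rewrite /u gM_dft // fmorphV rmorph_nat -mulrA mulr_suml mulr_sumr; apply: eq_bigr => j _.
  rewrite -!mulrA; congr (_ * (_ * _)); rewrite -eeD; congr ee.
  by rewrite rmorphM rmorph_int /= toC rmorphB /= -!pmulrn; ring.
under eq_bigr do rewrite E; rewrite exchange_big /= (bigD1 (Ordinal iL)) //= [X in _ + X]big1 ?addr0.
  under eq_bigr do rewrite subrr mul0r mulr0 ee0 mulr1.
  by rewrite sumr_const card_ord -[RHS]mulr_natl mulVKf.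
move=> j ji; rewrite -mulr_sumr.
have -> : \sum_(k < L) ee ((k%:Z - N%:Z)%:~R * ((i%:Z - j%:Z)%:~R / L%:R) : C) =
  ee (- N%:R * ((i%:Z - j%:Z)%:~R / L%:R)) * \sum_(k < L) ee (k%:R * ((i%:Z - j%:Z)%:~R / L%:R)).
  rewrite mulr_sumr; apply: eq_bigr => k _; rewrite -eeD; congr ee.
  by rewrite rmorphB /= -!pmulrn mulrBl mulNr addrC.
rewrite sum_ee //; case: ifP => [/dvdzP [q]|_]; last by rewrite !mulr0.
have := ltn_ord j; move/eqP: ji => ji jL E'.
have q0 : q = 0 by nia.
by case: ji; apply/val_inj => /=; lia.
Qed.
Lemma cv_invS : forall e : R, 0 < e -> exists N, forall n, (N <= n)%N -> n.+1%:R^-1 < e.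
Proof.
move=> e e0; exists (Num.bound e^-1) => n hn; rewrite invf_plt ?posrE ?ltr0n //.
have := archi_boundP (_ : 0 <= e^-1); rewrite invr_ge0 ltW // => /(_ isT) /lt_le_trans; apply.
by rewrite ler_nat ltnW.
Qed.
(* Poisson summation for the Gaussian, at the rational point j / L0 *)
Lemma gph_poisson (s : C) (L0 j : nat) : 0 < Im s -> (j < L0)%N -> ~~ odd L0 ->
  let v (k : int) := cexp (- (ipi * (k%:~R ^+ 2)%:C / s)) * ee (k%:~R * (j%:R / L0%:R)) in
  zas v /\ cv (fun l => gI s (L0 * l.+1) * zs v) (gph s (j%:R / L0%:R)).
Proof.
move=> s0 jL ev v; have L00 : (0 < L0)%N by apply: leq_ltn_trans jL.
have s1 : s != 0 by apply: contraTneq s0 => ->; rewrite ltxx.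
(* The meshes run over multiples of [L0], so that j / L0 stays a node, and are even, so that the
   frequencies split symmetrically. *)
pose L l := (L0 * l.+1)%N; pose N l := ((L0./2) * l.+1)%N.
have LN l : L l = (N l).*2 by rewrite /L /N -[in LHS](odd_double_half L0) (negPf ev) add0n -!muln2; lia.
have Lp l : (0 < L l)%N by rewrite muln_gt0 L00.
have jl l : (j * l.+1 < L l)%N by rewrite ltn_pmul2r.
have xE l : (j * l.+1)%:R / (L l)%:R = j%:R / L0%:R :> R.
  by rewrite /L !natrM invfM mulrACA divff ?mulr1 // pnatr_eq0.
have xEC l : (j * l.+1)%:R / (L l)%:R = j%:R / L0%:R :> C.
  by rewrite /L !natrM invfM mulrACA divff ?mulr1 // pnatr_eq0.
have [A A0 HA] := gau_decay s0; have [B B0 HB] := gau_bound 0 s0.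
have nI l : nm (gI s (L l)) <= B by have [_] := HB _ (invL01 (Lp l)).
pose D (n : nat) : R := (B + 4 * A) * n.+1%:R ^- 2.
have Mb l k : (2 * `|k| <= L l)%N -> nm (gM s (L l) k) <= (B + 4 * A) / (`|k|.+1%:R ^+ 2).
  move=> kL; have [->|k0] := eqVneq k 0.
    rewrite (_ : gM s (L l) 0 = gI s (L l)); last first.
      by apply: zs_eq => m; rewrite mul0r oppr0 ee0 mulr1.
    by apply: le_trans (nI l) _; rewrite expr1n invr1 mulr1 lerDl; nn.
  have [_ h] := HA (L l) k (Lp l) kL k0; apply: le_trans h _.
  rewrite -[k%:~R ^+ 2]real_normK ?num_real // -intr_norm -natr_absz.
  have : (0 < `|k|)%N by rewrite absz_gt0.
  move: (`|k|%N) => [//|n] _; rewrite -[n.+2%:R]natr1; set a := n.+1%:R.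
  have a1 : 1 <= a by rewrite ler1n.
  rewrite ler_pdivrMr ?exprn_gt0 ?(lt_le_trans ltr01) // mulrAC ler_pdivlMr ?exprn_gt0 ?addr_gt0 ?(lt_le_trans ltr01) //.
  have : (a + 1) ^+ 2 <= 4 * a ^+ 2 by nra.
  have : 0 <= a ^+ 2 by apply: sqr_ge0.
  nra.
have v_asum : zas v /\ bsum (fun n : nat => nm (v n%:Z) + nm (v (- n.+1%:Z))).
  pose r := nm (cexp (- (ipi / s))).
  have r01 : 0 <= r < 1.
    rewrite /r nm_ge0 nm_cexp expR_lt1; case: (s) s0 => a b /= b0.
    have : 0 < a ^+ 2 + b ^+ 2 by rewrite ltr_wpDl ?sqr_ge0 // exprn_gt0.
    by move=> d0; have p0 := pi_gt0 R; rewrite mul0r sub0r opprK mulrN oppr_lt0 mulr_gt0 // divr_gt0.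
  have nv k : nm (v k) <= r ^+ `|k|.
    rewrite nmM -[j%:R / _]/(j%:R / L0%:R) (_ : (k%:~R * (j%:R / L0%:R) : C) = (k%:~R * (j%:R / L0%:R) : R)%:C); last first.
      by rewrite rmorphM rmorphM fmorphV rmorph_int !rmorph_nat.
    have kE : ((k%:~R ^+ 2)%:C : C) = (`|k| ^ 2)%:R.
      by rewrite -(rmorph_nat (real_complex R)) natrX natr_absz intr_norm real_normK ?num_real.
    have eE : - (ipi * (k%:~R ^+ 2)%:C / s) = - (ipi / s) *+ (`|k| ^ 2) by rewrite kE -mulr_natr; ring.
    have cE : nm (cexp (- (ipi * (k%:~R ^+ 2)%:C / s))) = r ^+ (`|k| ^ 2) by rewrite eE cexpX nmX.
    have kk : (`|k| <= `|k| ^ 2)%N by case: `|k|%N => // n; rewrite -mulnn leq_pmulr.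
    rewrite (nm_eeR (k%:~R * (j%:R / L0%:R))) mulr1 cE; case/andP: r01 => r0 r1; exact: (ler_wiXn2l r0 (ltW r1) kk).
  have b1 : bsum (fun n : nat => nm (v n%:Z)) by apply: bsum_le (bsum_geo r01) => n; apply: nv.
  have b2 : bsum (fun n : nat => nm (v (- n.+1%:Z))).
    apply: bsum_le (bsum_geo r01) => n; apply: le_trans (nv _) _; rewrite abszN /=.
    by rewrite exprS ler_piMl ?exprn_ge0 //; case/andP: r01 => // _ /ltW.
  by split; [split | apply: bsumD].
have [vz vb] := v_asum; split=> //; have [vz1 vz2] := vz.
pose f n : R := 2 * D n + B * (nm (v n%:Z) + nm (v (- n.+1%:Z))).
have f0 n : 0 <= f n by rewrite /f /D; nn.
have bf : bsum f.
  apply: bsumD; last by apply: bsumZ.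
  by apply: bsumZ => //; apply: bsumZ; [nn | apply: bsum_inv2].
pose Mt l (k : int) := gM s (L l) k * ee (k%:~R * (j%:R / L0%:R)).
pose U l n := (if (n < N l)%N then Mt l n%:Z + Mt l (- n.+1%:Z) else 0) - gI s (L l) * (v n%:Z + v (- n.+1%:Z)).
have ne (k : int) : nm (ee (k%:~R * (j%:R / L0%:R) : C)) = 1.
  rewrite (_ : (k%:~R * (j%:R / L0%:R) : C) = (k%:~R * (j%:R / L0%:R) : R)%:C) ?nm_eeR //.
  by rewrite rmorphM rmorphM fmorphV rmorph_int !rmorph_nat.
have Uf l n : nm (U l n) <= f n.
  rewrite /U /f; apply: le_trans (nmB _ _) (lerD _ _); last first.
    by rewrite nmM; apply: ler_pM (nm_ge0 _) (nm_ge0 _) (nI l) (nmD _ _).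
  case: ifP => [nN|_]; last by rewrite nm0 /D; nn.
  apply: le_trans (nmD _ _) _; rewrite !nmM !ne !mulr1 mulrDl mul1r; apply: lerD.
    by apply: le_trans (Mb l n%:Z _) _; rewrite // LN -mul2n leq_mul2l /= ltnW.
  apply: le_trans (Mb l (- n.+1%:Z) _) _; rewrite abszN /=; first by rewrite LN -mul2n leq_mul2l.
  rewrite /D ler_wpM2l; [by []|by nn|].
  by rewrite lef_pV2 ?posrE ?exprn_gt0 ?ltr0n // lerXn2r ?nnegrE ?ler0n // ler_nat.
(* For a fixed frequency [gau_shift] replaces the shifted Riemann sum by [gI] up to O(1/L); the
   decay in k then lets Tannery's theorem sum over all frequencies. *)
have ck k : cv (fun l => Mt l k - gI s (L l) * v k) 0.
  have [A' A'0 HA'] := gau_shift k%:~R s0.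
  pose K := nm (cexp (- (ipi * (k%:~R ^+ 2)%:C / s))) * A' + 1.
  have K0 : 0 < K by rewrite ltr_wpDl //; nn.
  apply: (@cv0_maj R _ (fun l => K * l.+1%:R^-1)) => [l|e e0]; last first.
    have [M HM] := cv_invS (divr_gt0 e0 K0); exists M => n /HM; by rewrite ltr_pdivlMr // mulrC.
  have [_ E] := gMe k s0 (Lp l); rewrite subr0 /Mt /v E.
  have -> : forall a b c d : C, a * b * c - d * (a * c) = a * c * (b - d) by move=> *; ring.
  rewrite !nmM ne mulr1; apply: le_trans (ler_wpM2l (nm_ge0 _) (HA' _ (invL01 (Lp l)))) _.
  rewrite mulrA; apply: ler_pM; [by nn|by nn|by rewrite lerDl|].
  by rewrite lef_pV2 ?posrE ?ltr0n // ler_nat /L leq_pmull.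
have cU n : cv (fun l => U l n) 0.
  have := cvD (ck n%:Z) (ck (- n.+1%:Z)); rewrite addr0 => c e /c [M HM]; exists (M + n.+1)%N => l hl.
  have := HM l (leq_trans (leq_addr _ _) hl); congr (nm (_ - _) < _); rewrite /U.
  have -> : (n < N l)%N.
    apply: leq_trans (leq_trans (leq_addl _ _) hl) _; rewrite /N -[X in (X <= _)%N]mul1n leq_mul //.
    by rewrite half_gt0; case: (L0) L00 ev => [|[]].
  by ring.
have := tannery f0 bf Uf cU; rewrite tsum0 => cT.
have zsp : asum (fun n : nat => v n%:Z + v (- n.+1%:Z)) by apply: asumD.
have zsE : zs v = tsum (fun n : nat => v n%:Z + v (- n.+1%:Z)) by rewrite tsumD.
have TE l : tsum (U l) = gph s (j%:R / L0%:R) - gI s (L l) * zs v.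
  rewrite zsE -mulNr -tsumZ // -[gph _ _](_ : tsum (fun n => if (n < N l)%N then Mt l n%:Z + Mt l (- n.+1%:Z) else 0) = _).
    rewrite -tsumD; [by apply: tsum_eq => n; rewrite mulNr | | exact: asumZ].
    by apply: (@asum_fin R _ (N l)) => n; rewrite ltnNge => ->.
  rewrite (@tsum_fin _ _ (N l)) => [|n]; last by rewrite ltnNge => ->.
  have := @gM_inv s (N l) (j * l.+1) s0; rewrite -LN => /(_ (jl l)); rewrite xE => ->.
  apply: eq_bigr => n _; rewrite ltn_ord /Mt xEC; congr (_ + _ * ee _).
  by rewrite mulrNz mulNr.
have c0 := cvB (cv_cst (gph s (j%:R / L0%:R))) cT; rewrite subr0 in c0.
by apply: cv_eq c0 => l; rewrite TE; ring.
Qed.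
End Poisson.

(** * Eta near rational points *)

Lemma chi12_mod n : chi12 (n %% 12) = chi12 n.
Proof. by rewrite /chi12 modn_mod. Qed.
Lemma chi12M a b : chi12 (a * b) = chi12 a * chi12 b.
Proof.
rewrite -(chi12_mod (a * b)) -modnMm -(chi12_mod a) -(chi12_mod b).
move: (ltn_pmod a (isT : 0 < 12)%N) (ltn_pmod b (isT : 0 < 12)%N).
move: (a %% 12)%N (b %% 12)%N.
by do 12?[case=> [|]] => //; do 12?[case=> [|]].
Qed.
Lemma chi12_dvd (a b : nat) : (12 %| a)%N -> chi12 (a + b) = chi12 b.
Proof. by move=> /dvdnP[q ->]; rewrite -chi12_mod modnMDl chi12_mod. Qed.
Lemma chi12_modz (k : int) : chi12 `|k| = chi12 `|(k %% 12)%Z|.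
Proof.
set k' := `|(k %% 12)%Z|%N; have h : (`|k| %% 12 == k' %% 12)%N || (`|k| %% 12 == (11 * k') %% 12)%N.
  by apply/orP; rewrite /k'; case: (leP 0 k) => k0; [left | right]; apply/eqP; lia.
rewrite -(chi12_mod `|k|); case/orP: h => /eqP ->; rewrite chi12_mod // chi12M.
by rewrite (_ : chi12 11 = 1) // mul1r.
Qed.
Lemma chi12_cong (a b : int) : (12 %| a - b)%Z -> chi12 `|a| = chi12 `|b|.
Proof. by rewrite -eqz_mod_dvd => /eqP h; rewrite chi12_modz h -chi12_modz. Qed.
Section EtaCusp.
Variable R : realType.
Local Notation C := (R[i]).
Local Notation "x %:C" := (real_complex R x) : ring_scope.
Local Notation ipi := (Complex 0 pi : C).
Implicit Types (tau z : C).
(** The factor 144 appears because the summation index of eta is written 12 x + M y. *)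
Definition gs (M : nat) (b : int) : C := \sum_(x < M) ee ((144 * b * x%:Z ^+ 2)%:~R / M%:R).
Lemma natr_abs2 (m : int) : ((`|m| ^ 2)%N%:R : C) = m%:~R ^+ 2.
Proof. by rewrite -rmorphXn /= -[m ^+ 2]gez0_abs ?sqr_ge0 // abszX. Qed.
Lemma gs1 : (chi12 1)%:~R * gs 1 0 / 1%:R = 1.
Proof. by rewrite /gs big_ord1 (_ : 144 * 0 * 0%:Z ^+ 2 = 0) // mul0r ee0 divr1 mulr1. Qed.
Lemma sec_div (L j : nat) (m : int) : (0 < L)%N -> (m * L%:Z + j%:Z)%:~R / L%:R = m%:~R + j%:R / L%:R :> R.
Proof. by move=> L0; rewrite rmorphD rmorphM /= -!pmulrn mulrDl mulfK // pnatr_eq0 -lt0n. Qed.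
Lemma ee_cong (M : nat) (a b : int) : (0 < M)%N -> (M%:Z %| a - b)%Z ->
  ee (a%:~R / M%:R : C) = ee (b%:~R / M%:R).
Proof.
move=> M0 /dvdzP[q E]; have M1 : (M%:R : C) != 0 by exact: natC0.
have -> : a = b + q * M%:Z by rewrite -E addrC subrK.
by rewrite rmorphD rmorphM /= -pmulrn mulrDl mulfK // eeDint.
Qed.
Lemma Im_neg_inv tau : upper tau -> tau != 0 /\ upper (- tau^-1).
Proof.
rewrite /upper; case: tau => a b /= b0; split; first by rewrite eq_complex /= negb_and (gt_eqF b0) orbT.
by rewrite opprK mulr_gt0 // invr_gt0 ltr_wpDl ?sqr_ge0 // exprn_gt0.
Qed.
Lemma upper_addR tau (r : R) : upper tau -> upper (tau + r%:C).
Proof. by rewrite /upper; case: tau => a b /=; rewrite addr0. Qed.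
Lemma upper_mulR tau (r : R) : 0 < r -> upper tau -> upper (r%:C * tau).
Proof. by rewrite /upper; case: tau => a b /= r0 b0; rewrite mul0r addr0 mulr_gt0. Qed.
Lemma upper_aff tau (p q : C) (x y : R) : p = x%:C -> q = y%:C -> 0 < x -> upper tau -> upper (p * tau + q).
Proof. by move=> -> -> x0 t0; apply: upper_addR; apply: upper_mulR. Qed.
Lemma ratC (a b : int) : (a%:~R / b%:~R : C) = (a%:~R / b%:~R : R)%:C.
Proof. by rewrite rmorphM fmorphV !rmorph_int. Qed.
Lemma zs_eta z : upper z -> zas (fun m => (chi12 `|m|)%:~R * ee (z / 24) ^+ (`|m| ^ 2)) /\
  zs (fun m => (chi12 `|m|)%:~R * ee (z / 24) ^+ (`|m| ^ 2)) = 2 * eta z.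
Proof.
move=> z0; have X1 := nm_ee_lt1 z0 (isT : 0 < 24)%N; have a := asum_chi X1 chi12_le1.
have E2 n : (chi12 `|- n.+1%:Z|)%:~R * ee (z / 24) ^+ (`|- n.+1%:Z| ^ 2) =
   (chi12 (n + 1))%:~R * ee (z / 24) ^+ ((n + 1) ^ 2) by rewrite abszN /= addn1.
split; first by split=> //; apply: asum_eq (fun n => esym (E2 n)) (asum_shift 1 a).
rewrite /zs (tsum_eq E2) eta_chi // mulr_natl mulr2n; congr (_ + _).
by rewrite [RHS](tsum_split 1 a) big_ord1 /= /chi12 /= mul0r add0r.
Qed.
(** The finite Fourier transform of [chi12] is proportional to [chi12], as for every primitive real
    character. This is checked on the twelve residues with z^4 = z^2 - 1; the constant of
    proportionality stays unevaluated. *)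
Lemma ee12_sum (k : int) : \sum_(y < 12) (chi12 y)%:~R * ee ((k * y%:Z)%:~R / 12%:R) =
  (chi12 `|k|)%:~R * \sum_(y < 12) (chi12 y)%:~R * ee (y%:~R / 12%:R : C).
Proof.
pose z := ee (1 / 12%:R : C).
have zE (a : int) (n : nat) : (12%:Z %| a - n%:Z)%Z -> ee (a%:~R / 12%:R : C) = z ^+ n.
  by move=> /(ee_cong (isT : 0 < 12)%N) ->; rewrite /z -eeMn mul1r.
have z12 : z ^+ 12 = 1 by rewrite /z -eeMn mul1r divff ?ee1 // pnatr_eq0.
have z6 : z ^+ 6 != 1.
  by rewrite -(@zE 6%:Z 6%N) // (@ee_frac_eq1 R 12 6).
have z4 : z ^+ 4 != 1 by rewrite -(@zE 4%:Z 4%N) // (@ee_frac_eq1 R 12 4).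
have z6' : z ^+ 6 = -1.
  have : (z ^+ 6 - 1) * (z ^+ 6 + 1) = 0 by rewrite -subr_sqr -exprM z12 expr1n subrr.
  by move/eqP; rewrite mulf_eq0 subr_eq0 (negPf z6) /= addr_eq0 => /eqP.
have r4 : z ^+ 4 = z ^+ 2 - 1.
  have z2 : z ^+ 2 + 1 != 0.
    apply: contra z4; rewrite addr_eq0 => /eqP h.
    by rewrite (exprM z 2 2) h sqrrN expr1n.
  apply: (mulfI z2); transitivity (z ^+ 6 + 1 + (z ^+ 4 - 1)); first by ring.
  by rewrite z6' addNr; ring.
pose k' := (`|(k %% 12)%Z|)%N; have k'12 : (k' < 12)%N by rewrite /k'; lia.
have kE : k = (k %/ 12)%Z * 12 + k'%:Z by rewrite /k'; lia.
have cE : chi12 `|k| = chi12 k' by apply: chi12_modz.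
rewrite cE (eq_bigr (fun y : 'I_12 => (chi12 y)%:~R * z ^+ ((k' * y) %% 12))) => [|y _]; last first.
  by rewrite (@zE (k * y%:Z) ((k' * y) %% 12)%N) // {1}kE; apply/dvdzP; exists ((k %/ 12)%Z * y%:Z + ((k' * y) %/ 12)%N%:Z); have := divn_eq (k' * y) 12; lia.
rewrite [in RHS](eq_bigr (fun y : 'I_12 => (chi12 y)%:~R * z ^+ y)) => [|y _]; last first.
  by rewrite (@zE y%:Z y) // subrr.
have e5 : z ^+ 5 = z ^+ 3 - z by rewrite exprS r4; ring.
have e7 : z ^+ 7 = - z by rewrite exprS z6'; ring.
have e8 : z ^+ 8 = - z ^+ 2 by rewrite (exprD z 2 6) z6'; ring.
have e9 : z ^+ 9 = - z ^+ 3 by rewrite (exprD z 3 6) z6'; ring.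
have e10 : z ^+ 10 = 1 - z ^+ 2 by rewrite (exprD z 4 6) z6' r4; ring.
have e11 : z ^+ 11 = z - z ^+ 3 by rewrite (exprD z 5 6) z6' e5; ring.
move: k' k'12 {kE cE}; case=> [|[|[|[|[|[|[|[|[|[|[|[|?]]]]]]]]]]]] // _; rewrite !big_ord_recl !big_ord0 /= /chi12 /= ?expr0 ?expr1;
  rewrite ?z6' ?r4 ?e5 ?e7 ?e8 ?e9 ?e10 ?e11; ring.
Qed.
(** Completing the square: 576 = 4 times 144, so replacing x by x + 2 D k creates exactly the linear
    term k x and the constant D k^2. *)
Lemma gs_shift (M : nat) (b D k : int) : (0 < M)%N -> (M%:Z %| 576 * b * D - 1)%Z ->
  \sum_(x < M) ee ((144 * b * x%:Z ^+ 2 + k * x%:Z)%:~R / M%:R : C) = gs M b * ee ((- (D * k ^+ 2))%:~R / M%:R).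
Proof.
move=> M0 /dvdzP[q E].
rewrite /gs -(@period_shift R (fun x => ee ((144 * b * x ^+ 2)%:~R / M%:R)) M (2 * D * k)) => [|x]; last first.
  by apply: ee_cong => //; apply/dvdzP; exists (144 * b * (2 * x + M%:Z)); ring.
rewrite mulr_suml; apply: eq_bigr => x _; rewrite -eeD -mulrDl -rmorphD; apply: ee_cong => //.
apply/dvdzP; exists (- (q * (k * x%:Z + D * k ^+ 2))).
have -> : - (q * (k * x%:Z + D * k ^+ 2)) * M%:Z = - (q * M%:Z) * (k * x%:Z + D * k ^+ 2) by ring.
by rewrite -E; ring.
Qed.
Lemma gI_scale (s : C) (M l : nat) : 0 < Im s -> (0 < M)%N ->
  gI (M%:R ^+ 2 * s) (12 * M * l.+1) = M%:R^-1 * gI s (12 * l.+1).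
Proof.
move=> s0 M0; have M1 : (M%:R : R) != 0 by rewrite pnatr_eq0 -lt0n.
have l1 : (l.+1%:R : R) != 0 by rewrite pnatr_eq0.
have gE x : gau (M%:R ^+ 2 * s) 0 x = gau s 0 (M%:R * x).
  by rewrite /gau; congr cexp; rewrite !mul0r !subr0 rmorphM rmorph_nat; ring.
have xE m : M%:R * xi (12 * M * l.+1)%:R^-1 m = xi (12 * l.+1)%:R^-1 m :> R.
  by rewrite /xi mulrA; congr (_ * _); rewrite !natrM; field; rewrite M1 addrC natr1 l1.
have hE : (((12 * M * l.+1)%:R^-1)%:C : C) = M%:R^-1 * ((12 * l.+1)%:R^-1)%:C.
  by rewrite !fmorphV !rmorph_nat -invfM -natrM; congr (_%:R^-1); lia.
have [B _ /(_ _ (@invL01 R (12 * l.+1) isT)) [z _]] := @gau_bound R s 0 s0.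
by rewrite /gI -zsZ //; apply: zs_eq => m; rewrite gE xE hE mulrA.
Qed.
Lemma ipi_ee z : cexp (ipi * z) = ee (z / 2).
Proof.
rewrite /ee (_ : Complex 0 (2 * pi) = 2 * ipi); last by rewrite -(rmorph_nat (real_complex R)); simpc.
by congr cexp; field.
Qed.
(** The theta series is split modulo 12 M, each piece is transformed by Poisson summation, and the
    pieces are recombined by a finite Fourier transform. The Gaussian integral and the character sum
    remain as an unevaluated factor that does not depend on M, b or D. *)
Lemma eta_cusp_cv (M : nat) (b D : int) tau : (0 < M)%N -> coprime M 6 -> upper tau ->
  (M%:Z %| 576 * b * D - 1)%Z ->
  cv (fun l => gI (- (12 / tau)) (12 * l.+1) * (\sum_(y < 12) (chi12 y)%:~R * ee (y%:~R / 12%:R)) *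
     ((chi12 M)%:~R * gs M b / M%:R * eta (tau / M%:R ^+ 2 - 24 * D%:~R / M%:R)))
   (eta (24 * b%:~R / M%:R - tau^-1)).
Proof.
move=> M0 cM t0 hD; have [t1 t2] := Im_neg_inv t0; set T := \sum_(y < 12) _.
have M1 : (M%:R : C) != 0 by exact: natC0.
have M0R : 0 < (M%:R : R) by rewrite ltr0n.
pose s := - (12 / tau); pose s' := M%:R ^+ 2 * s.
have s0 : 0 < Im s.
  have -> : s = 12%:R%:C * (- tau^-1) by rewrite rmorph_nat /s; ring.
  by apply: (upper_mulR _ t2); rewrite ltr0n.
have s'0 : 0 < Im s'.
  have -> : s' = (M%:R ^+ 2)%:C * s by rewrite rmorphXn rmorph_nat.
  by apply: (upper_mulR _ s0); rewrite exprn_gt0.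
have x0 : upper (24 * b%:~R / M%:R - tau^-1).
  rewrite addrC (_ : 24 * b%:~R / M%:R = ((24 * b%:~R / M%:R : R)%:C)); first exact: upper_addR.
  by rewrite !rmorphM fmorphV rmorph_int !rmorph_nat.
have z0 : upper (tau / M%:R ^+ 2 - 24 * D%:~R / M%:R).
  rewrite mulrC (_ : - (24 * D%:~R / M%:R) = ((- (24 * D%:~R / M%:R) : R)%:C)); last first.
    by rewrite rmorphN !rmorphM fmorphV rmorph_int !rmorph_nat.
  apply: upper_addR; rewrite (_ : (M%:R ^+ 2)^-1 = ((M%:R ^+ 2)^-1 : R)%:C); last by rewrite fmorphV rmorphXn rmorph_nat.
  by apply: upper_mulR => //; rewrite invr_gt0 exprn_gt0.
pose psi (m : int) : C := (chi12 `|m|)%:~R * ee ((b * m ^+ 2)%:~R / M%:R).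
pose L0 := (12 * M)%N; have L00 : (0 < L0)%N by rewrite muln_gt0.
have psiP m (j : nat) : psi (m * L0%:Z + j%:Z) = psi j%:Z.
  rewrite /psi; congr (_%:~R * _).
    by apply: chi12_cong; rewrite addrK /L0 PoszM mulrA mulrAC dvdz_mull.
  apply: ee_cong => //; apply/dvdzP; exists (12 * b * (m ^+ 2 * L0%:Z + 2 * m * j%:Z)); rewrite /L0 PoszM; ring.
have [zx Ex] := zs_eta x0; have [zz Ez] := zs_eta z0.
have gx m : (chi12 `|m|)%:~R * ee ((24 * b%:~R / M%:R - tau^-1) / 24) ^+ (`|m| ^ 2) = psi m * gau s' 0 (m%:~R / L0%:R).
  rewrite /psi -eeMn -[RHS]mulrA; congr (_ * _).
  have mE : ((`|m| ^ 2)%N%:R : C) = m%:~R ^+ 2.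
    exact: natr_abs2.
  rewrite /gau mul0r subr0 -[ipi * s' * _]mulrA ipi_ee -eeD mE; congr ee.
  have -> : (m%:~R / L0%:R : R)%:C = m%:~R / (12%:R * M%:R) by rewrite rmorphM fmorphV rmorph_int rmorph_nat /L0 natrM.
  rewrite /s' /s rmorphM rmorphXn /=; field.
  by rewrite M1 t1.
have zg (j : nat) : (j < L0)%N -> zas (fun m => gau s' 0 (m%:~R + j%:R / L0%:R)).
  move=> jL; have [B _ /(_ _ (invL01 R L00)) [z _]] := @gau_bound R s' 0 s'0.
  apply: zas_eq (zasZ L0%:R (zas_sec L00 jL z)) => m.
  rewrite fmorphV rmorph_nat mulrA mulfV ?pnatr_eq0 -?lt0n // mul1r; congr gau.
  by rewrite /xi mulrC sec_div.
have E1 : 2 * eta (24 * b%:~R / M%:R - tau^-1) = \sum_(j < L0) psi j%:Z * gph s' (j%:R / L0%:R).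
  rewrite -Ex (zs_eq gx) (zs_sec L00); last exact: zas_eq gx zx.
  apply: eq_bigr => j _; rewrite /gph -zsZ; last exact: zg.
  apply: zs_eq => m; rewrite psiP; congr (_ * gau _ _ _).
  exact: sec_div.
pose v (j : nat) (k : int) := cexp (- (ipi * (k%:~R ^+ 2)%:C / s')) * ee (k%:~R * (j%:R / L0%:R)).
have ev : ~~ odd L0 by rewrite oddM.
have Pv (j : 'I_L0) := gph_poisson s'0 (ltn_ord j) ev.
have c1 : cv (fun l => \sum_(j < L0) psi j%:Z * (gI s' (L0 * l.+1) * zs (v j))) (\sum_(j < L0) psi j%:Z * gph s' (j%:R / L0%:R)).
  by apply: (cv_sum (r := index_enum 'I_L0)) => j _; apply: cvZ; case: (Pv j).
(* With j = 12 x + M y the sum factors into a character sum modulo 12 and a quadratic sum modulo M,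
   to which [gs_shift] applies. *)
have W (k : int) : \sum_(j < L0) psi j%:Z * ee (k%:~R * (j%:R / L0%:R)) =
   (chi12 M)%:~R * T * gs M b * ((chi12 `|k|)%:~R * ee ((- (D * k ^+ 2))%:~R / M%:R)).
  pose f (j : nat) := psi j%:Z * ee (k%:~R * (j%:R / L0%:R)).
  have fP j : f (j + L0)%N = f j.
    rewrite /f (_ : (j + L0)%N%:Z = 1 * L0%:Z + j%:Z) ?psiP; last by lia.
    congr (_ * _); rewrite natrD mulrDl divff ?mulrDr ?mulr1 ?eeDint //.
    by rewrite pnatr_eq0 -lt0n.
  rewrite -/(f _) (eq_bigr (fun j : 'I_L0 => f j)) // crt_sum //; last by rewrite coprime_sym (coprime_dvdr (_ : 12 %| 6 ^ 2)%N) // coprime_pexpr.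
  rewrite (_ : _ * _ * gs M b * _ = (chi12 M)%:~R * ((chi12 `|k|)%:~R * T) * (gs M b * ee ((- (D * k ^+ 2))%:~R / M%:R))); last by ring.
  rewrite -(gs_shift k M0 hD) -ee12_sum mulr_sumr; apply: eq_bigr => x _.
  rewrite mulr_sumr mulr_suml; apply: eq_bigr => y _; rewrite /f /psi /=.
  have -> : chi12 (12 * x + M * y) = chi12 M * chi12 y by rewrite chi12_dvd ?chi12M // dvdn_mulr.
  have -> : ee ((b * ((12 * x + M * y)%N%:Z) ^+ 2)%:~R / M%:R) = ee ((144 * b * x%:Z ^+ 2)%:~R / M%:R) :> C.
    by apply: ee_cong => //; apply/dvdzP; exists (b * (24 * x%:Z * y%:Z + M%:Z * y%:Z ^+ 2)); rewrite PoszD !PoszM; ring.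
  have -> : ee (k%:~R * ((12 * x + M * y)%N%:R / L0%:R)) = ee ((k * x%:Z)%:~R / M%:R) * ee ((k * y%:Z)%:~R / 12%:R) :> C.
    rewrite -eeD; congr ee; rewrite /L0 natrD !natrM !rmorphM /= -!pmulrn; field; by rewrite M1.
  have -> : ee ((144 * b * x%:Z ^+ 2 + k * x%:Z)%:~R / M%:R) = ee ((144 * b * x%:Z ^+ 2)%:~R / M%:R) * ee ((k * x%:Z)%:~R / M%:R) :> C.
    by rewrite -eeD -mulrDl -rmorphD.
  by rewrite [(chi12 M * chi12 y)%:~R]intrM; ring.
have E2 : \sum_(j < L0) psi j%:Z * zs (v j) = (chi12 M)%:~R * T * gs M b * (2 * eta (tau / M%:R ^+ 2 - 24 * D%:~R / M%:R)).
  rewrite -Ez -zsZ // (eq_bigr (fun j : 'I_L0 => zs (fun k => psi j%:Z * v j k))) => [|j _]; last first.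
    by rewrite zsZ //; case: (Pv j).
  rewrite -zs_sum => [|j]; last by apply: zasZ; case: (Pv j).
  apply: zs_eq => k; rewrite (eq_bigr (fun j : 'I_L0 => cexp (- (ipi * (k%:~R ^+ 2)%:C / s')) * (psi j%:Z * ee (k%:~R * (j%:R / L0%:R))))); last first.
    by move=> j _; rewrite /v mulrCA.
  rewrite -mulr_sumr W mulrCA; congr (_ * _); rewrite mulrCA; congr (_ * _).
  have kE : ((`|k| ^ 2)%N%:R : C) = k%:~R ^+ 2.
    exact: natr_abs2.
  have -> : - (ipi * (k%:~R ^+ 2)%:C / s') = ipi * - ((k%:~R ^+ 2)%:C / s') by rewrite mulrN mulrA.
  rewrite ipi_ee -eeMn kE -eeD; congr ee.
  have -> : (k%:~R ^+ 2)%:C = k%:~R ^+ 2 :> C by rewrite rmorphXn /= rmorph_int.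
  have -> : (- (D * k ^+ 2))%:~R = - (D%:~R * k%:~R ^+ 2) :> C by rewrite mulrNz intrM rmorphXn.
  rewrite /s' /s; field.
  by rewrite M1 t1.
have c2 := cvZ 2^-1 c1; rewrite -E1 mulKf ?pnatr_eq0 // in c2.
apply: cv_eq c2 => l; rewrite (eq_bigr (fun j : 'I_L0 => gI s' (L0 * l.+1) * (psi j%:Z * zs (v j)))); last by move=> j _; rewrite mulrCA.
by rewrite -mulr_sumr E2 /s' /L0 gI_scale // -/s; field.
Qed.
(** Comparing [eta_cusp_cv] for (M, b) and for (1, 0) cancels the common unevaluated factor. *)
Lemma eta_cusp (M : nat) (b D : int) tau : (0 < M)%N -> coprime M 6 -> upper tau ->
  (M%:Z %| 576 * b * D - 1)%Z ->
  eta (24 * b%:~R / M%:R - tau^-1) * eta tau =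
  eta (- tau^-1) * ((chi12 M)%:~R * gs M b / M%:R) * eta (tau / M%:R ^+ 2 - 24 * D%:~R / M%:R).
Proof.
move=> M0 cM t0 hD; have c1 := eta_cusp_cv M0 cM t0 hD.
have c2 := @eta_cusp_cv 1 0 0 tau isT isT t0 (dvd1z _).
have e1 : (24 * 0%:~R / 1%:R - tau^-1 : C) = - tau^-1 by rewrite mulr0 mul0r sub0r.
have e2 : (tau / 1%:R ^+ 2 - 24 * 0%:~R / 1%:R : C) = tau by rewrite expr1n divr1 mulr0 mul0r subr0.
have e3 := gs1.
rewrite e1 e2 e3 mul1r in c2.
have := cvZ (eta tau) c1; have := cvZ ((chi12 M)%:~R * gs M b / M%:R * eta (tau / M%:R ^+ 2 - 24 * D%:~R / M%:R)) c2.
move=> d2 d1; have E : eta tau * eta (24 * b%:~R / M%:R - tau^-1) =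
  (chi12 M)%:~R * gs M b / M%:R * eta (tau / M%:R ^+ 2 - 24 * D%:~R / M%:R) * eta (- tau^-1).
  by apply: (cv_uniq d1); apply: cv_eq d2 => l; ring.
by rewrite mulrC E -[RHS]mulrA [RHS]mulrC.
Qed.
(** By [gau_J] the square of the Gaussian integral times s does not depend on s, so eta(-1/tau)^2 is
    a constant times tau eta(tau)^2; the fixed point i gives the constant. Squaring avoids a branch
    of the square root. *)
Lemma eta_S2 tau : upper tau -> eta (- tau^-1) ^+ 2 = - 'i%C * tau * eta tau ^+ 2.
Proof.
have ii : ('i%C : C) ^+ 2 = -1 by apply: sqr_i.
have i0 : ('i%C : C) != 0 by apply/eqP => h; move: ii; rewrite h expr0n => /eqP; rewrite eq_sym oppr_eq0 oner_eq0.
have iu : upper ('i%C : C) by rewrite /upper /= ltr01.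
set T : C := \sum_(y < 12) (chi12 y)%:~R * ee (y%:~R / 12%:R).
have K z : upper z -> cv (fun l => gI (- (12 / z)) (12 * l.+1) * T * eta z) (eta (- z^-1)).
  move=> z0; have c2 := @eta_cusp_cv 1 0 0 z isT isT z0 (dvd1z _).
  have e1 : (24 * 0%:~R / 1%:R - z^-1 : C) = - z^-1 by rewrite mulr0 mul0r sub0r.
  have e2 : (z / 1%:R ^+ 2 - 24 * 0%:~R / 1%:R : C) = z by rewrite expr1n divr1 mulr0 mul0r subr0.
  have e3 := gs1.
  by rewrite e1 e2 e3 mul1r in c2.
have sI z : upper z -> 0 < Im (- (12 / z)).
  move=> z0; have [_ z2] := Im_neg_inv z0; have -> : - (12 / z) = 12%:R%:C * (- z^-1) by rewrite rmorph_nat; ring.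
  by apply: (upper_mulR _ z2); rewrite ltr0n.
move=> t0; have [t1 _] := Im_neg_inv t0.
have [A A0 HA] := gau_J (sI _ iu) (sI _ t0).
have cJ : cv (fun l => gI (- (12 / tau)) (12 * l.+1) ^+ 2 * - (12 / tau) - gI (- (12 / 'i%C)) (12 * l.+1) ^+ 2 * - (12 / 'i%C)) 0.
  apply: (@cv0_maj R _ (fun l => (A + 1) * l.+1%:R^-1)) => [l|e e0].
    rewrite subr0; apply: le_trans (HA _ (@invL01 R (12 * l.+1) isT)) _.
    by apply: ler_pM => //; rewrite ?invr_ge0 ?lerDl // lef_pV2 ?posrE ?ltr0n // ler_nat leq_pmull.
  have K0 : 0 < A + 1 by rewrite ltr_wpDl.
  by have [N HN] := cv_invS (divr_gt0 e0 K0); exists N => n /HN; rewrite ltr_pdivlMr // mulrC.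
have et := eta_neq0 t0; have ei := eta_neq0 iu.
have c1 := cvZ (eta tau)^-1 (K _ t0); have c2 := cvZ (eta 'i%C)^-1 (K _ iu).
have iV : - ('i%C : C)^-1 = 'i%C by apply: (mulfI i0); rewrite mulrN mulfV // -expr2 ii.
rewrite iV mulVf // in c2.
have d1 := cvM (cvM c1 c1) (cv_cst (- (12 / tau))); have d2 := cvM (cvM c2 c2) (cv_cst (- (12 / 'i%C))).
have d3 := cvB d1 d2; have d4 := cvM (cvM (cv_cst T) (cv_cst T)) cJ; rewrite mulr0 in d4.
have /eqP : 0 = (eta tau)^-1 * eta (- tau^-1) * ((eta tau)^-1 * eta (- tau^-1)) * - (12 / tau) - 1 * 1 * - (12 / 'i%C).
  by apply: (cv_uniq d4); apply: cv_eq d3 => l; field; rewrite et ei i0 t1.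
rewrite eq_sym subr_eq0 !mul1r => /eqP E.
have {}E : eta (- tau^-1) ^+ 2 = - (12 / 'i%C) / - (12 / tau) * eta tau ^+ 2 by rewrite -E; field; rewrite et t1.
rewrite E; congr (_ * _); have -> : - 'i%C = ('i%C)^-1 :> C by rewrite -[RHS]opprK iV.
by field; rewrite t1 i0.
Qed.
End EtaCusp.

(** * Numbers integral above ell *)

Lemma monic_top (A : nzRingType) (p : {poly A}) : p \is monic -> exists2 n, size p = n.+1 & p`_n = 1.
Proof.
move=> mp; have sp : size p = (size p).-1.+1 by rewrite prednK // size_poly_gt0 monic_neq0.
by exists (size p).-1; last by apply/eqP; move: mp; rewrite monicE.
Qed.
Section Oell.
Variable R : realType.
Local Notation C := (R[i]).
Definition iz (x : C) := integralOver (intr : int -> C) x.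
Lemma iz_int (m : int) : iz m%:~R. Proof. exact: (integral_id (intr : {rmorphism int -> C})). Qed.
Lemma iz_nat (m : nat) : iz m%:R. Proof. exact: (integral_nat (intr : {rmorphism int -> C})). Qed.
Lemma izD x y : iz x -> iz y -> iz (x + y). Proof. exact: (@integral_add _ _ (intr : {rmorphism int -> C})). Qed.
Lemma izM x y : iz x -> iz y -> iz (x * y). Proof. exact: (@integral_mul _ _ (intr : {rmorphism int -> C})). Qed.
Lemma izX x n : iz x -> iz (x ^+ n).
Proof. by move=> h; elim: n => [|n IH]; rewrite ?exprS; [exact: (iz_nat 1) | exact: izM]. Qed.
Lemma iz_monic u (p : {poly C}) : p \is monic -> root p u -> (forall i, iz p`_i) -> iz u.
Proof.
move=> h1 h2 h3; apply: (@integral_root_monic _ _ (intr : {rmorphism int -> C})) h1 h2 _.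
exact/(integral_poly (intr : {rmorphism int -> C})).
Qed.
Lemma iz_rootn x n : (0 < n)%N -> iz (x ^+ n) -> iz x.
Proof.
move=> n0 h; apply: (@iz_monic _ ('X^n - (x ^+ n)%:P)); first exact: monicXnsubC.
  by rewrite rootE !hornerE subrr.
move=> i; rewrite coefB coefXn coefC; apply: izD; first exact: iz_nat.
by rewrite -mulN1r; apply: izM; [exact: (iz_int (-1)) | case: ifP => // _; exact: (iz_nat 0)].
Qed.
Lemma denq_dvd (q : rat) (b a : int) : q * b%:~R = a%:~R -> (denq q %| b)%Z.
Proof.
move=> h; have e : numq q * b = a * denq q.
  by apply/eqP; rewrite -(eqr_int rat) !intrM numqE -mulrA (mulrC (denq q)%:~R) mulrA h.
have : (denq q %| numq q * b)%Z by rewrite e dvdz_mull.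
by rewrite Gauss_dvdzr // /coprimez /gcdz gcdnC; exact: coprime_num_den.
Qed.
Variable ell : nat.
Hypothesis pell : prime ell.
Local Notation O := (@in_Oell R ell).
Lemma ndvdM a b : ~~ (ell %| a)%N -> ~~ (ell %| b)%N -> ~~ (ell %| a * b)%N.
Proof. by move=> h1 h2; rewrite Euclid_dvdM // negb_or h1. Qed.
Lemma ell_ndvd1 : ~~ (ell %| 1)%N.
Proof. by rewrite dvdn1; apply: contraTN pell => /eqP->. Qed.
(** Scaling the roots of the monic equation by a common denominator prime to [ell] yields an
    algebraic integer. This reduces the ring operations of [O] to those of integral elements. *)
Lemma O_iff x : O x <-> exists2 d : nat, ~~ (ell %| d)%N & iz (d%:R * x).
Proof.
split=> [[p [mp [dp rp]]]|[d hd [p mp rp]]].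
  have [n sp pn] := monic_top mp.
  pose d := (\prod_(i < n.+1) `|denq p`_i|)%N.
  exists d; first by apply: (big_ind (fun m => ~~ (ell %| m)%N)) => [||i _]; [exact: ell_ndvd1|exact: ndvdM|have := dp i; rewrite dvdzE].
  have hd i : (i <= n)%N -> exists m : int, ratr p`_i * d%:R = m%:~R :> C.
    move=> le; have h : (i < n.+1)%N by [].
    exists (numq p`_i * (\prod_(j < n.+1 | j != Ordinal h) `|denq p`_j|)%N%:Z).
    rewrite /d (bigD1 (Ordinal h)) //= natrM mulrA intrM; congr (_ * _).
    have -> : (`|denq p`_i|%N%:R : C) = ratr (denq p`_i)%:~R.
      by rewrite ratr_int -{2}(absz_denq p`_i) -pmulrn.
    by rewrite -[RHS]ratr_int numqE rmorphM.
  pose q : {poly C} := \poly_(i < n.+1) (ratr p`_i * d%:R ^+ (n - i)).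
  have qn : q`_n = 1 by rewrite coef_poly ltnSn pn subnn expr0 mulr1 rmorph1.
  have sq : size q = n.+1 by rewrite size_poly_eq // pn subnn expr0 mulr1 rmorph1 oner_neq0.
  apply: (@iz_monic _ q).
  - by apply/monicP; rewrite /lead_coef sq.
  - rewrite rootE (horner_coef_wide _ (size_poly _ _)).
    move: rp; rewrite rootE (@horner_coef_wide _ n.+1); last by rewrite -sp size_poly.
    move=> /eqP e; apply/eqP; rewrite -[RHS](mulr0 (d%:R ^+ n)) -[in RHS]e mulr_sumr; apply: eq_bigr => i _.
    rewrite coef_poly ltn_ord coef_map_id0 ?rmorph0 // exprMn.
    have -> : d%:R ^+ n = d%:R ^+ (n - i) * d%:R ^+ i :> C by rewrite -exprD subnK // -ltnS.
    by ring.
  - move=> i; rewrite coef_poly; case: ifP => // [lti|_]; last exact: (iz_nat 0).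
    have [->|ne] := eqVneq i n; first by rewrite pn subnn expr0 mulr1 rmorph1; exact: (iz_nat 1).
    have lt : (i < n)%N by rewrite ltn_neqAle ne.
    rewrite (_ : (n - i = (n - i.+1).+1)%N); last by lia.
    rewrite exprS mulrA; have [m ->] := hd i (ltnW lt).
    by apply: izM; [exact: iz_int|apply: izX; exact: iz_nat].
have d0 : (d%:R : C) != 0 by rewrite pnatr_eq0; apply: contraNneq hd => ->.
have d0q : (d%:R : rat) != 0 by rewrite pnatr_eq0; apply: contraNneq hd => ->.
have [n sp pn] := monic_top mp.
pose q : {poly rat} := \poly_(i < n.+1) ((p`_i)%:~R / d%:R ^+ (n - i)).
have qn : q`_n = 1 by rewrite coef_poly ltnSn pn subnn expr0 divr1.
have sq : size q = n.+1 by rewrite size_poly_eq // pn subnn expr0 divr1 oner_neq0.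
exists q; split; first by apply/monicP; rewrite /lead_coef sq.
split=> [i|].
  rewrite coef_poly; case: ifP => [_|_]; last by rewrite (denq_int 0) dvdzE /= dvdn1; apply: contraTN pell => /eqP->.
  apply/negP => h; have := @denq_dvd ((p`_i)%:~R / d%:R ^+ (n - i)) ((d ^ (n - i))%N%:Z) p`_i.
  rewrite -pmulrn natrX divfK ?expf_neq0 // => /(_ erefl) h2.
  have := dvdz_trans h h2; rewrite dvdzE /= Euclid_dvdX // (negbTE hd) //.
rewrite rootE (@horner_coef_wide _ n.+1); last by rewrite -sq size_poly.
move: rp; rewrite rootE (@horner_coef_wide _ n.+1); last by rewrite -sp size_poly.
move=> /eqP e; apply/eqP; rewrite -[RHS](mulr0 ((d%:R ^+ n)^-1)) -[in RHS]e mulr_sumr; apply: eq_bigr => i _.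
rewrite coef_map_id0 ?rmorph0 // coef_map_id0 // coef_poly ltn_ord exprMn.
have -> : ratr ((p`_i)%:~R / d%:R ^+ (n - i)) = (p`_i)%:~R / d%:R ^+ (n - i) :> C.
  by rewrite rmorphM fmorphV rmorphXn /= ratr_nat ratr_int.
have -> : d%:R ^+ n = d%:R ^+ (n - i) * d%:R ^+ i :> C by rewrite -exprD subnK // -ltnS.
by field; rewrite !expf_neq0.
Qed.
Lemma OD x y : O x -> O y -> O (x + y).
Proof.
move=> /O_iff[d hd h] /O_iff[e he k]; apply/O_iff; exists (d * e)%N; first exact: ndvdM.
rewrite (_ : _ * _ = e%:R * (d%:R * x) + d%:R * (e%:R * y)); last by rewrite natrM; ring.
by apply: izD; apply: izM => //; exact: iz_nat.
Qed.
Lemma OM x y : O x -> O y -> O (x * y).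
Proof.
move=> /O_iff[d hd h] /O_iff[e he k]; apply/O_iff; exists (d * e)%N; first exact: ndvdM.
rewrite (_ : _ * _ = (d%:R * x) * (e%:R * y)); last by rewrite natrM; ring.
exact: izM.
Qed.
Lemma O_int (m : int) : O m%:~R.
Proof. by apply/O_iff; exists 1%N; rewrite ?ell_ndvd1 // mul1r; exact: iz_int. Qed.
Lemma O_nat (m : nat) : O m%:R. Proof. exact: (O_int m). Qed.
Lemma O0 : O 0. Proof. exact: (O_nat 0). Qed.
Lemma O1 : O 1. Proof. exact: (O_nat 1). Qed.
Lemma ON x : O x -> O (- x).
Proof. by move=> h; rewrite -mulN1r; apply: OM h; exact: (O_int (-1)). Qed.
Lemma OX x n : O x -> O (x ^+ n).
Proof. by move=> h; elim: n => [|n IH]; rewrite ?exprS; [exact: O1|exact: OM]. Qed.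
Lemma O_sum (J : Type) (s : seq J) (P : pred J) (F : J -> C) : (forall i, P i -> O (F i)) -> O (\sum_(i <- s | P i) F i).
Proof. by move=> h; apply: big_ind => //; [exact: O0|exact: OD]. Qed.
Lemma O_inv (n : nat) : ~~ (ell %| n)%N -> O n%:R^-1.
Proof.
move=> h; apply/O_iff; exists n => //; rewrite mulfV; first exact: (iz_nat 1).
by rewrite pnatr_eq0; apply: contraNneq h => ->.
Qed.
Lemma O_rootn x n : (0 < n)%N -> O (x ^+ n) -> O x.
Proof.
move=> n0 /O_iff[d hd h]; apply/O_iff; exists d => //; apply: (iz_rootn n0).
rewrite exprMn -(prednK n0) [d%:R ^+ _]exprSr -mulrA prednK //; apply: izM => //; apply: izX; exact: iz_nat.
Qed.
Lemma O_unity x n : (0 < n)%N -> x ^+ n = 1 -> O x.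
Proof. by move=> n0 e; apply: (O_rootn n0); rewrite e; exact: O1. Qed.
(** The ideal generated by [ell]. It is not prime, so only units, such as integers prime to [ell],
    may be cancelled. *)
Definition I_ (x : C) := O (x / ell%:R).
Local Notation I := I_.
Lemma conglE x : congl ell x 0 = I x. Proof. by rewrite /congl subr0. Qed.
Lemma ell_neq0 : (ell%:R : C) != 0.
Proof. by rewrite pnatr_eq0 -lt0n prime_gt0. Qed.
Lemma I0 : I 0. Proof. by rewrite /I mul0r; exact: O0. Qed.
Lemma ID x y : I x -> I y -> I (x + y). Proof. by rewrite /I mulrDl; exact: OD. Qed.
Lemma IN x : I x -> I (- x). Proof. by rewrite /I mulNr; exact: ON. Qed.
Lemma IB x y : I x -> I y -> I (x - y). Proof. by move=> h /IN; exact: ID. Qed.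
Lemma IMl x y : O x -> I y -> I (x * y). Proof. by rewrite /I -mulrA; exact: OM. Qed.
Lemma IMr x y : I x -> O y -> I (x * y). Proof. by rewrite mulrC => h k; exact: IMl. Qed.
Lemma I_O x : I x -> O x.
Proof. by move=> h; rewrite -(divfK ell_neq0 x); apply: OM h (O_nat _). Qed.
Lemma I_ell x : O x -> I (ell%:R * x).
Proof. by rewrite /I mulrAC divff ?ell_neq0 // mul1r. Qed.
Lemma I_nat n : (ell %| n)%N -> I n%:R.
Proof. by move=> /dvdnP[m ->]; rewrite mulnC natrM; apply: I_ell; exact: O_nat. Qed.
Lemma I_sum (J : Type) (s : seq J) (P : pred J) (F : J -> C) : (forall i, P i -> I (F i)) -> I (\sum_(i <- s | P i) F i).
Proof. by move=> h; apply: big_ind => //; [exact: I0|exact: ID]. Qed.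
Lemma I_cancel n x : ~~ (ell %| n)%N -> I (n%:R * x) -> I x.
Proof.
move=> h k; have n0 : (n%:R : C) != 0 by rewrite pnatr_eq0; apply: contraNneq h => ->.
by rewrite -(mulKf n0 x); apply: IMl k; exact: O_inv.
Qed.
(** If 1/ell were in [O], clearing the powers of [ell] in the monic equation of d/ell would make
    [ell] divide a power of d. *)
Lemma nI1 : ~ I 1.
Proof.
rewrite /I mul1r => /O_iff[d hd [p mp rp]].
have [n sp pn] := monic_top mp.
move: rp; rewrite rootE (@horner_coef_wide _ n.+1); last by rewrite -sp size_poly.
rewrite big_ord_recr /= coef_map /= pn mul1r exprMn exprVn => e.
pose m := \sum_(i < n) p`_i * d%:Z ^+ i * ell%:Z ^+ (n - i.+1).
have : (d%:Z ^+ n + ell%:Z * m) == 0.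
  rewrite -(eqr_int C) intrD intrM rmorphXn -!pmulrn /=.
  rewrite -(inj_eq (@mulIf _ (ell%:R ^- n) _)); last by rewrite invr_eq0 expf_neq0 ?ell_neq0.
  rewrite mul0r mulrDl addrC -[X in _ == X](eqP e); apply/eqP; congr (_ + _).
  rewrite mulrAC mulrC /m raddf_sum /= mulr_suml; apply: eq_bigr => i _.
  have cZ (k : nat) : (k%:Z)%:~R = k%:R :> C by [].
  rewrite coef_map_id0 // !intrM !rmorphXn /= !cZ.
  have -> : ell%:R ^+ n = ell%:R * ell%:R ^+ (n - i.+1) * ell%:R ^+ i :> C.
    by rewrite -exprS -exprD; congr (_ ^+ _); have := ltn_ord i; lia.
  rewrite exprMn exprVn; field.
  by rewrite !expf_neq0 ell_neq0.
rewrite addr_eq0 => /eqP e2; have : (ell%:Z %| d%:Z ^+ n)%Z by rewrite e2 -mulrN dvdz_mulr.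
rewrite dvdzE abszX /= Euclid_dvdX // (negbTE hd) //.
Qed.
Lemma I_intP (m : int) : I m%:~R -> (ell%:Z %| m)%Z.
Proof.
move=> h; apply/negPn/negP => nd; apply: nI1.
have cp : coprime `|m| ell by rewrite coprime_sym prime_coprime //; move: nd; rewrite dvdzE.
have [u v e] : exists2 u, True & exists v : int, u * m + v * ell%:Z = 1.
  have [u [v e]] := Bezoutz m ell%:Z; exists u => //; exists v; rewrite e /gcdz /=.
  by move: cp; rewrite /coprime => /eqP ->.
have [w <-] : exists w : int, (u * m + w * ell%:Z)%:~R = 1 :> C by case: e => w w1; exists w; rewrite w1.
by rewrite intrD !intrM; apply: ID; [apply: IMl h; exact: O_int|rewrite mulrC; apply: I_ell; exact: O_int].
Qed.
End Oell.

(** * Integral matrices acting on the half plane, Delta, and continuity *)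

Record m2 := M2 {ma : int; mb : int; mc : int; md : int}.
Definition m2mul A B := M2 (ma A * ma B + mb A * mc B) (ma A * mb B + mb A * md B)
                           (mc A * ma B + md A * mc B) (mc A * mb B + md A * md B).
Definition m2det A := ma A * md A - mb A * mc A.
Lemma m2detM A B : m2det (m2mul A B) = m2det A * m2det B.
Proof. by rewrite /m2det /m2mul /=; ring. Qed.
(** The integral matrices met below are reduced to upper triangular substitutions, whose effect on
    expansions is explicit. Bezout coefficients of the first column provide the unimodular
    factor. *)
Lemma hermite A : 0 < m2det A -> exists (g : m2) (al de : nat) (be : int),
  [/\ m2det g = 1, (0 < al)%N, (0 < de)%N, m2det A = (al * de)%N%:Z & A = m2mul g (M2 al be 0 de)].
Proof.
case: A => a b c d; rewrite /m2det /= => d0.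
have [u [v e]] := Bezoutz a c; set g := gcdz a c in e.
have g0 : 0 < g.
  have gg : 0 <= g by [].
  rewrite lt_def gg andbT; apply/negP; rewrite gcdz_eq0 => /andP[/eqP ha /eqP hc].
  by move: d0; rewrite ha hc mul0r mulr0 subrr ltxx.
have [a' ea] := dvdzP (dvdz_gcdl a c); have [c' ec] := dvdzP (dvdz_gcdr a c).
rewrite -/g in ea ec; have gn : g != 0 by rewrite gt_eqF.
have e1 : u * a' + v * c' = 1 by apply: (mulIf gn); rewrite mul1r -{2}e ea ec; ring.
have edet : a * d - b * c = g * (a' * d - c' * b) by rewrite {1}ea {1}ec; ring.
have del0 : 0 < a' * d - c' * b by rewrite edet pmulr_rgt0 in d0.
exists (M2 a' (- v) c' u), (absz g), (absz (a' * d - c' * b)%R), (u * b + v * d).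
have x0 : (a' * d - c' * b)%R != 0 by rewrite gt_eqF.
have eg : (absz g)%:Z = g by rewrite gez0_abs // ltW.
have ed : (absz (a' * d - c' * b)%R)%:Z = a' * d - c' * b by rewrite gez0_abs // ltW.
rewrite /m2det /m2mul /= PoszM eg ed; split=> //; rewrite ?absz_gt0 //; first by rewrite -e1; ring.
have e2 x : x = (u * a' + v * c') * x by rewrite e1 mul1r.
congr M2; [by rewrite ea; ring|by rewrite [LHS]e2; ring|by rewrite ec; ring|by rewrite [LHS]e2; ring].
Qed.
Section Modular.
Variable R : realType.
Local Notation C := (R[i]).
Implicit Types (tau z : C) (A B : m2).
Definition mob A tau : C := moebius (ma A) (mb A) (mc A) (md A) tau.
Definition jf A tau : C := (mc A)%:~R * tau + (md A)%:~R.
Lemma intC (n : int) : (n%:~R : C) = (n%:~R : R)%:C. Proof. by rewrite rmorph_int. Qed.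
Lemma upper_neq0 tau : upper tau -> tau != 0. Proof. by case/Im_neg_inv. Qed.
Lemma Im_affR (x y : R) tau : Im (x%:C * tau + y%:C) = x * Im tau.
Proof. by case: tau => p q; simpc. Qed.
Lemma nm_ee_mono (L : nat) z tau : Im z <= Im tau -> nm (ee (tau / L%:R)) <= nm (ee (z / L%:R)).
Proof.
move=> h; rewrite !nm_ee ler_expR lerN2 ler_wpM2l ?mulr_ge0 ?pi_ge0 //.
rewrite -!(rmorph_nat (real_complex R)) -!(fmorphV (real_complex R)).
rewrite ![_ * (real_complex R _)]mulrC -[_ * tau]addr0 -[_ * z]addr0 -(rmorph0 (real_complex R)) !Im_affR.
by rewrite ler_wpM2l ?invr_ge0.
Qed.
Lemma upper_affint (n k : int) tau : upper tau -> 0 < n -> upper (n%:~R * tau + k%:~R).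
Proof. by move=> t0 n0; apply: (upper_aff (intC n) (intC k)) => //; rewrite ltr0z. Qed.
Lemma affint_neq0 (n k : int) tau : upper tau -> (n != 0) || (k != 0) -> n%:~R * tau + k%:~R != 0.
Proof.
move=> t0; have [->|n0 _] /= := eqVneq n 0; first by rewrite mul0r add0r intr_eq0.
apply: contraTneq t0; rewrite intC intC => e; have := Im_affR n%:~R k%:~R tau.
by rewrite e /= => /eqP; rewrite eq_sym mulf_eq0 intr_eq0 (negbTE n0) /= => /eqP; rewrite /upper => ->; rewrite ltxx.
Qed.
Lemma jf_neq0 A tau : m2det A != 0 -> upper tau -> jf A tau != 0.
Proof.
case: A => a b c d; rewrite /m2det /jf /= => d0 t0; apply: affint_neq0 => //.
by apply: contraNT d0; rewrite negb_or !negbK => /andP[/eqP-> /eqP->]; rewrite !mulr0 subrr.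
Qed.
Lemma upper_mob A tau : 0 < m2det A -> upper tau -> upper (mob A tau).
Proof.
wlog: A / 0 <= mc A => [W|c0] d0 t0.
  have [|c0] := lerP 0 (mc A); first by move=> /W; exact.
  have := W (M2 (- ma A) (- mb A) (- mc A) (- md A)); rewrite /m2det /mob /moebius /= !mulrNN oppr_ge0 (ltW c0).
  by rewrite !mulrNz !mulNr -!opprD invrN mulrNN => /(_ isT d0 t0).
have jn := jf_neq0 (lt0r_neq0 d0) t0; case: A c0 d0 jn => a b c d; rewrite /m2det /mob /moebius /jf /= => c0 d0 jn.
move: c0; rewrite le_eqVlt => /orP[/eqP c0|c0].
  rewrite -c0 mul0r add0r mulrDl mulrAC; rewrite -c0 mulr0 subr0 in d0.
  have d1 : d != 0 by apply: contraTneq d0 => ->; rewrite mulr0 ltxx.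
  apply: (upper_aff (ratC R a d) (ratC R b d)) => //; have -> : (a%:~R / d%:~R : R) = (a * d)%:~R / d%:~R ^+ 2.
    by rewrite intrM; field; rewrite intr_eq0.
  by rewrite divr_gt0 ?ltr0z // exprn_even_gt0 //= intr_eq0.
have cC : (c%:~R : C) != 0 by rewrite intr_eq0 gt_eqF.
have -> : (a%:~R * tau + b%:~R) / (c%:~R * tau + d%:~R) =
   (a * d - b * c)%:~R / c%:~R * - (c%:~R * tau + d%:~R)^-1 + a%:~R / c%:~R :> C.
  by rewrite intrD mulrNz !intrM; field; rewrite cC jn.
apply: (upper_aff (ratC R _ c) (ratC R a c)); first by rewrite divr_gt0 // ltr0z.
by have [] := Im_neg_inv (upper_affint d t0 c0).
Qed.
Lemma mobM A B tau : 0 < m2det B -> upper tau -> m2det A != 0 ->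
  mob (m2mul A B) tau = mob A (mob B tau) /\ jf (m2mul A B) tau = jf A (mob B tau) * jf B tau.
Proof.
move=> dB t0 dA; have jB := jf_neq0 (lt0r_neq0 dB) t0; have uB := upper_mob dB t0.
have E : jf (m2mul A B) tau = jf A (mob B tau) * jf B tau.
  move: jB; rewrite /jf /mob /moebius /m2mul /= !intrD !intrM => jB; by field.
have E2 : (ma (m2mul A B))%:~R * tau + (mb (m2mul A B))%:~R = ((ma A)%:~R * mob B tau + (mb A)%:~R) * jf B tau.
  move: jB; rewrite /jf /mob /moebius /m2mul /= !intrD !intrM => jB; by field.
split=> //; rewrite {1}/mob {1}/moebius -/(jf _ _) E E2 -mulf_div divff // mulr1.
by [].
Qed.
Definition Delta tau : C := eta tau ^+ 24.
Lemma eta_T tau : upper tau -> eta (tau + 1) = ee (1 / 24) * eta tau.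
Proof.
move=> t0; have t1 : upper (tau + 1) by have := upper_addR 1 t0; rewrite rmorph1.
rewrite (eta_chi t1) (eta_chi t0) -tsumZ; last by apply: asum_chi; [exact: nm_ee_lt1|exact: chi12_le1].
apply: tsum_eq => n; rewrite mulrCA; have [->|h] := eqVneq (chi12 n) 0; first by rewrite !mul0r.
congr (_ * _); rewrite mulrDl eeD exprMn mulrC; congr (_ * _).
have m24 : (n ^ 2 = 1 %[mod 24])%N.
  have m12 : (n %% 12 \in [:: 1; 5; 7; 11])%N.
    by move: h; rewrite /chi12 !inE; case: ifP => [/orP[->|->]|_]; rewrite ?orbT //; case: ifP => [/orP[->|->]|_]; rewrite ?orbT.
  rewrite (divn_eq n 12); move: (n %/ 12)%N (n %% 12)%N m12 => k x xm.
  have -> : ((k * 12 + x) ^ 2 = (6 * k ^ 2 + k * x) * 24 + x ^ 2)%N by rewrite !expnS !expn0; lia.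
  by rewrite modnMDl; move: xm; rewrite !inE => /or4P[] /eqP ->.
have w24 : ee (1 / 24 : C) ^+ 24 = 1 by rewrite -eeMn mulrC divfK ?pnatr_eq0 // ee1.
move: (ee (1 / 24 : C)) w24 => w w24.
by rewrite (divn_eq (n ^ 2) 24) m24 exprD mulnC exprM w24 expr1n mul1r.
Qed.
Lemma eta_Tn tau (n : int) : upper tau -> eta (tau + n%:~R) = ee (n%:~R / 24) * eta tau.
Proof.
suff H (m : nat) (t : C) : upper t -> eta (t + m%:R) = ee (m%:R / 24) * eta t.
  case: n => n t0; first exact: H.
  have u0 : upper (tau - n.+1%:R) by have := upper_addR (- n.+1%:R) t0; rewrite rmorphN rmorph_nat.
  have := H n.+1 _ u0; rewrite subrK NegzE mulrNz -pmulrn => ->.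
  by rewrite mulrA -eeD mulNr addNr ee0 mul1r.
move=> t0; elim: m => [|m IH]; first by rewrite addr0 mul0r ee0 mul1r.
have u0 : upper (t + m%:R) by have := upper_addR m%:R t0; rewrite rmorph_nat.
by rewrite -natr1 addrA eta_T // IH mulrA -eeD; congr (ee _ * _); rewrite mulrDl addrC.
Qed.
Lemma Delta_T tau (n : int) : upper tau -> Delta (tau + n%:~R) = Delta tau.
Proof.
move=> t0; rewrite /Delta eta_Tn // exprMn -eeMn mulrC [24%:R * _]mulrC divfK ?pnatr_eq0 //.
by rewrite ee_int mulr1.
Qed.
Lemma Delta_S tau : upper tau -> Delta (- tau^-1) = tau ^+ 12 * Delta tau.
Proof.
move=> t0; rewrite /Delta -[24%N]/(2 * 12)%N !exprM eta_S2 // 2!exprMn (_ : (- 'i%C) ^+ 12 = 1) ?mul1r //.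
by rewrite -[12%N]/(2 * 6)%N exprM sqrrN sqr_i -signr_odd.
Qed.
(** Euclid's algorithm on the first column: A = T^q S A', where the lower left entry of A' is
    smaller in absolute value. *)
Lemma Delta_mod A tau : m2det A = 1 -> upper tau -> Delta (mob A tau) = jf A tau ^+ 12 * Delta tau.
Proof.
elim: {A}_.+1 {-2}A (ltnSn `|mc A|) => // N IH [a b c d] /=; rewrite ltnS => cN dA t0.
have [c0|c0] := eqVneq c 0.
  move: dA; rewrite /m2det /mob /jf /moebius /= c0 mulr0 subr0 mul0r add0r => ad.
  have [[-> ->]|[-> ->]] : (a = 1 /\ d = 1) \/ (a = -1 /\ d = -1).
    have : `|a|%N = 1%N by apply/eqP; have := congr1 absz ad; rewrite abszM => /eqP; rewrite muln_eq1 => /andP[].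
    by move: ad; clear; lia.
    by rewrite mul1r divr1 expr1n mul1r Delta_T.
  have -> : ((-1)%:~R * tau + b%:~R) / (-1)%:~R = tau + (- b)%:~R by rewrite !mulrNz; field.
  by rewrite Delta_T // (_ : (-1)%:~R ^+ 12 = 1 :> C) ?mul1r // mulrNz -signr_odd.
pose q := (a %/ c)%Z; pose r := (a %% c)%Z; have eqa : a = q * c + r := divz_eq a c.
pose A' := M2 c d (- r) (- (b - q * d)).
have d' : m2det A' = 1 by rewrite -dA /m2det /= eqa; ring.
have lt : (`|mc A'| < N)%N.
  apply: leq_trans cN; have := modz_ge0 a c0; have := ltz_mod a c0; rewrite /= -/r; lia.
have u' : upper (mob A' tau) by apply: upper_mob; rewrite ?d'.
have j' : jf A' tau != 0 by apply: jf_neq0; rewrite ?d'.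
have j0 : jf (M2 a b c d) tau != 0 by apply: jf_neq0; rewrite ?dA.
have E1 : jf (M2 a b c d) tau = mob A' tau * jf A' tau by rewrite /mob /moebius -/(jf A' tau) divfK.
have -> : mob (M2 a b c d) tau = - (mob A' tau)^-1 + q%:~R.
  move: j' j0; rewrite /mob /moebius /jf /= eqa !(intrD, intrM, mulrNz) => j' j0; field.
  by rewrite j0 j'.
by rewrite Delta_T ?Delta_S ?IH // ?E1 ?exprMn ?mulrA //; case: (Im_neg_inv u').
Qed.
Lemma Delta_neq0 tau : upper tau -> Delta tau != 0.
Proof. by move=> /eta_neq0 h; rewrite expf_neq0. Qed.
(** Sequential continuity on the upper half plane, the regularity that [root_const] asks for. *)
Definition contH (h : C -> C) := forall (u : nat -> C) tau, upper tau -> (forall n, upper (u n)) ->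
  cv u tau -> cv (fun n => h (u n)) (h tau).
Lemma cvV (u : nat -> C) (l : C) : l != 0 -> cv u l -> cv (fun n => (u n)^-1) l^-1.
Proof.
move=> l0 h; have n0 : 0 < nm l by rewrite nm_gt0.
have h1 : 0 < nm l / 2 by rewrite divr_gt0.
have [N0 HN0] := h _ h1 => e e0; have h2 : 0 < e * (nm l ^+ 2 / 2) by rewrite mulr_gt0 // divr_gt0 // exprn_gt0.
have [N1 HN1] := h _ h2; exists (maxn N0 N1) => n; rewrite geq_max => /andP[/HN0 k0 /HN1 k1].
have b : nm l / 2 < nm (u n).
  have := nmBD (u n) l 0; rewrite !subr0 nmBC; move: k0; rewrite ltr_pdivlMr // ltr_pdivrMr //; lra.
have un : u n != 0 by rewrite -nm_gt0; lra.
have -> : (u n)^-1 - l^-1 = - ((u n - l) / (u n * l)) by field; rewrite ?un ?l0.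
rewrite nmN nmM nmV nmM ltr_pdivrMr; last by rewrite mulr_gt0 // nm_gt0.
apply: (lt_le_trans k1); rewrite ler_pM2l // expr2 mulrAC ler_pM2r //; exact: ltW.
Qed.
Lemma cvX (u : nat -> C) l k : cv u l -> cv (fun n => u n ^+ k) (l ^+ k).
Proof.
move=> h; elim: k => [|k IH]; first exact: cv_cst.
by rewrite exprS; apply: (cv_eq _ (cvM h IH)) => n; rewrite exprS.
Qed.
Lemma cv_ee (u : nat -> C) l : cv u l -> cv (fun n => ee (u n)) (ee l).
Proof.
move=> h; pose K := nm (ee l) * (7 * nm (Complex 0 (2 * pi) : C) * expR (2 * nm (Complex 0 (2 * pi) : C))).
have K0 : 0 <= K by rewrite /K; nn.
move=> e e0; have h1 : 0 < Num.min 1 (e / (K + 1)) by rewrite lt_min ltr01 divr_gt0 // ltr_wpDl.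
have [N HN] := h _ h1; exists N => n /HN; rewrite lt_min => /andP[k1 k2].
have -> : ee (u n) - ee l = ee l * (ee (u n - l) - 1) by rewrite eeB; field; rewrite ee_neq0.
rewrite nmM; apply: (@le_lt_trans _ _ (K * nm (u n - l))); last first.
  move: k2; rewrite ltr_pdivlMr ?ltr_wpDl // => k2; apply: le_lt_trans k2.
  by rewrite mulrC ler_wpM2l ?nm_ge0 // lerDl.
rewrite /K -!mulrA ler_wpM2l ?nm_ge0 //; apply: (le_trans (cexp_lip _)); rewrite nmM -!mulrA ler_wpM2l //.
rewrite ler_wpM2l ?nm_ge0 // mulrC ler_wpM2r ?nm_ge0 // ler_expR ler_wpM2l //.
by rewrite -{2}[nm (Complex _ _)]mulr1 ler_wpM2l ?nm_ge0 // ltW.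
Qed.
Lemma contH_eta : contH (@eta R).
Proof.
move=> u tau t0 u0 h; have y0 : 0 < Im tau / 2 by rewrite divr_gt0.
have [N HN] := h _ y0.
pose y := Im tau / 2.
have hy n : y <= Im (u (n + N)%N).
  have := HN _ (leq_addl n N) => /ltW k; have := le_trans (Im_nm _) k; rewrite ler_norml => /andP[k1 _].
  have e : Im (u (n + N)%N - tau) = Im (u (n + N)%N) - Im tau by case: (u _) => ? ?; case: (tau).
  by rewrite e in k1; rewrite /y; lra.
pose z : C := Complex 0 y.
pose r := nm (ee (z / 24%:R)); have r1 : r < 1 by exact: nm_ee_lt1.
have le_r n : nm (ee (u (n + N)%N / 24%:R)) <= r.
  by rewrite nm_ee_mono // hy.
suff H : cv (fun n => eta (u (n + N)%N)) (eta tau).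
  move=> e e0; have [K HK] := H e e0; exists (K + N)%N => n le.
  by have := HK (n - N)%N; rewrite subnK; [apply; lia|lia].
rewrite (eta_chi t0).
apply: (@cv_eq _ (fun n => tsum (fun m => (chi12 m)%:~R * ee (u (n + N)%N / 24%:R) ^+ (m ^ 2)))).
  by move=> n; rewrite eta_chi.
apply: (@tannery _ _ _ (fun m => r ^+ m)); first by move=> n; rewrite exprn_ge0 ?nm_ge0.
- by apply: bsum_geo; rewrite nm_ge0.
- move=> n m; rewrite nmM nmX; apply: (@le_trans _ _ (1 * r ^+ (m ^ 2))).
    apply: ler_pM; rewrite ?nm_ge0 ?exprn_ge0 ?nm_ge0 //; last by rewrite lerXn2r ?nnegrE ?nm_ge0.
    by rewrite intC nm_real -intr_norm (ler_int R _ 1) chi12_le1.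
  rewrite mul1r ler_wiXn2l ?nm_ge0 ?ltW // expnS expn1; case: m => // m; exact: leq_pmulr.
- move=> m; apply: cvZ; apply: cvX; apply: cv_ee.
  by apply: cvM; [exact: cv_shift|exact: cv_cst].
Qed.
(** If the quotient w were not 1, its powers would sum to 0; but they stay so close to 1 that a sum
    of n of them cannot vanish. *)
Lemma unity_gap n (x y : C) : (0 < n)%N -> x ^+ n = 1 -> y ^+ n = 1 -> nm (x - y) < n%:R^-1 -> x = y.
Proof.
move=> n0 hx hy hd; have n1 : (n%:R : R) != 0 by rewrite pnatr_eq0 -lt0n.
have un (z : C) : z ^+ n = 1 -> nm z = 1.
  move=> e; have := congr1 (@nm R) e; rewrite nmX nm1 => /eqP; by rewrite pexpr_eq1 ?nm_ge0 // => /eqP.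
have y0 : y != 0 by rewrite -nm_gt0 un.
pose w := x / y; have hw : w ^+ n = 1 by rewrite exprMn exprVn hx hy divr1.
suff w1 : w = 1 by rewrite -(divfK y0 x) -/w w1 mul1r.
apply/eqP/negPn/negP => wn1.
have hd' : nm (w - 1) < n%:R^-1 by rewrite (_ : w - 1 = (x - y) / y) ?nmM ?nmV ?(un _ hy) ?invr1 ?mulr1 // mulrBl divff.
have wi i : nm (w ^+ i - 1) <= i%:R * nm (w - 1).
  elim: i => [|i IH]; first by rewrite subrr nm0 mul0r.
  have -> : w ^+ i.+1 - 1 = w * (w ^+ i - 1) + (w - 1) by rewrite exprS; ring.
  apply: (le_trans (nmD _ _)); rewrite nmM (un _ hw) mul1r -natr1 mulrDl mul1r; lra.
have s0 : \sum_(i < n) w ^+ i = 0.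
  have := subrX1 w n; rewrite hw subrr => /esym/eqP; rewrite mulf_eq0 subr_eq0 (negbTE wn1) => /eqP//.
have : nm (\sum_(i < n) (w ^+ i - 1)) < n%:R.
  apply: (le_lt_trans (nm_sum _ _ _)); case: n n0 n1 hd' {hx hy hd un hw s0} => // n _ n1 hd'.
  rewrite big_ord_recl expr0 subrr nm0 add0r -[X in _ < X]mulr1 mulr_natl; case: n n1 hd' => [|n] n1 hd'.
    by rewrite big_ord0 mulr1n.
  apply: (@le_lt_trans _ _ (\sum_(i < n.+1) 1)); last by rewrite sumr_const card_ord ltr_pMn2l.
  apply: ler_sum => i _; apply: (le_trans (wi _)).
  apply: (@le_trans _ _ (n.+2%:R * nm (w - 1))); first by rewrite ler_wpM2r ?nm_ge0 // ler_nat /= /bump leq0n add1n; have := ltn_ord i; lia.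
  by move: hd'; rewrite -(ltr_pM2l (ltr0Sn R n.+1)) mulfV // => /ltW.
by rewrite sumrB s0 sumr_const card_ord sub0r nmN nm_nat ltxx.
Qed.
(** On a segment, take the supremum of the parameters where h keeps its initial value; [unity_gap]
    and continuity carry the value past it. This is how multipliers of eta are shown to be
    constants: their 24th powers are known from Delta. *)
Lemma root_const n (h : C -> C) : (0 < n)%N -> contH h -> (forall tau, upper tau -> h tau ^+ n = 1) ->
  forall t0 t1, upper t0 -> upper t1 -> h t0 = h t1.
Proof.
move=> n0 hc h1 t0 t1 u0 u1; apply/eqP/negPn/negP => ne.
pose p (s : R) : C := t0 + s%:C * (t1 - t0).
have up (s : R) : 0 <= s <= 1 -> upper (p s).
  move=> /andP[s0 s1]; rewrite /upper /p; case: t0 t1 u0 u1 {ne p} => a b [c d]; rewrite /upper /=; simpc => /= b0 d0.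
  have -> : b + s * (d - b) = (1 - s) * b + s * d by ring.
  have [->|sn] := eqVneq s 1; first by rewrite subrr mul0r add0r mul1r.
  by apply: ltr_pwDl; [apply: mulr_gt0 => //; rewrite subr_gt0 lt_neqAle sn|rewrite mulr_ge0 // ltW].
pose E : set R := [set s : R | 0 <= s <= 1 /\ h (p s) = h t0]%classic.
have E0 : E 0 by split; rewrite ?lexx ?ler01 // /p rmorph0 mul0r addr0.
have ubE : has_sup E by split; [exists 0|exists 1 => s [/andP[]]].
pose m := sup E; have m0 : 0 <= m by apply: (ub_le_sup ubE.2 E0).
have m1 : m <= 1 by apply: (ge_sup ubE.1) => s [/andP[]].
have um s : E s -> s <= m by move=> Es; exact: (ub_le_sup ubE.2 Es).
have am e : 0 < e -> exists2 s, E s & m - e < s by move=> e0; exact: (sup_adherent e0 ubE).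
clearbody m.
have cp (s : nat -> R) : (forall k, 0 <= s k <= 1) -> (forall k, `|s k - m| <= k.+1%:R^-1) -> cv (fun k => h (p (s k))) (h (p m)).
  move=> h01 hs; apply: hc => [|k|]; [by apply: up; rewrite m0|exact: up|].
  move=> e e0; pose K := nm (t1 - t0) + 1; have K0 : 0 < K by rewrite ltr_wpDl ?nm_ge0.
  have [N _ HN] : exists2 N : nat, True & K / e < N%:R by exists (Num.bound (K / e)) => //; apply: archi_boundP; rewrite divr_ge0 // ltW.
  exists N => k le; rewrite /p opprD addrACA subrr add0r -mulrBl -rmorphB nmM nm_real.
  apply: (@le_lt_trans _ _ (k.+1%:R^-1 * nm (t1 - t0))); first by rewrite ler_wpM2r ?nm_ge0.
  rewrite mulrC ltr_pdivrMr ?ltr0Sn //; move: HN; rewrite ltr_pdivrMr // => HN.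
  have : (N%:R : R) <= k.+1%:R by rewrite ler_nat; lia.
  rewrite -(ler_pM2r e0); move: HN (nm_ge0 (t1 - t0)); rewrite /K; lra.
have Em : h (p m) = h t0.
  have ex k : exists s, E s /\ `|s - m| <= k.+1%:R^-1.
    have i0 : 0 < (k.+1%:R^-1 : R) by rewrite invr_gt0 ltr0Sn.
    have [s Es ls] := am _ i0; exists s; split=> //; have lsm := um _ Es.
    by rewrite ler0_norm ?subr_le0 // opprB lerBlDl -lerBlDr ltW.
  have [s hs] := choice ex; apply: cv_uniq (cp s (fun k => (hs k).1.1) (fun k => (hs k).2)) _.
  by apply: (cv_eq _ (cv_cst (h t0))) => k; case: (hs k) => -[].
have mlt : m < 1.
  rewrite lt_neqAle m1 andbT; apply: contraNneq ne => m1'; move: Em; rewrite m1' /p rmorph1 mul1r addrC subrK => ->.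
  by [].
have c2 := cp (fun k => m + (1 - m) * k.+1%:R^-1).
have k1 k : 0 < (k.+1%:R^-1 : R) <= 1 by rewrite invr_gt0 ltr0Sn /= invf_le1 ?ltr0Sn // ler1n.
have [] := c2 _ _ n%:R^-1.
- move=> k; have := k1 k; move: (k.+1%:R^-1 : R) => x /andP[a b]; apply/andP; split; nra.
- move=> k; have := k1 k; move: (k.+1%:R^-1 : R) => x /andP[a b]; rewrite addrAC subrr add0r ger0_norm; nra.
- by rewrite invr_gt0 ltr0n.
move=> N HN; move: (HN N (leqnn N)) (k1 N); move: (N.+1%:R^-1 : R) => x hN /andP[a b]; set s := m + _ in hN.
have s01 : 0 <= s <= 1 by apply/andP; split; rewrite /s; nra.
have e : h (p s) = h (p m) by apply: (unity_gap n0) => //; apply: h1; apply: up => //; rewrite m0.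
have := um s (conj s01 (etrans e Em)); rewrite /s; nra.
Qed.
Lemma contHM h k : contH h -> contH k -> contH (fun z => h z * k z).
Proof. by move=> a b u t t0 u0 c; apply: cvM; [exact: a|exact: b]. Qed.
Lemma contHX h n : contH h -> contH (fun z => h z ^+ n).
Proof. by move=> a u t t0 u0 c; apply: cvX; exact: a. Qed.
Lemma contHV h : contH h -> (forall z, upper z -> h z != 0) -> contH (fun z => (h z)^-1).
Proof. by move=> a n u t t0 u0 c; apply: cvV; [exact: n|exact: a]. Qed.
Lemma contH_cst (c : C) : contH (fun=> c). Proof. by move=> *; exact: cv_cst. Qed.
Lemma contH_id : contH id. Proof. by []. Qed.
Lemma contHD h k : contH h -> contH k -> contH (fun z => h z + k z).
Proof. by move=> a b u t t0 u0 c; apply: cvD; [exact: a|exact: b]. Qed.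
Lemma contH_comp h k : contH h -> contH k -> (forall z, upper z -> upper (k z)) -> contH (fun z => h (k z)).
Proof. by move=> a b n u t t0 u0 c; apply: a; [exact: n|move=> i; exact: n|exact: b]. Qed.
Lemma contH_mob A : 0 < m2det A -> contH (mob A).
Proof.
move=> d0; apply: contHM; first by apply: contHD; [apply: contHM; [exact: contH_cst|exact: contH_id]|exact: contH_cst].
apply: contHV => [|z z0]; first by apply: contHD; [apply: contHM; [exact: contH_cst|exact: contH_id]|exact: contH_cst].
exact: (jf_neq0 (lt0r_neq0 d0) z0).
Qed.
End Modular.

(* Expansions in fractional powers of q *)
Opaque ee tsum cexp eta.
Section QExp.
Variable R : realType.
Local Notation C := (R[i]).
Implicit Types (tau z : C) (c d : nat -> C) (h : C -> C) (L : nat) (m : int).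
(** Collects the terms u i under the exponent phi i, for theta series (phi i = i^2) and rescalings.
    The inequality i <= phi i makes the inner sums finite. *)
Definition spread (phi : nat -> nat) (u : nat -> C) n : C := \sum_(i < n.+1 | phi i == n) u i.
Lemma spread_psum phi u N : (forall i, (i <= phi i)%N) ->
  \sum_(n < N) spread phi u n = \sum_(i < N | (phi i < N)%N) u i.
Proof.
move=> hp; transitivity (\sum_(n < N) \sum_(i < N | phi i == n) u i).
  apply: eq_bigr => n _; rewrite /spread (big_ord_widen_cond N (fun i => phi i == n) u) //; apply: eq_bigl => i.
  by apply/andb_idr => /eqP <-; rewrite ltnS.
rewrite (exchange_big_dep (fun i : 'I_N => (phi i < N)%N)) /=; last by move=> n i _ /eqP ->.
apply: eq_bigr => i hi; by rewrite (big_pred1 (Ordinal hi)).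
Qed.
Lemma asum_spread phi u : (forall i, (i <= phi i)%N) -> asum u -> asum (spread phi u).
Proof.
move=> hp [B HB]; exists B => N; apply: le_trans (HB N).
apply: (@le_trans _ _ (\sum_(n < N) \sum_(i < N | phi i == n) nm (u i))).
  apply: ler_sum => n _; rewrite /spread (big_ord_widen_cond N (fun i => phi i == n) u) //.
  apply: (le_trans (nm_sum _ _ _)); rewrite le_eqVlt; apply/orP; left; apply/eqP; apply: eq_bigl => i.
  by apply/andb_idr => /eqP <-; rewrite ltnS.
rewrite (exchange_big_dep predT) //=; apply: ler_sum => i _.
have [lt|le] := ltnP (phi i) N; last by rewrite big1 ?nm_ge0 // => n /eqP e; move: (ltn_ord n); rewrite -e ltnNge le.
by rewrite (big_pred1 (Ordinal lt)) // => n; rewrite -val_eqE /= eq_sym.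
Qed.
Lemma tsum_spread phi u : (forall i, (i <= phi i)%N) -> asum u -> tsum (spread phi u) = tsum u.
Proof.
move=> hp hu; apply: tsum_uniq; first exact: asum_spread.
pose U N n := if (n < N)%N && (phi n < N)%N then u n else 0.
apply: (@cv_eq _ (fun N => tsum (U N))) => [N|].
  rewrite spread_psum // (tsum_fin (N := N)) => [|n]; last by rewrite /U ltnNge => ->.
  by rewrite [RHS]big_mkcond; apply: eq_bigr => i _; rewrite /U ltn_ord.
apply: (@tannery _ _ _ (fun n => nm (u n))) => //; first by move=> n; exact: nm_ge0.
  by move=> N n; rewrite /U; case: ifP => // _; rewrite nm0 nm_ge0.
move=> n e e0; exists (phi n).+1 => N le; rewrite /U.
by rewrite le (leq_trans _ le) ?subrr ?nm0 // ltnS.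
Qed.
(** An expansion in q^(1/L) starting at exponent m/L. Negative m is allowed, which covers 1/eta and
    poles at cusps; absolute convergence makes products Cauchy products. *)
Definition ql L m c h := forall tau, upper tau ->
  asum (fun n => c n * ee (tau / L%:R) ^+ n) /\
  h tau = ee (m%:~R * (tau / L%:R)) * tsum (fun n => c n * ee (tau / L%:R) ^+ n).
Lemma ql_eq L m c c' h h' : (forall n, c n = c' n) -> (forall tau, upper tau -> h tau = h' tau) ->
  ql L m c h -> ql L m c' h'.
Proof.
move=> ec eh H tau t0; have [a e] := H _ t0; split.
  by apply: asum_eq a => n; rewrite ec.
by rewrite -eh // e; congr (_ * _); apply: tsum_eq => n; rewrite ec.
Qed.
Lemma qlD L m c c' h h' : ql L m c h -> ql L m c' h' -> ql L m (fun n => c n + c' n) (fun t => h t + h' t).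
Proof.
move=> H H' tau t0; have [a e] := H _ t0; have [a' e'] := H' _ t0; split.
  by apply: asum_eq (asumD a a') => n; rewrite mulrDl.
by rewrite e e' -mulrDr -tsumD //; congr (_ * _); apply: tsum_eq => n; rewrite mulrDl.
Qed.
Lemma qlZ L m c h (x : C) : ql L m c h -> ql L m (fun n => x * c n) (fun t => x * h t).
Proof.
move=> H tau t0; have [a e] := H _ t0; split.
  by apply: asum_eq (asumZ x a) => n; rewrite mulrA.
by rewrite e mulrCA -(tsumZ x) //; congr (_ * _); apply: tsum_eq => n; rewrite mulrA.
Qed.
Lemma ql0 L m : ql L m (fun=> 0) (fun=> 0).
Proof.
move=> tau t0; have H : asum (fun=> 0 : C) by apply: (asum_fin (N := 0%N)).
by split; [apply: asum_eq H => n; rewrite mul0r|rewrite (tsum_eq (v := fun=> 0)) ?tsum0 ?mulr0 // => n; rewrite mul0r].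
Qed.
Lemma ql_sum L m (J : Type) (s : seq J) (c : J -> nat -> C) (h : J -> C -> C) :
  (forall j, ql L m (c j) (h j)) -> ql L m (fun n => \sum_(j <- s) c j n) (fun t => \sum_(j <- s) h j t).
Proof.
move=> H; elim: s => [|j s IH].
  by apply: (ql_eq _ _ (ql0 L m)) => [n|t _]; rewrite big_nil.
by apply: (ql_eq _ _ (qlD (H j) IH)) => [n|t _]; rewrite big_cons.
Qed.
Lemma qlM L m m' c c' h h' : ql L m c h -> ql L m' c' h' -> ql L (m + m') (conv c c') (fun t => h t * h' t).
Proof.
move=> H H' tau t0; have [a e] := H _ t0; have [a' e'] := H' _ t0.
have E n : conv (fun n => c n * ee (tau / L%:R) ^+ n) (fun n => c' n * ee (tau / L%:R) ^+ n) n = conv c c' n * ee (tau / L%:R) ^+ n.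
  rewrite /conv mulr_suml; apply: eq_bigr => i _; rewrite mulrACA -exprD subnKC //; by rewrite -ltnS.
split; first by apply: asum_eq E _; exact: asum_conv.
by rewrite e e' intrD mulrDl eeD mulrACA -tsum_conv // (tsum_eq E).
Qed.
Definition monc (k n : nat) : C := (n == k)%:R.
Lemma ql_mon L m (k : nat) : ql L m (monc k) (fun tau => ee ((m + k%:Z)%:~R * (tau / L%:R))).
Proof.
move=> tau t0; have Z n : (k.+1 <= n)%N -> monc k n * ee (tau / L%:R) ^+ n = 0.
  by move=> h; rewrite /monc gtn_eqF // mul0r.
split; first exact: asum_fin Z.
rewrite (tsum_fin Z) (bigD1 ord_max) //= big1 => [|i ne].
  by rewrite addr0 /monc eqxx mul1r intrD mulrDl eeD -eeMn.
by rewrite /monc (_ : (i == k :> nat) = false) ?mul0r //; apply: contraNF ne => /eqP e; apply/eqP/val_inj.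
Qed.
Lemma conv_mon c k n : conv c (monc k) n = if (k <= n)%N then c (n - k)%N else 0.
Proof.
rewrite /conv; case: ifP => [le|/negbT]; last first.
  rewrite -ltnNge => lt; rewrite big1 // => i _; rewrite /monc (_ : (_ == _) = false) ?mulr0 //.
  by apply/negbTE; rewrite neq_ltn; apply/orP; left; apply: leq_ltn_trans lt; rewrite leq_subr.
have lt : (n - k < n.+1)%N by rewrite ltnS leq_subr.
rewrite (bigD1 (Ordinal lt)) //= big1 => [|i ne]; first by rewrite addr0 /monc subKn // eqxx mulr1.
rewrite /monc (_ : (_ == _) = false) ?mulr0 //; apply: contraNF ne => /eqP e.
by apply/eqP/val_inj => /=; rewrite -e subKn // -ltnS.
Qed.
Lemma ql_shift L m (k : nat) c h : ql L (m + k%:Z) c h -> ql L m (fun n => if (k <= n)%N then c (n - k)%N else 0) h.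
Proof.
move=> H; have := qlM H (ql_mon L (- k%:Z) k); rewrite addrK; apply: ql_eq => [n|t t0]; first exact: conv_mon.
by rewrite addNr mul0r ee0 mulr1.
Qed.
Lemma ql_unshift L m (k : nat) c h : (forall n, (n < k)%N -> c n = 0) -> ql L m c h ->
  ql L (m + k%:Z) (fun n => c (n + k)%N) h.
Proof.
move=> z H tau t0; have [a e] := H _ t0.
have a1 := asum_shift k a; have nz := ee_neq0 (tau / L%:R).
have a2 : asum (fun n => c (n + k)%N * ee (tau / L%:R) ^+ n).
  apply: asum_eq (asumZ (ee (tau / L%:R) ^- k) a1) => n.
  by rewrite mulrCA; congr (_ * _); rewrite exprD mulrC mulfK ?expf_neq0.
split=> //; rewrite e (tsum_split k a) big1 ?add0r => [|i _]; last by rewrite z ?mul0r.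
have -> : tsum (fun n => c (n + k)%N * ee (tau / L%:R) ^+ (n + k)) = ee (tau / L%:R) ^+ k * tsum (fun n => c (n + k)%N * ee (tau / L%:R) ^+ n).
  by rewrite -tsumZ //; apply: tsum_eq => n; rewrite exprD; ring.
by rewrite mulrA -eeMn -eeD; congr (ee _ * _); rewrite intrD mulrDl.
Qed.
Lemma ee_scale (al de L : nat) (be : int) tau : (0 < de)%N -> (0 < L)%N ->
  ee ((al%:R * tau + be%:~R) / de%:R / L%:R) = ee (tau / (L * de)%N%:R) ^+ al * ee (be%:~R / (L * de)%N%:R).
Proof.
move=> d0 L0; rewrite -eeMn -eeD; congr ee; rewrite natrM; field.
by rewrite !pnatr_eq0 -!lt0n d0.
Qed.
(** Coefficients after tau becomes (al tau + be)/de: indices are stretched by [al] and twisted by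
    roots of unity. *)
Definition trc L (al de : nat) (be : int) c n : C :=
  spread (muln al) (fun i => c i * ee (be%:~R / (L * de)%N%:R) ^+ i) n.
Lemma upper_tri (al de : nat) (be : int) tau : (0 < al)%N -> (0 < de)%N -> upper tau ->
  upper ((al%:R * tau + be%:~R) / de%:R).
Proof.
move=> a0 d0 t0; have -> : (al%:R * tau + be%:~R) / de%:R = al%:~R / de%:~R * tau + be%:~R / de%:~R :> C.
  by rewrite -!pmulrn; field; rewrite pnatr_eq0 -lt0n.
by apply: (upper_aff (ratC R al de) (ratC R be de)) => //; rewrite divr_gt0 // ltr0z.
Qed.
Lemma ql_tri L m c h (al de : nat) (be : int) : (0 < L)%N -> (0 < al)%N -> (0 < de)%N -> ql L m c h ->
  ql (L * de) (al%:Z * m) (fun n => ee (m%:~R * (be%:~R / (L * de)%N%:R)) * trc L al de be c n)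
     (fun tau => h ((al%:R * tau + be%:~R) / de%:R)).
Proof.
move=> L0 a0 d0 H tau t0; have [a e] := H _ (upper_tri be a0 d0 t0).
pose X := ee (tau / (L * de)%N%:R); pose z := ee (be%:~R / (L * de)%N%:R : C).
have E i : c i * ee ((al%:R * tau + be%:~R) / de%:R / L%:R) ^+ i = c i * z ^+ i * X ^+ (al * i).
  by rewrite ee_scale // -/X -/z exprMn exprM mulrA mulrAC.
have a' : asum (fun i => c i * z ^+ i * X ^+ (al * i)) := asum_eq E a.
have hp i : (i <= al * i)%N by rewrite leq_pmull.
have E2 n : spread (muln al) (fun i => c i * z ^+ i * X ^+ (al * i)) n = trc L al de be c n * X ^+ n.
  by rewrite /trc /spread mulr_suml; apply: eq_bigr => i /eqP ->.
have a2 : asum (fun n => trc L al de be c n * X ^+ n) := asum_eq E2 (asum_spread hp a').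
split; first by apply: asum_eq (asumZ (ee (m%:~R * (be%:~R / (L * de)%N%:R))) a2) => n; rewrite mulrA.
have E3 : tsum (fun n => ee (m%:~R * (be%:~R / (L * de)%N%:R)) * trc L al de be c n * X ^+ n) =
    ee (m%:~R * (be%:~R / (L * de)%N%:R)) * tsum (fun n => trc L al de be c n * X ^+ n).
  by rewrite -(tsumZ _ a2); apply: tsum_eq => n; rewrite -mulrA.
rewrite e (tsum_eq E) -(tsum_spread hp a') (tsum_eq E2) E3 mulrA -eeD; congr (ee _ * _); rewrite intrM natrM -pmulrn; field.
by rewrite !pnatr_eq0 -!lt0n d0.
Qed.
Lemma trc_lead L (al de : nat) (be : int) c : (0 < al)%N -> trc L al de be c 0 = c 0%N.
Proof. by move=> a0; rewrite /trc /spread big_mkcond big_ord1 /= muln0 eqxx expr0 mulr1. Qed.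
Lemma trcE L (al de : nat) (be : int) c n : (0 < al)%N ->
  trc L al de be c n = if (al %| n)%N then c (n %/ al)%N * ee (be%:~R / (L * de)%N%:R) ^+ (n %/ al) else 0.
Proof.
move=> a0; rewrite /trc /spread; case: ifP => [d|nd].
  have lt : (n %/ al < n.+1)%N by rewrite ltnS leq_div.
  rewrite (big_pred1 (Ordinal lt)) //= => i /=; rewrite -val_eqE /=.
  apply/eqP/eqP => [e|->]; last by rewrite mulnC divnK.
  by have := congr1 (divn^~ al) e; rewrite /= mulKn.
by rewrite big1 // => i /eqP e; have := dvdn_mulr i (dvdnn al); rewrite e nd.
Qed.
(* Averaging over translates isolates the n-th coefficient. *)
Lemma coef_bound L m c h tau B : (0 < L)%N -> ql L m c h -> upper tau -> (forall x : R, nm (h (tau + x%:C)) <= B) ->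
  forall n, nm (ee (m%:~R * (tau / L%:R)) * (c n * ee (tau / L%:R) ^+ n)) <= B.
Proof.
move=> L0 H t0 hB n; pose u p := c p * ee (tau / L%:R) ^+ p; have [a _] := H _ t0; rewrite -/(u n).
pose U K p := if (K.+1%:Z %| p%:Z - n%:Z)%Z then u p else 0.
have cU : cv (fun K => tsum (U K)) (u n).
  have -> : u n = tsum (fun p => if p == n then u p else 0).
    rewrite (tsum_fin (N := n.+1)) => [|p lt]; last by rewrite gtn_eqF.
    rewrite (bigD1 ord_max) //= eqxx big1 ?addr0 // => i ne; rewrite (_ : (_ == _) = false) //.
    by apply: contraNF ne => /eqP e; apply/eqP/val_inj.
  apply: (@tannery _ _ _ (fun p => nm (u p))) => //; first by move=> p; exact: nm_ge0.
    by move=> K p; rewrite /U; case: ifP => // _; rewrite nm0 nm_ge0.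
  move=> p; have [->|ne] := eqVneq p n.
    by apply: (cv_eq _ (cv_cst _)) => K; rewrite /U subrr dvdz0.
  move=> e e0; exists (p + n)%N => K le; rewrite /U (_ : (_ %| _)%Z = false) ?subrr ?nm0 //.
  apply/negP; rewrite dvdzE => /dvdn_leq; lia.
apply: (cv_le (cvZ _ cU)) => K.
pose x (j : nat) : R := j%:R * L%:R / K.+1%:R.
have xE (j : nat) : (x j)%:C = j%:R * L%:R / K.+1%:R by rewrite /x !rmorphM fmorphV !rmorph_nat.
have L1 : (L%:R : C) != 0 by exact: natC0.
have tE (j : nat) : (tau + (x j)%:C) / L%:R = tau / L%:R + j%:R / K.+1%:R by rewrite xE mulrDl; congr (_ + _); rewrite mulrAC mulfK.
have S : K.+1%:R * (ee (m%:~R * (tau / L%:R)) * tsum (U K)) =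
   \sum_(j < K.+1) ee (- ((m + n%:Z)%:~R * (j%:R / K.+1%:R))) * h (tau + (x j)%:C).
  transitivity (\sum_(j < K.+1) ee (m%:~R * (tau / L%:R)) * tsum (fun p => ee (j%:R * ((p%:Z - n%:Z)%:~R / K.+1%:R)) * u p)); last first.
    apply: eq_bigr => j _; have [aj ->] := H _ (upper_addR (x j) t0).
    rewrite mulrA -eeD tE (_ : - _ + _ = m%:~R * (tau / L%:R) - n%:~R * (j%:R / K.+1%:R)); last by rewrite intrD; ring.
    rewrite eeD -mulrA; congr (_ * _).
    rewrite tE in aj; rewrite -(tsumZ _ aj); apply: tsum_eq => p; rewrite /u eeD exprMn -(eeMn (j%:R / K.+1%:R) p).
    have -> : j%:R * ((p%:Z - n%:Z)%:~R / K.+1%:R) = - (n%:~R * (j%:R / K.+1%:R)) + p%:R * (j%:R / K.+1%:R) :> C.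
      by rewrite intrD mulrNz -!pmulrn; ring.
    by rewrite eeD; ring.
  rewrite -mulr_sumr mulrCA; congr (_ * _); rewrite -tsum_sum => [|j]; last first.
    apply: (asum_bsum _ a) => p; rewrite nmM (_ : nm (ee _) = 1) ?mul1r //.
    have -> : (j%:R * ((p%:Z - n%:Z)%:~R / K.+1%:R) : C) = (j%:R * ((p%:Z - n%:Z)%:~R / K.+1%:R) : R)%:C.
      by rewrite !rmorphM fmorphV !rmorph_nat rmorph_int.
    exact: nm_eeR.
  have aU : asum (U K) by apply: (asum_bsum _ a) => p; rewrite /U; case: ifP => // _; rewrite nm0 nm_ge0.
  rewrite -tsumZ //; apply: tsum_eq => p; rewrite -mulr_suml sum_ee // /U.
  by case: ifP => _; rewrite ?mulr0 ?mul0r.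
rewrite -[X in X <= _](mulKf (x := K.+1%:R)) ?pnatr_eq0 // ler_pdivrMl ?ltr0Sn // -{1}(nm_nat R K.+1) -nmM S.
apply: (le_trans (nm_sum _ _ _)); apply: (@le_trans _ _ (\sum_(j < K.+1) B)); last by rewrite sumr_const card_ord mulr_natl.
apply: ler_sum => j _; rewrite nmM (_ : nm (ee _) = 1) ?mul1r //.
have -> : (- ((m + n%:Z)%:~R * (j%:R / K.+1%:R)) : C) = (- ((m + n%:Z)%:~R * (j%:R / K.+1%:R)) : R)%:C.
  by rewrite rmorphN !rmorphM fmorphV !rmorph_nat rmorph_int.
exact: nm_eeR.
Qed.
Lemma upper_i : upper ('i%C : C). Proof. by rewrite /upper /= ltr01. Qed.
Lemma ql_inj0 L m c h : (0 < L)%N -> ql L m c h -> (forall tau, upper tau -> h tau = 0) -> forall n, c n = 0.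
Proof.
move=> L0 H h0 n; have := coef_bound (B := 0) L0 H upper_i; move=> /(_ _ n) P; apply/eqP.
have := P _; rewrite le_eqVlt ltNge nm_ge0 orbF nm_eq0 !mulf_eq0 (negbTE (ee_neq0 _)) /=.
rewrite expf_eq0 (negbTE (ee_neq0 _)) andbF orbF; apply.
by move=> x; rewrite h0 ?nm0 //; apply: upper_addR; exact: upper_i.
Qed.
Lemma ql_inj L m c c' h : (0 < L)%N -> ql L m c h -> ql L m c' h -> forall n, c n = c' n.
Proof.
move=> L0 H H' n; apply/eqP; rewrite -subr_eq0; apply/eqP.
have := qlD H (qlZ (-1) H'); move/(ql_inj0 L0) => /(_ _ n); rewrite mulN1r; apply.
by move=> t t0; rewrite mulN1r subrr.
Qed.
Lemma ql_per L m c h : (0 < L)%N -> ql L m c h -> (forall tau, upper tau -> h (tau + 1) = h tau) ->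
  forall n, ~~ (L%:Z %| m + n%:Z)%Z -> c n = 0.
Proof.
move=> L0 H hp n nd; have H1 := ql_tri (al := 1) (de := 1) 1 L0 isT isT H.
rewrite muln1 mul1r in H1; have := ql_inj L0 H (ql_eq (fun=> erefl) _ H1) n.
rewrite trcE // dvd1n divn1 muln1 => /(_ _) e.
have {e} e : c n = ee ((m + n%:Z)%:~R / L%:R) * c n.
  rewrite {1}e; last by move=> t t0; rewrite mul1r divr1 hp.
  rewrite mulrCA mulrC; congr (_ * _); rewrite -eeMn -eeD; congr ee; rewrite intrD -pmulrn; ring.
apply/eqP; move/eqP: e; rewrite eq_sym -subr_eq0 -{2}[c n]mul1r -mulrBl mulf_eq0 subr_eq0 => /orP[/eqP e|//].
move: nd; rewrite (divz_eq (m + n%:Z) L) in e *; set x := (_ %% _)%Z in e *.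
have x0 : 0 <= x by apply: modz_ge0; lia.
have xL : x < L%:Z by rewrite /x; apply: ltz_pmod.
rewrite rpredDl ?dvdz_mull // => nd; exfalso.
rewrite intrD mulrDl intrM -pmulrn mulfK ?pnatr_eq0 -?lt0n // addrC eeDint in e.
case: (x) x0 xL nd e => // j _ jL nd; move/eqP; apply/negP.
apply: (@ee_frac_eq1 R L j); rewrite ltz_nat in jL; rewrite jL andbT lt0n; apply: contraNneq nd => ->; exact: dvdz0.
Qed.
Lemma ql_reduce L m c h : (0 < L)%N -> ql L (L%:Z * m) c h -> (forall tau, upper tau -> h (tau + 1) = h tau) ->
  ql 1 m (fun n => c (L * n)%N) h.
Proof.
move=> L0 H hp tau t0; have [a e] := H _ t0; have L1 : (L%:R : C) != 0 by exact: natC0.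
have E n : c (L * n)%N * ee (tau / L%:R) ^+ (L * n) = c (L * n)%N * ee (tau / 1%:R) ^+ n.
  by rewrite exprM -[ee _ ^+ L]eeMn mulrCA divff ?mulr1 ?divr1.
have a1 : asum (fun n => c (L * n)%N * ee (tau / L%:R) ^+ (L * n)).
  by apply: asum_eq (asum_sec L0 L0 a) => n; rewrite addn0 mulnC.
split; first exact: asum_eq E a1.
have eA : ee ((L%:Z * m)%:~R * (tau / L%:R)) = ee (m%:~R * (tau / 1%:R)).
  have eI : ((L%:Z * m)%:~R : C) = m%:~R * L%:R by rewrite mulrC intrM.
  by congr ee; rewrite eI -mulrA (mulrC L%:R) divfK // divr1.
rewrite e eA; apply: (f_equal (fun x => ee (m%:~R * (tau / 1%:R)) * x)).
have hp' i : (i <= L * i)%N by rewrite leq_pmull.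
rewrite -(tsum_eq E) -(tsum_spread hp' a1).
apply: tsum_eq => n; rewrite /spread; have [d|nd] := boolP (L %| n)%N.
  have lt : (n %/ L < n.+1)%N by rewrite ltnS leq_div.
  rewrite (big_pred1 (Ordinal lt)) /=; first by rewrite mulnC divnK.
  move=> i /=; rewrite -val_eqE /=.
  apply/eqP/eqP => [e1|->]; last by rewrite mulnC divnK.
  by have := congr1 (divn^~ L) e1; rewrite /= mulKn.
rewrite (ql_per L0 H hp) ?mul0r ?big1 // => [i /eqP e2|].
  by have := dvdn_mulr i (dvdnn L); rewrite e2 (negbTE nd).
by rewrite rpredDl ?dvdz_mulr // dvdzE.
Qed.
End QExp.

(** * Level one: vanishing from a high order at infinity *)

Section Sturm.
Variable R : realType.
Local Notation C := (R[i]).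
Implicit Types (tau z : C) (c d : nat -> C) (h : C -> C) (L : nat) (m : int).
Lemma upper_T tau : upper tau -> upper (tau + 1).
Proof. by move=> t0; have := upper_addR 1 t0; rewrite rmorph1. Qed.
Lemma upper_S tau : upper tau -> upper (- tau^-1).
Proof. by case/Im_neg_inv. Qed.
Lemma Im_S tau : Im (- tau^-1) = Im tau / nm tau ^+ 2.
Proof. by rewrite nm2; case: tau => a b /=; rewrite ?mulNr ?mulrN opprK. Qed.
(** Transformation under the two generators only; the behaviour at the cusp is supplied separately
    by [ql]. *)
Definition modf (w : nat) h := (forall tau, upper tau -> h (tau + 1) = h tau) /\
  (forall tau, upper tau -> h (- tau^-1) = tau ^+ w * h tau).
Lemma modfM w w' h h' : modf w h -> modf w' h' -> modf (w + w') (fun t => h t * h' t).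
Proof. by move=> [a b] [a' b']; split=> t t0; rewrite ?a ?a' ?b ?b' // exprD mulrACA. Qed.
Lemma modfX w h k : modf w h -> modf (w * k) (fun t => h t ^+ k).
Proof. by move=> [a b]; split=> t t0; rewrite ?a ?b // exprMn exprM. Qed.
Lemma modfD w h h' : modf w h -> modf w h' -> modf w (fun t => h t + h' t).
Proof. by move=> [a b] [a' b']; split=> t t0; rewrite ?a ?a' ?b ?b' // mulrDr. Qed.
Lemma modfZ w h (x : C) : modf w h -> modf w (fun t => x * h t).
Proof. by move=> [a b]; split=> t t0; rewrite ?a ?b // mulrCA. Qed.
Lemma modf_Delta : modf 12 (@Delta R).
Proof. by split=> t t0; [exact: (Delta_T 1)|exact: Delta_S]. Qed.
Lemma ql_bdd L m c h (y : R) : (0 < L)%N -> 0 <= m -> 0 < y -> ql L m c h ->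
  exists2 B : R, 0 <= B & forall tau, y <= Im tau -> nm (h tau) <= B.
Proof.
move=> L0 m0 y0 H; pose z : C := Complex 0 y; have z0 : upper z by [].
have [[B HB] _] := H _ z0; have B0 : 0 <= B by apply: le_trans (HB 0%N); rewrite big_ord0.
exists B => // tau ty; have t0 : upper tau by exact: lt_le_trans ty.
have [a ->] := H _ t0.
have le : nm (ee (tau / L%:R)) <= nm (ee (z / L%:R)) by exact: nm_ee_mono.
case: m m0 H => // m _ H; rewrite nmM -[X in _ <= X]mul1r; apply: ler_pM; rewrite ?nm_ge0 //.
  by rewrite -pmulrn eeMn nmX exprn_ile1 ?nm_ge0 // ltW // nm_ee_lt1.
apply: (nm_tsum (f := fun n => nm (c n * ee (z / L%:R) ^+ n)) _ HB) => n; rewrite (nmM (c n)) (nmM (c n)) !nmX.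
by apply: ler_wpM2l; rewrite ?nm_ge0 // lerXn2r ?nnegrE ?nm_ge0.
Qed.
(* Every point is equivalent to one of height at least 1/2: one inversion after centring doubles smaller heights. *)
Lemma reduce_half (P : C -> Prop) : (forall tau (n : int), upper tau -> P (tau + n%:~R) -> P tau) ->
  (forall tau, upper tau -> P (- tau^-1) -> P tau) -> (forall tau, 1 / 2 <= Im tau -> P tau) ->
  forall tau, upper tau -> P tau.
Proof.
move=> hT hS hP.
suff H k tau : upper tau -> 1 / 2 <= 2 ^+ k * Im tau -> P tau.
  move=> tau t0; have [k hk] : exists k : nat, (Im tau)^-1 / 2 < k%:R.
    by exists (Num.bound ((Im tau)^-1 / 2)); apply: archi_boundP; rewrite divr_ge0 // invr_ge0 ltW.
  apply: (H k) => //; have kk : (k%:R : R) <= 2 ^+ k by rewrite -natrX ler_nat ltnW // ltn_expl.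
  have -> : 1 / 2 = (Im tau)^-1 / 2 * Im tau by field; rewrite gt_eqF.
  by rewrite ler_pM2r // ltW // (lt_le_trans hk).
elim: k tau => [|k IH] tau t0 hk; first by apply: hP; have := hk; rewrite expr0 [1 * Im _]mul1r.
have [|lt] := lerP (1 / 2) (Im tau); first exact: hP.
pose n := Num.floor (Re tau + 1 / 2); have /andP[n1 n2] := floor_itv (Re tau + 1 / 2).
rewrite -/n in n1 n2; pose w := tau + (- n)%:~R.
have wI : Im w = Im tau by rewrite /w intC; case: (tau) => ? ?; simpc.
have wR : Re w = Re tau - n%:~R by rewrite /w intC mulrNz; case: (tau) => ? ?; simpc.
have w0 : upper w by rewrite /upper wI.
apply: (hT _ (- n)) => //; rewrite -/w; apply: hS => //; apply: IH; first exact: upper_S.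
have r1 : `|Re w| <= 1 / 2.
  rewrite wR ler_norml; rewrite intrD mulr1z in n2; apply/andP; split; lra.
have q : 0 < nm w ^+ 2 <= 1 / 2.
  rewrite exprn_gt0 ?nm_gt0 ?upper_neq0 //= nm2 wI; move: t0 lt r1; rewrite /upper ler_norml.
  move: (Re w) (Im tau) => x y y0 y1 /andP[x0 x1].
  have h1 : x ^+ 2 <= 1 / 4 by nra.
  have h2 : y ^+ 2 <= 1 / 4 by nra.
  lra.
rewrite Im_S wI.
move: q => /andP[q1 q2]; apply: (le_trans hk); rewrite exprSr -!mulrA ler_wpM2l ?exprn_ge0 //.
move: t0; rewrite /upper ler_pdivlMr //; move: (Im tau) (nm w ^+ 2) q1 q2 => y q q1 q2 y0; nra.
Qed.
End Sturm.
Section OExp.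
Variable R : realType.
Local Notation C := (R[i]).
Implicit Types (tau z : C) (c d : nat -> C) (h : C -> C) (L : nat) (m : int).
Variable ell : nat.
Hypothesis pell : prime ell.
Local Notation O := (@in_Oell R ell).
Local Notation I := (@I_ R ell).
(** The leading coefficient is tracked because it decides whether the form can be cancelled modulo
    [ell]. *)
Definition qo L m (a : C) h := exists c, [/\ ql L m c h, forall n, O (c n) & c 0%N = a].
Lemma conv_O c d : (forall n, O (c n)) -> (forall n, O (d n)) -> forall n, O (conv c d n).
Proof. by move=> h k n; apply: O_sum => // i _; apply: OM. Qed.
Lemma conv_I c d : (forall n, O (c n)) -> (forall n, I (d n)) -> forall n, I (conv c d n).
Proof. by move=> h k n; apply: I_sum => // i _; apply: IMl. Qed.
Lemma conv_lead c d : conv c d 0 = c 0%N * d 0%N.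
Proof. by rewrite /conv big_ord1. Qed.
Lemma qo_ext L m a h h' : (forall tau, upper tau -> h tau = h' tau) -> qo L m a h -> qo L m a h'.
Proof. by move=> e [c [H ? ?]]; exists c; split=> //; apply: ql_eq H. Qed.
Lemma qoM L m m' a a' h h' : qo L m a h -> qo L m' a' h' -> qo L (m + m') (a * a') (fun t => h t * h' t).
Proof.
move=> [c [H h1 <-]] [d [H' h2 <-]]; exists (conv c d); rewrite conv_lead; split=> //; first exact: qlM.
exact: conv_O.
Qed.
Lemma qo1 L : qo L 0 1 (fun=> 1).
Proof.
exists (monc R 0); split=> // [|n]; last exact: O_nat.
by move: (@ql_mon R L 0 0); apply: ql_eq => // t t0; rewrite mul0r ee0.
Qed.
Lemma qoX L m a h k : qo L m a h -> qo L (m *+ k) (a ^+ k) (fun t => h t ^+ k).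
Proof.
move=> H; elim: k => [|k IH]; first exact: qo1.
by rewrite mulrS exprS; apply: (qo_ext _ (qoM H IH)) => t t0; rewrite exprS.
Qed.
Lemma qoZ L m a h x : O x -> qo L m a h -> qo L m (x * a) (fun t => x * h t).
Proof. by move=> ox [c [H h1 <-]]; exists (fun n => x * c n); split=> // [|n]; [exact: qlZ|exact: OM]. Qed.
Lemma qoD L m a a' h h' : qo L m a h -> qo L m a' h' -> qo L m (a + a') (fun t => h t + h' t).
Proof.
by move=> [c [H h1 <-]] [d [H' h2 <-]]; exists (fun n => c n + d n); split=> // [|n]; [exact: qlD|exact: OD].
Qed.
Lemma qo_low L m m' a h : m' < m -> qo L m a h -> qo L m' 0 h.
Proof.
move=> lt [c [H h1 h2]]; pose k := absz (m - m'); have e : m = m' + k%:Z by rewrite /k; lia.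
rewrite e in H; exists (fun n => if (k <= n)%N then c (n - k)%N else 0); split=> [|n|]; first exact: ql_shift.
  by case: ifP => // _; exact: O0.
by rewrite leqn0 (_ : (k == 0%N) = false) // /k; lia.
Qed.
Lemma O_ee (p : int) (q : nat) : O (ee (p%:~R / q%:R)).
Proof.
have [->|q0] := eqVneq q 0%N; first by rewrite invr0 mulr0 ee0; exact: O1.
apply: (O_unity pell (n := q)); first by rewrite lt0n.
by rewrite -eeMn mulrC divfK ?pnatr_eq0 // ee_int.
Qed.
Lemma trc_O L al de (be : int) c : (forall n, O (c n)) -> forall n, O (trc L al de be c n).
Proof. by move=> h n; apply: O_sum => // i _; apply: OM => //; apply: OX => //; exact: O_ee. Qed.
Lemma trc_I L al de (be : int) c : (forall n, I (c n)) -> forall n, I (trc L al de be c n).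
Proof. by move=> h n; apply: I_sum => // i _; apply: IMr => //; apply: OX => //; exact: O_ee. Qed.
Lemma O_eeM (m be : int) (q : nat) : O (ee (m%:~R * (be%:~R / q%:R))).
Proof. by rewrite mulrA -intrM; exact: O_ee. Qed.
Lemma qo_tri L m a h (al de : nat) (be : int) : (0 < L)%N -> (0 < al)%N -> (0 < de)%N -> qo L m a h ->
  qo (L * de) (al%:Z * m) (ee (m%:~R * (be%:~R / (L * de)%N%:R)) * a) (fun tau => h ((al%:R * tau + be%:~R) / de%:R)).
Proof.
move=> L0 a0 d0 [c [H h1 <-]]; have := ql_tri be L0 a0 d0 H; set e := ee _ => H1.
exists (fun n => e * trc L al de be c n); split=> // [n|]; last by rewrite trc_lead.
by apply: OM => //; [exact: O_eeM|exact: trc_O].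
Qed.
Lemma qo_lift L m a h k : (0 < L)%N -> (0 < k)%N -> qo L m a h -> qo (L * k) (k%:Z * m) a h.
Proof.
move=> L0 k0 H; have := qo_tri 0 L0 k0 k0 H; rewrite mul0r mulr0 ee0 mul1r; apply: qo_ext => t t0.
by rewrite addr0 mulrC mulKf // pnatr_eq0 -lt0n.
Qed.
Lemma qo_reduce L m a h : (0 < L)%N -> qo L (L%:Z * m) a h -> (forall tau, upper tau -> h (tau + 1) = h tau) ->
  qo 1 m a h.
Proof. by move=> L0 [c [H h1 h2]] hp; exists (fun n => c (L * n)%N); split; [exact: ql_reduce|by move=> n; exact: h1|by rewrite muln0]. Qed.
Lemma qo_eta : qo 24 1 1 (@eta R).
Proof.
pose c0 := spread (fun i => (i ^ 2)%N) (fun i => (chi12 i)%:~R : C).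
have hp i : (i <= i ^ 2)%N by case: i => // i; rewrite expnS expn1 leq_pmulr.
have H : ql 24 0 c0 (@eta R).
  move=> tau t0; rewrite mul0r ee0 mul1r.
  have a := @asum_chi R _ chi12 (nm_ee_lt1 t0 (isT : 0 < 24)%N) chi12_le1.
  have E n : spread (fun i => (i ^ 2)%N) (fun i => (chi12 i)%:~R * ee (tau / 24%:R) ^+ (i ^ 2)) n = c0 n * ee (tau / 24%:R) ^+ n.
    by rewrite /c0 /spread mulr_suml; apply: eq_bigr => i /eqP ->.
  split; first exact: asum_eq E (asum_spread hp a).
  by rewrite (eta_chi t0) -(tsum_spread hp a) (tsum_eq E).
exists (fun n => c0 (n + 1)%N); split=> [|n|].
- have := ql_unshift (k := 1) _ H; rewrite add0r; apply=> n; rewrite ltnS leqn0 => /eqP ->.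
  by rewrite /c0 /spread big_mkcond big_ord1.
- by apply: O_sum => // i _; exact: O_int.
- by rewrite /c0 /spread big_mkcond !big_ord_recl big_ord0 /= addr0 add0r.
Qed.
Lemma qo_etaV : qo 24 (-1) 1 (fun t => (@eta R t)^-1).
Proof.
pose c := spread (muln 24) (fun i => (part i i)%:R : C).
have hp i : (i <= 24 * i)%N by rewrite leq_pmull.
exists c; split=> [tau t0|n|].
- have [a e] := eta_inv t0.
  have E n : spread (muln 24) (fun i => (part i i)%:R * ee (tau / 24%:R) ^+ (24 * i)) n = c n * ee (tau / 24%:R) ^+ n.
    by rewrite /c /spread mulr_suml; apply: eq_bigr => i /eqP ->.
  split; first exact: asum_eq E (asum_spread hp a).
  rewrite (_ : (-1)%:~R * (tau / 24%:R) = - (tau / 24%:R)) ?eeN; last by rewrite mulrNz mulN1r.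
  have n0 := eta_neq0 t0; apply: (mulfI n0); rewrite mulfV // -(tsum_eq E) (tsum_spread hp a).
  exact: esym e.
- by apply: O_sum => // i _; exact: O_nat.
- by rewrite /c /spread big_mkcond big_ord1.
Qed.
Lemma qo_Delta : qo 1 1 1 (@Delta R).
Proof.
apply: (qo_reduce (L := 24)) => // [|t t0]; last exact: (Delta_T 1).
by have := qoX 24 qo_eta; rewrite expr1n mulr1.
Qed.
Lemma qo_DeltaV : qo 1 (-1) 1 (fun t => (@Delta R t)^-1).
Proof.
apply: (qo_reduce (L := 24)) => // [|t t0]; last by rewrite (Delta_T 1).
have := qoX 24 qo_etaV; rewrite expr1n (_ : -1 *+ 24 = 24%:Z * -1) //.
by apply: qo_ext => t t0; rewrite exprVn.
Qed.
(* [G^2 / Delta^(8k+1)] has weight -12 and positive order, so it is O(y^6) as y -> 0, which kills its coefficients. *)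
Lemma modf_zero (k : nat) m c G : modf (48 * k) G -> ql 1 m c G -> (4 * k)%:Z < m ->
  forall tau, upper tau -> G tau = 0.
Proof.
move=> [GT GS] H lt.
have [c1 [H1 _ _]] := qoX (8 * k + 1) qo_DeltaV.
have H2 := qlM (qlM H H) H1; set m2 := (m + m + _) in H2; set c2 := conv _ _ in H2.
set psi := (fun t => _) in H2.
have m20 : 0 <= m2 by rewrite /m2 mulNrn natz; lia.
have psiT t : upper t -> psi (t + 1) = psi t by move=> t0; rewrite /psi GT // (Delta_T 1).
have psiTn t (n : int) : upper t -> psi (t + n%:~R) = psi t.
  move=> t0; case: n => n; elim: n => [|n IH]; first by rewrite addr0.
  - have u : upper (t + n%:R) by have := upper_addR n%:R t0; rewrite rmorph_nat.
    by rewrite -addn1 PoszD intrD addrA psiT.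
  - have u : upper (t - 1) by have := upper_addR (-1) t0; rewrite rmorphN rmorph1.
    by rewrite NegzE mulrNz -(psiT _ u) subrK.
  - have u : upper (t + (Negz n.+1)%:~R) by rewrite intC; exact: upper_addR.
    rewrite -(psiT _ u) -IH; congr psi; rewrite -addrA; congr (_ + _).
    by rewrite (_ : Negz n = Negz n.+1 + 1) ?intrD // NegzE; lia.
have psiS t : upper t -> t ^+ 12 * psi (- t^-1) = psi t.
  move=> t0; have tn := upper_neq0 t0; rewrite /psi GS // Delta_S //.
  have e : t ^+ 12 * (t ^+ (48 * k) * t ^+ (48 * k)) = (t ^+ 12) ^+ (8 * k + 1).
    by rewrite -!exprM -!exprD; congr (_ ^+ _); lia.
  have p0 : t ^+ 12 != 0 by rewrite expf_neq0.
  move: (Delta t) (G t) (t ^+ (48 * k)) (t ^+ 12) e p0 => D g q p e p0.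
  move: (8 * k + 1)%N e => n e.
  transitivity (p * (q * q) / p ^+ n * (g * g * D^-1 ^+ n)).
    by rewrite invfM exprMn [p^-1 ^+ n]exprVn; move: (p ^- n) (D^-1 ^+ n) => x y; ring.
  by rewrite e divff ?mul1r // expf_neq0.
have [B B0 HB] : exists2 B : R, 0 <= B & forall tau, 1 / 2 <= Im tau -> nm (psi tau) <= B.
  by apply: (ql_bdd _ _ _ H2) => //; lra.
(* The quantity |psi| / y^6 is invariant under both generators, so a bound on y >= 1/2 propagates
   everywhere; 64 is 2^6. *)
have bnd t : upper t -> nm (psi t) <= B * 64%:R * Im t ^+ 6.
  move: t; apply: reduce_half => [t n t0|t t0|t ht].
  - by rewrite psiTn // intC; case: (t) => ? ?; simpc.
  - move=> hb; rewrite -(psiS t t0) nmM nmX.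
    have tn : 0 < nm t by rewrite nm_gt0 upper_neq0.
    have -> : Im t ^+ 6 = nm t ^+ 12 * Im (- t^-1) ^+ 6.
      by rewrite Im_S exprMn exprVn -exprM mulrC divfK // expf_neq0 // gt_eqF.
    by rewrite mulrCA ler_wpM2l ?exprn_ge0 ?nm_ge0.
  - apply: (le_trans (HB _ ht)); rewrite -mulrA ler_peMr //.
    have : (1 / 2) ^+ 6 <= Im t ^+ 6 by rewrite lerXn2r ?nnegrE //; lra.
    lra.
have c20 n : c2 n = 0.
  apply/eqP; rewrite -nm_eq0 eq_le nm_ge0 andbT leNgt; apply/negP => c2n.
  pose K := expR (2 * pi * (m2%:~R + n%:R)) * (B * 64%:R + 1); have K0 : 0 < K by rewrite mulr_gt0 ?expR_gt0 // ltr_wpDl ?mulr_ge0.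
  pose y := Num.min 1 (nm (c2 n) / (2 * K)); have y0 : 0 < y by rewrite lt_min ltr01 divr_gt0 // mulr_gt0.
  have y1 : y <= 1 by rewrite ge_min lexx.
  have yK : y <= nm (c2 n) / (2 * K) by rewrite ge_min lexx orbT.
  clearbody y; have t0 : upper (Complex 0 y : C) by [].
  have hb (x : R) : nm (psi (Complex 0 y + x%:C)) <= B * 64%:R * y ^+ 6.
    have := bnd _ (upper_addR x t0); rewrite (_ : Im _ = y) //; by simpc.
  have := @coef_bound R 1 m2 c2 psi (Complex 0 y) _ isT H2 t0 hb n; rewrite !nmM nmX divr1 !nm_ee /=.
  have -> : Im (m2%:~R * Complex 0 y) = m2%:~R * y by rewrite intC; simpc.
  rewrite -expRM_natl mulrCA -expRD => hc.
  have : nm (c2 n) <= K * y.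
    rewrite -(ler_pM2r (expR_gt0 (- (2 * pi * (m2%:~R * y)) + n%:R * - (2 * pi * y)))).
    apply: (le_trans hc); rewrite /K.
    have -> : - (2 * pi * (m2%:~R * y)) + n%:R * - (2 * pi * y) = - (2 * pi * (m2%:~R + n%:R) * y) by ring.
    have y6 : y ^+ 6 <= y by rewrite -[X in _ <= X]expr1 ler_wiXn2l // ltW.
    have e1 : 1 <= expR (2 * pi * (m2%:~R + n%:R)) * expR (- (2 * pi * (m2%:~R + n%:R) * y)).
      have : 0 <= 2 * pi * (m2%:~R + n%:R : R) by rewrite mulr_ge0 ?mulr_ge0 ?pi_ge0 // addr_ge0 // ler0z.
      rewrite -expRD; move: (2 * pi * _) => w w0; apply: le_trans (expR_ge1Dx _); nra.
    have -> : expR (2 * pi * (m2%:~R + n%:R)) * (B * 64%:R + 1) * y * expR (- (2 * pi * (m2%:~R + n%:R) * y)) =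
       expR (2 * pi * (m2%:~R + n%:R)) * expR (- (2 * pi * (m2%:~R + n%:R) * y)) * ((B * 64%:R + 1) * y) by ring.
    apply: (@le_trans _ _ ((B * 64%:R + 1) * y)); last by rewrite ler_peMl // mulr_ge0 ?(ltW y0) // addr_ge0 // mulr_ge0.
    apply: ler_pM => //; rewrite ?mulr_ge0 ?exprn_ge0 ?(ltW y0) //; lra.
  rewrite leNgt => /negP; apply.
  have k2 : 0 < 2 * K by rewrite mulr_gt0.
  have yK' : y * (2 * K) <= nm (c2 n) by rewrite -(ler_pdivlMr _ _ k2).
  move: yK' K0; move: (nm (c2 n)) (K) => x K' h kk; nra.
move=> t t0; have := H2 t t0 => -[_]; rewrite (tsum_eq (v := fun=> 0)) => [|n]; last by rewrite c20 mul0r.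
rewrite tsum0 mulr0 /psi => /eqP; rewrite mulf_eq0 [X in _ || X]expf_eq0 invr_eq0 (negbTE (Delta_neq0 t0)) andbF orbF mulf_eq0 orbb.
by move/eqP.
Qed.
End OExp.

(** * Sturm's bound modulo ell in level one *)

Section LevelOneBasis.
Variable R : realType.
Local Notation C := (R[i]).
Implicit Types (tau z : C) (c d : nat -> C) (h : C -> C) (L : nat) (m : int).
Lemma eta_S8 z : upper z -> eta (- z^-1) ^+ 8 = z ^+ 4 * eta z ^+ 8.
Proof.
move=> z0; rewrite -[8%N]/(2 * 4)%N !exprM eta_S2 // 2!exprMn (_ : (- 'i%C) ^+ 4 = 1) ?mul1r //.
by rewrite -[4%N]/(2 * 2)%N exprM sqrrN sqr_i sqrrN expr1n.
Qed.
Lemma eta_S4 z : upper z -> eta (- z^-1) ^+ 4 = - (z ^+ 2 * eta z ^+ 4).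
Proof.
move=> z0; rewrite -[4%N]/(2 * 2)%N !exprM eta_S2 // 2!exprMn sqrrN sqr_i.
by rewrite mulN1r mulNr.
Qed.
Definition etr (al de : nat) (be : int) tau : C := eta ((al%:R * tau + be%:~R) / de%:R).
(** In terms of theta constants, [wu], [wv] and [wx] are theta_2^4 eta^4, theta_4^4 eta^4 and
    -theta_3^4 eta^4, which the modular group permutes up to automorphy factors. *)
Definition wu tau : C := 16%:R * etr 2 1 0 tau ^+ 8.
Definition wv tau : C := etr 1 2 0 tau ^+ 8.
Definition wx tau : C := ee (1 / 3) * etr 1 2 1 tau ^+ 8.
Lemma ee24X (n : int) (k : nat) : ee (n%:~R / 24 : C) ^+ k = ee ((n * k%:Z)%:~R / 24).
Proof. by rewrite -eeMn; congr ee; rewrite intrM -pmulrn; ring. Qed.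
Lemma eta_Tn8 z (n : int) : upper z -> eta (z + n%:~R) ^+ 8 = ee (n%:~R / 3) * eta z ^+ 8.
Proof. by move=> z0; rewrite eta_Tn // exprMn ee24X; congr (ee _ * _); rewrite intrM -pmulrn; field. Qed.
Lemma ee_half : ee (1 / 2 : C) = -1.
Proof.
have e : ee (1 / 2 : C) ^+ 2 = 1 by rewrite -eeMn mulrC divfK ?pnatr_eq0 // ee1.
have n1 := @ee_frac_eq1 R 2 1 isT; move/eqP: e; rewrite sqrf_eq1 => /orP[e|/eqP//].
by rewrite e in n1.
Qed.
Lemma ee_third3 : ee (2 / 3 : C) ^+ 3 = 1.
Proof. by rewrite -eeMn mulrC divfK ?pnatr_eq0 // (ee_nat R 2). Qed.
Lemma wT tau : upper tau -> [/\ wu (tau + 1) = ee (2 / 3) * wu tau, wv (tau + 1) = ee (2 / 3) * wx tau &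
  wx (tau + 1) = ee (2 / 3) * wv tau].
Proof.
move=> t0; have e1 : ee (2 / 3 : C) * ee (1 / 3) = 1.
  by rewrite -eeD (_ : 2 / 3 + 1 / 3 = 1 :> C) ?ee1 //; field.
have uu : upper ((2%:R * tau + 0%:~R) / 1%:R) := upper_tri (al := 2) (de := 1) 0 isT isT t0.
have uv : upper ((1%:R * tau + 0%:~R) / 2%:R) := upper_tri (al := 1) (de := 2) 0 isT isT t0.
split.
- rewrite /wu /etr (_ : (2%:R * (tau + 1) + 0%:~R) / 1%:R = (2%:R * tau + 0%:~R) / 1%:R + 2%:~R); last by rewrite !divr1 !addr0 mulrDr mulr1.
  by rewrite (eta_Tn8 _ uu) mulrCA.
- rewrite /wv /wx /etr (_ : (1%:R * (tau + 1) + 0%:~R) / 2%:R = (1%:R * tau + 1%:~R) / 2%:R); last by rewrite addr0 !mul1r.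
  by rewrite mulrA e1 mul1r.
- rewrite /wv /wx /etr (_ : (1%:R * (tau + 1) + 1%:~R) / 2%:R = (1%:R * tau + 0%:~R) / 2%:R + 1%:~R); last by field.
  rewrite (eta_Tn8 _ uv).
  by rewrite mulrA -eeD; congr (ee _ * _); rewrite -mulrDl.
Qed.
Lemma wS tau : upper tau -> [/\ wu (- tau^-1) = tau ^+ 4 * wv tau, wv (- tau^-1) = tau ^+ 4 * wu tau &
  wx (- tau^-1) = tau ^+ 4 * wx tau].
Proof.
move=> t0; have tn := upper_neq0 t0.
have uu : upper ((2%:R * tau + 0%:~R) / 1%:R) := upper_tri (al := 2) (de := 1) 0 isT isT t0.
have uv : upper ((1%:R * tau + 0%:~R) / 2%:R) := upper_tri (al := 1) (de := 2) 0 isT isT t0.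
split.
- rewrite /wu /wv /etr (_ : (2%:R * (- tau^-1) + 0%:~R) / 1%:R = - ((1%:R * tau + 0%:~R) / 2%:R)^-1); last by field.
  rewrite (eta_S8 uv) addr0 mul1r mulrA; congr (_ * _); by field.
- rewrite /wu /wv /etr (_ : (1%:R * (- tau^-1) + 0%:~R) / 2%:R = - ((2%:R * tau + 0%:~R) / 1%:R)^-1); last by field.
  rewrite (eta_S8 uu) addr0 divr1 mulrA; congr (_ * _); by ring.
pose z := (1%:R * tau + 1%:~R) / 2%:R : C.
have z0 : upper z := upper_tri (al := 1) (de := 2) 1 isT isT t0.
have ze : z = (tau + 1) / 2 by rewrite /z mul1r.
clearbody z; have z1 : upper (z + (-1)%:~R) by rewrite intC; exact: upper_addR.
have zn := upper_neq0 z1.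
have u1 := upper_S z1; have u2 : upper (- (z + (-1)%:~R)^-1 + (-2)%:~R) by rewrite [(-2)%:~R]intC; exact: upper_addR.
have wn := upper_neq0 u2.
have E1 : (- (z + (-1)%:~R)^-1 + (-2)%:~R) * (z + (-1)%:~R) = - tau :> C.
  by rewrite mulrDl mulNr mulVf // ze !mulrNz; field.
rewrite /wx /etr (_ : (1%:R * (- tau^-1) + 1%:~R) / 2%:R = - (- (z + (-1)%:~R)^-1 + (-2)%:~R)^-1); last first.
  apply: (mulIf wn); rewrite [RHS]mulNr mulVf //; apply: (mulIf zn); rewrite -[LHS]mulrA E1 ze !mulrNz; by field.
rewrite (_ : (1%:R * tau + 1%:~R) / 2%:R = z); last by rewrite ze mul1r.
rewrite eta_S8 // eta_Tn8 // eta_S8 // eta_Tn8 // mulrCA.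
transitivity (ee (1 / 3) * (((- (z + (-1)%:~R)^-1 + (-2)%:~R) * (z + (-1)%:~R)) ^+ 4 * (ee ((-2)%:~R / 3) * ee ((-1)%:~R / 3) * eta z ^+ 8))).
  by rewrite exprMn; ring.
rewrite E1 -eeD (_ : (-2)%:~R / 3 + (-1)%:~R / 3 = (-1)%:~R :> C); last by rewrite !mulrNz; field.
by rewrite ee_int mul1r; move: (ee _) (eta z ^+ 8) => x y; ring.
Qed.
(** [B16] is 2 E_4 Delta and [B18] is 2 E_6 Delta, with the Eisenstein series written in theta
    constants. Integrality and the leading coefficient 2, a unit since [ell] >= 5, thus come from
    eta alone. *)
Definition B16 tau : C := (wu tau ^+ 2 + wv tau ^+ 2 + wx tau ^+ 2) * eta tau ^+ 16.
Definition B18 tau : C := (wu tau - wv tau) * (wv tau - wx tau) * (wx tau - wu tau) * eta tau ^+ 12.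
Lemma modf_B16 : modf 16 B16.
Proof.
split=> t t0; rewrite /B16.
- have [-> -> ->] := wT t0; have e : eta (t + 1) ^+ 16 = ee (2 / 3) * eta t ^+ 16.
    by rewrite (eta_Tn 1 t0) exprMn ee24X; congr (ee _ * _); field.
  rewrite e; have := ee_third3; move: (ee _) => w w3.
  by rewrite -[RHS]mul1r -w3; ring.
- have [-> -> ->] := wS t0; rewrite -[16%N]/(8 * 2)%N !exprM eta_S8 //; ring.
Qed.
Lemma modf_B18 : modf 18 B18.
Proof.
split=> t t0; rewrite /B18.
- have [-> -> ->] := wT t0; have e : eta (t + 1) ^+ 12 = - eta t ^+ 12.
    rewrite (eta_Tn 1 t0) exprMn ee24X (_ : (1 * 12%:Z)%:~R / 24 = 1 / 2 :> C) ?ee_half ?mulN1r //.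
    by rewrite mul1r -pmulrn; field.
  rewrite e; have := ee_third3; move: (ee _) => w w3.
  by rewrite -[RHS]mul1r -w3; ring.
- have [-> -> ->] := wS t0; rewrite -[12%N]/(4 * 3)%N !exprM eta_S4 //; ring.
Qed.
Variable ell : nat.
Hypothesis pell : prime ell.
Hypothesis ell5 : (5 <= ell)%N.
Local Notation O := (@in_Oell R ell).
Local Notation I := (@I_ R ell).
Local Notation qo := (@qo R ell).
Lemma qo_cast L m m' a a' h : m = m' -> a = a' -> qo L m a h -> qo L m' a' h.
Proof. by move=> -> ->. Qed.
Lemma qo_w : [/\ qo 48 8 0 wu, qo 48 8 1 wv & qo 48 8 (-1) wx].
Proof.
have e := qo_eta R pell; split.
- have H := qo_lift pell (L := 24) (k := 2) isT isT (qo_tri pell (al := 2) (de := 1) 0 (isT : 0 < 24)%N isT isT e).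
  exact: (qo_low pell (m := 32)) (qoZ pell (O_nat R pell 16) (qoX pell 8 H)).
- have H := qo_tri pell (al := 1) (de := 2) 0 (isT : 0 < 24)%N isT isT e.
  by apply: qo_cast (qoX pell 8 H) => //; rewrite mul0r mulr0 ee0 mulr1 expr1n.
- have H := qo_tri pell (al := 1) (de := 2) 1 (isT : 0 < 24)%N isT isT e.
  have o3 : O (ee (1 / 3)) by exact: (O_ee R pell 1 3).
  apply: qo_cast (qoZ pell o3 (qoX pell 8 H)) => //; rewrite mulr1 -eeMn -eeD -ee_half; congr ee; by field.
Qed.
Lemma qo_eta48 : qo 48 2 1 (@eta R).
Proof. by have := qo_lift pell (k := 2) (isT : 0 < 24)%N isT (qo_eta R pell). Qed.
Lemma qo_B16 : qo 1 1 2 B16.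
Proof.
apply: (qo_reduce (L := 48)) => // [|t t0]; last by case: modf_B16 => ->.
have [hu hv ht] := qo_w.
have := qoM pell (qoD pell (qoD pell (qoX pell 2 hu) (qoX pell 2 hv)) (qoX pell 2 ht)) (qoX pell 16 qo_eta48).
by apply: qo_cast => //; ring.
Qed.
Lemma qo_B18 : qo 1 1 2 B18.
Proof.
apply: (qo_reduce (L := 48)) => // [|t t0]; last by case: modf_B18 => ->.
have [hu hv ht] := qo_w; have N h a : qo 48 8 a h -> qo 48 8 (- a) (fun t => - h t).
  move=> H; have := qoZ pell (O_int R pell (-1)) H; rewrite (_ : (-1)%:~R = -1 :> C) // mulN1r.
  by apply: qo_ext => t t0; rewrite mulN1r.
have := qoM pell (qoM pell (qoM pell (qoD pell hu (N _ _ hv)) (qoD pell hv (N _ _ ht))) (qoD pell ht (N _ _ hu))) (qoX pell 12 qo_eta48).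
by apply: qo_cast => //; ring.
Qed.
Lemma O_inv2X k : O (2 ^- k).
Proof.
by rewrite -exprVn; apply: (OX pell); apply: (O_inv R pell); apply/negP => /dvdn_leq; lia.
Qed.
(* [Delta^(4i) B16^(3(k-i))], 0 <= i <= k, is a triangular basis of the forms of weight 48k and order at least 3k *)
Lemma sturm48 k j c G : (j <= k.+1)%N -> modf (48 * k) G -> ql 1 0 c G -> (forall n, O (c n)) ->
  (forall n, (n < 3 * k + j)%N -> c n = 0) -> (forall n, (n <= 4 * k)%N -> I (c n)) -> forall n, I (c n).
Proof.
move: {2}(k.+1 - j)%N (erefl (k.+1 - j)%N) => s; elim: s j c G => [|s IH] j c G es jk mG H oc zc ic.
  have H2 := ql_unshift zc H; rewrite add0r in H2.
  have G0 := modf_zero pell mG H2 _; move=> n; rewrite (ql_inj0 _ H) //; first exact: I0.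
  by move=> t t0; apply: G0 => //; lia.
have jk' : (j <= k)%N by lia.
have [d [Hd od d0]] := qoM pell (qoX pell (4 * j) (qo_Delta R pell)) (qoX pell (3 * (k - j)) qo_B16).
rewrite !natz -PoszD (_ : (4 * j + 3 * (k - j) = 3 * k + j)%N) in Hd; last by lia.
rewrite expr1n mul1r in d0.
have mE := modfM (modfX (4 * j) (modf_Delta R)) (modfX (3 * (k - j)) modf_B16).
rewrite (_ : (12 * (4 * j) + 16 * (3 * (k - j)) = 48 * k)%N) in mE; last by lia.
set E := (fun t => _) in Hd mE.
(* The basis form of order 3k + j has leading coefficient 2^(3(k-j)). Subtracting x times it kills
   the coefficient at 3k + j and changes nothing modulo [ell], as x lies in the ideal. *)
pose x := c (3 * k + j)%N * 2 ^- (3 * (k - j)).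
have ix : I x by apply: IMr => //; [apply: ic; lia|exact: O_inv2X].
have Hd0 := ql_shift (k := 3 * k + j) (m := 0) Hd;
set d' := (fun n => if _ then _ else _) in Hd0.
have od' n : O (d' n) by rewrite /d'; case: ifP => // _; exact: O0.
have H1 := qlD H (qlZ (- x) Hd0).
have m1 := modfD mG (modfZ (- x) mE).
have ox : O (- x) by apply: ON => //; exact: I_O.
have iM n : I (- x * d' n) by apply: IMr => //; apply: IN.
have := IH j.+1 _ _ _ _ m1 H1; rewrite ltnS jk' => P n.
rewrite -(addrK (- x * d' n) (c n)); apply: IB => //; apply: P => //.
- lia.
- by move=> p; apply: OD => //; apply: OM.
- move=> p; rewrite addnS ltnS leq_eqVlt => /orP[/eqP->|lt]; last first.
    by rewrite zc // /d' leqNgt lt mulr0 addr0.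
  by rewrite /d' leqnn subnn d0 /x mulNr mulfVK ?subrr // expf_neq0 // pnatr_eq0.
- by move=> p lp; apply: ID => //; exact: ic.
Qed.
(** Multiplication by a product of [B16], [B18] and Delta brings any even weight to 48 k with a zero
    of order at least 3k, where [sturm48] applies. Its leading coefficient is a power of 2, so it
    can be divided out again, coefficient by coefficient. *)
Lemma sturm (kap : nat) c G : ~~ odd kap -> modf kap G -> ql 1 0 c G -> (forall n, O (c n)) ->
  (forall n, (12 * n <= kap + 24)%N -> I (c n)) -> forall n, I (c n).
Proof.
move=> ev mG H oc ic.
pose h := kap./2; have eh : kap = h.*2 by rewrite /h even_halfK.
(* With kap = 2h, these residues make kap + 16a + 18b divisible by 12, modulo 3 through a and modulo
   2 through b. *)
pose a := (h %% 3)%N; pose b := (h %% 2)%N; pose t := ((kap + 16 * a + 18 * b) %/ 12)%N.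
have et : (12 * t = kap + 16 * a + 18 * b)%N.
  rewrite /t mulnC divnK // eh /a /b; lia.
(* Here 12 t + 12 c' = 48 k, while the order n0 of the multiplier is at least 3k and 4k - n0 is at
   most t - a - b, within the range where [ic] gives information. *)
pose c' := (4 * kap + 4 + 3 * t)%N; pose k := (t + kap + 1)%N.
have [d [Hd od d0]] := qoM pell (qoM pell (qoX pell a qo_B16) (qoX pell b qo_B18)) (qoX pell c' (qo_Delta R pell)).
rewrite expr1n mulr1 -exprD in d0; rewrite !natz -!PoszD in Hd.
have mE := modfM (modfM (modfX a modf_B16) (modfX b modf_B18)) (modfX c' (modf_Delta R)).
have mGE := modfM mG mE.
rewrite (_ : (kap + (16 * a + 18 * b + 12 * c') = 48 * k)%N) in mGE; last by rewrite /c' /k; lia.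
set n0 := (a + b + c')%N in Hd; have H1 := qlM H Hd; rewrite add0r in H1.
have H2 := ql_shift (k := n0) (m := 0) (_ : ql 1 (0 + n0%:Z) _ _); rewrite add0r in H2; move/(_ _ _ _ H1) in H2.
set e := (fun n => if _ then _ else _) in H2.
have oe n : O (e n) by rewrite /e; case: ifP => _; [exact: conv_O|exact: O0].
have ie n : (n < n0)%N -> e n = 0 by move=> lt; rewrite /e leqNgt lt.
have a2 : (a <= 2)%N by rewrite /a; lia.
have b1 : (b <= 1)%N by rewrite /b; lia.
have P : forall n, I (e n).
  apply: (sturm48 (leq0n _) mGE H2 oe) => n.
    by rewrite addn0 => lt; apply: ie; rewrite /n0 /c'; move: lt; rewrite /k; lia.
  move=> le; rewrite /e; case: ifP => // [ln|_]; last exact: I0.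
  apply: I_sum => // i _; apply: IMr => //; apply: ic.
  have := ltn_ord i; move: ln le; rewrite /n0 /c' /k; lia.
elim/ltn_ind => n IH; have := P (n + n0)%N; rewrite /e leq_addl addnK /conv big_ord_recr /= subnn d0.
rewrite addrC => h1; have : I (c n * 2 ^+ (a + b)).
  rewrite -(addrK (\sum_(i < n) c i * d (n - i)%N) (c n * _)); apply: IB => //.
  by apply: I_sum => // i _; apply: IMr => //; exact: IH.
move=> h2; rewrite -[c n](mulfK (_ : 2 ^+ (a + b) != 0)) ?expf_neq0 ?pnatr_eq0 //.
by apply: IMr => //; exact: O_inv2X.
Qed.
End LevelOneBasis.

(** * Eta quotients and their orders at the cusps *)

Section EtaProducts.
Variable R : realType.
Local Notation C := (R[i]).
Implicit Types (tau z : C) (c d : nat -> C) (h : C -> C) (L : nat) (m : int).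
Variable ell : nat.
Hypothesis pell : prime ell.
Local Notation O := (@in_Oell R ell).
Local Notation I := (@I_ R ell).
Local Notation qo := (@qo R ell).
(** The function and its inverse both have integral expansions, so arbitrary integer powers stay
    integral. *)
Definition qu L m (u : C) h := [/\ u != 0, qo L m u h & qo L (- m) u^-1 (fun t => (h t)^-1)].
Lemma qu_ext L m a h h' : (forall tau, upper tau -> h tau = h' tau) -> qu L m a h -> qu L m a h'.
Proof. by move=> e [a0 H K]; split=> //; [exact: qo_ext H|apply: qo_ext K => t t0; rewrite e]. Qed.
Lemma quM L m m' u u' h h' : qu L m u h -> qu L m' u' h' -> qu L (m + m') (u * u') (fun t => h t * h' t).
Proof.
move=> [u0 H K] [u0' H' K']; split; [by rewrite mulf_neq0|exact: qoM|].
by rewrite opprD invfM; apply: qo_ext (qoM pell K K') => t t0; rewrite invfM.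
Qed.
Lemma quC L x : x != 0 -> O x -> O x^-1 -> qu L 0 x (fun=> x).
Proof.
move=> x0 ox ox'; split=> //.
  by have := qoZ pell ox (qo1 R pell L); rewrite mulr1.
by rewrite oppr0; have := qoZ pell ox' (qo1 R pell L); rewrite mulr1.
Qed.
Lemma quV L m u h : qu L m u h -> qu L (- m) u^-1 (fun t => (h t)^-1).
Proof. by move=> [u0 H K]; split; rewrite ?invr_eq0 // opprK invrK; apply: qo_ext H => t t0; rewrite invrK. Qed.
Lemma quX L m u h k : qu L m u h -> qu L (m * k%:Z) (u ^+ k) (fun t => h t ^+ k).
Proof.
move=> H; elim: k => [|k IH].
  by rewrite mulr0; apply: quC; rewrite ?invr1 ?oner_neq0 //; exact: O1.
rewrite exprS (_ : m * k.+1%:Z = m + m * k%:Z); last by rewrite intS mulrDr mulr1.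
by apply: qu_ext (quM H IH) => t t0; rewrite exprS.
Qed.
Lemma quXz L m u h (e : int) : qu L m u h -> qu L (m * e) (u ^ e) (fun t => h t ^ e).
Proof.
case: e => k H; first exact: quX.
by rewrite NegzE mulrN; have := quV (quX k.+1 H).
Qed.
Lemma qu_tri L m u h (al de : nat) (be : int) : (0 < L)%N -> (0 < al)%N -> (0 < de)%N -> qu L m u h ->
  qu (L * de) (al%:Z * m) (ee (m%:~R * (be%:~R / (L * de)%N%:R)) * u) (fun tau => h ((al%:R * tau + be%:~R) / de%:R)).
Proof.
move=> L0 a0 d0 [u0 H K]; split; [by rewrite mulf_neq0 ?ee_neq0|exact: qo_tri|].
have := qo_tri pell be L0 a0 d0 K; rewrite mulrN mulrNz mulNr eeN invfM; exact.
Qed.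
Lemma qu_lift L m u h k : (0 < L)%N -> (0 < k)%N -> qu L m u h -> qu (L * k) (k%:Z * m) u h.
Proof. by move=> L0 k0 [u0 H K]; split; [by []|exact: qo_lift|rewrite -mulrN; exact: qo_lift]. Qed.
Lemma qu_Delta : qu 1 1 1 (@Delta R).
Proof. by split; rewrite ?oner_neq0 ?invr1 //; [exact: qo_Delta|exact: qo_DeltaV]. Qed.
(** Hermite form of diag(m, 1) g. Its diagonal entry [al] is gcd(m, c), which is the source of the
    gcd in [ordl]. *)
Lemma Delta_slash (m : nat) (g : m2) : (0 < m)%N -> m2det g = 1 -> exists (al de : nat) (be : int),
  [/\ (0 < al)%N, (0 < de)%N, (al * de)%N = m, al = gcdn m `|mc g| &
  forall tau, upper tau -> Delta (m%:R * mob g tau) = (jf g tau / de%:R) ^+ 12 * Delta ((al%:R * tau + be%:~R) / de%:R :> C)].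
Proof.
move=> m0 dg; pose A := M2 (m%:Z * ma g) (m%:Z * mb g) (mc g) (md g).
have dA : m2det A = m%:Z by rewrite -[RHS]mulr1 -dg /m2det /=; ring.
have [|g' [al [de [be [d' a0 d0 e1 eA]]]]] := @hermite A; first by rewrite dA.
have eaa : m%:Z * ma g = ma g' * al%:Z by have := congr1 ma eA; rewrite /= mulr0 addr0.
have ecc : mc g = mc g' * al%:Z by have := congr1 mc eA; rewrite /= mulr0 addr0.
exists al, de, be; have em : (al * de)%N = m by move: e1; rewrite dA => -[].
split=> //.
  apply/eqP; rewrite eqn_dvd dvdn_gcd -{1}em dvdn_mulr //=; apply/andP; split.
    by rewrite ecc abszM dvdn_mull.
  have : ((gcdn m `|mc g|)%:Z %| al%:Z)%Z.
    have -> : al%:Z = m%:Z * ma g * md g' - mc g * mb g' by rewrite eaa ecc -[LHS]mulr1 -d' /m2det; ring.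
    by apply: rpredB; apply: dvdz_mulr; [apply: dvdz_mulr|]; rewrite dvdzE /= ?dvdn_gcdl ?dvdn_gcdr.
  by rewrite dvdzE.
move=> t t0; pose z := (al%:R * t + be%:~R) / de%:R : C.
have z0 : upper z by exact: upper_tri.
have dn : (de%:R : C) != 0 by exact: natC0.
have B0 : 0 < m2det (M2 al be 0 de) by rewrite /m2det /= mulr0 subr0 -PoszM ltz_nat muln_gt0 a0.
have zE : mob (M2 al be 0 de) t = z by rewrite /mob /moebius /= mul0r add0r.
have jE : jf (M2 al be 0 de) t = de%:R by rewrite /jf /= mul0r add0r.
have [e2 e3] : mob A t = mob g' z /\ jf A t = jf g' z * de%:R.
  by rewrite eA -zE -jE; apply: mobM => //; rewrite d'.
have -> : m%:R * mob g t = mob A t.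
  by rewrite /mob /moebius /= !intrM mulrA mulrDr mulrA.
by rewrite e2 Delta_mod // -/z; congr (_ ^+ _ * _); rewrite -[jf g t]/(jf A t) e3 mulfK.
Qed.
Implicit Type l : seq (nat * int).
(** Quotients of Delta instead of eta carry no multiplier; the weight is 12 times [wtl]. *)
Definition EP l tau : C := \prod_(p <- l) Delta (p.1%:R * tau) ^ p.2.
Definition wtl l : int := \sum_(p <- l) p.2.
(** The classical order formula for eta quotients at a cusp of denominator c, in units of
    q^(1/N). *)
Definition ordl (N c : nat) l : int := \sum_(p <- l) p.2 * ((N %/ p.1)%N * gcdn p.1 c ^ 2)%N%:Z.
Lemma upper_natM (m : nat) tau : (0 < m)%N -> upper tau -> upper (m%:R * tau).
Proof. by move=> m0 t0; rewrite -[_ * _]addr0; apply: (upper_affint 0 t0 (n := m)). Qed.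
Lemma EP_Gamma0 N l (g : m2) tau : m2det g = 1 -> (N%:Z %| mc g)%Z -> all (fun p => (0 < p.1)%N && (p.1 %| N)%N) l ->
  upper tau -> EP l (mob g tau) = jf g tau ^ (12 * wtl l) * EP l tau.
Proof.
move=> dg Nc; rewrite /EP /wtl => h t0; have j0 : jf g tau != 0 by apply: jf_neq0; rewrite ?dg.
elim: l h => [|[m e] l IH] /=; first by rewrite !big_nil mulr0 expr0z mul1r.
move=> /andP[/andP[m0 mN] /IH {}IH]; rewrite !big_cons /= IH mulrDr expfzDr // mulrACA; congr (_ * _).
have mN' : (m%:Z %| N%:Z)%Z by rewrite dvdzE.
have [q eq] := dvdzP (dvdz_trans mN' Nc).
pose g' := M2 (ma g) (m%:Z * mb g) q (md g).
have dg' : m2det g' = 1 by rewrite -dg /m2det /= eq; ring.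
have -> : m%:R * mob g tau = mob g' (m%:R * tau).
  rewrite /mob /moebius /= eq !intrM -!pmulrn -[q%:~R * m%:R * tau]mulrA; ring.
have um := upper_natM m0 t0; rewrite Delta_mod //.
have -> : jf g' (m%:R * tau) = jf g tau by rewrite /jf /= eq intrM -pmulrn mulrA.
by rewrite expfzMl exprnP exprz_exp.
Qed.
Lemma EP_slash N l (g : m2) : (0 < N)%N -> ~~ (ell %| N)%N -> m2det g = 1 ->
  all (fun p => (0 < p.1)%N && (p.1 %| N)%N) l ->
  exists u, qu N (ordl N `|mc g| l) u (fun tau => EP l (mob g tau) * jf g tau ^ (- (12 * wtl l))).
Proof.
move=> N0 lN dg; rewrite /EP /wtl /ordl; elim: l => [|[m e] l IH] /=.
  move=> _; exists 1; rewrite big_nil; apply: (qu_ext (h := fun=> 1)).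
    by move=> t t0; rewrite !big_nil mulr0 oppr0 expr0z mulr1.
  by apply: quC; rewrite ?invr1 ?oner_neq0 //; exact: O1.
move=> /andP[/andP[m0 mN] /IH [u Hu]].
have [al [de [be [a0 d0 em eal H]]]] := Delta_slash m0 dg.
have deN : (de %| N)%N by apply: dvdn_trans mN; rewrite -em dvdn_mull.
have ld : ~~ (ell %| de)%N by apply: contra lN => /dvdn_trans; apply.
have dn : (de%:R : C) != 0 by exact: natC0.
have q0 : (0 < N %/ de)%N by rewrite divn_gt0 // dvdn_leq.
have H2 := qu_tri be (isT : 0 < 1)%N a0 d0 qu_Delta.
rewrite mul1n in H2; have H3 := qu_lift d0 q0 H2; rewrite mulnC divnK // in H3.
have HC : qu N 0 (de%:R ^- 12) (fun=> de%:R ^- 12).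
  apply: quC; rewrite ?invr_eq0 ?expf_neq0 ?invrK //; first by rewrite -exprVn; apply: OX => //; exact: O_inv.
  by apply: OX => //; exact: O_nat.
have H4 := quM (quXz e (quM HC H3)) Hu.
exists ((de%:R ^- 12 * (ee (1%:~R * (be%:~R / de%:R)) * 1)) ^ e * u); rewrite big_cons /=.
rewrite (_ : e * _ = (0 + (N %/ de)%N%:Z * (al%:Z * 1)) * e); last first.
  rewrite add0r mulr1 -PoszM mulrC -eal; congr (Posz _ * _).
  have -> : (N %/ de = N %/ m * al)%N by rewrite -{1}(divnK mN) -{2}em mulnA mulnK.
  by rewrite -mulnA mulnn.
apply: qu_ext H4 => t t0; rewrite !big_cons /=; have j0 : jf g t != 0 by apply: jf_neq0; rewrite ?dg.
rewrite H //; pose X := de%:R ^- 12 * Delta ((al%:R * t + be%:~R) / de%:R) : C; rewrite -/X.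
set S := \sum_(p <- l) p.2; set P := \prod_(p <- l) _.
have -> : (jf g t / de%:R) ^+ 12 * Delta ((al%:R * t + be%:~R) / de%:R) = jf g t ^+ 12 * X.
  by rewrite /X exprMn exprVn [RHS]mulrA.
clearbody X; rewrite expfzMl (exprnP (jf g t)) exprz_exp.
have -> : jf g t ^ (- (12%:Z * S)) = jf g t ^ (12%:Z * e) * jf g t ^ (- (12%:Z * (e + S))).
  by rewrite -expfzDr //; congr (_ ^ _); ring.
by ring.
Qed.
End EtaProducts.

Lemma gcdn_mul_coprime (m n c : nat) : coprime m n -> gcdn (m * n) c = (gcdn m c * gcdn n c)%N.
Proof.
move=> cmn; apply/eqP; rewrite eqn_dvd; apply/andP; split.
  rewrite muln_gcdr !muln_gcdl !dvdn_gcd dvdn_gcdl /= dvdn_mulr ?dvdn_gcdr //= dvdn_mull ?dvdn_gcdr //=.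
  by rewrite dvdn_mulr // dvdn_gcdr.
have cg : coprime (gcdn m c) (gcdn n c).
  by apply: (coprime_dvdl (dvdn_gcdl m c)); apply: (coprime_dvdr (dvdn_gcdl n c)).
by rewrite Gauss_dvd // !dvdn_gcd !dvdn_gcdr !andbT dvdn_mulr ?dvdn_gcdl //= dvdn_mull ?dvdn_gcdl.
Qed.
(** With [m] standing for Delta(m tau), this expands the product over p of p [p^2] - [p]. The factor
    of p contributes gcd(p^2, c)^2 - gcd(p, c)^2 to the order, which is 0 unless p^2 divides c: all
    zeros lie at infinity, although the weight is positive. *)
Fixpoint dl (s : seq nat) : seq (nat * int) :=
  if s is p :: s' then [seq ((p ^ 2 * x.1)%N, p%:Z * x.2) | x <- dl s'] ++ [seq ((p * x.1)%N, - x.2) | x <- dl s']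
  else [:: (1%N, 1)].
Definition lprod (s : seq nat) : nat := (\prod_(p <- s) p)%N.
Lemma lprod_cons p s : lprod (p :: s) = (p * lprod s)%N. Proof. by rewrite /lprod big_cons. Qed.
Lemma cop_lprod p s : prime p -> all prime s -> p \notin s -> coprime p (lprod s).
Proof.
move=> pp; elim: s => [|q s IH] /=; first by rewrite /lprod big_nil coprimen1.
case/andP => pq ps; rewrite inE negb_or => /andP[ne ns]; rewrite lprod_cons coprimeMr IH // andbT.
by rewrite prime_coprime // dvdn_prime2.
Qed.
Definition nsq (s : seq nat) := (lprod s ^ 2)%N.
Lemma nsq_cons p s : nsq (p :: s) = (p ^ 2 * nsq s)%N.
Proof. by rewrite /nsq lprod_cons expnMn. Qed.
Lemma dl_dvd s : all prime s -> all (fun x => (0 < x.1)%N && (x.1 %| nsq s)%N) (dl s).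
Proof.
elim: s => [|p s IH] /=; first by rewrite dvd1n.
move=> /andP[pp /IH h]; rewrite all_cat !all_map; have p0 := prime_gt0 pp.
apply/andP; split; apply: sub_all h => -[m e] /= /andP[m0 mN]; rewrite muln_gt0 ?expn_gt0 p0 m0 nsq_cons /=.
  by rewrite dvdn_mul.
by apply: dvdn_mul => //; rewrite expnS dvdn_mulr.
Qed.
Lemma dl_coprime s q : prime q -> all prime s -> q \notin s -> all (fun x => coprime q x.1) (dl s).
Proof.
move=> pq; elim: s => [|p s IH] /=; first by rewrite coprimen1.
move=> /andP[pp ps]; rewrite inE negb_or => /andP[qp qs]; rewrite all_cat !all_map.
have cqp : coprime q p by rewrite prime_coprime // dvdn_prime2.
by apply/andP; split; apply: sub_all (IH ps qs) => -[m e] /= h; rewrite coprimeMr h andbT ?coprimeXr.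
Qed.
Lemma ordl_dl s c : all prime s -> uniq s -> ordl (nsq s) c (dl s) =
  \prod_(p <- s) (p%:Z * ((gcdn (p ^ 2) c)%:Z ^+ 2 - (gcdn p c)%:Z ^+ 2)).
Proof.
elim: s => [|p s IH]; first by rewrite /ordl /nsq /lprod !big_nil big_seq1 /= gcd1n.
move=> ps us; have /andP[pp pss] := ps; have /andP[pns uss] := us.
rewrite big_cons -IH // /ordl /= big_cat !big_map /= -big_split /= mulr_sumr big_seq [in RHS]big_seq.
apply: eq_bigr => -[m e] xin; have /andP[/= m0 mN] := allP (dl_dvd pss) _ xin.
have cpm := allP (dl_coprime pp pss pns) _ xin; rewrite /= in cpm *; have p0 := prime_gt0 pp.
rewrite (gcdn_mul_coprime _ (coprimeXl 2 cpm)) (gcdn_mul_coprime _ cpm) nsq_cons.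
rewrite divnMl ?expn_gt0 ?p0 // (_ : p ^ 2 * nsq s = p * (p * nsq s))%N; last by rewrite expnS expn1 mulnA.
rewrite divnMl // -muln_divA // !PoszM; move: (nsq s %/ m)%N (gcdn (p ^ 2) c) (gcdn p c) (gcdn m c) => a b d g.
by ring.
Qed.
Lemma dl_ord0 s c : all prime s -> uniq s -> ~~ (nsq s %| c)%N -> ordl (nsq s) c (dl s) = 0.
Proof.
move=> ps us nd; rewrite ordl_dl //.
have [|] := boolP (all (fun p => (p ^ 2 %| c)%N) s); last first.
  rewrite -has_predC => /hasP[p pin /= np]; rewrite (big_rem p) //=.
  suff -> : gcdn (p ^ 2) c = gcdn p c by rewrite subrr mulr0 mul0r.
  have pp := allP ps _ pin.
  apply/eqP; rewrite eqn_dvd !dvdn_gcd !dvdn_gcdr !andbT; apply/andP; split; last first.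
    by apply: (dvdn_trans (dvdn_gcdl _ _)); rewrite expnS dvdn_mulr.
  have [m] := dvdn_pfactor _ _ pp (dvdn_gcdl (p ^ 2) c); case: m => [|[|[|//]]] _ e; rewrite e ?dvd1n ?expn1 //.
  by case/negP: np; rewrite -e dvdn_gcdr.
move=> h; case/negP: nd; elim: s ps us h => [|p s IH] /=; first by rewrite /nsq /lprod big_nil dvd1n.
move=> /andP[pp ps] /andP[pns us] /andP[pc h]; rewrite nsq_cons Gauss_dvd ?pc ?IH //.
by rewrite coprimeXl // coprimeXr //; exact: cop_lprod.
Qed.
Lemma wtl_dl s : all prime s -> 0 < wtl (dl s).
Proof.
elim: s => [|p s IH] /=; first by rewrite /wtl big_seq1.
move=> /andP[pp /IH h]; rewrite /wtl big_cat !big_map /= -mulr_sumr sumrN -/(wtl (dl s)).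
have := prime_gt1 pp; move: (wtl _) h => w w0 p1; nia.
Qed.
Lemma ordl_cat N c l l' : ordl N c (l ++ l') = ordl N c l + ordl N c l'.
Proof. by rewrite /ordl big_cat. Qed.
Lemma wtl_cat l l' : wtl (l ++ l') = wtl l + wtl l'.
Proof. by rewrite /wtl big_cat. Qed.
Definition scl (k : int) (l : seq (nat * int)) := [seq (x.1, k * x.2) | x <- l].
Lemma ordl_scl N c k l : ordl N c (scl k l) = k * ordl N c l.
Proof. by rewrite /ordl big_map mulr_sumr; apply: eq_bigr => x _; rewrite mulrA. Qed.
Lemma wtl_scl k l : wtl (scl k l) = k * wtl l.
Proof. by rewrite /wtl big_map mulr_sumr. Qed.
Lemma ordl_le N l : all (fun x => (0 < x.1)%N) l -> exists B : nat, forall c, ordl N c l <= B%:Z.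
Proof.
elim: l => [|[m e] l IH] /=; first by exists 0%N => c; rewrite /ordl big_nil.
move=> /andP[m0 /IH[B HB]]; exists (`|e| * (N * m ^ 2) + B)%N => c; rewrite /ordl big_cons /= PoszD.
apply: lerD (HB c); apply: (@le_trans _ _ (`|e| * (N %/ m * gcdn m c ^ 2)%N%:Z)); first by rewrite ler_wpM2r // ler_norm.
rewrite [X in _ <= X]PoszM abszE ler_wpM2l // lez_nat leq_mul ?leq_div // leq_exp2r //.
by rewrite dvdn_leq ?dvdn_gcdl.
Qed.

(** * The trace from Gamma_0(N) to level one *)

Section Trace.
Variable N : nat.
Hypothesis N0 : (0 < N)%N.
(** Encodes the coset of g under Gamma_0(N) as a finite set: the pairs modulo N proportional to the
    bottom row of g. *)
Definition lab (g : m2) : {set 'I_N * 'I_N} := [set p | (N%:Z %| (val p.1)%:Z * md g - (val p.2)%:Z * mc g)%Z].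
Lemma lab_sub (g g' : m2) : m2det g = 1 -> (N%:Z %| mc g * md g' - md g * mc g')%Z -> lab g \subset lab g'.
Proof.
move=> dg h; apply/fintype.subsetP => -[x y]; rewrite !inE /= => k.
rewrite -[X in (_ %| X)%Z]mul1r -dg /m2det.
have -> : (ma g * md g - mb g * mc g) * (x%:Z * md g' - y%:Z * mc g') =
   (ma g * md g' - mb g * mc g') * (x%:Z * md g - y%:Z * mc g) + (mc g * md g' - md g * mc g') * (y%:Z * ma g - x%:Z * mb g) by ring.
by apply: rpredD; [apply: dvdz_mull|apply: dvdz_mulr].
Qed.
Lemma lab_eq (g g' : m2) : m2det g = 1 -> m2det g' = 1 ->
  (lab g = lab g') <-> (N%:Z %| mc g * md g' - md g * mc g')%Z.
Proof.
move=> dg dg'; split=> [e|h]; last first.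
  apply/eqP; rewrite finset.eqEsubset !lab_sub //.
  by rewrite (_ : mc g' * md g - md g' * mc g = - (mc g * md g' - md g * mc g')) ?rpredN //; ring.
have lt (c : int) : (`|(c %% N)%Z| < N)%N.
  have := ltz_pmod c (_ : 0 < N%:Z); have := modz_ge0 c (_ : N%:Z != 0); lia.
pose p := (Ordinal (lt (mc g)), Ordinal (lt (md g))).
have E (c : int) : (`|(c %% N)%Z|%N)%:Z = (c %% N)%Z by rewrite gez0_abs // modz_ge0 //; lia.
have pE (g1 : m2) : (p \in lab g1) = (N%:Z %| mc g * md g1 - md g * mc g1)%Z.
  rewrite inE /= !E -[in RHS](subrK ((mc g %% N)%Z * md g1 - (md g %% N)%Z * mc g1) (_ - _)).
  rewrite [RHS]rpredDl //.
  have -> : mc g * md g1 - md g * mc g1 - ((mc g %% N)%Z * md g1 - (md g %% N)%Z * mc g1) =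
     (mc g - (mc g %% N)%Z) * md g1 - (md g - (md g %% N)%Z) * mc g1 by ring.
  have D (c : int) : (N%:Z %| c - (c %% N)%Z)%Z by rewrite {1}(divz_eq c N) addrK dvdz_mull.
  by rewrite rpredB // dvdz_mulr.
have : p \in lab g by rewrite pE mulrC subrr dvdz0.
by rewrite e pE.
Qed.
Definition Lset : {set {set 'I_N * 'I_N}} := [set X | `[< exists g, m2det g = 1 /\ X = lab g >]].
Definition rep (X : {set 'I_N * 'I_N}) : m2 := 
  if pselect (exists g, m2det g = 1 /\ X = lab g) is left h then projT1 (cid h) else M2 1 0 0 1.
Lemma repP X : X \in Lset -> m2det (rep X) = 1 /\ lab (rep X) = X.
Proof.
rewrite inE => /asboolP h; rewrite /rep; case: pselect => // h'.
by case: (cid h') => g [d e] /=.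
Qed.
Lemma lab_in (g : m2) : m2det g = 1 -> lab g \in Lset.
Proof. by move=> dg; rewrite inE; apply/asboolP; exists g. Qed.
Variable R : realType.
Local Notation C := (R[i]).
Variables (Psi : C -> C) (kap : int).
Hypothesis PsiG : forall (g : m2) tau, m2det g = 1 -> (N%:Z %| mc g)%Z -> upper tau ->
  Psi (mob g tau) = jf g tau ^ kap * Psi tau.
Definition sl (g : m2) (tau : C) := Psi (mob g tau) * jf g tau ^ (- kap).
Lemma slM (g h : m2) tau : m2det g = 1 -> m2det h = 1 -> upper tau ->
  sl (m2mul g h) tau = sl g (mob h tau) * jf h tau ^ (- kap).
Proof.
move=> dg dh t0; have [] := @mobM R g h tau; rewrite ?dg ?dh // => e1 e2.
by rewrite /sl e1 e2 expfzMl mulrA.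
Qed.
Lemma sl_lab (g g' : m2) tau : m2det g = 1 -> m2det g' = 1 -> lab g = lab g' -> upper tau -> sl g tau = sl g' tau.
Proof.
move=> dg dg' /lab_eq => /(_ dg dg') h t0.
pose dlt := m2mul g' (M2 (md g) (- mb g) (- mc g) (ma g)).
have dd : m2det dlt = 1 by rewrite m2detM dg' mul1r -dg /m2det /=; ring.
have e : g' = m2mul dlt g.
  move: dg; rewrite /dlt /m2mul /m2det /=; case: (g) (g') => a b c d [a' b' c' d'] /= dg; congr M2.
  - by rewrite -[LHS]mulr1 -dg; ring.
  - by rewrite -[LHS]mulr1 -dg; ring.
  - by rewrite -[LHS]mulr1 -dg; ring.
  - by rewrite -[LHS]mulr1 -dg; ring.
have ug : upper (mob g tau) by apply: upper_mob; rewrite ?dg.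
have jn : jf dlt (mob g tau) != 0 by apply: jf_neq0; rewrite ?dd.
have hd : (N%:Z %| mc dlt)%Z.
  have -> : mc dlt = - (mc g * md g' - md g * mc g') by rewrite /dlt /=; ring.
  by rewrite rpredN; exact: h.
rewrite e slM // /sl (PsiG dd hd ug); congr (_ * _).
by rewrite mulrAC -expfzDr // subrr expr0z mul1r.
Qed.
Definition Tr tau := \sum_(X in Lset) sl (rep X) tau.
Lemma Tr_act (g : m2) tau : m2det g = 1 -> upper tau -> Tr (mob g tau) * jf g tau ^ (- kap) = Tr tau.
Proof.
move=> dg t0; rewrite /Tr mulr_suml.
pose f X := lab (m2mul (rep X) g).
have dM X : X \in Lset -> m2det (m2mul (rep X) g) = 1 by case/repP => d _; rewrite m2detM d dg.
have fL X : X \in Lset -> f X \in Lset by move=> /dM; exact: lab_in.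
have finj : {in Lset &, injective f}.
  move=> X Y XL YL /lab_eq; have [dX eX] := repP XL; have [dY eY] := repP YL.
  rewrite !m2detM dX dY dg => /(_ (mulr1 1) (mulr1 1)) h; rewrite -eX -eY; apply/lab_eq => //.
  move: h; congr (_ \in dvdz _); rewrite /= -[RHS]mul1r -dg /m2det; ring.
have fim : f @: Lset = Lset.
  by apply/eqP; rewrite eqEcard card_in_imset // leqnn andbT; apply/fintype.subsetP => _ /finset.imsetP[X XL ->]; exact: fL.
rewrite -[in RHS]fim big_imset //=; apply: eq_bigr => X XL; have [dX eX] := repP XL.
have [d1 e1] := repP (fL _ XL); rewrite -slM //; apply: sl_lab => //; first exact: dM.
Qed.
Lemma modf_Tr : 0 <= kap -> modf `|kap| Tr.
Proof.
move=> k0; split=> t t0.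
  have e1 : mob (M2 1 1 0 1) t = t + 1 by rewrite /mob /moebius /= mul1r mul0r add0r divr1.
  have e2 : jf (M2 1 1 0 1) t = 1 by rewrite /jf /= mul0r add0r.
  by have := @Tr_act (M2 1 1 0 1) t erefl t0; rewrite e1 e2 exp1rz mulr1.
have tn := upper_neq0 t0.
have e1 : mob (M2 0 (-1) 1 0) t = - t^-1 by rewrite /mob /moebius /= mul0r add0r mul1r addr0 mulrNz mulN1r.
have e2 : jf (M2 0 (-1) 1 0) t = t by rewrite /jf /= mul1r addr0.
have := @Tr_act (M2 0 (-1) 1 0) t erefl t0; rewrite e1 e2 => <-.
rewrite (_ : t ^+ `|kap| = t ^ kap); last by rewrite -{2}(gez0_abs k0) exprnP.
have -> : t ^ kap * (Tr (- t^-1) * t ^ (- kap)) = (t ^ kap * t ^ (- kap)) * Tr (- t^-1) by rewrite mulrCA mulrC.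
by rewrite -expfzDr // subrr expr0z mul1r.
Qed.
End Trace.

(** The bottom row is then proportional to (1, j) modulo N: these are the cosets over the cusp 0. *)
Lemma coprime_lab (N : nat) (g : m2) : m2det g = 1 ->
  coprime N `|mc g| <-> exists j : int, (N%:Z %| mc g * j - md g)%Z.
Proof.
move=> dg; split=> [cp|[j h]].
  have [x [y e]] := Bezoutz (mc g) N%:Z; have e1 : x * mc g + y * N%:Z = 1.
    by rewrite e /gcdz /= gcdnC; move: cp; rewrite /coprime => /eqP ->.
  exists (x * md g); rewrite (_ : _ - _ = - (md g * y) * N%:Z) ?dvdz_mull //.
  by rewrite -[in LHS](mulr1 (md g)) -{2}e1; ring.
rewrite /coprime -dvdn1.
have d1 : ((gcdn N `|mc g|)%:Z %| mc g)%Z by rewrite dvdzE /= dvdn_gcdr.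
have d2 : ((gcdn N `|mc g|)%:Z %| md g)%Z.
  rewrite -(subKr (mc g * j) (md g)); apply: rpredB; first exact: dvdz_mulr.
  by apply: dvdz_trans h; rewrite dvdzE /= dvdn_gcdl.
have : ((gcdn N `|mc g|)%:Z %| m2det g)%Z by rewrite /m2det; apply: rpredB; apply: dvdz_mull.
by rewrite dg dvdzE.
Qed.
Definition STg (j : int) : m2 := m2mul (M2 0 (-1) 1 0) (M2 1 j 0 1).
Lemma STg_det j : m2det (STg j) = 1. Proof. by rewrite m2detM /m2det /=; ring. Qed.
Lemma STg_lab (N : nat) (g : m2) (j : int) : (0 < N)%N -> m2det g = 1 ->
  lab N g = lab N (STg j) <-> (N%:Z %| mc g * j - md g)%Z.
Proof.
move=> N0 dg; rewrite (lab_eq N0 dg (STg_det j)) /=.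
by rewrite (_ : _ - _ = mc g * j - md g) //; ring.
Qed.
(** The cusp 0 has width N: its cosets are those of S T^j for 0 <= j < N, pairwise distinct. *)
Lemma card_cop (N : nat) : (0 < N)%N -> #|[set X in Lset N | coprime N `|mc (rep X)|]| = N.
Proof.
move=> N0; pose f (j : 'I_N) := lab N (STg j%:Z).
have finj : injective f.
  move=> i j /(STg_lab _ N0 (STg_det _)) /=.
  rewrite (_ : _ - _ = j%:Z - i%:Z); last by ring.
  move=> h; apply/val_inj; have := ltn_ord i; have := ltn_ord j; move: h => /=.
  move: (nat_of_ord i) (nat_of_ord j) => {}i {}j; rewrite dvdzE => h ji ii.
  have [->|ne] := eqVneq i j; first by [].
  by have := dvdn_leq _ h; lia.
rewrite -[RHS]card_ord -(card_imset _ finj); apply: eq_card => X; rewrite inE.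
apply/andP/finset.imsetP => [[XL cp]|[j _ ->]]; last first.
  have XL := lab_in N (STg_det j%:Z); split=> //; have [dg eg] := repP XL.
  by apply/(coprime_lab _ dg); exists j%:Z; apply/(STg_lab _ N0 dg).
have [dg eg] := repP XL; have [j hj] := (coprime_lab _ dg).1 cp.
have lt : (`|(j %% N)%Z| < N)%N.
  have := @ltz_pmod j N%:Z; have := @modz_ge0 j N%:Z; lia.
exists (Ordinal lt) => //; rewrite -eg /f; apply/(STg_lab _ N0 dg) => /=.
rewrite gez0_abs ?modz_ge0 //; last by lia.
rewrite (_ : _ - _ = (mc (rep X) * j - md (rep X)) - mc (rep X) * (j %/ N)%Z * N%:Z).
  by apply: rpredB => //; apply: dvdz_mull.
by rewrite {2}(divz_eq j N%:Z); ring.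
Qed.

(** * Carrying a congruence from the cusp infinity to the cusp 0 *)

Section Transfer.
Variable R : realType.
Local Notation C := (R[i]).
Implicit Types (tau z : C) (c d : nat -> C) (h : C -> C) (L : nat) (m : int).
Variable ell : nat.
Hypothesis pell : prime ell.
Hypothesis ell5 : (5 <= ell)%N.
Local Notation O := (@in_Oell R ell).
Local Notation I := (@I_ R ell).
Local Notation qo := (@qo R ell).
Lemma ql_perN (N : nat) c h : (0 < N)%N -> ql (24 * N) 0 c h ->
  (forall tau, upper tau -> h (tau + N%:R) = h tau) -> forall n, ~~ (24 %| n)%N -> c n = 0.
Proof.
move=> N0 H hp n nd; have L0 : (0 < 24 * N)%N by rewrite muln_gt0.
have H1 := ql_tri (al := N) (de := 1) 0 L0 N0 isT H.
have L1 : (0 < 24 * N * 1)%N by rewrite muln1.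
have H2 hp' := @ql_per R _ _ _ _ L1 H1 hp' (N * n)%N.
have e : ((N%:Z * 0 + (N * n)%N%:Z) = (N * n)%N%:Z)%R by lia.
rewrite e {e} in H2; move: H2; rewrite trcE // dvdn_mulr // mulKn // !mul0r !ee0 mul1r expr1n mulr1; apply.
  by move=> t t0; rewrite !addr0 !divr1 mulrDr mulr1 hp //; exact: upper_natM.
by rewrite dvdzE /= muln1 mulnC dvdn_pmul2l.
Qed.
Variables (s : seq nat) (w : nat) (H : C -> C).
Hypotheses (ps : all prime s) (us : uniq s) (s0 : s != [::]) (ls : ~~ (ell %| nsq s)%N) (ew : ~~ odd w).
Local Notation N := (nsq s).
Hypothesis HG : forall (g : m2) tau, m2det g = 1 -> (N%:Z %| mc g)%Z -> upper tau ->
  H (mob g tau) = jf g tau ^+ w * H tau.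
Hypothesis HO : forall g : m2, m2det g = 1 -> exists c, ql (24 * N) 0 c (fun t => H (mob g t) * jf g t ^ (- w%:Z)) /\
  forall n, O (c n).
Hypothesis HI : exists c, ql (24 * N) 0 c H /\ forall n, I (c n).
Lemma N_gt0 : (0 < N)%N.
Proof. by rewrite expn_gt0 orbF /lprod big_seq; apply: prodn_cond_gt0 => p /(allP ps)/prime_gt0. Qed.
Lemma N_gt1 : (1 < N)%N.
Proof.
have := N_gt0; case: (s) s0 ps => [|p s'] //= _ /andP[pp _]; rewrite nsq_cons muln_gt0 => /andP[_ h].
by apply: (@leq_trans (p ^ 2)); [rewrite (@ltn_exp2l p 0 2) ?prime_gt1|rewrite leq_pmulr].
Qed.
Section Fixed.
Variables (sN K Rr n0 : nat).
Hypothesis e0 : (sN + n0 = N * n0.+1)%N.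
(** Delta(N tau)^sN has order sN/N at the cusp 0 and at least 4 sN/N where gcd(N, c) > 1. The power
    -K of [dl] lowers the weight at the price of poles at infinity only. Delta^Rr clears the poles,
    adding Rr to the orders and to Sturm's bound alike. By [e0] the index 24 n0 at the cusp 0
    becomes the integral exponent n0 + 1 + Rr. *)
Definition lst : seq (nat * int) := (N, sN%:Z) :: scl (- K%:Z) (dl s) ++ [:: (1%N, Rr%:Z)].
Definition kapz : int := w%:Z + 12 * wtl lst.
Lemma lst_ok : all (fun p => (0 < p.1)%N && (p.1 %| N)%N) lst.
Proof. by rewrite /= N_gt0 dvdnn /= all_cat all_map /= dvd1n /= andbT; exact: dl_dvd. Qed.
Lemma wtl_lst : wtl lst = sN%:Z - K%:Z * wtl (dl s) + Rr%:Z.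
Proof. by rewrite /lst -cat1s !wtl_cat wtl_scl /wtl !big_seq1 /= mulNr; ring. Qed.
Lemma ordl_lst (c : nat) : ordl N c lst = sN%:Z * (gcdn N c ^ 2)%N%:Z - K%:Z * ordl N c (dl s) + Rr%:Z * N%:Z.
Proof.
rewrite /lst -cat1s !ordl_cat ordl_scl {1 3}/ordl !big_seq1 /= divnn N_gt0 mul1n divn1 gcd1n exp1n muln1 mulNr; ring.
Qed.
Definition Psi tau := H tau * EP lst tau.
Lemma PsiG (g : m2) tau : m2det g = 1 -> (N%:Z %| mc g)%Z -> upper tau -> Psi (mob g tau) = jf g tau ^ kapz * Psi tau.
Proof.
move=> dg Ng t0; have jn : jf g tau != 0 by apply: jf_neq0; rewrite ?dg.
by rewrite /Psi HG // (EP_Gamma0 dg Ng lst_ok t0) /kapz expfzDr // -exprnP mulrACA.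
Qed.
(* coefficients of [Psi | g] : those of [H | g] times a unit series of order [ordl] *)
Lemma Psi_slash (g : m2) : m2det g = 1 -> 0 <= ordl N `|mc g| lst -> exists (u : nat -> C),
  [/\ forall n, O (u n), u 0%N != 0 /\ O (u 0%N)^-1 &
   forall c, ql (24 * N) 0 c (fun t => H (mob g t) * jf g t ^ (- w%:Z)) ->
   ql (24 * N) 0 (fun n => if (24 * `|ordl N `|mc g| lst| <= n)%N then conv c u (n - 24 * `|ordl N `|mc g| lst|)%N else 0)
      (sl Psi kapz g)].
Proof.
move=> dg o0; have [v Hv] := @EP_slash R ell pell N lst g N_gt0 ls dg lst_ok.
have [v0 [u [Hu ou u0]] [u' [_ ou' u0']]] := qu_lift pell N_gt0 (isT : 0 < 24)%N Hv.
exists u; split; [exact: ou|by rewrite u0 v0 -u0'; split; [|exact: ou']|].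
move=> c Hc; rewrite mulnC in Hu; have H1 := qlM Hc Hu.
have H2 := @ql_shift R (24 * N) 0 (24 * `|ordl N `|mc g| lst|) (conv c u) _; apply: H2.
rewrite add0r PoszM gez0_abs //; rewrite add0r in H1; apply: ql_eq H1 => // t t0.
have jn : jf g t != 0 by apply: jf_neq0; rewrite ?dg.
rewrite /sl /Psi /kapz opprD expfzDr //; ring.
Qed.
Hypotheses (hK : (w + sN + 3 <= K)%N) (hR : forall c : nat, K%:Z * ordl N c (dl s) <= Rr%:Z)
  (hR2 : K%:Z * wtl (dl s) <= Rr%:Z).
Variable b : nat -> C.
Hypothesis Hb : ql (24 * N) 0 b (fun t => H (- t^-1) * t ^ (- w%:Z)).
Hypothesis Ib : forall n, (n < 24 * n0)%N -> I (b n).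
Lemma ord_ge0 (c : nat) : 0 <= ordl N c lst.
Proof.
have N1 := N_gt0; rewrite ordl_lst; have := hR c; move: (K%:Z * _) => x hx.
have : Rr%:Z <= Rr%:Z * N%:Z by rewrite -{1}[Rr%:Z]mulr1 ler_wpM2l // lez_nat.
have : 0 <= sN%:Z * (gcdn N c ^ 2)%N%:Z by rewrite mulr_ge0.
lia.
Qed.
Lemma sN_gt : (n0 < sN)%N. Proof. have := N_gt1; have := e0; nia. Qed.
Lemma kapz_ge0 : 0 <= kapz. Proof. by rewrite /kapz wtl_lst; move: hR2; lia. Qed.
Local Notation Sg := (M2 0 (-1) 1 0).
Lemma TE (j : int) (t : C) : mob (M2 1 j 0 1) t = t + j%:~R /\ jf (M2 1 j 0 1) t = 1.
Proof. by rewrite /mob /moebius /jf /= mul1r mul0r add0r divr1. Qed.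
Lemma SE (t : C) : mob Sg t = - t^-1 /\ jf Sg t = t.
Proof. by rewrite /mob /moebius /jf /= mul0r add0r mul1r addr0 mulrNz mulN1r. Qed.
Lemma ordl_lst1 : `|ordl N 1 lst|%N = (sN + Rr * N)%N.
Proof.
rewrite ordl_lst dl_ord0 ?dvdn1 ?(gtn_eqF N_gt1) //.
by rewrite gcdn1 exp1n mulr0 subr0 mulr1 -PoszM -PoszD.
Qed.
Lemma HbS : ql (24 * N) 0 b (fun t => H (mob Sg t) * jf Sg t ^ (- w%:Z)).
Proof. by apply: ql_eq Hb => // t t0; case: (SE t) => -> ->. Qed.
Lemma L_gt0 : (0 < 24 * N)%N. Proof. by rewrite muln_gt0 N_gt0. Qed.
Lemma Ob n : O (b n).
Proof. by have [c2 [H2 o2]] := HO (erefl : m2det Sg = 1); rewrite (ql_inj L_gt0 HbS H2). Qed.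
Definition cSl (u : nat -> C) n := if (24 * (sN + Rr * N) <= n)%N then conv b u (n - 24 * (sN + Rr * N))%N else 0.
(** If c is prime to N, the expansion is a translate of the one at 0 and agrees with it at integral
    exponents. If N divides c, it comes from H at infinity and vanishes modulo [ell]. Otherwise
    gcd(N, c) >= 2 puts its order, at least 4 sN before the common shift, beyond the range, because
    n0 < sN. *)
Lemma coset_coef u : (forall n, O (u n)) -> ql (24 * N) 0 (cSl u) (sl Psi kapz Sg) ->
  forall X, exists c, X \in Lset N -> [/\ ql (24 * N) 0 c (sl Psi kapz (rep X)), forall n, O (c n),
    forall e, coprime N `|mc (rep X)| -> c (24 * N * e)%N = cSl u (24 * N * e)%N &
    forall n, ~~ coprime N `|mc (rep X)| -> (n <= 24 * (n0 + (sN + Rr * N)))%N -> I (c n)].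
Proof.
move=> ou HcS X; have N1 := N_gt0; have N2 := N_gt1; have sg := sN_gt; have L0 := L_gt0.
have [XL|] := boolP (X \in Lset N); last by exists (fun=> 0).
have [dg eg] := repP XL; move: (rep X) dg eg => g dg eg.
have [v [ov [v0 ov0] Hv]] := Psi_slash dg (ord_ge0 _).
have [c [Hc oc]] := HO dg.
have [cp|ncp] := boolP (coprime N `|mc g|).
  have [j hj] := (coprime_lab _ dg).1 cp; have lg := (STg_lab _ N1 dg).2 hj.
  have H1 := ql_tri (al := 1) (de := 1) j L0 isT isT HcS; rewrite muln1 in H1.
  set c1 := (fun n => _ * trc _ _ _ _ _ _) in H1.
  have c1E n : c1 n = cSl u n * ee (j%:~R / (24 * N)%N%:R) ^+ n.
    by rewrite /c1 trcE // dvd1n divn1 mul0r ee0 mul1r muln1.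
  have oS n : O (cSl u n) by rewrite /cSl; case: ifP => _; [apply: conv_O => // p; exact: Ob|exact: O0].
  exists c1 => _; split.
  - have dT : m2det (M2 1 j 0 1) = 1 by rewrite /m2det /= mulr0 subr0.
    apply: ql_eq H1 => // t t0.
    rewrite (sl_lab N1 PsiG dg (STg_det j) lg t0) /STg slM //; have [-> ->] := TE j t.
    by rewrite exp1rz mulr1 mul1r divr1.
  - by move=> n; rewrite c1E; apply: OM => //; apply: OX => //; exact: O_ee.
  - move=> e _; rewrite c1E -eeMn (_ : _ * (j%:~R / _) = (e%:Z * j)%:~R :> C); first by rewrite ee_int mulr1.
    by rewrite natrM intrM -pmulrn; field; rewrite pnatr_eq0 -lt0n.
  - by [].
have Hc' := Hv _ Hc; set c1 := (fun n => if _ then _ else _) in Hc'; exists c1 => _; split.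
- exact: Hc'.
- by move=> n; rewrite /c1; case: ifP => _; [exact: conv_O|exact: O0].
- by [].
move=> n _ le; rewrite /c1; case: ifP => // [le2|_]; last exact: I0.
have [dN|ndN] := boolP (N %| `|mc g|)%N.
  have [c0 [H0 I0']] := HI.
  have e1 : forall n, c n = c0 n.
    apply: (ql_inj L0 Hc); apply: ql_eq H0 => // t t0.
    have jn : jf g t != 0 by apply: jf_neq0; rewrite ?dg.
    by rewrite HG ?dvdzE // mulrAC exprnP -expfzDr // subrr expr0z mul1r.
  by apply: I_sum => // i _; apply: IMr => //; rewrite e1.
exfalso; have g2 : (2 <= gcdn N `|mc g|)%N.
  have : (0 < gcdn N `|mc g|)%N by rewrite gcdn_gt0 N1.
  by move: ncp; rewrite /coprime; lia.
have oE : `|ordl N `|mc g| lst|%N = (sN * gcdn N `|mc g| ^ 2 + Rr * N)%N.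
  by rewrite ordl_lst dl_ord0 // mulr0 subr0 -!PoszM -PoszD.
have g4 : (4 <= gcdn N `|mc g| ^ 2)%N by rewrite -[4%N]/(2 ^ 2)%N leq_exp2r.
have := leq_trans le2 le; rewrite oE leq_pmul2l //; move: (gcdn N _ ^ 2)%N g4 => q g4; nia.
Qed.
(** Below the exponent n0 + 1 + Rr the trace vanishes modulo [ell] by [Ib], and Sturm's bound is
    below Rr, so it vanishes entirely. Its coefficient at that exponent is N times b(24 n0) times a
    unit, up to terms already known to vanish. *)
Lemma fixed_step : I (b (24 * n0)).
Proof.
have N1 := N_gt0; have N2 := N_gt1; have sg := sN_gt; have L0 := L_gt0.
have [u [ou [u0 ou0] Hu]] := @Psi_slash Sg erefl (ord_ge0 _).
have {Hu} := Hu _ HbS; rewrite (_ : `|ordl N `|mc Sg| lst|%N = (sN + Rr * N)%N); last exact: ordl_lst1.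
rewrite -/(cSl u) => HcS; pose E0 := (n0.+1 + Rr)%N; set o1 := (sN + Rr * N)%N.
have eE0 : (N * E0 = n0 + o1)%N by rewrite /E0 /o1 mulnDr; have := e0; lia.
have [cc Hcc] := choice (coset_coef ou HcS).
have HT : ql (24 * N) 0 (fun n => \sum_(X in Lset N) cc X n) (Tr N Psi kapz).
  have := @ql_sum R (24 * N) 0 _ (enum (Lset N)) (fun X => if X \in Lset N then cc X else fun=> 0)
     (fun X => if X \in Lset N then sl Psi kapz (rep X) else fun=> 0) _.
  have F X : ql (24 * N) 0 (if X \in Lset N then cc X else fun=> 0) (if X \in Lset N then sl Psi kapz (rep X) else fun=> 0).
    by case: ifP => [/Hcc[]//|_]; exact: ql0.
  move=> /(_ F); apply: ql_eq => [n|t t0].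
  - by rewrite big_enum; apply: eq_bigr => X ->.
  - by rewrite /Tr big_enum; apply: eq_bigr => X ->.
have mT := modf_Tr N1 PsiG kapz_ge0.
have H1 := @ql_reduce R (24 * N) 0 _ _ L0 _ mT.1; rewrite mulr0 in H1; have {}H1 := H1 _ HT.
pose g e := \sum_(X in Lset N) cc X (24 * N * e)%N.
have gE e : (e <= E0)%N -> I (g e - N%:R * cSl u (24 * N * e)%N).
  move=> le; rewrite /g (bigID (fun X => coprime N `|mc (rep X)|)) /=.
  rewrite (eq_bigr (fun=> cSl u (24 * N * e)%N)) => [|X /andP[/Hcc[_ _ h _]]]; last exact: h.
  rewrite (eq_bigl (fun X => X \in [set X in Lset N | coprime N `|mc (rep X)|])) => [|X]; last by rewrite [RHS]inE.
  rewrite sumr_const (card_cop N1).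
  rewrite mulr_natl addrAC subrr add0r; apply: I_sum => // X /andP[/Hcc[_ _ _ h] ncp]; apply: h => //.
  by rewrite -mulnA leq_pmul2l // -eE0 leq_pmul2l.
have cI e : (e < E0)%N -> I (cSl u (24 * N * e)%N).
  move=> lt; rewrite /cSl; case: ifP => // [le|_]; last exact: I0.
  apply: I_sum => // i _; apply: IMr => //; apply: Ib; have := ltn_ord i; rewrite ltnS => li.
  apply: (leq_ltn_trans li); rewrite -mulnA -mulnBr ltn_pmul2l //.
  have : (N * e < N * E0)%N by rewrite ltn_pmul2l.
  rewrite eE0 -/o1; move: le; rewrite -mulnA leq_pmul2l //; rewrite -/o1; lia.
have gO e : O (g e) by apply: O_sum => // X /Hcc[_ h _ _]; exact: h.
have gI : forall e, I (g e).
  apply: (sturm pell ell5 _ mT H1 gO) => [|e he].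
    have := even_halfK ew; have := kapz_ge0; rewrite /kapz; move: (wtl lst) (w./2) => x h k0 hw.
    rewrite -hw in k0 *; rewrite (_ : absz (h.*2%:Z + 12 * x)%R = (absz (h%:Z + 6 * x)%R).*2) ?odd_double //.
    by move: k0; rewrite -!muln2; lia.
  (* From K >= w + sN + 3 and a positive weight of [dl]: [kapz] + 24 is below 12 Rr. *)
  have eR : (e < Rr)%N.
    move: he; have := kapz_ge0; have := wtl_dl ps; rewrite /kapz wtl_lst; move: (wtl (dl s)) hK => x k1 x0; nia.
  have lt : (e < E0)%N by rewrite /E0; lia.
  rewrite -/(g e) -(subrK (N%:R * cSl u (24 * N * e)%N) (g e)); apply: ID => //; first by apply: gE; exact: ltnW.
  by apply: IMl => //; [exact: O_nat|exact: cI].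
have : I (N%:R * cSl u (24 * N * E0)%N).
  by rewrite -[_ * _](subKr (g E0)); apply: IB => //; exact: gE.
move/(I_cancel pell ls); rewrite /cSl -mulnA eE0 -/o1 leq_pmul2l // leq_addl -mulnBr addnK /conv big_ord_recr /= subnn.
move=> h; have h2 : I (b (24 * n0)%N * u 0%N).
  rewrite -(addKr (\sum_(i < 24 * n0) b i * u (24 * n0 - i)%N) (_ * _)) addrC; apply: IB => //.
  by apply: I_sum => // i _; apply: IMr => //; exact: Ib.
by rewrite -(mulfK u0 (b _)); apply: IMr.
Qed.
End Fixed.
(** Strong induction on the index. Indices not divisible by 24 have coefficient exactly 0, since the
    form at the cusp 0 has period N; the others are settled by [fixed_step] with parameters adapted
    to the index. *)
Lemma transfer b : ql (24 * N) 0 b (fun t => H (- t^-1) * t ^ (- w%:Z)) -> forall n, I (b n).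
Proof.
move=> Hb; elim/ltn_ind => n IH; have N1 := N_gt0; have N2 := N_gt1.
have [/dvdnP[n0 en]|nd] := boolP (24 %| n)%N; last first.
  rewrite (ql_perN N1 Hb) //; first exact: I0.
  move=> t t0; have tn := upper_neq0 t0; have t1 := upper_S t0.
  have t2 : upper (t + N%:R) by have := upper_addR N%:R t0; rewrite rmorph_nat.
  have tn2 := upper_neq0 t2; pose g := M2 1 0 (- N%:Z) 1.
  have eg : mob g (- t^-1) = - (t + N%:R)^-1.
    by rewrite /mob /moebius /= mulrNz -pmulrn; field; rewrite tn tn2.
  have ej : jf g (- t^-1) = (t + N%:R) / t by rewrite /jf /= mulrNz -pmulrn; field.
  have dg : m2det g = 1 by rewrite /m2det /= mul0r subr0.
  have Ng : (N%:Z %| mc g)%Z by rewrite /= rpredN.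
  rewrite -eg HG // ej exprMn exprVn -!exprnN; field.
  by rewrite !expf_neq0.
rewrite mulnC in en; rewrite en; pose sN := (N * n0.+1 - n0)%N; pose K := (w + sN + 3)%N.
have aa : all (fun x : nat * int => (0 < x.1)%N) (dl s) by apply: sub_all (dl_dvd ps) => x /andP[].
have [B HB] := ordl_le N aa.
have e0 : (sN + n0 = N * n0.+1)%N by rewrite /sN subnK //; nia.
(* Large enough to make the orders at all cusps and the weight nonnegative after the division by the
   K-th power of [dl]. *)
pose Rr := (K * (B + `|wtl (dl s)|))%N.
apply: (@fixed_step sN K Rr n0 e0 _ _ _ b Hb) => //.
- move=> c; have := HB c; rewrite /Rr PoszM PoszD; move: (ordl _ _ _) => x hx.
  by apply: ler_wpM2l => //; lia.
- by rewrite /Rr PoszM PoszD; apply: ler_wpM2l => //; lia.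
- by move=> m lt; apply: IH; rewrite en.
Qed.
End Transfer.

(** * Residues modulo p and periodic sums *)

Lemma dvdz_Fp (p : nat) (x : int) : prime p -> (p%:Z %| x)%Z = (x%:~R == 0 :> 'F_p).
Proof.
move=> pp; have ch : p \in [pchar 'F_p] by exact: pchar_Fp.
case: x => n; first by rewrite dvdzE /= (dvdn_pcharf ch).
by rewrite NegzE mulrNz oppr_eq0 rpredN dvdzE /= (dvdn_pcharf ch).
Qed.
(** Otherwise the squares would be stable under subtracting k, hence every element of the field
    would be a square and squaring would be injective, although 1 and -1 have the same square. *)
Lemma nonsquare_shift (p : nat) (k : int) : prime p -> odd p -> ~~ (p%:Z %| k)%Z ->
  exists u : int, forall v : int, ~~ (p%:Z %| v ^+ 2 - (u ^+ 2 - k))%Z.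
Proof.
move=> pp op nk; apply: contrapT => H.
have toI (x : 'F_p) : x = (val x)%:~R by rewrite -pmulrn natr_Zp.
have H1 (u : 'F_p) : exists v : 'F_p, v ^+ 2 = u ^+ 2 - k%:~R.
  apply: contrapT => h; apply: H; exists (val u) => v; apply/negP => hv; apply: h; exists v%:~R.
  by apply/eqP; rewrite -subr_eq0; move: hv; rewrite dvdz_Fp // !rmorphB !rmorphXn /= -toI.
have H2 (j : nat) : exists v : 'F_p, v ^+ 2 = - (j%:R * k%:~R).
  elim: j => [|j [v hv]]; first by exists 0; rewrite mul0r oppr0 expr0n.
  by have [v' hv'] := H1 v; exists v'; rewrite hv' hv -natr1 mulrDl mul1r opprD.
have k0 : (k%:~R : 'F_p) != 0 by rewrite -dvdz_Fp.
have H3 (x : 'F_p) : exists v : 'F_p, v ^+ 2 = x.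
  have [v hv] := H2 (val (- x / k%:~R)); exists v; rewrite hv natr_Zp divfK //; exact: opprK.
have [g hg] := choice H3; have gi : injective g by move=> x y e; rewrite -(hg x) e hg.
have [g' _ gg'] := injF_bij gi.
have e1 : g' 1 = g' (-1) by rewrite -(hg (g' 1)) -(hg (g' (-1))) !gg' sqrrN.
have := gg' 1; rewrite e1 gg' => /esym/eqP; rewrite -subr_eq0 opprK -mulr2n -(dvdn_pcharf (pchar_Fp pp)) => /dvdn_leq; have := prime_gt1 pp.
by move: op; case: p pp {H toI H1 H2 k0 H3 g hg gi g' gg' e1 nk} => [|[|[|p]]] //; lia.
Qed.
Section PeriodMul.
Variable V : nmodType.
Lemma period_modz (F : int -> V) (M : nat) (x : int) : (forall x, F (x + M%:Z) = F x) -> F (x %% M)%Z = F x.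
Proof.
move=> hF; have H (n : nat) y : F (y + n%:Z * M%:Z) = F y.
  elim: n => [|n IH]; first by rewrite mul0r addr0.
  by rewrite intS mulrDl mul1r (addrC M%:Z) addrA hF.
rewrite {2}(divz_eq x M) addrC; case: (x %/ M)%Z => n; first by rewrite H.
by rewrite -[RHS](H n.+1) -addrA -mulrDl NegzE addNr mul0r addr0.
Qed.
Lemma period_mul (F : int -> V) (M : nat) (u : int) : (0 < M)%N -> coprime `|u| M -> (forall x, F (x + M%:Z) = F x) ->
  \sum_(x < M) F (u * x%:Z) = \sum_(x < M) F x%:Z.
Proof.
move=> M0 cu hF.
have lt (x : int) : (absz (x %% M)%Z < M)%N.
  have := @ltz_pmod x M%:Z; have := @modz_ge0 x M%:Z; lia.
have lE (x : int) : (absz (x %% M)%Z)%:Z = (x %% M)%Z by rewrite gez0_abs // modz_ge0 //; lia.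
pose h (x : 'I_M) := Ordinal (lt (u * x%:Z)).
have hi : injective h.
  move=> x y /(congr1 val)/= e; apply/val_inj => /=.
  have : (u * x%:Z == u * y%:Z %[mod M])%Z by apply/eqP; rewrite -(lE (u * x%:Z)) -(lE (u * y%:Z)) e.
  rewrite eqz_mod_dvd -mulrBr Gauss_dvdzr; last by rewrite /coprimez /gcdz /= gcdnC.
  rewrite dvdzE => d; have := ltn_ord x; have := ltn_ord y; move: d => /=.
  move: (nat_of_ord x) (nat_of_ord y) => {e}x {}y d yM xM.
  have [->//|ne] := eqVneq x y; have := dvdn_leq _ d; lia.
rewrite [RHS](reindex_inj hi); apply: eq_bigr => x _.
by rewrite /= lE period_modz.
Qed.
End PeriodMul.

(** * First properties of the cusp form *)

Section CuspForm.
Variable R : realType.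
Local Notation C := (R[i]).
Variable ell : nat.
Hypothesis pell : prime ell.
Local Notation O := (@in_Oell R ell).
Local Notation I := (@I_ R ell).
Implicit Types (tau z : C).
Lemma psqrt2 z : psqrt z ^+ 2 = z.
Proof. by rewrite /psqrt; case: ifP => _; rewrite ?sqrrN sqrtCK. Qed.
Lemma ee_int_eq1 (L : nat) (x : int) : (0 < L)%N -> ee (x%:~R / L%:R : C) = 1 -> (L%:Z %| x)%Z.
Proof.
move=> L0 e; rewrite (divz_eq x L) in e *; set y := (_ %% _)%Z in e *.
have y0 : 0 <= y by apply: modz_ge0; lia.
have yL : y < L%:Z by rewrite /y; apply: ltz_pmod.
rewrite intrD mulrDl intrM -pmulrn mulfK ?pnatr_eq0 -?lt0n // addrC eeDint in e.
rewrite rpredDr ?dvdz_mull //; case: (y) y0 yL e => // j _ jL e; apply/negPn/negP => nd.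
move/eqP: e; apply/negP; apply: (@ee_frac_eq1 R L j).
by rewrite ltz_nat in jL; rewrite jL andbT lt0n; apply: contraNneq nd => ->; exact: dvdz0.
Qed.
Variables (k2 r : int) (a : nat -> C).
Hypothesis cf : cusp_form ell k2 r a.
Hypothesis anz : exists n, a n != 0.
Local Notation f := (qseries a).
Lemma a_O n : O (a n). Proof. by case: cf. Qed.
(** Plain convergence at half the height bounds the terms there, hence dominates those at the given
    height by a geometric series. *)
Lemma ql_f : ql 24 0 a f.
Proof.
move=> tau t0; case: cf => _ _ hc _.
pose t1 : C := Complex (Re tau) (Im tau / 2).
have u1 : upper t1 by rewrite /upper /= divr_gt0.
pose q := nm (ee (t1 / 24%:R)); have q1 : q < 1 by exact: nm_ee_lt1.
have qE : nm (ee (tau / 24%:R)) = q ^+ 2.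
  rewrite /q !nm_ee -expRM_natl; congr expR.
  have E (z : C) : Im (z / 24%:R) = 24%:R^-1 * Im z.
    by rewrite -(rmorph_nat (real_complex R)) -(fmorphV (real_complex R)) mulrC -[_ * z]addr0 -(rmorph0 (real_complex R)) Im_affR.
  by rewrite !E /=; field.
have [B B0 HB] := cv_bound (cvgn_cv (hc _ u1)).
have tb n : nm (a n) * q ^+ n <= 2 * B.
  have -> : nm (a n) * q ^+ n = nm ((\sum_(i < n.+1) a i * qpow24 i t1) - \sum_(i < n) a i * qpow24 i t1).
    by rewrite big_ord_recr /= [X in _ = nm X]addrAC subrr add0r nmM qpow24E nmX.
  apply: (le_trans (nmB _ _)); have := HB n; have := HB n.+1; lra.
have as1 : asum (fun n => a n * ee (tau / 24%:R) ^+ n).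
  apply: (@asum_bsum _ _ (fun n => 2 * B * q ^+ n)); last first.
    by apply: bsumZ; [rewrite mulr_ge0 // ltW|apply: bsum_geo; rewrite nm_ge0].
  move=> n; rewrite nmM nmX qE -exprM mul2n -addnn exprD mulrA ler_wpM2r ?exprn_ge0 ?nm_ge0 //.
split=> //; rewrite mul0r ee0 mul1r; apply/esym; apply: tsum_uniq => //.
have := cvgn_cv (hc _ t0); apply: cv_eq => n; by apply: eq_bigr => i _; rewrite qpow24E.
Qed.
Lemma f_nz : exists2 tau, upper tau & f tau != 0.
Proof.
apply: contrapT => h; case: anz => n /negP; apply; apply/eqP; apply: (ql_inj0 (isT : 0 < 24)%N ql_f) => t t0.
by apply/eqP/negPn/negP => ne; apply: h; exists t.
Qed.
(** The matrix -I acts trivially on tau. At a point where f is nonzero the transformation law forces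
    p^(k2 - r) = 1 for the principal square root p of -1. *)
Lemma weight4 : exists w1 : int, k2 - r = 4 * w1.
Proof.
have [t t0 ft] := f_nz; case: cf => _ _ _ /(_ (-1) 0 0 (-1) t erefl t0).
have -> : moebius (-1) 0 0 (-1) t = t by rewrite /moebius mul0r add0r addr0 mulrAC divff ?mul1r // intr_eq0.
set p := psqrt _; have p2 : p ^+ 2 = -1 by rewrite psqrt2 mul0r add0r mulrNz.
have p0 : p != 0 by apply: contra_eq_neq p2 => ->; rewrite expr0n /= eq_sym oppr_eq0 oner_eq0.
have e0 := eta_neq0 t0; rewrite invfM mulrCA divff // mulr1 => /esym/eqP.
rewrite -{2}[f t]mul1r (inj_eq (mulIf ft)) => /eqP.
rewrite exprz_inv -expfzDr // => h.
have h4 : p ^ (k2 - r) = 1 by rewrite -h addrC.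
exists ((k2 - r) %/ 4)%Z; rewrite {1}(divz_eq (k2 - r) 4) mulrC.
suff -> : ((k2 - r) %% 4)%Z = 0 by rewrite addr0.
have m0 : 0 <= ((k2 - r) %% 4)%Z by apply: modz_ge0.
have m4 : ((k2 - r) %% 4)%Z < 4 by apply: ltz_pmod.
have e4 : p ^ 4 = (p ^+ 2) ^+ 2 by rewrite -exprM.
have p4 : p ^ 4 = 1 by rewrite e4 p2 sqrrN expr1n.
have : p ^ (((k2 - r) %/ 4)%Z * 4 + ((k2 - r) %% 4)%Z) = 1 by rewrite -divz_eq.
rewrite expfzDr // (mulrC _ 4) -exprz_exp p4 exp1rz mul1r; case: (((k2 - r) %% 4)%Z) m0 m4 => // -[|[|[|[|]]]] // _ _; rewrite -exprnP.
- by rewrite expr1 => e; move: p2; rewrite e expr1n => /eqP; rewrite -addr_eq0 -mulr2n pnatr_eq0.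
- by rewrite p2 => /eqP; rewrite eq_sym -addr_eq0 -mulr2n pnatr_eq0.
- rewrite exprS p2 mulrN1 => e; move: p2; rewrite -sqrrN e expr1n => /eqP; rewrite -addr_eq0 -mulr2n pnatr_eq0 //.
Qed.
Variable w1 : int.
Hypothesis ew1 : k2 - r = 4 * w1.
(** Dividing by eta^r removes the multiplier and leaves the integral weight 2 w1. *)
Definition G0 tau := f tau / eta tau ^ r.
Lemma G0_mod (g : m2) tau : m2det g = 1 -> upper tau -> G0 (mob g tau) = jf g tau ^ (2 * w1) * G0 tau.
Proof.
move=> dg t0; case: cf => _ _ _ /(_ _ _ _ _ tau dg t0); rewrite /G0 -/(mob g tau) -/(jf g tau) => ->.
have ug : upper (mob g tau) by apply: upper_mob; rewrite ?dg.
have e1 := eta_neq0 ug; have e2 := eta_neq0 t0.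
set p := psqrt _; have p2 : p ^+ 2 = jf g tau by exact: psqrt2.
have p0 : p != 0 by apply: contraTneq (jf_neq0 (_ : m2det g != 0) t0) => [ep|]; rewrite ?dg // -p2 ep expr0n /= eqxx.
rewrite -p2 exprnP exprz_exp (_ : 2 * (2 * w1) = k2 - r); last by rewrite ew1; ring.
move: (eta (mob g tau)) (eta tau) e1 e2 => x y x0 y0; rewrite !invr_expz expfzDr //.
have -> : (x / (p * y)) ^ r = x ^ r * (p ^ (- r) * y ^ (- r)) by rewrite invfM !expfzMl !exprz_inv.
have xr : x ^ r * x ^ (- r) = 1 by rewrite -expfzDr // subrr expr0z.
move: (x ^ r) (x ^ (- r)) (y ^ (- r)) (p ^ k2) (p ^ (- r)) (f tau) xr => A B D E F g1 AB.
transitivity (A * B * (E * F * (g1 * D))); first by ring.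
by rewrite AB mul1r.
Qed.
Lemma f_T tau : upper tau -> f (tau + 1) = ee (r%:~R / 24) * f tau.
Proof.
move=> t0; have := @G0_mod (M2 1 1 0 1) tau erefl t0; have [-> ->] := TE 1 tau.
rewrite exp1rz mul1r /G0 (eta_Tn 1 t0) expfzMl => e.
have e2 := expfz_neq0 r (eta_neq0 t0).
have e3 : ee (1 / 24 : C) ^ r = ee (r%:~R / 24).
  case: (r) => n; first by rewrite -exprnP -eeMn mul1r.
  by rewrite NegzE -exprnN -eeMn mul1r -eeN mulrNz mulNr.
have e4 := ee_neq0 (r%:~R / 24 : C); rewrite e3 in e.
by apply: (mulIf (invr_neq0 (mulf_neq0 e4 e2))); rewrite e; field; rewrite e2 e4.
Qed.
Lemma a_supp n : a n != 0 -> (24 %| n%:Z - r)%Z.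
Proof.
move=> an; have H1 := ql_tri (al := 1) (de := 1) 1 (isT : 0 < 24)%N isT isT ql_f.
rewrite muln1 mulr0 in H1.
have H2 : ql 24 0 (fun n => ee (r%:~R / 24) * a n) (fun t => ee (r%:~R / 24) * f t) by apply: qlZ; exact: ql_f.
have fE t : upper t -> ee (r%:~R / 24) * f t = f ((1%:R * t + 1%:~R) / 1%:R) by move=> t0; rewrite mul1r divr1 f_T.
have := ql_inj (isT : 0 < 24)%N H1 (ql_eq (fun=> erefl) fE H2) n.
rewrite trcE // dvd1n divn1 mul0r ee0 mul1r muln1 -eeMn => e.
apply: ee_int_eq1 => //; rewrite intrD mulrNz mulrDl mulNr eeB; apply: (mulIf an).
rewrite mul1r mulrAC; apply: (mulIf (ee_neq0 (r%:~R / 24%:R : C))); rewrite divfK ?ee_neq0 // [RHS]mulrC -e mulrC.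
by rewrite -pmulrn mul1r.
Qed.
End CuspForm.

Lemma prod_primes_dvd (s : seq nat) (k : nat) : all prime s -> uniq s -> all (fun p => (p %| k)%N) s ->
  (lprod s %| k)%N.
Proof.
elim: s => [|p s IH] /=; first by rewrite /lprod big_nil dvd1n.
by move=> /andP[pp ps] /andP[pns us] /andP[pc h]; rewrite lprod_cons Gauss_dvd ?pc ?IH ?cop_lprod.
Qed.
Lemma bezout_inv (d : int) (M : nat) : coprime `|d| M -> exists e : int, (M%:Z %| e * d - 1)%Z.
Proof.
move=> cp; have [x [y e]] := Bezoutz d M%:Z; exists x.
have e1 : x * d + y * M%:Z = 1 by rewrite e /gcdz /=; move: cp; rewrite /coprime => /eqP ->.
by rewrite -e1 opprD addrA subrr add0r -mulNr dvdz_mull.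
Qed.

(** * Translates of eta under Gamma_0(M^2) *)

Section EtaTwist.
Variable R : realType.
Local Notation C := (R[i]).
Implicit Types (tau z : C).
Variables (s : seq nat).
Hypotheses (ps : all prime s) (us : uniq s) (s5 : all (fun p => (5 <= p)%N) s).
Local Notation M := (lprod s).
(** The factor 24 turns the phase acquired by q^(n/24) into exp(2 pi i b n / M). *)
Definition tb (b : int) tau : C := tau + 24%:R * b%:~R / M%:R.
Lemma M_gt0 : (0 < M)%N.
Proof. by rewrite /lprod big_seq; apply: prodn_cond_gt0 => p /(allP ps)/prime_gt0. Qed.
Lemma M_neq0 : (M%:R : C) != 0. Proof. by rewrite pnatr_eq0 -lt0n M_gt0. Qed.
Lemma M_cop12 : coprime M 12.
Proof.
rewrite /lprod big_seq; apply: (big_ind (fun m => coprime m 12)) => [|m n a b|p pin]; first exact: coprime1n.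
- by rewrite coprimeMl a.
have pp := allP ps _ pin; have p5 := allP s5 _ pin; rewrite prime_coprime //.
apply/negP => h; have := dvdn_leq (isT : 0 < 12)%N h; move: p5 h pp; clear; do 13!(case: p => [|p] //).
Qed.
Lemma upper_tb b tau : upper tau -> upper (tb b tau).
Proof.
move=> t0; rewrite /tb (_ : 24%:R * b%:~R / M%:R = (24%:R * b%:~R / M%:R : R)%:C%C); first exact: upper_addR.
by rewrite !rmorphM fmorphV !rmorph_nat rmorph_int.
Qed.
Lemma gam_gen (k : nat) (g : m2) (b : int) : m2det g = 1 -> ((M ^ 2)%N%:Z %| mc g)%Z -> exists g' : m2, m2det g' = 1 /\
  forall tau, upper tau -> mob g tau + k%:R * b%:~R / M%:R = mob g' (tau + k%:R * (md g ^+ 2 * b)%:~R / M%:R) /\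
    jf g' (tau + k%:R * (md g ^+ 2 * b)%:~R / M%:R) = jf g tau.
Proof.
move=> dg /dvdzP[q ec]; case: g dg ec => a B c d /= dg ec; rewrite PoszM in ec.
pose g' := M2 (a + k%:Z * b * M%:Z * q) (B - k%:Z * b * d * B * M%:Z * q - k%:Z * k%:Z * (b * b) * q * (d * d)) c (d - k%:Z * (d * d) * b * M%:Z * q).
have M1 := M_neq0; rewrite /m2det /= in dg.
have ad : a * d = 1 + B * (q * (M%:Z * M%:Z)) by rewrite -ec -dg; ring.
exists g'; split.
  rewrite /m2det /= ec; have -> : (a + k%:Z * b * M%:Z * q) * (d - k%:Z * (d * d) * b * M%:Z * q) -
    (B - k%:Z * b * d * B * M%:Z * q - k%:Z * k%:Z * (b * b) * q * (d * d)) * (q * (M%:Z * M%:Z)) =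
    (a * d - B * (q * (M%:Z * M%:Z))) + k%:Z * b * M%:Z * q * d * (1 + B * (q * (M%:Z * M%:Z)) - a * d) by ring.
  by rewrite ad; ring.
move=> t t0; have j0 : jf (M2 a B c d) t != 0 by apply: jf_neq0; rewrite /m2det /= ?dg.
have adC : a%:~R * d%:~R = 1 + B%:~R * (q%:~R * (M%:R * M%:R)) :> C.
  by have := congr1 (intr : int -> C) ad; rewrite intrD !intrM.
have ecC : c%:~R = q%:~R * (M%:R * M%:R) :> C by rewrite ec !intrM.
have e2 : (d ^+ 2 * b)%:~R = d%:~R * d%:~R * b%:~R :> C by rewrite expr2 !intrM.
have ej : jf g' (t + k%:R * (d ^+ 2 * b)%:~R / M%:R) = jf (M2 a B c d) t.
  rewrite /jf /= e2 !(intrD, mulrNz, intrM) -?pmulrn ecC; move: (M%:R : C) M1 => m m0; by field.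
split=> //; rewrite /mob /moebius -!/(jf _ _) ej -[k%:R * _ / _](mulfK j0) -mulrDl; congr (_ / _).
rewrite /jf /= e2 !(intrD, mulrNz, intrM) -?pmulrn ecC.
move: (a%:~R) (B%:~R) (d%:~R) (q%:~R) (b%:~R) (k%:R : C) (M%:R : C) M1 adC => x y z v u l m m0 adX.
apply/eqP; rewrite -subr_eq0; have -> : x * t + y + l * u / m * (v * (m * m) * t + z) -
   ((x + l * u * m * v) * (t + l * (z * z * u) / m) + (y - l * u * z * y * m * v - l * l * (u * u) * v * (z * z))) =
   l * u * z / m * (1 + y * (v * (m * m)) - x * z) by field.
by rewrite -adX subrr mulr0.
Qed.
Lemma gam (g : m2) (b : int) : m2det g = 1 -> ((M ^ 2)%N%:Z %| mc g)%Z -> exists g' : m2, m2det g' = 1 /\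
  forall tau, upper tau -> mob g tau + 24%:R * b%:~R / M%:R = mob g' (tb (md g ^+ 2 * b) tau) /\
    jf g' (tb (md g ^+ 2 * b) tau) = jf g tau.
Proof. exact: gam_gen. Qed.
Lemma eta_tb (b : int) tau : upper tau ->
  asum (fun m => (chi12 m)%:~R * ee ((b * m%:Z ^+ 2)%:~R / M%:R) * ee (tau / 24%:R) ^+ (m ^ 2)) /\
  eta (tb b tau) = tsum (fun m => (chi12 m)%:~R * ee ((b * m%:Z ^+ 2)%:~R / M%:R) * ee (tau / 24%:R) ^+ (m ^ 2)).
Proof.
move=> t0; have u := upper_tb b t0; have M1 := M_neq0.
have E m : (chi12 m)%:~R * ee (tb b tau / 24%:R) ^+ (m ^ 2) =
    (chi12 m)%:~R * ee ((b * m%:Z ^+ 2)%:~R / M%:R) * ee (tau / 24%:R) ^+ (m ^ 2).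
  rewrite -mulrA; congr (_ * _); rewrite -!eeMn -eeD; congr ee.
  rewrite /tb natrX intrM rmorphXn /= -pmulrn; move: (M%:R : C) M1 => m' m0; by field.
have a := @asum_chi R _ chi12 (nm_ee_lt1 u (isT : 0 < 24)%N) chi12_le1.
by split; [exact: asum_eq E a|rewrite (eta_chi u); exact: tsum_eq].
Qed.
(** The exponents of eta are squares, so its part in a nonsquare class modulo M is empty. *)
Lemma eta_tb_nonsquare (c : int) tau : upper tau -> (forall v : int, ~~ (M%:Z %| v ^+ 2 - c)%Z) ->
  \sum_(b < M) ee (- (c * b%:Z)%:~R / M%:R) * eta (tb b%:Z tau) = 0.
Proof.
move=> t0 ns; have F (b : 'I_M) : asum (fun m => ee (- (c * b%:Z)%:~R / M%:R) * ((chi12 m)%:~R * ee ((b%:Z * m%:Z ^+ 2)%:~R / M%:R) * ee (tau / 24%:R) ^+ (m ^ 2))).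
  by apply: asumZ; case: (eta_tb b%:Z t0).
rewrite (eq_bigr (fun b : 'I_M => tsum (fun m => ee (- (c * b%:Z)%:~R / M%:R) * ((chi12 m)%:~R * ee ((b%:Z * m%:Z ^+ 2)%:~R / M%:R) * ee (tau / 24%:R) ^+ (m ^ 2))))); last first.
  by move=> b _; have [a ->] := eta_tb b%:Z t0; rewrite tsumZ.
rewrite -tsum_sum // (tsum_eq (v := fun=> 0)) ?tsum0 // => m.
rewrite (eq_bigr (fun b : 'I_M => (chi12 m)%:~R * ee (tau / 24%:R) ^+ (m ^ 2) * ee (b%:R * ((m%:Z ^+ 2 - c)%:~R / M%:R)))).
  by rewrite -mulr_sumr sum_ee ?M_gt0 // (negbTE (ns _)) mulr0.
move=> b _; have -> : b%:R * ((m%:Z ^+ 2 - c)%:~R / M%:R) = - (c * b%:Z)%:~R / M%:R + (b%:Z * m%:Z ^+ 2)%:~R / M%:R :> C.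
  by rewrite intrD mulrNz !intrM; move: (M%:R^-1 : C) => x; ring.
by rewrite eeD; ring.
Qed.
Definition Yt (b : int) tau : C := eta (tb b tau) / eta tau.
(** The quotient of the two sides is continuous and, by the modularity of Delta, has 24th power 1;
    [root_const] makes it constant. *)
Lemma Y_root (g : m2) (b : int) : m2det g = 1 -> ((M ^ 2)%N%:Z %| mc g)%Z ->
  exists x : C, forall tau, upper tau -> Yt b (mob g tau) = x * Yt (md g ^+ 2 * b) tau.
Proof.
move=> dg Ng; have [g' [dg' Hg']] := gam b dg Ng.
pose h tau := Yt b (mob g tau) / Yt (md g ^+ 2 * b) tau.
have u1 z : upper z -> upper (mob g z) by apply: upper_mob; rewrite dg.
have Yn c z : upper z -> Yt c z != 0.
  by move=> z0; rewrite mulf_neq0 ?invr_neq0 ?eta_neq0 //; exact: upper_tb.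
have cY c : contH (Yt c).
  apply: contHM; last by apply: contHV; [exact: contH_eta|move=> z z0; exact: eta_neq0].
  apply: contH_comp; [exact: contH_eta| |exact: upper_tb].
  by apply: contHD; [exact: contH_id|exact: contH_cst].
have ch : contH h.
  apply: contHM; first by apply: contH_comp => //; apply: contH_mob; rewrite dg.
  by apply: contHV => // z z0; exact: Yn.
have h24 z : upper z -> h z ^+ 24 = 1.
  move=> z0; have [e1 e2] := Hg' z z0; have z1 := upper_tb (md g ^+ 2 * b) z0.
  have j0 : jf g z != 0 by apply: jf_neq0; rewrite ?dg.
  have E : Yt b (mob g z) ^+ 24 = Yt (md g ^+ 2 * b) z ^+ 24.
    have D1 (x y : C) : (eta x / eta y) ^+ 24 = Delta x / Delta y by rewrite exprMn exprVn.
    have e3 : tb b (mob g z) = mob g' (tb (md g ^+ 2 * b) z) := e1.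
    rewrite /Yt D1 D1 e3 (Delta_mod dg' z1) (Delta_mod dg z0) e2.
    have d1 := Delta_neq0 z0; move: (Delta (tb _ _)) (Delta z) d1 (jf g z ^+ 12) (expf_neq0 12 j0) => A B B0 J J0.
    by field; rewrite B0 J0.
  by rewrite /h exprMn exprVn E divff // expf_neq0 // Yn.
exists (h 'i%C) => z z0; rewrite (root_const (isT : 0 < 24)%N ch h24 (upper_i R) z0).
by rewrite /h divfK // Yn.
Qed.
Lemma spread_sq (u : nat -> C) m : spread (fun i => (i ^ 2)%N) u (m ^ 2) = u m.
Proof.
have lt : (m < (m ^ 2).+1)%N by rewrite ltnS; case: m => // m; rewrite expnS expn1 leq_pmulr.
by rewrite /spread (big_pred1 (Ordinal lt)) //= => i; rewrite eqn_exp2r.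
Qed.
Lemma ql_etb (b : int) : ql 24 0 (spread (fun i => (i ^ 2)%N) (fun m => (chi12 m)%:~R * ee ((b * m%:Z ^+ 2)%:~R / M%:R))) (fun t => eta (tb b t)).
Proof.
have hp i : (i <= i ^ 2)%N by case: i => // i; rewrite expnS expn1 leq_pmulr.
move=> t t0; rewrite mul0r ee0 mul1r; have [a e] := eta_tb b t0.
have E n : spread (fun i => (i ^ 2)%N) (fun m => (chi12 m)%:~R * ee ((b * m%:Z ^+ 2)%:~R / M%:R) * ee (t / 24%:R) ^+ (m ^ 2)) n =
   spread (fun i => (i ^ 2)%N) (fun m => (chi12 m)%:~R * ee ((b * m%:Z ^+ 2)%:~R / M%:R)) n * ee (t / 24%:R) ^+ n.
  by rewrite /spread mulr_suml; apply: eq_bigr => i /eqP ->.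
split; first exact: asum_eq E (asum_spread hp a).
by rewrite e -(tsum_spread hp a) (tsum_eq E).
Qed.
Lemma md_coprime (g : m2) : m2det g = 1 -> ((M ^ 2)%N%:Z %| mc g)%Z -> coprime `|md g| M.
Proof.
move=> dg /dvdzP[q ec]; have : coprimez (md g) M%:Z.
  by apply/coprimezP; exists (ma g, - (mb g * q * M%:Z)) => /=; rewrite -[RHS]dg /m2det ec PoszM; ring.
by rewrite /coprimez /gcdz /=.
Qed.
Lemma twist_res (u : int) : exists m : nat, (M%:Z %| m%:Z - u)%Z /\ chi12 m = 1.
Proof.
have M0 := M_gt0; pose r1 := absz (u %% M)%Z.
have rE : r1%:Z = (u %% M)%Z by rewrite gez0_abs // modz_ge0 //; lia.
exists (chinese M 12 r1 1); split; last first.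
  by rewrite -chi12_mod chinese_modr ?M_cop12.
have := chinese_modl M_cop12 r1 1 => h.
have h1 : (M%:Z %| (chinese M 12 r1 1)%:Z - r1%:Z)%Z.
  by rewrite -eqz_mod_dvd !modz_nat h.
rewrite -(subrK r1%:Z (_%:Z)) -addrA; apply: rpredD => //.
rewrite rE {2}(divz_eq u M) opprD addrCA subrr addr0 -mulNr dvdz_mull //.
Qed.
(** By [Y_root] each translate acquires a constant S b, with S 0 = 1. Transporting the relations of
    [eta_tb_nonsquare] through g makes the Fourier transform of S vanish away from 0, so S is
    constant. This determines the multiplier without its explicit formula. *)
Lemma Y_inv (g : m2) (b : 'I_M) tau : m2det g = 1 -> ((M ^ 2)%N%:Z %| mc g)%Z -> upper tau ->
  Yt b%:Z (mob g tau) = Yt (md g ^+ 2 * b%:Z) tau.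
Proof.
move=> dg Ng t0; have M0 := M_gt0; have M1 := M_neq0.
have [S HS] := choice (fun b : 'I_M => Y_root b%:Z dg Ng).
have u1 z : upper z -> upper (mob g z) by apply: upper_mob; rewrite dg.
have [e he] := bezout_inv (md_coprime dg Ng).
pose Sh (k : int) := \sum_(b < M) S b * ee ((b%:Z * k)%:~R / M%:R).
have Sh_cong (k k' : int) : (M%:Z %| k - k')%Z -> Sh k = Sh k'.
  move=> h; apply: eq_bigr => i _; congr (_ * _); apply: ee_cong => //; rewrite -mulrBr; exact: dvdz_mull.
have T0 (c : int) : (forall v : int, ~~ (M%:Z %| v ^+ 2 - c)%Z) -> forall m : nat, chi12 m != 0 ->
    Sh (md g ^+ 2 * m%:Z ^+ 2 - c) = 0.
  move=> ns m cm.
  have H1 := @ql_sum R 24 0 _ (enum 'I_M) _ _ (fun b : 'I_M => qlZ (ee (- (c * b%:Z)%:~R / M%:R) * S b) (ql_etb (md g ^+ 2 * b%:Z))).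
  have := ql_inj0 (isT : 0 < 24)%N H1 _ (m ^ 2)%N.
  rewrite (eq_bigr (fun b : 'I_M => (chi12 m)%:~R * (S b * ee ((b%:Z * (md g ^+ 2 * m%:Z ^+ 2 - c))%:~R / M%:R)))); last first.
    move=> i _; rewrite spread_sq.
    have -> : (i%:Z * (md g ^+ 2 * m%:Z ^+ 2 - c))%:~R / M%:R = - (c * i%:Z)%:~R / M%:R + (md g ^+ 2 * i%:Z * m%:Z ^+ 2)%:~R / M%:R :> C.
      rewrite -mulrDl -mulrNz -intrD; congr (_%:~R / _); ring.
    by rewrite eeD; ring.
  rewrite big_enum -mulr_sumr => /(_ _)/eqP; rewrite mulf_eq0 intr_eq0 (negbTE cm) /= => h; apply/eqP; apply: h.
  move=> z z0; rewrite big_enum /=.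
  have := eta_tb_nonsquare (u1 _ z0) ns => e0.
  have ng := eta_neq0 (u1 _ z0); have nz := eta_neq0 z0.
  apply/eqP; rewrite -(inj_eq (mulIf (mulf_neq0 ng (invr_neq0 nz)))) mul0r -{2}e0 mulr_suml; apply/eqP/eq_bigr => i _.
  have := HS i z z0; rewrite /Yt => h; have -> : eta (tb i%:Z (mob g z)) = S i * (eta (tb (md g ^+ 2 * i%:Z) z) / eta z) * eta (mob g z).
    by rewrite -h divfK.
  by ring.
have Sh0 (k : 'I_M) : (0 < k)%N -> Sh k%:Z = 0.
  move=> k0; have [p pin npk] : exists2 p, p \in s & ~~ (p %| k)%N.
    apply/allPn; apply/negP => h; have := dvdn_leq k0 (prod_primes_dvd ps us h); have := ltn_ord k; lia.
  have pp := allP ps _ pin; have p5 := allP s5 _ pin.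
  have op : odd p by case: (even_prime pp) => // e2; rewrite e2 in p5.
  have [|u hu] := @nonsquare_shift p k%:Z pp op; first by rewrite dvdzE.
  have pM : (p%:Z %| M%:Z)%Z by rewrite dvdzE /= /lprod (big_rem p) //= dvdn_mulr.
  have ns v : ~~ (M%:Z %| v ^+ 2 - (u ^+ 2 - k%:Z))%Z by apply: contra (hu v) => /(dvdz_trans pM).
  (* Since e inverts d modulo M, d m is u modulo M and d^2 m^2 - (u^2 - k) is k; chi12 m = 1 keeps
     the coefficient of index m^2 nonzero. *)
  have [m [hm cm]] := twist_res (e * u).
  have := T0 _ ns m; rewrite cm => /(_ isT) <-; apply: Sh_cong.
  have -> : k%:Z - (md g ^+ 2 * m%:Z ^+ 2 - (u ^+ 2 - k%:Z)) = - ((md g * m%:Z - u) * (md g * m%:Z + u)) by ring.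
  rewrite rpredN dvdz_mulr //.
  have -> : md g * m%:Z - u = md g * (m%:Z - e * u) + u * (e * md g - 1) by ring.
  by apply: rpredD; apply: dvdz_mull.
have inv (b0 : 'I_M) : M%:R * S b0 = Sh 0.
  transitivity (\sum_(k < M) ee (- (b0%:Z * k%:Z)%:~R / M%:R) * Sh k%:Z); last first.
    rewrite (bigD1 (Ordinal M0)) //= big1 => [|k kn]; last first.
      by rewrite Sh0 ?mulr0 // lt0n; apply: contraNneq kn => k0; apply/eqP/val_inj.
    by rewrite mulr0 mulr0z oppr0 mul0r ee0 mul1r addr0.
  transitivity (\sum_(k < M) \sum_(b < M) S b * ee (k%:R * ((b%:Z - b0%:Z)%:~R / M%:R))).
    rewrite exchange_big /= (bigD1 b0) //= [X in _ + X]big1 ?addr0 => [|i ni].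
      by rewrite -mulr_sumr sum_ee // subrr dvdz0 mulrC.
    rewrite -mulr_sumr sum_ee // (_ : (_ %| _)%Z = false) ?mulr0 //; apply/negP; rewrite dvdzE => d.
    case/negP: ni; apply/eqP/val_inj; have := ltn_ord i; have := ltn_ord b0; move: d => /=.
    move: (nat_of_ord i) (nat_of_ord b0) => x y d yM xM; have [->//|ne] := eqVneq x y; have := dvdn_leq _ d; lia.
  apply: eq_bigr => k _; rewrite mulr_sumr; apply: eq_bigr => i _; rewrite [RHS]mulrCA -eeD; congr (_ * ee _).
  by rewrite intrD mulrNz !intrM -!pmulrn; move: (M%:R^-1 : C) => x; ring.
have S0 : S (Ordinal M0) = 1.
  have := HS (Ordinal M0) _ t0; rewrite /= mulr0 /Yt /tb mulr0 mul0r !addr0 !divff ?eta_neq0 ?mulr1 //; exact: u1.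
rewrite (HS b tau t0) (_ : S b = 1) ?mul1r //.
by apply: (mulfI M1); rewrite inv -(inv (Ordinal M0)) S0.
Qed.
End EtaTwist.

(** * Combinations of translates of f and their expansion at the cusp 0 *)

Section Twist.
Variable R : realType.
Local Notation C := (R[i]).
Implicit Types (tau z : C).
Variable ell : nat.
Hypothesis pell : prime ell.
Hypothesis ell5 : (5 <= ell)%N.
Local Notation O := (@in_Oell R ell).
Local Notation I := (@I_ R ell).
Local Notation qo := (@qo R ell).
Lemma qo_to0 L m a h : 0 <= m -> qo L m a h -> exists c, ql L 0 c h /\ forall n, O (c n).
Proof.
move=> m0 [c [H oc _]]; exists (fun n => if (`|m| <= n)%N then c (n - `|m|)%N else 0); split.
  by apply: ql_shift; rewrite add0r gez0_abs.
by move=> n; case: ifP => // _; exact: O0.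
Qed.
Lemma contHXz (h : C -> C) (e : int) : contH h -> (forall z, upper z -> h z != 0) -> contH (fun z => h z ^ e).
Proof.
move=> ch hn; case: e => n; first exact: contHX.
by apply: contHV; [exact: contHX|move=> z /hn h0; rewrite expf_neq0].
Qed.
Lemma O_ratz (x y : nat) (e : int) : ~~ (ell %| x)%N -> ~~ (ell %| y)%N -> O ((x%:R / y%:R) ^ e).
Proof.
move=> lx ly; case: e => n; first by apply: OX => //; apply: OM => //; [exact: O_nat|exact: O_inv].
rewrite NegzE -exprnN -exprVn invfM invrK; apply: OX => //; apply: OM => //; [exact: O_inv|exact: O_nat].
Qed.
(** Because r + r' = 24 m, eta enters only through its 24th power, whose transformation is known. *)
Lemma eta_alg (m r' : nat) (r : int) (x y v j : C) : r'%:Z = 24%:Z * m%:Z - r -> x != 0 -> y != 0 -> x ^+ 24 = j ^+ 12 * y ^+ 24 ->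
  (v / y * x) ^ r * x ^+ r' = j ^+ (12 * m) * (v ^ r * y ^+ r').
Proof.
move=> er x0 y0 e.
have X (z : C) : z != 0 -> z ^ r * z ^+ r' = (z ^+ 24) ^+ m.
  by move=> z0; rewrite [z ^+ r']exprnP -expfzDr // er addrC subrK -exprM [RHS]exprnP.
have -> : (v / y * x) ^ r = v ^ r * y ^ (- r) * x ^ r by rewrite expfzMl expfzMl exprz_inv.
have := X _ x0; rewrite e exprMn -(X _ y0) -exprM => ex.
have yr : y ^ (- r) * y ^ r = 1 by rewrite -expfzDr // addrC subrr expr0z.
move: (12 * m)%N ex yr => p; move: (x ^ r) (x ^+ r') (y ^ r) (y ^+ r') (y ^ (- r)) (v ^ r) (j ^+ p) => x1 x2 y1 y2 y3 v1 j1 ex yr.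
transitivity (v1 * y3 * (x1 * x2)); first by ring.
rewrite ex; transitivity ((y3 * y1) * (j1 * (v1 * y2))); first by ring.
by rewrite yr mul1r.
Qed.
Variables (k2 r : int) (a : nat -> C).
Hypothesis cf : cusp_form ell k2 r a.
Variable w1 : int.
Hypothesis ew1 : k2 - r = 4 * w1.
Local Notation f := (qseries a).
Variables (m r' w' : nat).
Hypotheses (er' : r'%:Z = 24%:Z * m%:Z - r) (ew' : w'%:Z = 2 * w1 + 12 * m%:Z).
Variables (s : seq nat).
Hypotheses (ps : all prime s) (us : uniq s) (s5 : all (fun p => (5 <= p)%N) s) (ls : ~~ (ell %| lprod s)%N).
Local Notation M := (lprod s).
Local Notation b_tb := tb.
Local Notation tb := (tb s).
Lemma f_G0 z : upper z -> f z = G0 r a z * eta z ^ r.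
Proof. by move=> z0; rewrite /G0 divfK // expfz_neq0 // eta_neq0. Qed.
Lemma ql_ftb (b : int) : ql 24 0 (fun n => ee (b%:~R / M%:R) ^+ n * a n) (fun t => f (tb b t)).
Proof.
move=> t t0; have [h1 h2] := ql_f cf (upper_tb s b t0).
have E : ee (tb b t / 24%:R) = ee (b%:~R / M%:R) * ee (t / 24%:R).
  rewrite -eeD; apply: (f_equal (@ee R)); rewrite /b_tb mulrDl addrC; congr (_ + _).
  by rewrite -mulrA mulrAC divff ?mul1r // pnatr_eq0.
have F n : a n * ee (tb b t / 24%:R) ^+ n = ee (b%:~R / M%:R) ^+ n * a n * ee (t / 24%:R) ^+ n.
  by rewrite E exprMn mulrCA mulrA.
split; first by apply: asum_eq h1 => n; rewrite F.
by rewrite h2 !mul0r; apply: (f_equal (fun x => ee 0 * x)); apply: tsum_eq => n; rewrite F.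
Qed.
Lemma f_tb_per (b : int) t : upper t -> f (tb (b + M%:Z) t) = f (tb b t).
Proof.
move=> t0; have [_ ->] := ql_ftb (b + M%:Z) t0; have [_ ->] := ql_ftb b t0.
have -> : ee ((b + M%:Z)%:~R / M%:R) = ee (b%:~R / M%:R : C) by apply: ee_cong; [exact: M_gt0 ps|rewrite addrC addKr].
by [].
Qed.
Lemma f_tb_mob (g : m2) (b : 'I_M) t : m2det g = 1 -> ((M ^ 2)%N%:Z %| mc g)%Z -> upper t ->
  f (tb b%:Z (mob g t)) * eta (mob g t) ^+ r' = jf g t ^+ w' * (f (tb (md g ^+ 2 * b%:Z) t) * eta t ^+ r').
Proof.
move=> dg Ng t0; have ug : upper (mob g t) by apply: upper_mob; rewrite ?dg.
have [g' [dg' /(_ t t0) [eg ej]]] := gam R ps b%:Z dg Ng.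
have Y := @Y_inv R s ps us s5 g b t dg Ng t0; rewrite /Yt in Y.
move: ej Y eg; rewrite -/(tb b%:Z (mob g t)); set z := tb (_ * _) t => ej Y eg.
have z0 : upper z by exact: upper_tb.
have ex := eta_neq0 ug; have ey := eta_neq0 t0.
have Y' : eta (tb b%:Z (mob g t)) = eta z / eta t * eta (mob g t) by rewrite -Y divfK.
rewrite (f_G0 (upper_tb s b%:Z ug)) (f_G0 z0) Y' eg (G0_mod cf ew1 dg' z0) ej.
have D := Delta_mod dg t0; rewrite /Delta in D.
have A := eta_alg (eta z) er' ex ey D.
rewrite -[LHS]mulrA A [_ ^+ w']exprnP ew' expfzDr ?(jf_neq0 _ t0) ?dg //.
rewrite [jf g t ^ (12 * _)](_ : _ = jf g t ^+ (12 * m)) //.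
move: (12 * m)%N => p; move: (jf g t ^ (2 * w1)) (jf g t ^+ p) (G0 r a z) (eta z ^ r) (eta t ^+ r') => *; ring.
Qed.
Variable c : int -> C.
Hypotheses (cO : forall b, O (c b)) (cper : forall b, c (b + M%:Z) = c b).
Hypothesis csq : forall d b : int, coprime `|d| M -> c (d ^+ 2 * b) = c b.
(** The weights c act on a(n) through their Fourier transform. Their invariance under b -> d^2 b
    lets Gamma_0(M^2) permute the terms. *)
Definition Ef t : C := \sum_(b < M) c b%:Z * f (tb b%:Z t).
(** As r + r' = 24 m, the factor eta^r' removes the multiplier; the weight becomes the integer
    w'. *)
Definition HH t : C := Ef t * eta t ^+ r'.
Lemma HH_G (g : m2) t : m2det g = 1 -> ((M ^ 2)%N%:Z %| mc g)%Z -> upper t -> HH (mob g t) = jf g t ^+ w' * HH t.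
Proof.
move=> dg Ng t0; rewrite /HH /Ef !mulr_suml mulr_sumr.
pose F (b : int) := jf g t ^+ w' * (c b * f (tb b t) * eta t ^+ r').
have cd := md_coprime dg Ng.
have cd2 : coprime `|md g ^+ 2| M by rewrite abszX coprimeXl.
transitivity (\sum_(b < M) F (md g ^+ 2 * b%:Z)).
  apply: eq_bigr => b _; rewrite /F -mulrA (f_tb_mob _ dg Ng t0) csq //.
  move: (jf g t ^+ w') (f _) (eta t ^+ r') (c b) => *; ring.
by apply: period_mul => //; [exact: M_gt0 ps|move=> x; rewrite /F cper f_tb_per].
Qed.
Lemma tb_tri (g : m2) (b : int) : m2det g = 1 -> exists (g' : m2) (al de : nat) (be : int),
  [/\ m2det g' = 1, (0 < al)%N, (0 < de)%N, (M ^ 2 = de * al)%N &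
  forall t : C, upper t -> tb b (mob g t) = mob g' ((al%:R * t + be%:~R) / de%:R) /\
    jf g' ((al%:R * t + be%:~R) / de%:R) = M%:R / de%:R * jf g t].
Proof.
move=> dg; have M0 := M_gt0 ps; pose A0 := M2 M%:Z (24 * b) 0 M%:Z.
have dA : m2det (m2mul A0 g) = (M ^ 2)%N%:Z by rewrite m2detM dg mulr1 /m2det /= mulr0 subr0 PoszM.
have A0d : 0 < m2det A0 by rewrite /m2det /= mulr0 subr0 -PoszM ltz_nat muln_gt0 M0.
have [|g' [al [de [be [dg' al0 de0 eA EA]]]]] := @hermite (m2mul A0 g); first by rewrite dA ltz_nat expn_gt0 M0.
exists g', al, de, be; split=> //; first by apply/eqP; rewrite -eqz_nat -dA eA mulnC.
move=> t t0; have de0' : (de%:R : C) != 0 by exact: natC0.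
have T : mob (M2 al be 0 de) t = (al%:R * t + be%:~R) / de%:R by rewrite /mob /moebius /= mul0r add0r -!pmulrn.
have dg0 : 0 < m2det g by rewrite dg.
have [e1 e2] := @mobM R A0 g t dg0 t0 (lt0r_neq0 A0d).
have [|||e3 e4] := @mobM R g' (M2 al be 0 de) t; rewrite ?dg' //; first by rewrite /m2det /= mulr0 subr0 -PoszM ltz_nat muln_gt0 al0.
rewrite -EA -T in e3 e4 *; split.
  have AE (x : C) : mob A0 x = (M%:R * x + (24 * b)%:~R) / (0 * x + M%:R) by [].
  have MC := M_neq0 R ps; rewrite -e3 e1 AE mul0r add0r /b_tb intrM; field; exact: MC.
have jA : jf A0 (mob g t) = M%:R by rewrite /jf /= mul0r add0r.
have jT : jf (M2 al be 0 de) t = de%:R by rewrite /jf /= mul0r add0r.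
by apply: (mulIf de0'); move: e4; rewrite e2 jA jT => <-; rewrite mulrAC divfK.
Qed.
(** The eta factors combine into [rho], whose 24th power is constant, so [rho] is constant. Being a
    24th root of an [ell]-integral number it is [ell]-integral, which makes the expansion at every
    cusp integral. *)
Lemma qo_term (g : m2) (b : int) : m2det g = 1 ->
  exists a0, qo (24 * M ^ 2) 0 a0 (fun t => f (tb b (mob g t)) * eta (mob g t) ^+ r' * jf g t ^ (- w'%:Z)).
Proof.
move=> dg; have [g' [al [de [be [dg' al0 de0 eM E]]]]] := tb_tri b dg.
pose z t : C := (al%:R * t + be%:~R) / de%:R.
have uz t : upper t -> upper (z t) by exact: upper_tri.
have ug t : upper t -> upper (mob g t) by apply: upper_mob; rewrite dg.
have ugz t : upper t -> upper (mob g' (z t)) by move=> t0; apply: upper_mob; rewrite ?dg' //; exact: uz.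
have j0 (t : C) : upper t -> jf g t != 0 by apply: jf_neq0; rewrite dg.
have M0 := M_gt0 ps; have MC := M_neq0 R ps.
have deC : (de%:R : C) != 0 by exact: natC0.
pose q : C := M%:R / de%:R; have q0 : q != 0 by rewrite mulf_neq0 ?invr_eq0.
pose rho t := (eta (mob g' (z t)) / eta (z t)) ^ r * (eta (mob g t) / eta t) ^+ r' * jf g t ^ (- (12 * m%:Z)).
have rho24 t : upper t -> rho t ^+ 24 = q ^ (12 * r).
  move=> t0; rewrite /rho.
  have D1 := Delta_mod dg t0; have D2 := Delta_mod dg' (uz t t0); rewrite /Delta in D1 D2.
  have [_ e2] := E t t0; rewrite -/(z t) -/q in e2; rewrite e2 in D2.
  have := eta_neq0 (uz t t0); have := eta_neq0 t0; move: D1 D2.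
  move: (eta (mob g t)) (eta t) (eta (mob g' (z t))) (eta (z t)) (jf g t) (j0 t t0) => x y u v j jn D1 D2 y0 v0; rewrite exprMn exprMn.
  have -> : ((u / v) ^ r) ^+ 24 = (q * j) ^ (12 * r).
    transitivity (((u / v) ^+ 24) ^ r); first by rewrite -[LHS]/(((u / v) ^ r) ^ 24%:Z) exprzAC.
    rewrite expr_div_n D2 mulfK ?expf_neq0 //.
    by rewrite exprnP exprz_exp.
  have -> : ((x / y) ^+ r') ^+ 24 = j ^ (12 * r'%:Z).
    by rewrite -exprM mulnC exprM expr_div_n D1 mulfK ?expf_neq0 // -exprM exprnP.
  rewrite exprnP exprz_exp expfzMl -!mulrA -2!(expfzDr _ _ jn) [X in _ * j ^ X](_ : _ = 0) ?expr0z ?mulr1 //.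
  by rewrite er'; ring.
have rho_c : contH rho.
  apply: contHM; [apply: contHM|].
  - apply: contHXz; last by move=> t t0; exact: (mulf_neq0 (eta_neq0 (ugz t t0)) (invr_neq0 (eta_neq0 (uz t t0)))).
    have cz : contH z.
      by apply: contHM; [apply: contHD; [apply: contHM; [exact: contH_cst|exact: contH_id]|exact: contH_cst]|exact: contH_cst].
    apply: contHM; [|apply: contHV; [|by move=> t t0; apply: eta_neq0; exact: uz]].
      by apply: contH_comp; [exact: contH_eta|apply: contH_comp; [apply: contH_mob; rewrite dg'|exact: cz|exact: uz]|exact: ugz].
    by apply: contH_comp; [exact: contH_eta|exact: cz|exact: uz].
  - apply: contHX; apply: contHM; [|apply: contHV; [exact: contH_eta|by move=> t t0; exact: eta_neq0]].
    by apply: contH_comp; [exact: contH_eta|apply: contH_mob; rewrite dg|exact: ug].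
  apply: contHXz; last exact: j0.
  by apply: contHD; [apply: contHM; [exact: contH_cst|exact: contH_id]|exact: contH_cst].
have ui := upper_i R; pose r0 := rho 'i%C.
have r00 : r0 != 0.
  by apply/eqP => h; have := expfz_neq0 (12 * r) q0; rewrite -(rho24 _ ui) -/r0 h expr0n eqxx.
have rhoE t : upper t -> rho t = r0.
  move=> t0; have cr : contH (fun t => rho t * r0^-1) by apply: contHM; [exact: rho_c|exact: contH_cst].
  have h1 t' : upper t' -> (rho t' * r0^-1) ^+ 24 = 1.
    by move=> t1; rewrite exprMn exprVn (rho24 t') // /r0 (rho24 _ ui) divff // expfz_neq0.
  exact: (mulIf (invr_neq0 r00) (@root_const R 24 (fun t => rho t * r0^-1) isT cr h1 t _ t0 ui)).
have lde : ~~ (ell %| de)%N.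
  apply: contra ls => h; have : (ell %| M ^ 2)%N by rewrite eM dvdn_mulr.
  by rewrite Euclid_dvdX // => /andP[].
have Or : O r0 by apply: (@O_rootn _ _ pell _ 24) => //; rewrite rho24 //; apply: O_ratz.
have Qf : qo 24 0 (a 0%N) f by exists a; split=> //; [exact: (ql_f cf)|exact: (a_O cf)].
have d24 : (0 < 24 * de)%N by rewrite muln_gt0.
have M20 : (0 < M ^ 2)%N by rewrite expn_gt0 M0.
have Q1 := qo_lift pell d24 al0 (qo_tri pell be (isT : 0 < 24)%N al0 de0 Qf).
rewrite -mulnA -eM in Q1.
have Q2 := qo_lift pell (isT : 0 < 24)%N M20 (qoX pell r' (qo_eta R pell)).
have Q3 := qoZ pell (O_ratz (2 * w1) ls lde) (qoZ pell Or (qoM pell Q1 Q2)).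
have o0 : 0 <= al%:Z * (al%:Z * 0) + (M ^ 2)%N%:Z * (1 *+ r') by rewrite !mulr0 add0r mulr_ge0 // mulrn_wge0.
have [d [Qd Od]] := qo_to0 o0 Q3.
exists (d 0%N), d; split=> //; apply: ql_eq Qd => // t t0.
rewrite -(rhoE t t0) /rho -/(z t); have [-> e2] := E t t0; rewrite -/(z t) -/q in e2 *.
have z1 := uz t t0; have ez := eta_neq0 z1; have et := eta_neq0 t0.
rewrite (f_G0 (ugz t t0)) (f_G0 z1) (G0_mod cf ew1 dg' z1) e2 [(q * jf g t) ^ _]expfzMl ew' opprD expfzDr ?j0 //.
have jj : jf g t ^ (2 * w1) * jf g t ^ (- (2 * w1)) = 1 by rewrite -expfzDr ?j0 // subrr expr0z.
rewrite [(eta (mob g' (z t)) / eta (z t)) ^ r]expfzMl [((eta (z t))^-1) ^ r]exprz_inv [(eta (mob g t) / eta t) ^+ r']exprMn exprVn.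
have ez1 : eta (z t) ^ r * eta (z t) ^ (- r) = 1 by rewrite -expfzDr // subrr expr0z.
have et1 : (eta t ^+ r')^-1 * eta t ^+ r' = 1 by rewrite mulVf // expf_neq0.
move: (q ^ (2 * w1)) (jf g t ^ (2 * w1)) (jf g t ^ (- (2 * w1))) (jf g t ^ (- (12 * m%:Z))) (G0 r a (z t)) (eta (z t) ^ r) (eta (z t) ^ (- r)) (eta (mob g' (z t)) ^ r) (eta (mob g t) ^+ r') (eta t ^+ r') (eta t ^+ r')^-1 jj ez1 et1.
move=> x1 x2 x3 x4 x5 x6 x7 x8 x9 x11 x10 jj ez1 et1.
transitivity (x1 * x4 * x5 * x8 * x9 * (x6 * x7) * (x10 * x11)); first by ring.
by rewrite ez1 et1 !mulr1; transitivity (x1 * x4 * x5 * x8 * x9 * (x2 * x3)); [rewrite jj mulr1|]; ring.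
Qed.
Lemma HH_O (g : m2) : m2det g = 1 -> exists d, ql (24 * M ^ 2) 0 d (fun t => HH (mob g t) * jf g t ^ (- w'%:Z)) /\
  forall n, O (d n).
Proof.
move=> dg; have H (b : 'I_M) : exists d, ql (24 * M ^ 2) 0 d (fun t => f (tb b%:Z (mob g t)) * eta (mob g t) ^+ r' * jf g t ^ (- w'%:Z)) /\ forall n, O (d n).
  by have [a0 [d [h1 h2 _]]] := qo_term b%:Z dg; exists d.
have [d Hd] := choice H.
exists (fun n => \sum_(b < M) c b%:Z * d b n); split; last first.
  by move=> n; apply: O_sum => // b _; apply: OM => //; exact: (Hd b).2.
have := @ql_sum R (24 * M ^ 2) 0 _ (index_enum 'I_M) _ _ (fun b => qlZ (c b%:Z) (Hd b).1).
apply: ql_eq => // t t0; rewrite /HH /Ef !mulr_suml; apply: eq_bigr => b _.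
by rewrite !mulrA.
Qed.
Lemma ql_eta_pow : exists d, ql (24 * M ^ 2) 0 d (fun t => eta t ^+ r') /\ forall n, O (d n).
Proof.
have M20 : (0 < M ^ 2)%N by rewrite expn_gt0 (M_gt0 ps).
have Q := qo_lift pell (isT : 0 < 24)%N M20 (qoX pell r' (qo_eta R pell)).
by apply: qo_to0 Q; rewrite mulr_ge0 // mulrn_wge0.
Qed.
Lemma HH_I : (forall n, I ((\sum_(b < M) c b%:Z * ee (b%:R / M%:R) ^+ n) * a n)) ->
  exists d, ql (24 * M ^ 2) 0 d HH /\ forall n, I (d n).
Proof.
move=> van; have M20 : (0 < M ^ 2)%N by rewrite expn_gt0 (M_gt0 ps).
have Q1 := @ql_sum R 24 0 _ (index_enum 'I_M) _ _ (fun b : 'I_M => qlZ (c b%:Z) (ql_ftb b%:Z)).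
have {Q1} := @ql_tri R 24 0 _ _ (M ^ 2) (M ^ 2) 0 isT M20 M20 Q1.
set e := (fun n => _ * _) => Q1.
have Ie n : I (e n).
  apply: IMl => //; first exact: O_eeM.
  apply: trc_I => // k; have := van k; rewrite mulr_suml => /(eq_ind _ I); apply; apply: eq_bigr => b _.
  by rewrite mulrA.
have [d [Qd Od]] := ql_eta_pow.
exists (conv d e); split; last exact: conv_I.
have := qlM Qd Q1; rewrite mulr0 addr0; apply: ql_eq => // t t0.
rewrite /HH mulrC; congr (_ * _); rewrite /Ef; apply: eq_bigr => b _; congr (_ * f (tb _ _)).
by rewrite addr0 mulrC mulKf // pnatr_eq0 -lt0n.
Qed.
Definition gb (b : nat) : nat := gcdn b M.
Definition M1 (b : nat) : nat := (M %/ gb b)%N.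
Definition b1 (b : nat) : nat := (b %/ gb b)%N.
(** The factor of [eta_cusp] at b/M, which is b1/M1 in lowest terms. *)
Definition kap (b : nat) : C := (chi12 (M1 b))%:~R * gs R (M1 b) (b1 b)%:Z / (M1 b)%:R.
Variable D : nat -> int.
Hypothesis HD : forall b, (M1 b %| 576 * (b1 b)%:Z * D b - 1)%Z.
Lemma gb_gt0 b : (0 < gb b)%N. Proof. by rewrite gcdn_gt0 (M_gt0 ps) orbT. Qed.
Lemma M1_gt0 b : (0 < M1 b)%N.
Proof. by rewrite divn_gt0 ?gb_gt0 // dvdn_leq ?(M_gt0 ps) // dvdn_gcdr. Qed.
Lemma M1E b : (M1 b * gb b)%N = M. Proof. by rewrite divnK // dvdn_gcdr. Qed.
(** A matrix with bottom row (M1, 24 D), which exists because 576 b1 D = 1 modulo M1, carries z to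
    24 b/M - 1/t. Integral weight handles [G0], and [eta_cusp] supplies the power of eta. *)
Lemma cusp0_term (b : nat) t : upper t ->
  f (tb b%:Z (- t^-1)) * eta (- t^-1) ^+ r' * t ^ (- w'%:Z) =
  (M1 b)%:R ^ (- (2 * w1)) * kap b ^ r * f (t / (M1 b)%:R ^+ 2 - 24 * (D b)%:~R / (M1 b)%:R) * eta t ^+ r'.
Proof.
move=> t0; have m0 := M1_gt0 b; have mC : ((M1 b)%:R : C) != 0 by exact: natC0.
set z := (t / _ - _); set n := M1 b in m0 mC z *.
have z0 : upper z.
  have := @upper_tri R 1 (n ^ 2) (- (24 * D b * n%:Z)) t isT _ t0; rewrite expn_gt0 m0 => /(_ isT).
  congr upper; rewrite /z mul1r natrX mulrDl; congr (_ + _); rewrite mulrNz mulNr !intrM -pmulrn; congr (- _).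
  by field.
have /dvdzP[e He] := HD b; rewrite -/n in He.
pose g := M2 (24 * (b1 b)%:Z) e n%:Z (24 * D b).
have dg : m2det g = 1 by rewrite /m2det /=; have := He; lia.
have jg : jf g z = t / n%:R by rewrite /jf /z /= intrM -!pmulrn; field.
have tn := upper_neq0 t0.
have eb : 24 * (b1 b)%:~R / n%:R = 24 * b%:R / M%:R :> C.
  rewrite -(M1E b) -/n -{2}(divnK (dvdn_gcdl b M : (gb b %| b)%N)) -/(b1 b) !natrM -pmulrn; field.
  by rewrite mC pnatr_eq0 -lt0n gb_gt0.
have mg : mob g z = 24 * (b1 b)%:~R / n%:R - t^-1.
  have mE : mob g z = ((24 * (b1 b)%:Z)%:~R * z + e%:~R) / jf g z by [].
  have He' : 24 * 24 * (b1 b)%:R * (D b)%:~R - 1 = e%:~R * n%:R :> C.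
    by rewrite [RHS](_ : _ = (e * n%:Z)%:~R); [rewrite -He; ring|rewrite intrM].
  have -> : 24 * (b1 b)%:~R / n%:R - t^-1 = (24 * (b1 b)%:R * t - n%:R) / (n%:R * t) :> C by field; rewrite tn mC.
  have eE : (e%:~R : C) = (24 * 24 * (b1 b)%:R * (D b)%:~R - 1) / n%:R by apply: (mulIf mC); rewrite divfK.
  have bE : (24 * (b1 b)%:Z)%:~R = 24 * (b1 b)%:R :> C by ring.
  rewrite mE jg bE eE /z.
  by field; rewrite tn mC.
have mgu : upper (mob g z) by apply: upper_mob; rewrite ?dg.
have us' := upper_S t0; have es := eta_neq0 us'; have et := eta_neq0 t0; have ez := eta_neq0 z0.
have ctb : tb b%:Z (- t^-1) = mob g z by rewrite mg eb /b_tb addrC.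
have cop : coprime n 6.
  have : coprime M 6 by have := M_cop12 ps s5; rewrite (_ : 12 = 6 * 2)%N // coprimeMr => /andP[].
  by apply: coprime_dvdl; rewrite -(M1E b) dvdn_mulr.
have ec := eta_cusp m0 cop t0 (HD b); rewrite -/n -/z -mg -/(kap b) in ec.
have em : eta (mob g z) = kap b * eta z * (1 / eta t * eta (- t^-1)).
  by apply: (mulIf et); rewrite ec; field.
rewrite ctb (f_G0 mgu) (f_G0 z0) (G0_mod cf ew1 dg z0) em jg.
have DS := Delta_S t0; rewrite /Delta in DS.
have A := eta_alg 1 er' es et DS; rewrite exp1rz in A.
rewrite [(kap b * eta z * _) ^ r]expfzMl [(kap b * eta z) ^ r]expfzMl.
rewrite [(t / n%:R) ^ _]expfzMl exprz_inv ew' opprD expfzDr //.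
have t1 : t ^ (2 * w1) * t ^ (- (2 * w1)) = 1 by rewrite -expfzDr // subrr expr0z.
have t2 : t ^+ (12 * m) * t ^ (- (12 * m%:Z)) = 1 by rewrite exprnP -expfzDr // subrr expr0z.
move: t1 t2 A; move: (12 * m)%N => p.
move: ((1 / eta t * eta (- t^-1)) ^ r) (eta (- t^-1) ^+ r') (t ^ (2 * w1)) (t ^ (- (2 * w1))) (t ^+ p) (t ^ (- (12 * m%:Z))) (n%:R ^ _) (G0 r a z) (kap b ^ r) (eta z ^ r) (eta t ^+ r').
move=> y1 y2 x1 x2 x3 x4 x5 x6 x7 x8 x9 t1 t2 A.
transitivity ((x1 * x2) * x4 * (x5 * x7 * (x6 * x8) * (y1 * y2))); first by ring.
rewrite A t1; transitivity ((x3 * x4) * (x5 * x7 * (x6 * x8) * x9)); first by ring.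
by rewrite t2 mul1r.
Qed.
(** At the cusp 0 the translate with gcd(b, M) = g is a series in q^(g^2/(24 M^2)), whence the
    divisibility test. *)
Definition Bc (k : nat) : C := \sum_(b < M) c b%:Z * ((M1 b)%:R ^ (- (2 * w1)) * kap b ^ r *
  (if (gb b ^ 2 %| k)%N then a (k %/ gb b ^ 2)%N * ee (- (D b)%:~R / (M1 b)%:R) ^+ (k %/ gb b ^ 2) else 0)).
Lemma ql_Bc_term (b : nat) : ql (24 * M ^ 2) 0
  (fun k => if (gb b ^ 2 %| k)%N then a (k %/ gb b ^ 2)%N * ee (- (D b)%:~R / (M1 b)%:R) ^+ (k %/ gb b ^ 2) else 0)
  (fun t => f (t / (M1 b)%:R ^+ 2 - 24 * (D b)%:~R / (M1 b)%:R)).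
Proof.
have g0 : (0 < gb b ^ 2)%N by rewrite expn_gt0 gb_gt0.
have M20 : (0 < M ^ 2)%N by rewrite expn_gt0 (M_gt0 ps).
have := @ql_tri R 24 0 _ _ (gb b ^ 2) (M ^ 2) (- (24 * D b * (M * gb b)%N%:Z)) isT g0 M20 (ql_f cf).
have gC : ((gb b)%:R : C) != 0 by rewrite pnatr_eq0 -lt0n gb_gt0.
have mC : ((M1 b)%:R : C) != 0 by rewrite pnatr_eq0 -lt0n M1_gt0.
have ME : (M%:R : C) = (M1 b)%:R * (gb b)%:R by rewrite -natrM M1E.
have E1 : (- (24 * D b * (M * gb b)%N%:Z))%:~R = - (24 * (D b)%:~R * ((M1 b)%:R * (gb b)%:R * (gb b)%:R)) :> C.
  by rewrite -ME -natrM; ring.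
have E2 : ((M ^ 2)%N%:R : C) = ((M1 b)%:R * (gb b)%:R) ^+ 2 by rewrite natrX ME.
have E3 : ((24 * M ^ 2)%N%:R : C) = 24 * ((M1 b)%:R * (gb b)%:R) ^+ 2 by rewrite natrM E2.
rewrite mulr0; apply: ql_eq => [k|t t0].
  have E4 : (- (24 * D b * (M * gb b)%N%:Z))%:~R / (24 * M ^ 2)%N%:R = - (D b)%:~R / (M1 b)%:R :> C.
    by rewrite E1 E3; field; rewrite gC mC.
  rewrite mul0r ee0 mul1r -E4; exact: (trcE 24 _ _ a k g0).
by apply: (f_equal f); rewrite E1 E2 natrX; field; rewrite gC mC.
Qed.
Lemma ql_Bc : ql (24 * M ^ 2) 0 Bc (fun t => \sum_(b < M) c b%:Z * ((M1 b)%:R ^ (- (2 * w1)) * kap b ^ r *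
   f (t / (M1 b)%:R ^+ 2 - 24 * (D b)%:~R / (M1 b)%:R))).
Proof. by apply: ql_sum => b; apply: qlZ; apply: qlZ; exact: ql_Bc_term. Qed.
(** [transfer] applies to the form times eta^r'; multiplying by the integral expansion of eta^(-r')
    isolates [Bc]. *)
Lemma cusp0_transfer : s != [::] -> ~~ odd w' ->
  (forall n, I ((\sum_(b < M) c b%:Z * ee (b%:R / M%:R) ^+ n) * a n)) -> forall k, I (Bc k).
Proof.
move=> s0 ow van k; have M20 : (0 < M ^ 2)%N by rewrite expn_gt0 (M_gt0 ps).
have lN : ~~ (ell %| nsq s)%N by rewrite /nsq Euclid_dvdX // negb_and ls.
have L0 : (0 < 24 * M ^ 2)%N by rewrite muln_gt0.
have [d [Qd Od]] := ql_eta_pow.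
have QH : ql (24 * M ^ 2) 0 (conv Bc d) (fun t => HH (- t^-1) * t ^ (- w'%:Z)).
  have := qlM ql_Bc Qd; rewrite addr0; apply: ql_eq => // t t0.
  rewrite /HH /Ef !mulr_suml; apply: eq_bigr => b _; rewrite -!mulrA; congr (_ * _).
  by rewrite !mulrA cusp0_term // !mulrA.
have Ib := @transfer R ell pell ell5 s w' HH ps us s0 lN ow HH_G HH_O (HH_I van) _ QH.
have [v [Qv Ov _]] := qo_lift pell (isT : 0 < 24)%N M20 (qoX pell r' (qo_etaV R pell)).
have eN : (M ^ 2)%N%:Z * ((-1) *+ r') + (M ^ 2 * r')%N%:Z = 0 by rewrite PoszM mulNrn mulrN -mulr_natr mul1r natz addNr.
have Q1 := qlM Qv QH; rewrite addr0 in Q1.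
have Q2 := @ql_shift R (24 * M ^ 2) ((M ^ 2)%N%:Z * ((-1) *+ r')) (M ^ 2 * r') Bc _; rewrite eN in Q2.
have Q2' := Q2 _ ql_Bc.
have Q3 : ql (24 * M ^ 2) ((M ^ 2)%N%:Z * ((-1) *+ r')) (conv v (conv Bc d)) (fun t => \sum_(b < M) c b%:Z * ((M1 b)%:R ^ (- (2 * w1)) * kap b ^ r *
   f (t / (M1 b)%:R ^+ 2 - 24 * (D b)%:~R / (M1 b)%:R))).
  move: Q1; apply: ql_eq => // t t0; have et : eta t ^+ r' != 0 by rewrite expf_neq0 // eta_neq0.
  apply: (mulfI et); rewrite !mulrA exprVn divff // mul1r [RHS]mulrC mulr_suml.
  rewrite /HH /Ef !mulr_suml; apply: eq_bigr => b _; rewrite -!mulrA; congr (_ * _).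
  by rewrite !mulrA cusp0_term // !mulrA.
have := ql_inj L0 Q2' Q3 (M ^ 2 * r' + k)%N; rewrite leq_addr addKn => ->.
exact: conv_I.
Qed.
End Twist.

(** * Legendre symbols and Gauss sums *)

Section Legendre.
Variable p : nat.
Hypotheses (pp : prime p) (p3 : (3 <= p)%N).
Local Notation h := (p.-1 %/ 2)%N.
Implicit Types m n x : int.
Lemma half_p : (h + h).+1 = p.
Proof. by have := even_prime pp; case=> [e|]; [move: p3; rewrite e|move: p3; lia]. Qed.
Lemma legE n : legendre n p = if n%:~R == 0 :> 'F_p then 0 else if n%:~R ^+ h == 1 :> 'F_p then 1 else -1.
Proof. by rewrite /legendre !dvdz_Fp // rmorphB rmorphXn /= subr_eq0. Qed.
Lemma leg_cong n m : (p%:Z %| n - m)%Z -> legendre n p = legendre m p.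
Proof. by rewrite dvdz_Fp // rmorphB /= subr_eq0 !legE => /eqP->. Qed.
Lemma leg_per n : legendre (n + p%:Z) p = legendre n p.
Proof. by apply: leg_cong; rewrite addrC addKr dvdzz. Qed.
Lemma fermatF (x : 'F_p) : x != 0 -> x ^+ h ^+ 2 = 1.
Proof.
move=> x0; apply: (mulfI x0); rewrite -exprM -exprS mulr1.
have -> : (h * 2).+1 = #|'F_p| by rewrite card_Fp //; have := half_p; lia.
exact: finfield.expf_card.
Qed.
Lemma leg_Fp n : (legendre n p)%:~R = n%:~R ^+ h :> 'F_p.
Proof.
have hh := half_p; rewrite legE; case: eqVneq => [->|x0]; first by rewrite expr0n; case: eqP => // e; move: p3 hh; lia.
have := fermatF x0; move: (_ ^+ h) => y /eqP; rewrite sqrf_eq1 => /orP[] /eqP->; rewrite ?eqxx //.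
by case: eqP => [->//|_]; rewrite rmorphN1.
Qed.
Lemma leg_val n : [|| legendre n p == 0, legendre n p == 1 | legendre n p == -1].
Proof. by rewrite legE; case: ifP => // _; case: ifP. Qed.
(** Symbols take the values 0, 1, -1, so an equality between them can be checked in ['F_p] once p >=
    3. *)
Lemma small_Fp (k : int) : `|k| <= 2 -> k%:~R = 0 :> 'F_p -> k = 0.
Proof. by move=> k2 /eqP; rewrite -dvdz_Fp // dvdzE /= => /dvdn_leq; move: p3 k2; lia. Qed.
Lemma legM m n : legendre (m * n) p = legendre m p * legendre n p.
Proof.
apply/eqP; rewrite -subr_eq0; apply/eqP; apply: small_Fp; last first.
  by rewrite rmorphB rmorphM /= !leg_Fp rmorphM /= exprMn subrr.
have := leg_val (m * n); have := leg_val m; have := leg_val n.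
by do 3![case/or3P => /eqP->].
Qed.
Lemma leg0 n : (legendre n p == 0) = (p%:Z %| n)%Z.
Proof. by rewrite /legendre; case: ifP => // _; case: ifP. Qed.
Lemma leg1 : legendre 1 p = 1.
Proof. by rewrite legE expr1n eqxx oner_eq0. Qed.
Lemma leg_sq n : ~~ (p%:Z %| n)%Z -> legendre (n ^+ 2) p = 1.
Proof. by rewrite -leg0 expr2 legM; have := leg_val n; case/or3P => /eqP->. Qed.
Lemma leg2 n : ~~ (p%:Z %| n)%Z -> legendre n p ^+ 2 = 1.
Proof. by rewrite -leg0; have := leg_val n; case/or3P => /eqP->. Qed.
Lemma nonresidue : exists u : int, legendre u p = -1.
Proof.
apply: contrapT => H; have hh := half_p.
have all1 (x : 'F_p) : x != 0 -> root ('X^h - 1) x.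
  move=> x0; have xE : x = (val x)%:Z%:~R by rewrite -pmulrn natr_Zp.
  rewrite /root hornerD hornerN hornerXn hornerC subr_eq0.
  have : legendre (val x)%:Z p != -1 by apply/eqP => e; apply: H; exists (val x).
  by rewrite legE -xE (negbTE x0); case: ifP.
have h0 : (0 < h)%N by move: p3 hh; lia.
have n0 : ('X^h - 1 : {poly 'F_p}) != 0 by rewrite -size_poly_eq0 size_XnsubC.
have := @max_poly_roots _ _ (enum [pred x : 'F_p | x != 0]) n0; rewrite size_XnsubC // -cardE cardC1 card_Fp //.
have -> : all (root ('X^h - 1)) (enum [pred x : 'F_p | x != 0]) by apply/allP => x; rewrite mem_enum => /all1.
by rewrite enum_uniq => /(_ isT isT); move: p3 hh; lia.
Qed.
End Legendre.
Section GaussSums.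
Variable R : realType.
Local Notation C := (R[i]).
Definition em (M : nat) (x : int) : C := ee (x%:~R / M%:R).
Lemma emD M x y : em M (x + y) = em M x * em M y.
Proof. by rewrite /em intrD mulrDl eeD. Qed.
Lemma em_cong M x y : (0 < M)%N -> (M%:Z %| x - y)%Z -> em M x = em M y.
Proof. exact: ee_cong. Qed.
Lemma em_scale (a M : nat) x : (0 < a)%N -> em (a * M) (a%:Z * x) = em M x.
Proof.
move=> a0; have aC : (a%:R : C) != 0 by exact: natC0.
by apply: (f_equal (@ee R)); rewrite intrM natrM -pmulrn invfM mulrACA divff // mul1r.
Qed.
Lemma sum_em (M : nat) (j : int) : (0 < M)%N -> \sum_(k < M) em M (j * k%:Z) = if (M%:Z %| j)%Z then M%:R else 0.
Proof.
move=> M0; rewrite -(sum_ee R j M0); apply: eq_bigr => k _; apply: (f_equal (@ee R)).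
by rewrite intrM mulrAC -mulrA mulrCA mulrC mulrA -pmulrn; ring.
Qed.
Section OnePrime.
Variable p : nat.
Hypotheses (pp : prime p) (p3 : (3 <= p)%N).
Local Notation leg n := ((legendre n p)%:~R : C).
Let p0 : (0 < p)%N. Proof. exact: prime_gt0. Qed.
Lemma cop_p (u : int) : ~~ (p%:Z %| u)%Z -> coprime `|u| p.
Proof. by rewrite dvdzE /= coprime_sym prime_coprime. Qed.
Lemma leg_sum0 : \sum_(x < p) leg x%:Z = 0.
Proof.
have [u hu] := nonresidue pp p3.
have cu : coprime `|u| p by apply: cop_p; rewrite -leg0 hu.
have := @period_mul C (fun x => leg x) p u p0 cu (fun x => congr1 intr (leg_per pp x)).
rewrite (eq_bigr (fun x : 'I_p => - leg x%:Z)) ?sumrN; last by move=> x _; rewrite legM // hu mulN1r rmorphN.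
by move/eqP; rewrite eq_sym -subr_eq0 opprK -mulr2n mulrn_eq0 => /eqP.
Qed.
Definition G1 : C := \sum_(x < p) leg x%:Z * em p x%:Z.
Lemma gauss_leg (b : int) : \sum_(x < p) leg x%:Z * em p (x%:Z * b) = leg b * G1.
Proof.
have [db|nb] := boolP (p%:Z %| b)%Z.
  have -> : legendre b p = 0 by apply/eqP; rewrite leg0.
  rewrite mul0r -[RHS]leg_sum0; apply: eq_bigr => x _.
  rewrite (em_cong (y := 0) p0) ?subr0 ?dvdz_mull // /em mul0r ee0 mulr1 //.
rewrite mulr_sumr -(@period_mul C (fun x => leg b * (leg x * em p x)) p b p0 (cop_p nb)); last first.
  by move=> x; rewrite leg_per // (em_cong (y := x) p0) // addrC addKr dvdzz.
apply: eq_bigr => x _; rewrite legM // intrM mulrA mulrA -intrM -expr2 leg2 // mul1r.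
by rewrite mulrC [b * _]mulrC mulrC.
Qed.
Lemma G1_sq : G1 ^+ 2 = leg (-1) * p%:R.
Proof.
rewrite expr2 {2}/G1 mulr_sumr.
rewrite (eq_bigr (fun m : 'I_p => \sum_(x < p) leg x%:Z * em p ((x%:Z + 1) * m%:Z))); last first.
  move=> m _; rewrite mulrA [G1 * _]mulrC -gauss_leg mulr_suml; apply: eq_bigr => x _.
  by rewrite -mulrA -emD mulrDl mul1r.
rewrite exchange_big /=.
rewrite (eq_bigr (fun x : 'I_p => leg x%:Z * (if (p%:Z %| x%:Z + 1)%Z then p%:R else 0))); last first.
  by move=> x _; rewrite -mulr_sumr sum_em.
have lt : (p.-1 < p)%N by rewrite prednK.
rewrite (bigD1 (Ordinal lt)) //= big1 => [|x].
  rewrite addr0 -[p.-1%:Z + 1]/((p.-1 + 1)%N%:Z) addn1 prednK // dvdzz.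
  by rewrite (leg_cong pp (_ : (p%:Z %| p.-1%:Z - -1)%Z)) // opprK -[p.-1%:Z + 1]/((p.-1 + 1)%N%:Z) addn1 prednK // dvdzz.
move=> /eqP nx; case: ifP => [|_]; last by rewrite mulr0.
rewrite -[x%:Z + 1]/((x + 1)%N%:Z) dvdzE /= => d; case: nx; apply: val_inj => /=.
by have := dvdn_leq _ d; have := ltn_ord x; lia.
Qed.
Lemma phi_lt (x : 'I_p) : (x ^ 2 %% p < p)%N. Proof. by rewrite ltn_mod. Qed.
Definition phi x := Ordinal (phi_lt x).
Lemma phiP (x i : 'I_p) : (phi x == i) = (p%:Z %| x%:Z ^+ 2 - i%:Z)%Z.
Proof.
rewrite -[_ ^+ 2]/((x ^ 2)%N%:Z) -eqz_mod_dvd !modz_nat -(inj_eq val_inj) /= eqz_nat.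
by rewrite (modn_small (ltn_ord i)).
Qed.
Definition sqc (n : 'I_p) : nat := #|[set x | phi x == n]|.
Lemma sqc_le (n : 'I_p) : (sqc n)%:Z <= 1 + legendre n%:Z p.
Proof.
have P1 (x : 'I_p) : (p%:Z %| x%:Z ^+ 2 - n%:Z)%Z -> ~~ (p%:Z %| n%:Z)%Z -> legendre n%:Z p = 1.
  move=> d nn; rewrite -(leg_cong pp d) leg_sq //; apply: contra nn => dx.
  by have := rpredB (dvdz_mulr x%:Z dx) d; rewrite -expr2 opprB addrC subrK.
rewrite /sqc.
have [dn|nn] := boolP (p%:Z %| n%:Z)%Z.
  have -> : legendre n p = 0 by apply/eqP; rewrite leg0.
  rewrite addr0 lez_nat -(cards1 (Ordinal p0)).
  apply: subset_leq_card; apply/fintype.subsetP => x; rewrite !inE phiP => d.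
  have : (p%:Z %| x%:Z ^+ 2)%Z by have := rpredD d dn; rewrite subrK.
  rewrite dvdzE abszX Euclid_dvdX //= => /andP[dx _]; apply/eqP; apply: val_inj => /=.
  have [//|x0] := posnP x; have := dvdn_leq x0 dx; have := ltn_ord x; lia.
case: (pickP [pred x | phi x == n]) => [x0 /= d0|no]; last first.
  rewrite eq_card0; last by move=> x; have := no x; rewrite !inE.
  by have := leg_val pp n; case/or3P => /eqP->.
rewrite phiP in d0; rewrite (P1 _ d0 nn); have lt : ((p - x0) %% p < p)%N by rewrite ltn_mod.
rewrite lez_nat; apply: (@leq_trans #|[set x0; Ordinal lt]|); last by rewrite cards2; case: (_ != _).
apply: subset_leq_card; apply/fintype.subsetP => x; rewrite !inE phiP => d.
have : (p%:Z %| (x%:Z - x0%:Z) * (x%:Z + x0%:Z))%Z by have := rpredB d d0; rewrite opprB addrA subrK subr_sqr.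
rewrite dvdzE abszM Euclid_dvdM // => /orP[] dx; apply/orP; [left|right]; apply/eqP; apply: val_inj => /=.
  move: dx (ltn_ord x) (ltn_ord x0); move: (nat_of_ord x) (nat_of_ord x0) => u v dx ux vx; apply/eqP.
  by apply: contraTT isT => /eqP ne; have : (absz (u%:Z - v%:Z)%R < p)%N /\ (0 < absz (u%:Z - v%:Z)%R)%N; [clear -ne ux vx; lia|case=> h1 /dvdn_leq/(_ dx); rewrite leqNgt h1].
have {}dx : (p %| x + x0)%N by move: dx; rewrite -PoszD.
have [x00|x0p] := posnP x0.
  rewrite x00 subn0 modnn; move: dx; rewrite x00 addn0 => dx; have [//|xp] := posnP x.
  by have := dvdn_leq xp dx; have := ltn_ord x; lia.
move: (ltn_ord x) (ltn_ord x0) dx x0p; move: (nat_of_ord x) (nat_of_ord x0) => u v ux vx dx x0p.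
rewrite modn_small; last by rewrite ltn_subrL x0p p0.
have [k hk] := dvdnP dx; clear -hk ux vx x0p; case: k hk => [|[|k]] hk; nia.
Qed.
(** The upper bounds of [sqc_le] sum to p over all classes, and so do the numbers of square roots;
    hence every bound is attained. *)
Lemma sqcE (n : 'I_p) : (sqc n)%:Z = 1 + legendre n%:Z p.
Proof.
have tot : \sum_(i < p) (1 + legendre i%:Z p - (sqc i)%:Z) = 0.
  rewrite sumrB big_split /= sumr_const card_ord.
  have -> : \sum_(i < p) legendre i%:Z p = 0.
    by apply/eqP; rewrite -(intr_eq0 C) rmorph_sum /= leg_sum0.
  have -> : \sum_(i < p) (sqc i)%:Z = p%:Z.
    transitivity ((\sum_(x < p) 1)%N%:Z); last by rewrite sum1_card card_ord.
    rewrite [in RHS](partition_big phi predT) //= -[RHS]natz natr_sum.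
    apply: eq_bigr => i _; rewrite natz /sqc -sum1_card; congr Posz; by apply: eq_bigl => x; rewrite inE.
  by rewrite addr0 natz subrr.
have ge (i : 'I_p) : 0 <= 1 + legendre i%:Z p - (sqc i)%:Z by rewrite subr_ge0 sqc_le.
by have /eqP := psumr_eq0P (fun i _ => ge i) tot (i := n) isT; rewrite subr_eq0 => /eqP.
Qed.
Lemma sum_sq (F : int -> C) : (forall x, F (x + p%:Z) = F x) ->
  \sum_(x < p) F (x%:Z ^+ 2) = \sum_(n < p) (1 + leg n%:Z) * F n%:Z.
Proof.
move=> hF; rewrite (partition_big phi predT) //=; apply: eq_bigr => n _.
rewrite -[1 + _]/((1 : int)%:~R + _) -intrD -sqcE -pmulrn /sqc -sum1_card natr_sum mulr_suml.
rewrite [RHS](eq_bigl (fun x => phi x == n)); last by move=> x; rewrite inE.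
apply: eq_bigr => x /eqP <-; rewrite mul1r -[_ ^+ 2]/((x ^ 2)%N%:Z) -(period_modz _ hF) modz_nat.
by [].
Qed.
Lemma gauss_quad (b : int) : ~~ (p%:Z %| b)%Z -> \sum_(x < p) em p (b * x%:Z ^+ 2) = leg b * G1.
Proof.
move=> nb; rewrite (sum_sq (F := fun x => em p (b * x))); last first.
  by move=> x; apply: em_cong => //; rewrite mulrDr addrC addKr dvdz_mull.
rewrite (eq_bigr (fun n : 'I_p => em p (b * n%:Z) + leg n%:Z * em p (n%:Z * b))); last first.
  by move=> n _; rewrite mulrDl mul1r [b * _]mulrC.
by rewrite big_split /= sum_em // (negbTE nb) add0r gauss_leg.
Qed.
Lemma ramanujan (b : int) : \sum_(x < p) leg x%:Z ^+ 2 * em p (x%:Z * b) = (if (p%:Z %| b)%Z then p%:R else 0) - 1.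
Proof.
rewrite -sum_em // (bigD1 (Ordinal p0)) //= [in RHS](bigD1 (Ordinal p0)) //=.
have -> : legendre 0 p = 0 by apply/eqP; rewrite leg0 dvdz0.
rewrite expr0n mul0r add0r mulr0 {2}/em mul0r ee0 addrC addrK; apply: eq_bigr => x x0.
rewrite -rmorphXn /= leg2 ?mul1r 1?mulrC // dvdzE /=; apply/negP => /dvdn_leq; have := ltn_ord x.
by move/eqP: x0 => x0; have : (x : nat) <> 0%N; [move=> e; apply: x0; apply: val_inj|lia].
Qed.
End OnePrime.
End GaussSums.

(** The Jacobi symbol modulo [lprod s], kept as a list so that inductions run over the primes. *)
Definition chi (s : seq nat) (n : int) : int := \prod_(p <- s) legendre n p.
Lemma chi_cons p s n : chi (p :: s) n = legendre n p * chi s n. Proof. by rewrite /chi big_cons. Qed.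
Section Chi.
Implicit Types (s : seq nat) (m n b : int).
Definition oddp s := all (fun p => prime p && (3 <= p)%N) s.
Lemma chiM s m n : oddp s -> chi s (m * n) = chi s m * chi s n.
Proof.
rewrite /chi; elim: s => [|p s IH] /=; first by rewrite !big_nil.
by case/andP => /andP[pp p3] /IH h; rewrite !big_cons h legM //; ring.
Qed.
Lemma chi_cong s m n : oddp s -> ((lprod s)%:Z %| m - n)%Z -> chi s m = chi s n.
Proof.
elim: s => [|p s IH] /=; first by rewrite /chi !big_nil.
case/andP => /andP[pp p3] os; rewrite !chi_cons lprod_cons PoszM => d.
rewrite (leg_cong pp (dvdz_trans (dvdz_mulr _ (dvdzz _)) d)) IH //.
exact: dvdz_trans (dvdz_mull _ (dvdzz _)) d.
Qed.
Lemma chi_per s n : oddp s -> chi s (n + (lprod s)%:Z) = chi s n.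
Proof. by move=> os; apply: chi_cong => //; rewrite addrC addKr dvdzz. Qed.
Lemma chi_val s n : oddp s -> [|| chi s n == 0, chi s n == 1 | chi s n == -1].
Proof.
elim: s => [|p s IH] /=; first by rewrite /chi !big_nil.
case/andP => /andP[pp p3] /IH; rewrite chi_cons; have := leg_val pp n.
by do 2![case/or3P => /eqP->].
Qed.
Lemma chi0 s n : oddp s -> (chi s n != 0) = coprime `|n| (lprod s).
Proof.
elim: s => [|p s IH] /=; first by rewrite /chi /lprod !big_nil coprimen1.
case/andP => /andP[pp p3] /IH h; rewrite chi_cons lprod_cons coprimeMr mulf_eq0 negb_or h leg0 dvdzE /=.
by rewrite -prime_coprime // [coprime p _]coprime_sym.
Qed.
Lemma chi2 s n : oddp s -> coprime `|n| (lprod s) -> chi s n ^+ 2 = 1.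
Proof. by move=> os; rewrite -chi0 //; have := chi_val n os; case/or3P => /eqP->. Qed.
Lemma chi_sqr s n : oddp s -> coprime `|n| (lprod s) -> chi s (n ^+ 2) = 1.
Proof. by move=> os c; rewrite expr2 chiM // -expr2 chi2. Qed.
Lemma oddp_prime s : oddp s -> all prime s.
Proof. by apply: sub_all => p /andP[]. Qed.
Lemma lprod_gt0 s : oddp s -> (0 < lprod s)%N.
Proof. by move=> /oddp_prime; apply: M_gt0. Qed.
End Chi.
Section GaussProd.
Variable R : realType.
Local Notation C := (R[i]).
Local Notation em := (@em R).
Local Notation chC s n := ((chi s n)%:~R : C).
(** The Ramanujan sum of squarefree modulus [lprod s], in product form. *)
Definition rm (s : seq nat) (b : int) : C := \prod_(p <- s) ((if (p%:Z %| b)%Z then p%:R else 0) - 1).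
Lemma em_scaler (a M : nat) x : (0 < a)%N -> em (M * a) (a%:Z * x) = em M x.
Proof. by rewrite mulnC; exact: em_scale. Qed.
Lemma em_mult (M : nat) x : (0 < M)%N -> em M (M%:Z * x) = 1.
Proof. by move=> M0; rewrite (@em_cong R M _ 0) ?subr0 ?dvdz_mulr // /em mul0r ee0. Qed.
Lemma crt_em (p M' : nat) (F G : int -> C) (b : int) : (0 < p)%N -> (0 < M')%N -> coprime p M' ->
  (forall x, F (x + p%:Z) = F x) -> (forall x, G (x + M'%:Z) = G x) ->
  \sum_(j < p * M') F j%:Z * G j%:Z * em (p * M') (j%:Z * b) =
  (\sum_(y < p) F (M'%:Z * y%:Z) * em p (y%:Z * b)) * (\sum_(x < M') G (p%:Z * x%:Z) * em M' (x%:Z * b)).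
Proof.
move=> p0 M0 cp hF hG.
have FE (k : nat) x : F (x + k%:Z * p%:Z) = F x.
  by elim: k => [|k IH]; rewrite ?mul0r ?addr0 // intS mulrDl mul1r [_%:Z + _ * _]addrC addrA hF.
have GE (k : nat) x : G (x + k%:Z * M'%:Z) = G x.
  by elim: k => [|k IH]; rewrite ?mul0r ?addr0 // intS mulrDl mul1r [_%:Z + _ * _]addrC addrA hG.
rewrite (crt_sum (f := fun j => F j%:Z * G j%:Z * em (p * M') (j%:Z * b))) //.
  rewrite mulr_sumr; apply: eq_bigr => x _; rewrite mulr_suml; apply: eq_bigr => y _.
  have -> : (p * x + M' * y)%N%:Z = M'%:Z * y%:Z + x%:Z * p%:Z by rewrite PoszD !PoszM; ring.
  rewrite FE [M'%:Z * _ + _]addrC (_ : _ + _ = p%:Z * x%:Z + y%:Z * M'%:Z); last by ring.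
  rewrite GE (_ : (_ + _) * b = p%:Z * (x%:Z * b) + M'%:Z * (y%:Z * b)); last by ring.
  rewrite emD em_scale // em_scaler //; ring.
move=> x; rewrite PoszD PoszM {1}[p%:Z * _]mulrC FE GE; congr (_ * _); apply: em_cong; first by rewrite muln_gt0 p0.
by rewrite PoszM mulrDl addrC addKr dvdz_mulr.
Qed.
(** One number g serves both the linear Gauss sums of chi and the quadratic sums [gs], as 144 is a
    square prime to the modulus. Its sign stays undetermined; g^2 is recorded. *)
Lemma gauss_prod s : oddp s -> uniq s -> all (fun p => (5 <= p)%N) s -> exists g : C, [/\
  forall b, \sum_(x < lprod s) chC s x%:Z * em (lprod s) (x%:Z * b) = chC s b * g,
  g ^+ 2 = chC s (-1) * (lprod s)%:R &
  forall b, coprime `|b| (lprod s) -> gs R (lprod s) b = chC s b * g].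
Proof.
elim: s => [|p s IH].
  exists 1; rewrite /chi /gs /lprod; split=> [b||b _]; rewrite ?big_nil ?mulr1 ?expr1n // big_ord1 ?big_nil.
    by rewrite mul0r /em mul0r ee0 mulr1.
  by rewrite expr0n mulr0 mul0r ee0.
move=> /= /andP[/andP[pp p3] os] /andP[ns us] /andP[p5 s5]; have [g [h1 h2 h3]] := IH os us s5.
have p0 := prime_gt0 pp; have M0 := lprod_gt0 os.
have cp : coprime p (lprod s) by apply: cop_lprod => //; exact: oddp_prime.
have pM : ~~ (p%:Z %| (lprod s)%:Z)%Z by rewrite dvdzE /= -prime_coprime.
have P1 x : (legendre (x + p%:Z) p)%:~R = (legendre x p)%:~R :> C by rewrite leg_per.
have P2 x : chC s (x + (lprod s)%:Z) = chC s x by rewrite chi_per.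
exists ((legendre (lprod s) p)%:~R * chC s p%:Z * (G1 R p * g)); split.
- move=> b; rewrite lprod_cons.
  rewrite (eq_bigr (fun j : 'I_(p * lprod s) => (legendre j%:Z p)%:~R * chC s j%:Z * em (p * lprod s) (j%:Z * b))); last first.
    by move=> j _; rewrite chi_cons intrM.
  rewrite (crt_em b p0 M0 cp P1 P2) chi_cons intrM.
  rewrite (eq_bigr (fun y : 'I_p => (legendre (lprod s) p)%:~R * ((legendre y p)%:~R * em p (y%:Z * b)))); last first.
    by move=> y _; rewrite legM // intrM mulrA.
  rewrite -mulr_sumr gauss_leg //.
  rewrite (eq_bigr (fun x : 'I_(lprod s) => chC s p%:Z * (chC s x%:Z * em (lprod s) (x%:Z * b)))); last first.
    by move=> x _; rewrite chiM // intrM mulrA.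
  rewrite -mulr_sumr h1; ring.
- have l2 := leg2 pp pM; have c2 := @chi2 s p%:Z os cp.
  rewrite exprMn exprMn -!rmorphXn /= l2 c2.
  rewrite exprMn h2 G1_sq // chi_cons lprod_cons natrM intrM; ring.
move=> b; rewrite lprod_cons coprimeMr => /andP[cb1 cb2].
have nb : ~~ (p%:Z %| b)%Z by rewrite dvdzE /= -prime_coprime // coprime_sym.
rewrite /gs (crt_sum (f := fun j : nat => em (p * lprod s) (144 * b * j%:Z ^+ 2))) //; last first.
  move=> x; apply: em_cong; first by rewrite muln_gt0 p0.
  have -> : 144 * b * (x + p * lprod s)%N%:Z ^+ 2 - 144 * b * x%:Z ^+ 2 = (p * lprod s)%N%:Z * (144 * b * (x%:Z *+ 2 + (p * lprod s)%N%:Z)).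
    by rewrite PoszD; ring.
  by rewrite dvdz_mulr.
transitivity (gs R (lprod s) (b * p%:Z) * (\sum_(y < p) em p (144 * (b * (lprod s)%:Z) * y%:Z ^+ 2))).
  rewrite /gs mulr_suml; apply: eq_bigr => x _; rewrite mulr_sumr; apply: eq_bigr => y _.
  have -> : 144 * b * (p * x + lprod s * y)%N%:Z ^+ 2 = p%:Z * (144 * (b * p%:Z) * x%:Z ^+ 2) +
     ((lprod s)%:Z * (144 * (b * (lprod s)%:Z) * y%:Z ^+ 2) + (p * lprod s)%N%:Z * (288 * b * x%:Z * y%:Z)).
    by rewrite PoszD !PoszM; ring.
  by rewrite emD em_scale // emD em_scaler // em_mult ?mulr1 // muln_gt0 p0.
have n12 : ~~ (p%:Z %| 12)%Z.
  rewrite dvdzE /=; apply/negP => h; have := @Euclid_dvdM 4 3 p pp; rewrite (_ : 4 * 3 = 12)%N // h (_ : 4 = 2 ^ 2)%N // Euclid_dvdX // andbT => /esym/orP[] /dvdn_leq; clear -p5; lia.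
have n144 : ~~ (p%:Z %| 144 * (b * (lprod s)%:Z))%Z.
  rewrite -(leg0) !legM // !mulf_eq0 !negb_or !leg0 nb pM (_ : 144 = 12 ^+ 2) // !andbT.
  by rewrite dvdzE abszX Euclid_dvdX // andbT -[(p %| _)%N]/(p%:Z %| 12)%Z.
rewrite h3 ?abszM ?coprimeMl ?cb2 // gauss_quad // chi_cons (legM pp p3 144) (_ : 144 = 12 ^+ 2) // leg_sq // !legM // chiM // !intrM; ring.
Qed.
Lemma rm_sum s b : oddp s -> uniq s ->
  \sum_(x < lprod s) chC s x%:Z ^+ 2 * em (lprod s) (x%:Z * b) = rm s b.
Proof.
elim: s => [|p s IH].
  by move=> _ _; rewrite /rm /lprod /chi !big_nil big_ord1 big_nil expr1n mul1r mul0r /em mul0r ee0.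
move=> /= /andP[/andP[pp p3] os] /andP[ns us]; have {}IH := IH os us.
have p0 := prime_gt0 pp; have M0 := lprod_gt0 os.
have cp : coprime p (lprod s) by apply: cop_lprod => //; exact: oddp_prime.
have pM : ~~ (p%:Z %| (lprod s)%:Z)%Z by rewrite dvdzE /= -prime_coprime.
have P1 x : (legendre (x + p%:Z) p)%:~R ^+ 2 = (legendre x p)%:~R ^+ 2 :> C by rewrite leg_per.
have P2 x : chC s (x + (lprod s)%:Z) ^+ 2 = chC s x ^+ 2 by rewrite chi_per.
rewrite lprod_cons /rm big_cons -/(rm s b).
rewrite (eq_bigr (fun j : 'I_(p * lprod s) => (legendre j%:Z p)%:~R ^+ 2 * chC s j%:Z ^+ 2 * em (p * lprod s) (j%:Z * b))); last first.
  by move=> j _; rewrite chi_cons intrM exprMn.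
rewrite (crt_em b p0 M0 cp P1 P2) -ramanujan // -IH; congr (_ * _); apply: eq_bigr => x _.
  by rewrite legM // intrM exprMn -[_%:~R ^+ 2 * _%:~R ^+ 2](mulrC) -[X in _ * X * _]rmorphXn /= leg2 // mulr1.
by rewrite chiM // intrM exprMn -[X in X * _ * _]rmorphXn /= chi2 // mul1r.
Qed.
End GaussProd.

(** * Isolating chi = -1, and the resulting relation between a(Q^2 n) and a(n) *)

Lemma chi12_sq (n : nat) : coprime n 12 -> chi12 n ^+ 2 = 1.
Proof.
rewrite -coprime_modl /chi12; have := ltn_pmod n (isT : 0 < 12)%N.
by move: (n %% 12)%N; do 12![case=> //].
Qed.
Lemma oddpow (R : realType) (e r r1 : int) : r + 1 = 2 * r1 -> e ^+ 2 = 1 -> (e%:~R : R[i]) ^ r = e%:~R.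
Proof.
move=> er e2; have e0 : (e%:~R : R[i]) != 0.
  by rewrite intr_eq0; apply: contra_eq_neq e2 => ->; rewrite expr0n.
apply: (mulIf e0); rewrite -{2}(expr1z (e%:~R : R[i])) -expfzDr // er -exprz_exp -[_ ^ 2]/(_ ^+ 2) -expr2 -rmorphXn /= e2 exp1rz.
by [].
Qed.
Lemma chi_ncop s n : oddp s -> ~~ coprime `|n| (lprod s) -> chi s n = 0.
Proof. by move=> os; rewrite -chi0 // negbK => /eqP. Qed.
Section Weights.
Variable R : realType.
Local Notation C := (R[i]).
Local Notation em := (@em R).
Local Notation chC s n := ((chi s n)%:~R : C).
Lemma rm_cop s b : oddp s -> coprime `|b| (lprod s) -> rm R s b = (-1) ^+ size s.
Proof.
elim: s => [|p s IH] /=; first by rewrite /rm big_nil.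
case/andP => /andP[pp _] os; rewrite lprod_cons coprimeMr => /andP[c1 c2].
have -> : rm R (p :: s) b = ((if (p%:Z %| b)%Z then p%:R else 0) - 1) * rm R s b by rewrite /rm big_cons.
by rewrite IH // dvdzE /= [(p %| _)%N](negbTE _) ?sub0r -?exprS // -prime_coprime // coprime_sym.
Qed.
Variable s : seq nat.
Hypotheses (os : oddp s) (us : uniq s).
Local Notation M := (lprod s).
Let M0 : (0 < M)%N. Proof. exact: lprod_gt0. Qed.
(** Fourier coefficients of chi^2 - chi, which is twice the indicator of chi = -1; see [wt_inv]. *)
Definition wt (b : int) : C := M%:R^-1 * \sum_(n < M) (chC s n%:Z ^+ 2 - chC s n%:Z) * em M (n%:Z * - b).
Lemma wt_per b : wt (b + M%:Z) = wt b.
Proof.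
congr (_ * _); apply: eq_bigr => n _; congr (_ * _); apply: em_cong => //.
by rewrite opprD mulrDr addrC addKr mulrN rpredN dvdz_mull.
Qed.
Lemma wt_sqr d b : coprime `|d| M -> wt (d ^+ 2 * b) = wt b.
Proof.
move=> cd; congr (_ * _).
have c2 : coprime `|d ^+ 2| M by rewrite abszX coprimeXl.
rewrite -[RHS](@period_mul C (fun n => (chC s n ^+ 2 - chC s n) * em M (n * - b)) M (d ^+ 2) M0 c2).
  by apply: eq_bigr => n _; rewrite chiM // chi_sqr // mul1r; congr (_ * em _ _); ring.
move=> x; rewrite chi_per //; congr (_ * _); apply: em_cong => //.
by rewrite mulrDl addrC addKr dvdz_mulr.
Qed.
Lemma wt_O ell b : prime ell -> ~~ (ell %| M)%N -> in_Oell ell (wt b).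
Proof.
move=> pell lM; apply: OM => //; first exact: O_inv.
apply: O_sum => // n _; apply: OM => //; last exact: O_ee.
by rewrite -rmorphXn -rmorphB; exact: O_int.
Qed.
Lemma wt_inv (n : nat) : \sum_(b < M) wt b%:Z * ee (b%:R / M%:R) ^+ n = chC s n%:Z ^+ 2 - chC s n%:Z.
Proof.
have MC : (M%:R : C) != 0 by exact: natC0.
rewrite (eq_bigr (fun b : 'I_M => \sum_(m < M) M%:R^-1 * ((chC s m%:Z ^+ 2 - chC s m%:Z) * em M ((n%:Z - m%:Z) * b%:Z)))); last first.
  move=> b _; rewrite /wt -mulrA mulr_suml mulr_sumr; apply: eq_bigr => m _; rewrite -!mulrA; congr (_ * (_ * _)).
  have -> : (n%:Z - m%:Z) * b%:Z = m%:Z * - b%:Z + n%:Z * b%:Z by ring.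
  rewrite emD -eeMn; apply: (f_equal (fun x => _ * x)); apply: (f_equal (@ee R)).
  by rewrite intrM mulrA.
rewrite exchange_big /=; have lt : (n %% M < M)%N by rewrite ltn_mod.
rewrite (bigD1 (Ordinal lt)) //= [X in _ + X]big1 ?addr0 => [|i /eqP ni].
  rewrite -mulr_sumr -mulr_sumr sum_em // -eqz_mod_dvd !modz_nat modn_mod eqxx.
  rewrite mulrCA mulVf // mulr1 (@chi_cong s _ n%:Z) // -eqz_mod_dvd !modz_nat modn_mod //.
rewrite -mulr_sumr -mulr_sumr sum_em // -eqz_mod_dvd !modz_nat eqz_nat; case: eqP => [e|_]; last by rewrite !mulr0.
by case: ni; apply: val_inj; rewrite /= e modn_small.
Qed.
Variable g : C.
Hypothesis hg : forall b, \sum_(x < M) chC s x%:Z * em M (x%:Z * b) = chC s b * g.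
Lemma wtE b : wt b = M%:R^-1 * (rm R s (- b) - chC s (- b) * g).
Proof.
by congr (_ * _); rewrite -rm_sum // -hg -sumrB; apply: eq_bigr => n _; rewrite mulrBl.
Qed.
Variable D : nat -> int.
Hypothesis HD : forall b : nat, coprime b M -> (M%:Z %| 576 * b%:Z * D b - 1)%Z.
Hypothesis c24 : coprime M 24.
Lemma D_cop b : coprime b M -> coprime `|D b| M.
Proof.
move=> cb; have /dvdzP[e he] := HD cb;
have : (gcdz (D b) M %| 1)%Z.
  have : (gcdz (D b) M %| 576 * b%:Z * D b - e * M%:Z)%Z by rewrite rpredB // dvdz_mull // ?dvdz_gcdl ?dvdz_gcdr.
  by rewrite -he opprB addrC subrK.
by rewrite dvdz1 /gcdz /coprime.
Qed.
Lemma chi_D b : coprime b M -> chi s (D b) = chi s b%:Z.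
Proof.
move=> cb.
have e1 : chi s (576 * b%:Z * D b) = chi s 1 by apply: chi_cong => //; exact: HD.
have c1 : chi s 1 = 1 by have := @chi_sqr s 1 os; rewrite expr1n coprime1n; apply.
have c2 : chi s 576 = 1 by apply: (@chi_sqr s 24) => //; rewrite coprime_sym.
move: e1; rewrite !chiM // c1 c2 mul1r => e; have := @chi2 s b%:Z os cb.
by rewrite expr2 => e2; rewrite -[LHS]mul1r -e2 -mulrA e mulr1.
Qed.
(** [D b] inverts 576 b modulo M, so it permutes the invertible classes. *)
Lemma inv_sum (F : int -> C) : (forall x, F (x + M%:Z) = F x) ->
  \sum_(b < M | coprime b M) F (D b) = \sum_(b < M | coprime b M) F b%:Z.
Proof.
move=> hF.
have lt (x : int) : (absz (x %% M)%Z < M)%N by move: (@ltz_pmod x M%:Z) (@modz_ge0 x M%:Z) M0; clear; lia.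
have lE (x : int) : (absz (x %% M)%Z)%:Z = (x %% M)%Z by rewrite gez0_abs // modz_ge0 //; move: M0; clear; lia.
have ld (x : int) : (M%:Z %| (absz (x %% M)%Z)%:Z - x)%Z by rewrite lE -eqz_mod_dvd modz_mod.
pose h (b : 'I_M) := if coprime b M then Ordinal (lt (D b)) else b.
have hc b : coprime (h b) M = coprime b M.
  rewrite /h; case: ifP => [cb|->//] /=; rewrite -[coprime _ M](chi0 (absz (D b %% M)%Z)%:Z os).
  by rewrite (chi_cong os (ld _)) chi0 // D_cop.
have hi : injective h.
  move=> b b' e; have ec : coprime b M = coprime b' M by rewrite -hc e hc.
  move: e; rewrite /h -ec; case: ifP => // cb /(congr1 val)/= e; have cb' := cb; rewrite ec in cb'.
  have d : (M%:Z %| D b - D b')%Z.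
    have := rpredB (ld (D b')) (ld (D b)); rewrite e; congr (_ %| _)%Z; ring.
  have [d1 d2] := (HD cb, HD cb').
  have : (M%:Z %| b%:Z - b'%:Z)%Z.
    have -> : b%:Z - b'%:Z = b'%:Z * (576 * b%:Z * D b - 1) - b%:Z * (576 * b'%:Z * D b' - 1) - 576 * b%:Z * b'%:Z * (D b - D b') by ring.
    by apply: rpredB; [apply: rpredB|]; apply: dvdz_mull.
  move=> /[dup]; rewrite -eqz_mod_dvd !modz_nat eqz_nat !modn_small // => /eqP ee _; exact: val_inj.
rewrite [RHS](reindex_inj hi); apply: eq_big => [b|b cb]; first by rewrite hc.
by rewrite /h cb /= lE period_modz.
Qed.
End Weights.
Section Relation.
Variable R : realType.
Local Notation C := (R[i]).
Local Notation em := (@em R).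
Local Notation chC s n := ((chi s n)%:~R : C).
Variable ell : nat.
Hypothesis pell : prime ell.
Hypothesis ell5 : (5 <= ell)%N.
Local Notation O := (@in_Oell R ell).
Local Notation I := (@I_ R ell).
Variables (k2 r : int) (a : nat -> C).
Hypothesis cf : cusp_form ell k2 r a.
Variables w1 r1 : int.
Hypotheses (ew1 : k2 - r = 4 * w1) (er1 : r + 1 = 2 * r1).
Variables (Q : nat) (s : seq nat).
Local Notation S := (Q :: s).
Hypotheses (oS : oddp S) (uS : uniq S) (S5 : all (fun p => (5 <= p)%N) S) (lS : ~~ (ell %| lprod S)%N).
Local Notation M := (lprod S).
Local Notation P := (lprod s).
Let pQ : prime Q. Proof. by have := oS; rewrite /= => /andP[/andP[]]. Qed.
Let os : oddp s. Proof. by have := oS; rewrite /= => /andP[]. Qed.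
Let us : uniq s. Proof. by have := uS; rewrite /= => /andP[]. Qed.
Let s5 : all (fun p => (5 <= p)%N) s. Proof. by have := S5; rewrite /= => /andP[]. Qed.
Let M0 : (0 < M)%N. Proof. exact: lprod_gt0. Qed.
Let P0 : (0 < P)%N. Proof. exact: lprod_gt0. Qed.
Let ME : M = (Q * P)%N. Proof. exact: lprod_cons. Qed.
Let QP : coprime Q P.
Proof. by apply: cop_lprod => //; [exact: oddp_prime|have := uS; rewrite /= => /andP[]]. Qed.
Lemma kap_cop (L : seq nat) (g : C) (n : nat) : oddp L -> all (fun p => (5 <= p)%N) L -> coprime n (lprod L) -> gs R (lprod L) n%:Z = chC L n%:Z * g ->
  ((chi12 (lprod L))%:~R * gs R (lprod L) n%:Z / (lprod L)%:R) ^ r = (chi12 (lprod L))%:~R * chC L n%:Z * (g / (lprod L)%:R) ^ r.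
Proof.
move=> oL L5 cn ->; rewrite mulrA -[_ * g / _]mulrA !expfzMl.
rewrite (oddpow R er1 (chi12_sq (M_cop12 (oddp_prime oL) L5))).
by rewrite (oddpow R er1 (@chi2 L n%:Z oL cn)).
Qed.
Lemma sum_gcdQ (T : nat -> C) : \sum_(b < M | gcdn b M == Q) T b = \sum_(b < P | coprime b P) T (Q * b)%N.
Proof.
have Q0 := prime_gt0 pQ.
have l1 (b : 'I_P) : (Q * b < M)%N by rewrite ME ltn_pmul2l.
have l2 (b : 'I_M) : (b %/ Q < P)%N by rewrite ltn_divLR // mulnC -ME.
rewrite (reindex_onto (fun b => Ordinal (l1 b)) (fun b => Ordinal (l2 b))) /= => [|b /eqP e].
  apply: eq_bigl => b; have -> : (gcdn (Q * b) M == Q) = coprime b P.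
    by rewrite ME -muln_gcdr -{2}(muln1 Q) eqn_pmul2l.
  by case: (coprime b P) => //=; apply/eqP/val_inj; rewrite /= mulKn.
by apply: val_inj; rewrite /= mulnC divnK // -[X in (X %| _)%N]e dvdn_gcdl.
Qed.
Variable n1 : nat.
Hypotheses (cn1 : coprime n1 P) (lQ : ~~ (ell %| Q.-1)%N).
Hypothesis van : forall n : nat, chi S n%:Z = -1 -> I (a n).
Lemma rm_Q b : (Q%:Z %| b)%Z -> coprime `|b| P -> rm R S b = Q.-1%:R * (-1) ^+ size s.
Proof.
move=> dQ cb; have -> : rm R S b = ((if (Q%:Z %| b)%Z then Q%:R else 0) - 1) * rm R s b by rewrite /rm big_cons.
by rewrite dQ rm_cop //; congr (_ * _); rewrite -{1}(prednK (prime_gt0 pQ)) -natr1 addrK.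
Qed.
Variables g h : C.
Hypotheses (hg : forall b, \sum_(x < M) chC S x%:Z * em M (x%:Z * b) = chC S b * g)
  (gg : forall b, coprime `|b| M -> gs R M b = chC S b * g)
  (hh : forall b, \sum_(x < P) chC s x%:Z * em P (x%:Z * b) = chC s b * h)
  (hk : forall b, coprime `|b| P -> gs R P b = chC s b * h).
Variable D : nat -> int.
Hypothesis HD : forall b, (M1 S b %| 576 * (b1 S b)%:Z * D b - 1)%Z.
Local Notation k := (Q ^ 2 * n1)%N.
Lemma c24 : coprime M 24.
Proof.
have := M_cop12 (oddp_prime oS) S5; rewrite -(@coprime_pexpr 2 M 12) //; apply: coprime_dvdr.
by apply/dvdnP; exists 6.
Qed.
Definition T (b : nat) : C := wt R S b%:Z * ((M1 S b)%:R ^ (- (2 * w1)) * kap R S b ^ r *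
  (if (gb S b ^ 2 %| k)%N then a (k %/ gb S b ^ 2)%N * ee (- (D b)%:~R / (M1 S b)%:R) ^+ (k %/ gb S b ^ 2) else 0)).
(** The square of gcd(b, M) would have to divide Q^2 n1 with n1 prime to P, so only divisors of Q
    survive. *)
Lemma T0 b : gcdn b M != 1%N -> gcdn b M != Q -> T b = 0.
Proof.
rewrite /T -/(gb S b) => n1' nQ; case: ifP => [d|_]; last by rewrite !mulr0.
have gM : (gb S b %| Q * P)%N by rewrite -ME dvdn_gcdr.
have c1 : coprime (gb S b) P.
  have dP := dvdn_gcdr (gb S b) P; have cd : coprime (gcdn (gb S b) P ^ 2) k.
    have cQ : coprime (gcdn (gb S b) P) Q by rewrite (coprime_dvdl dP) // coprime_sym.
    have cn : coprime (gcdn (gb S b) P) n1 by rewrite (coprime_dvdl dP) // coprime_sym.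
    by rewrite coprimeXl // coprimeMr coprimeXr.
  have h2 : (gcdn (gb S b) P ^ 2 %| k)%N by apply: dvdn_trans d; rewrite dvdn_exp2r // dvdn_gcdl.
  by move: cd; rewrite /coprime (gcdn_idPl h2) -[X in _ == X](exp1n 2) eqn_exp2r.
move: gM; rewrite (Gauss_dvdl _ c1) => /(primeP pQ).2.
by rewrite (negbTE n1') (negbTE nQ).
Qed.
Lemma ee_em (L n : nat) (x : int) : ee (- x%:~R / L%:R : C) ^+ n = em L (x * - n%:Z).
Proof. by rewrite -eeMn; apply: (f_equal (@ee R)); rewrite intrM mulrNz -pmulrn; ring. Qed.
(** The power of [kap] contributes chi(b). Against it the Ramanujan part of [wt] sums to chi(-k) g =
    0, as Q divides k, while the chi part sums to a Ramanujan sum, the source of the factor Q -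
    1. *)
Lemma sum1E : \sum_(b < M | coprime b M) T b =
  M%:R^-1 * (Q.-1%:R * (-1) ^+ size s) * (- (M%:R ^ (- (2 * w1)) * (chi12 M)%:~R * (g / M%:R) ^ r * chC S (-1) * g * a k)).
Proof.
pose F (x : int) := (M%:R ^ (- (2 * w1)) * (chi12 M)%:~R * (g / M%:R) ^ r * a k) *
  (M%:R^-1 * ((-1) ^+ size S * (chC S x * em M (x * - k%:Z)) - chC S (-1) * g * (chC S x ^+ 2 * em M (x * - k%:Z)))).
have HD' b : coprime b M -> (M%:Z %| 576 * b%:Z * D b - 1)%Z.
  by move=> cb; have := HD b; rewrite /M1 /b1 /gb (eqP cb) !divn1.
rewrite (eq_bigr (fun b : 'I_M => F (D b))) => [|b cb]; last first.
  have g1 : gcdn b M = 1%N by apply/eqP.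
  rewrite /T /kap /M1 /b1 /gb g1 !divn1 ?exp1n ?dvd1n ?divn1 ee_em (@kap_cop _ g _ oS S5 cb (@gg b%:Z cb)).
  rewrite (wtE oS uS hg) rm_cop ?abszN // /F chi_D ?c24 // -[- b%:Z]mulN1r chiM // [in LHS]intrM.
  move: (M%:R^-1) (M%:R ^ _) (chC S b%:Z) ((-1) ^+ size S) (em M _) ((g / M%:R) ^ r) => *; ring.
rewrite (@inv_sum R _ oS _ HD' F); last first.
  move=> x; rewrite /F chi_per // (em_cong R (y := x * - k%:Z)) //.
  by rewrite mulrDl addrC addKr dvdz_mulr.
transitivity (\sum_(b < M) F b%:Z).
  rewrite [RHS](bigID (fun b : 'I_M => coprime b M)) /= [X in _ + X]big1 ?addr0 // => b nb.
  by rewrite /F (@chi_ncop S b%:Z) // expr0n /= !mul0r !mulr0 subr0 !mulr0.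
rewrite -mulr_sumr -mulr_sumr sumrB -!mulr_sumr hg rm_sum // rm_Q; last 2 first.
- by rewrite rpredN dvdzE /= dvdn_mulr // dvdn_exp.
- by rewrite abszN coprimeMl coprimeXl.
have -> : chi S (- k%:Z) = 0 by apply/eqP; rewrite chi_cons mulf_eq0 leg0 rpredN dvdzE /= dvdn_mulr // dvdn_exp.
rewrite mul0r mulr0 sub0r; rewrite /=; move: (M%:R^-1) (M%:R ^ _) ((-1) ^+ size s) ((g / M%:R) ^ r) => *; ring.
Qed.
(** For b = Q b' the chi part of [wt] vanishes and its Ramanujan part is constant, with factor Q -
    1; the sum over b' is a Gauss sum modulo P. *)
Lemma sum2E : \sum_(b < M | gcdn b M == Q) T b =
  M%:R^-1 * (Q.-1%:R * (-1) ^+ size s) * (P%:R ^ (- (2 * w1)) * (chi12 P)%:~R * (h / P%:R) ^ r * chC s (- n1%:Z) * h * a n1).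
Proof.
have Q0 := prime_gt0 pQ; rewrite sum_gcdQ.
pose D' b := D (Q * b)%N.
have gE b : coprime b P -> gcdn (Q * b) M = Q by move=> /eqP c; rewrite ME -muln_gcdr c muln1.
have PE : (M %/ Q = P)%N by rewrite ME mulKn.
have HD' b : coprime b P -> (P%:Z %| 576 * b%:Z * D' b - 1)%Z.
  by move=> cb; have := HD (Q * b); rewrite /M1 /b1 /gb gE // mulKn // PE.
have c24' : coprime P 24 by apply: (coprime_dvdl _ c24); rewrite ME dvdn_mull.
pose F (x : int) := (M%:R^-1 * (Q.-1%:R * (-1) ^+ size s)) * (P%:R ^ (- (2 * w1)) * (chi12 P)%:~R * (h / P%:R) ^ r * a n1) *
  (chC s x * em P (x * - n1%:Z)).
rewrite (eq_bigr (fun b : 'I_P => F (D' b))) => [|b cb]; last first.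
  rewrite /T /kap /M1 /b1 /gb gE // mulKn // PE ee_em.
  rewrite dvdn_mulr // mulKn ?expn_gt0 ?Q0 // (@kap_cop _ h _ os s5 cb (@hk b%:Z cb)).
  rewrite (wtE oS uS hg) rm_Q; last 2 first.
  - by rewrite rpredN dvdzE /= dvdn_mulr.
  - by rewrite abszN coprimeMl QP.
  have -> : chi S (- (Q * b)%N%:Z) = 0 by apply/eqP; rewrite chi_cons mulf_eq0 leg0 rpredN dvdzE /= dvdn_mulr.
  rewrite mul0r subr0 /F (chi_D os HD' c24') //.
  move: (M%:R^-1) (P%:R ^ _) ((-1) ^+ size s) (em P _) ((h / P%:R) ^ r) => *; ring.
rewrite (@inv_sum R _ os _ HD' F); last first.
  move=> x; rewrite /F chi_per // (em_cong R (y := x * - n1%:Z)) //.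
  by rewrite mulrDl addrC addKr dvdz_mulr.
transitivity (\sum_(b < P) F b%:Z).
  rewrite [RHS](bigID (fun b : 'I_P => coprime b P)) /= [X in _ + X]big1 ?addr0 // => b nb.
  by rewrite /F (@chi_ncop s b%:Z) // mul0r mulr0.
rewrite -mulr_sumr hh; move: (M%:R^-1) (P%:R ^ _) ((-1) ^+ size s) ((h / P%:R) ^ r) => *; ring.
Qed.
End Relation.
Lemma I_eq (R : realType) ell (x y : R[i]) : x = y -> I_ ell x -> I_ ell y.
Proof. by move=> ->. Qed.
Section Relation2.
Variable R : realType.
Local Notation C := (R[i]).
Local Notation chC s n := ((chi s n)%:~R : C).
Variable ell : nat.
Hypothesis pell : prime ell.
Hypothesis ell5 : (5 <= ell)%N.
Local Notation O := (@in_Oell R ell).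
Local Notation I := (@I_ R ell).
Lemma O_natz (n : nat) (e : int) : ~~ (ell %| n)%N -> O (n%:R ^ e).
Proof. by move=> ln; have := O_ratz R pell e ln (ell_ndvd1 pell); rewrite divr1. Qed.
Variables (Q : nat) (s : seq nat).
Local Notation S := (Q :: s).
Local Notation M := (lprod S).
Local Notation P := (lprod s).
Local Notation lQC := ((legendre (-1) Q)%:~R : C).
(** The coefficient of index Q^2 n1 at the cusp 0 is the sum of the parts gcd(b, M) = 1 and gcd(b,
    M) = Q. Both carry the factor Q - 1, a unit modulo [ell] by [lQ]; dividing by the common units
    leaves the relation. *)
Lemma hecke_relation (k2 r : int) (a : nat -> C) (w1 r1 : int) (n1 : nat) :
  cusp_form ell k2 r a -> k2 - r = 4 * w1 -> r + 1 = 2 * r1 ->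
  oddp S -> uniq S -> all (fun p => (5 <= p)%N) S -> ~~ (ell %| M)%N ->
  coprime n1 P -> ~~ (ell %| Q.-1)%N -> (forall n : nat, chi S n%:Z = -1 -> I (a n)) ->
  I (chC s n1%:Z * a n1 -
    (Q%:R ^ (- (2 * w1) - r) * (chi12 Q)%:~R * lQC * (lQC * Q%:R) ^ r1) * a (Q ^ 2 * n1)%N).
Proof.
move=> cf ew1 er1 oS uS S5 lS cn1 lQ van.
have [/andP[pQ Q3] os] : (prime Q && (3 <= Q)%N) /\ oddp s by have := oS; rewrite /= => /andP[].
have us : uniq s by have := uS; rewrite /= => /andP[].
have [Q5 s5] : (5 <= Q)%N /\ all (fun p => (5 <= p)%N) s by have := S5; rewrite /= => /andP[].
have [g [hg g2 gg]] := gauss_prod R oS uS S5; have [h [hh h2 hk]] := gauss_prod R os us s5.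
have pS := oddp_prime oS; have Q0 := prime_gt0 pQ.
have D_ex (b : nat) : exists d : int, (M1 S b %| 576 * (b1 S b)%:Z * d - 1)%Z.
  have [|e he] := @bezout_inv (576 * (b1 S b)%:Z) (M1 S b); last by exists e; rewrite mulrC.
  have c12 : coprime (M1 S b) 24 by apply: (coprime_dvdl _ (c24 oS S5)); rewrite -(M1E S b) dvdn_mulr.
  rewrite abszM coprimeMl; apply/andP; split.
    by have -> : (576 : int) = 24%:Z ^+ 2 by []; rewrite abszX coprimeXl // coprime_sym.
  rewrite absz_nat /coprime -(eqn_pmul2l (gb_gt0 pS b)) muln1 muln_gcdr /b1 /M1 ![(gb S b * _)%N]mulnC.
  by rewrite !divnK ?dvdn_gcdr ?dvdn_gcdl.
have [D HD] := choice D_ex.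
(* Any m that makes 24 m - r and 2 w1 + 12 m nonnegative will do. *)
pose m := (absz r + absz (2 * w1)%R)%N.
have [r' er'] : exists r' : nat, r'%:Z = 24%:Z * m%:Z - r by exists (absz (24%:Z * m%:Z - r)%R); rewrite /m; clear; lia.
have [w' ew'] : exists w' : nat, w'%:Z = 2 * w1 + 12 * m%:Z by exists (absz (2 * w1 + 12 * m%:Z)%R); rewrite /m; clear; lia.
have ow : ~~ odd w' by clear -ew'; lia.
have van' n : I ((\sum_(b < M) wt R S b%:Z * ee (b%:R / M%:R) ^+ n) * a n).
  rewrite wt_inv //; have := chi_val n%:Z oS; case/or3P => /eqP e; rewrite e.
  - by rewrite expr0n subr0 mul0r; exact: I0.
  - by rewrite expr1n subrr mul0r; exact: I0.
  by apply: IMl => //; [rewrite -rmorphXn -rmorphB; exact: O_int|exact: van].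
have := cusp0_transfer pell ell5 cf ew1 er' ew' pS uS S5 lS (fun b => wt_O R b pell lS) (fun b => wt_per R oS b) (fun d b => @wt_sqr R _ oS d b) HD isT ow van' (Q ^ 2 * n1)%N.
move=> IB.
have {IB} : I (\sum_(b < M) T r a w1 Q s n1 D b) by [].
rewrite (bigID (fun b : 'I_M => coprime b M)) /=.
rewrite [X in _ + X](bigID (fun b : 'I_M => gcdn b M == Q)) /= [X in _ + (_ + X)]big1 ?addr0; last first.
  by move=> b /andP[]; exact: T0.
rewrite [X in _ + X](eq_bigl (fun b : 'I_M => gcdn b M == Q)); last first.
  move=> b; rewrite /coprime; case: (gcdn b _ =P Q) => [->|_]; rewrite ?andbF ?andbT //.
  by rewrite neq_ltn prime_gt1 // orbT.
rewrite (sum1E a w1 er1 oS uS S5 cn1 hg gg HD) (sum2E a w1 er1 oS uS S5 n1 hg hh hk HD) -mulrDr.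
have MC : (M%:R : C) != 0 by rewrite pnatr_eq0 -lt0n lprod_gt0.
have QC : (Q%:R : C) != 0 by exact: natC0.
have PC : (P%:R : C) != 0 by rewrite pnatr_eq0 -lt0n lprod_gt0.
have ME : (M%:R : C) = Q%:R * P%:R by rewrite lprod_cons natrM.
have cS : coprime 1 P by exact: coprime1n.
have x2 : chC s (-1) ^+ 2 = 1 by rewrite -rmorphXn /= (@chi2 s (-1)).
(* As r + 1 = 2 r1, the product x^r x is a power of x^2, so the squares of the Gauss sums
   suffice. *)
have r0 (x : C) : x ^+ 2 != 0 -> forall y : C, (x / y) ^ r * x = (x ^+ 2) ^ r1 * y ^ (- r).
  move=> x0 y; have xn : x != 0 by apply: contra_neq x0 => ->; rewrite expr0n.
  by rewrite expfzMl exprz_inv mulrAC -{2}(expr1z x) -expfzDr // er1 -exprz_exp.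
have chin (L : seq nat) : oddp L -> chC L (-1) != 0 by move=> oL; rewrite intr_eq0 chi0 // coprime1n.
have hr : (h / P%:R) ^ r * h = chC s (-1) ^ r1 * P%:R ^ (r1 - r).
  by rewrite r0 h2 ?mulf_neq0 ?chin // expfzMl [_ ^ (r1 - r)]expfzDr // mulrA.
have gr : (g / M%:R) ^ r * g = (lQC * Q%:R) ^ r1 * Q%:R ^ (- r) * (chC s (-1) ^ r1 * P%:R ^ (r1 - r)).
  rewrite r0 g2 ?mulf_neq0 ?chin // expfzMl ME chi_cons intrM !expfzMl (expfzDr _ _ PC).
  move: (_ ^ r1) (_ ^ r1) (_ ^ r1) (_ ^ r1) (_ ^ (- r)) (_ ^ (- r)) => *; ring.
have d12 : coprime P 12 := M_cop12 (oddp_prime os) s5.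
have z2 : ((chi12 P)%:~R : C) ^+ 2 = 1 by rewrite -rmorphXn /= chi12_sq.
have [lQ' ls] : ~~ (ell %| Q)%N /\ ~~ (ell %| P)%N.
  by have := lS; rewrite lprod_cons Euclid_dvdM // negb_or => /andP[].
have m2 : ((-1) ^+ size s : C) ^+ 2 = 1 by rewrite -exprM mulnC exprM sqrrN expr1n expr1n.
(* multiply by the inverse of the unit in front of [a n1] *)
pose u : C := M%:R * (-1) ^+ size s * (P%:R ^ (2 * w1 - (r1 - r)) * (chi12 P)%:~R * chC s (-1) ^ (- r1) * chC s (-1)).
have Ou : O u.
  do ![apply: OM => //]; try exact: O_nat; try exact: O_int; try exact: O_natz.
    by apply: OX => //; apply: ON => //; exact: O1.
  have e : chC s (-1) = 1 \/ chC s (-1) = -1.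
    by have := chi_val (-1) os; have := chin s os; rewrite intr_eq0 => /negbTE-> /orP[//|/orP[]] /eqP->; [left|right].
  have [->|->] := e; first by rewrite exp1rz; exact: O1.
  apply: (@O_rootn _ _ pell _ 2) => //.
  have -> : (((-1 : C) ^ (- r1)) ^+ 2) = 1.
    by rewrite -[LHS]/(((-1 : C) ^ (- r1)) ^ 2%:Z) exprzAC -[(-1) ^ 2%:Z]/((-1 : C) ^+ 2) sqrrN expr1n exp1rz.
  exact: O1.
move=> /(IMl pell Ou) IX; apply: (@I_cancel _ _ pell Q.-1) => //; move: IX; apply: I_eq.
rewrite /u ME.
have -> : chi12 M = chi12 Q * chi12 P by rewrite lprod_cons chi12M.
rewrite chi_cons -[- n1%:Z]mulN1r chiM // !intrM [Q%:R ^ (- (2 * w1) - r)]expfzDr // (expfzMl (Q%:R : C)).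
rewrite ME in gr MC; move: gr hr.
move: ((g / (Q%:R * P%:R)) ^ r) ((h / P%:R) ^ r) => G H gr hr.
have f1 : (Q%:R * P%:R) * (Q%:R * P%:R)^-1 = 1 :> C by rewrite divff.
have f2 : P%:R ^ (2 * w1 - (r1 - r)) * P%:R ^ (- (2 * w1)) * P%:R ^ (r1 - r) = 1 :> C.
  by rewrite -!expfzDr // (_ : _ + _ = 0) ?expr0z //; ring.
have f3 : chC s (-1) ^ (- r1) * chC s (-1) ^ r1 = 1 by rewrite -expfzDr ?chin // addNr expr0z.
move: f1 f2 f3 gr hr x2 z2 m2.
move: (Q%:R * P%:R : C) (Q%:R * P%:R)^-1; move: (P%:R ^ (2 * w1 - (r1 - r)) : C) (P%:R ^ (- (2 * w1)) : C) (P%:R ^ (r1 - r) : C).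
move: (chC s (-1)) (chC s (-1) ^ (- r1)) (chC s (-1) ^ r1) ((chi12 P)%:~R : C) ((-1) ^+ size s : C) => x xri xr z si Pu p1 pr mm mi f1 f2 f3.
move: lQC ((lQC * Q%:R) ^ r1 : C) (Q%:R ^ (- r) : C) (Q%:R ^ (- (2 * w1)) : C) ((chi12 Q)%:~R : C) (chC s n1%:Z) (a n1) (a (Q ^ 2 * n1)%N) (Q.-1%:R : C) => l qr qm q1 y ch a1 ak Q1 gr hr x2 z2 m2.
transitivity ((mm * mi) * si ^+ 2 * z ^+ 2 * x ^+ 2 * (Pu * p1 * xri * Q1) * (ch * (H * h) * a1 - q1 * y * l * (G * g) * ak)); first by ring.
rewrite gr hr; transitivity ((mm * mi) * si ^+ 2 * z ^+ 2 * x ^+ 2 * (Pu * p1 * pr) * (xri * xr) * (Q1 * (ch * a1 - q1 * qm * y * l * qr * ak))); first by ring.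
by rewrite f1 m2 z2 x2 f2 f3 !mul1r.
Qed.
End Relation2.

(** * Quadratic reciprocity *)

Lemma leg_N1 p : prime p -> (3 <= p)%N -> legendre (-1) p = (-1) ^+ (p %% 4 == 3)%N.
Proof.
move=> pp p3; have hp := half_p pp p3; apply/eqP; rewrite -subr_eq0; apply/eqP.
apply: (small_Fp pp p3).
  by have := leg_val pp (-1); case/or3P => /eqP->; case: (_ == _).
rewrite rmorphB /= leg_Fp // -(rmorphN1 (intmul 1)) rmorphXn /= !rmorphN1 -signr_odd -[in X in _ - X]signr_odd.
have -> : odd (p.-1 %/ 2) = odd (p %% 4 == 3)%N; last by rewrite subrr.
by rewrite oddb; clear -hp p3; lia.
Qed.
Section Reciprocity.
Variable R : realType.
Local Notation C := (R[i]).
Lemma freshman q (J : Type) (l : seq J) (P : pred J) (F : J -> C) : prime q -> (forall i, P i -> in_Oell q (F i)) ->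
  I_ q ((\sum_(i <- l | P i) F i) ^+ q - \sum_(i <- l | P i) F i ^+ q).
Proof.
move=> pq OF; have q0 := prime_gt0 pq.
have two (x y : C) : in_Oell q x -> in_Oell q y -> I_ q ((x + y) ^+ q - (x ^+ q + y ^+ q)).
  move=> Ox Oy; rewrite exprDn (bigD1 ord0) //= (bigD1 ord_max) /=; last by rewrite -(inj_eq val_inj) /= -lt0n.
  rewrite subn0 subnn bin0 binn !mulr1n !expr0 mulr1 mul1r.
  have E (A B S : C) : A + (B + S) - (A + B) = S by ring.
  rewrite E.
  apply: I_sum => // i /andP[i0 im]; rewrite -mulr_natl; apply: IMr => //; last by apply: OM => //; exact: OX.
  apply: I_nat => //; apply: prime_dvd_bin => //; rewrite lt0n; apply/andP; split.
    by apply: contra i0 => /eqP e; apply/eqP/val_inj.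
  by rewrite ltn_neqAle -ltnS ltn_ord andbT; apply: contra im => /eqP e; apply/eqP/val_inj.
elim: l => [|x l IH]; first by rewrite !big_nil expr0n (gtn_eqF q0) subr0; exact: I0.
rewrite !big_cons; case: ifP => // Px.
set s := \sum_(i <- l | P i) F i in IH *; set s' := (X in F x ^+ q + X).
have -> : (F x + s) ^+ q - (F x ^+ q + s') = ((F x + s) ^+ q - (F x ^+ q + s ^+ q)) + (s ^+ q - s') by ring.
by apply: ID => //; apply: two; [exact: OF|apply: O_sum].
Qed.
Lemma odd_pow_leg q p n : prime q -> (3 <= q)%N -> prime p -> (legendre n p) ^+ q = legendre n p.
Proof.
move=> pq q3 pp; have := half_p pq q3; move: (q.-1 %/ 2)%N => h <-; rewrite exprS addnn -muln2 mulnC exprM.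
by have := leg_val pp n; case/or3P => /eqP->; rewrite ?mul0r ?sqrrN ?expr1n ?mulr1.
Qed.
Lemma leg_star p q : prime p -> (3 <= p)%N -> prime q -> (3 <= q)%N -> p != q ->
  legendre (legendre (-1) p * p%:Z) q = legendre q%:Z p.
Proof.
move=> pp p3 pq q3 ne; set ps := legendre (-1) p * p%:Z.
have hq := half_p pq q3; set h := (q.-1 %/ 2)%N in hq.
have OG : in_Oell q (G1 R p).
  by apply: O_sum => // x _; apply: OM => //; [exact: O_int|exact: O_ee].
have G2 : G1 R p ^+ 2 = ps%:~R by rewrite G1_sq // intrM.
have A : I_ q (G1 R p ^+ q - (legendre q%:Z p)%:~R * G1 R p).
  rewrite -gauss_leg // /G1.
  have := freshman (index_enum 'I_p) (P := xpredT) (F := fun x : 'I_p => (legendre x%:Z p)%:~R * em R p x%:Z) pq.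
  rewrite (eq_bigr (fun x : 'I_p => (legendre x%:Z p)%:~R * em R p (x%:Z * q%:Z)) (F1 := fun x => _ ^+ q)).
    by apply=> x _; apply: OM => //; [exact: O_int|exact: O_ee].
  move=> x _; rewrite exprMn -rmorphXn /= odd_pow_leg // /em -eeMn; congr (_ * _); apply: (f_equal (@ee R)).
  by rewrite intrM -!pmulrn mulrA [q%:R * _]mulrC.
have B : I_ q (((ps ^+ h - legendre q%:Z p) * ps)%:~R : C).
  have := IMr pq A OG; apply: I_eq.
  rewrite mulrBl -exprSr -mulrA -expr2 G2 intrM rmorphB rmorphXn /= mulrBl; congr (_ - _).
  by rewrite -exprSr -hq -G2 -exprM; congr (_ ^+ _); lia.
have nps : ~~ (q%:Z %| ps)%Z.
  rewrite /ps; apply/negP; rewrite dvdzE abszM Euclid_dvdM // => /orP[].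
    have := leg_N1 pp p3 => ->; case: (_ == _) => /= /dvdn_leq; clear -q3; lia.
  by rewrite /= dvdn_prime2 // eq_sym (negbTE ne).
have := I_intP pq B; rewrite dvdz_Fp // rmorphM /= mulf_eq0 -!dvdz_Fp // (negbTE nps) orbF dvdz_Fp // rmorphB rmorphXn /= -leg_Fp // -rmorphB /= => /eqP e.
apply/eqP; rewrite -subr_eq0; apply/eqP; apply: (small_Fp pq q3) => //.
by have := leg_val pq ps; have := leg_val pp q%:Z; do 2![case/or3P => /eqP->].
Qed.
Definition sg (a b : nat) : int := (-1) ^+ ((a %% 4 == 3) && (b %% 4 == 3))%N.
Lemma sgC a b : sg a b = sg b a. Proof. by rewrite /sg andbC. Qed.
Lemma sg2 a b : sg a b * sg a b = 1. Proof. by rewrite /sg; case: (_ && _). Qed.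
Lemma sg_mod a a' b : a = a' %[mod 4] -> sg a b = sg a' b. Proof. by rewrite /sg => ->. Qed.
Lemma sgM a a' b : odd a -> odd a' -> sg (a * a') b = sg a b * sg a' b.
Proof.
rewrite /sg => oa oa'; have -> : ((a * a') %% 4 == 3)%N = (a %% 4 == 3)%N (+) (a' %% 4 == 3)%N.
  rewrite -modnMm; have : (a %% 4 == 1)%N || (a %% 4 == 3)%N by clear -oa; lia.
  have : (a' %% 4 == 1)%N || (a' %% 4 == 3)%N by clear -oa'; lia.
  by case/orP => /eqP->; case/orP => /eqP->.
by case: (a %% 4 == 3)%N; case: (a' %% 4 == 3)%N; case: (b %% 4 == 3)%N.
Qed.
Lemma qr p q : prime p -> (3 <= p)%N -> prime q -> (3 <= q)%N -> p != q ->
  legendre p%:Z q = sg p q * legendre q%:Z p.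
Proof.
move=> pp p3 pq q3 ne; rewrite -(leg_star pp p3 pq q3 ne) legM // leg_N1 // /sg.
case: (p %% 4 == 3)%N => /=; last by rewrite !expr0 leg1 // !mul1r.
by rewrite expr1 leg_N1 // mulrA -expr2 -exprM mulnC exprM sqrrN expr1n mul1r.
Qed.
Lemma lprod_odd s : oddp s -> odd (lprod s).
Proof.
elim: s => [|p s IH] /=; first by rewrite /lprod big_nil.
by case/andP => /andP[pp p3] /IH; rewrite lprod_cons oddM => ->; rewrite andbT; have := half_p pp p3; clear; lia.
Qed.
Lemma recip1 q s : prime q -> (3 <= q)%N -> oddp s -> q \notin s ->
  legendre (lprod s)%:Z q = sg q (lprod s) * chi s q%:Z.
Proof.
move=> pq q3; elim: s => [|p s IH] /=.
  by move=> _ _; rewrite /chi /lprod !big_nil leg1 // /sg andbF.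
case/andP => /andP[pp p3] os; rewrite inE negb_or => /andP[ne ns].
rewrite lprod_cons chi_cons PoszM legM // IH // qr // 1?eq_sym // [sg q (_ * _)]sgC sgM ?lprod_odd //.
  rewrite ![sg _ q]sgC; ring.
by have := half_p pp p3; clear; lia.
Qed.
Lemma recip_list s u : oddp s -> oddp u -> (forall q, q \in u -> q \notin s) ->
  chi u (lprod s)%:Z = sg (lprod u) (lprod s) * chi s (lprod u)%:Z.
Proof.
move=> os; elim: u => [|q u IH] /=.
  move=> _ _; rewrite /chi [lprod [::]]/lprod !big_nil /sg mul1r big1_seq // => p /andP[_ ps].
  by have /andP[pp p3] := allP os _ ps; rewrite leg1.
case/andP => /andP[pq q3] ou H; rewrite chi_cons lprod_cons PoszM chiM // sgM ?lprod_odd //; last first.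
  by have := half_p pq q3; clear; lia.
rewrite recip1 ?H ?mem_head // IH // => [|x xu]; first by ring.
by apply: H; rewrite inE xu orbT.
Qed.
End Reciprocity.
(** Prime factors with multiplicity, so that [chi (plist n)] is the Jacobi symbol modulo an odd
    n. *)
Definition plist (n : nat) : seq nat := flatten [seq nseq p.2 p.1 | p <- prime_decomp n].
Lemma plist_prod n : (0 < n)%N -> lprod (plist n) = n.
Proof.
move=> n0; rewrite [RHS](prod_prime_decomp n0) /lprod /plist big_flatten big_map; apply: eq_bigr => p _.
by rewrite big_nseq -[RHS]/(expn p.1 p.2); elim: p.2 => //= k ->; rewrite expnS.
Qed.
Lemma plist_oddp n : odd n -> oddp (plist n).
Proof.
move=> on; apply/allP => x /flatten_mapP[[p e] pe]; rewrite mem_nseq => /andP[_ /eqP->].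
have /mem_prime_decomp[pp e0 d] := pe; rewrite pp /=; have := prime_gt1 pp.
have : p != 2.
  by apply: contraTneq on => p2; rewrite -dvdn2; apply: dvdn_trans (d); rewrite p2 -{1}(expn1 2) dvdn_exp2l.
by move=> h1 h2; clear -h1 h2; lia.
Qed.
Lemma mem_dvd_lprod p s : p \in s -> (p %| lprod s)%N.
Proof. by rewrite /lprod => /(big_rem p) ->; rewrite dvdn_mulr. Qed.
(** A repeated prime contributes a square to the symbol, so its copies can be removed in pairs; the
    modulus becomes squarefree. *)
Lemma reduce_list s : oddp s -> exists u, [/\ uniq u, {subset u <= s} &
  forall n : int, coprime `|n| (lprod s) -> chi u n = chi s n].
Proof.
elim: s => [|p s IH] /=; first by exists [::].
case/andP => /andP[pp p3] os; have [u [uu us hu]] := IH os.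
have [pu|pu] := boolP (p \in u).
  exists (rem p u); split; first exact: rem_uniq.
    by move=> x /mem_rem /us xs; rewrite inE xs orbT.
  move=> n; rewrite lprod_cons coprimeMr => /andP[c1 c2]; rewrite chi_cons -hu // {2}/chi (big_rem p pu) /= mulrA -expr2 leg2 ?mul1r //.
  by rewrite dvdzE /= -prime_coprime // coprime_sym.
exists (p :: u); split=> /=; first by rewrite pu.
  by move=> x; rewrite !inE => /orP[->//|/us->]; rewrite orbT.
by move=> n; rewrite lprod_cons coprimeMr => /andP[c1 c2]; rewrite !chi_cons hu.
Qed.

(** * Vanishing of the Hecke operator *)

Section HeckeZero.
Variable R : realType.
Local Notation C := (R[i]).
Lemma chi12_leg Q : prime Q -> (5 <= Q)%N -> legendre 12 Q = chi12 Q.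
Proof.
move=> pQ Q5; have Q3 : (3 <= Q)%N by apply: leq_trans Q5.
have nQ2 : ~~ (Q%:Z %| 2)%Z by rewrite dvdzE /=; apply/negP => /dvdn_leq; clear -Q5; lia.
rewrite (_ : 12 = 2 ^+ 2 * 3%:Z) // legM // leg_sq // mul1r (qr R (isT : prime 3)) //; last first.
  by apply/eqP => e; move: Q5; rewrite -e.
have := leg_cong (isT : prime 3) (_ : (3%:Z %| Q%:Z - (Q %% 3)%N%:Z)%Z) => ->; last first.
  by rewrite {1}(divn_eq Q 3) PoszD addrK PoszM dvdz_mull.
have o2 : odd Q by have := half_p pQ Q3; clear; lia.
have n3 : (Q %% 3 != 0)%N by rewrite -/(dvdn 3 Q) dvdn_prime2 //; apply/eqP => e; move: Q5; rewrite -e.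
have l2 : legendre 2%N 3 = -1 by rewrite (leg_cong (isT : prime 3) (_ : (3%:Z %| 2%N%:Z - -1)%Z)) // leg_N1.
have l1 : legendre 1%N 3 = 1 by rewrite leg1.
rewrite /sg /chi12 /=; have [e|[e|[e|e]]] : (Q %% 12 = 1 \/ Q %% 12 = 5 \/ Q %% 12 = 7 \/ Q %% 12 = 11)%N.
- by clear -o2 n3; move: n3; rewrite -(@modn_dvdm 12 Q 3) //; have := ltn_pmod Q (isT : 0 < 12)%N; lia.
- by rewrite -(@modn_dvdm 12 Q 3) // -(@modn_dvdm 12 Q 4) // e /= l1.
- by rewrite -(@modn_dvdm 12 Q 3) // -(@modn_dvdm 12 Q 4) // e /= l2.
- by rewrite -(@modn_dvdm 12 Q 3) // -(@modn_dvdm 12 Q 4) // e /= l1.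
by rewrite -(@modn_dvdm 12 Q 3) // -(@modn_dvdm 12 Q 4) // e /= l2.
Qed.
(** P starts as an integer from the Chinese remainder theorem and is replaced by the product of its
    primes of odd multiplicity, which gives the same symbols on integers prime to it. The free sign
    [sig] prescribes (Q/P). *)
Lemma choose_twist (Q W n ell : nat) (sig : bool) : prime Q -> (5 <= Q)%N -> prime ell -> ell != Q -> (0 < W)%N -> (0 < n)%N ->
  exists s, [/\ oddp (Q :: s), uniq (Q :: s), all (fun p => (5 <= p)%N) (Q :: s), ~~ (ell %| lprod (Q :: s))%N &
   [/\ coprime n (lprod s), chi s Q%:Z = (-1) ^+ sig &
   forall t : nat, odd t -> (t %| W)%N -> coprime t Q -> chi s t%:Z = legendre t%:Z Q]].
Proof.
move=> pQ Q5 pl lQ W0 n0; have Q3 : (3 <= Q)%N by apply: leq_trans Q5.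
(* Being prime to Y keeps the primes of P at least 5, different from [ell], and prime to n and to
   W. *)
pose Y := (12 * ell * n * W)%N; have Y0 : (0 < Y)%N by rewrite /Y !muln_gt0 (prime_gt0 pl) n0 W0.
have [Y' cY eY] := pfactor_coprime pQ Y0.
have [rho hr] : exists rho : nat, legendre rho%:Z Q = (-1) ^+ sig * sg Q Q.
  have [u hu] := nonresidue pQ Q3.
  have toN (x : int) : exists y : nat, legendre y%:Z Q = legendre x Q.
    exists (absz (x %% Q)%Z); apply: leg_cong => //; rewrite gez0_abs ?modz_ge0 //; last by rewrite -lt0n prime_gt0.
    by rewrite -eqz_mod_dvd modz_mod.
  have [y1 h1] := toN 1; have [yu h2] := toN u; rewrite leg1 // in h1; rewrite hu in h2.
  have : (-1) ^+ sig * sg Q Q = 1 \/ (-1) ^+ sig * sg Q Q = -1.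
    by rewrite /sg; case: sig; case: (_ && _); [left|right|right|left].
  by case=> ->; [exists y1|exists yu].
have c4 : coprime (4 * Y') Q.
  rewrite coprimeMl [coprime Y' Q]coprime_sym cY andbT coprime_sym prime_coprime //.
  by apply/negP => /dvdn_leq; clear -Q5; lia.
(* P0 agrees with Q modulo 4 and modulo every odd t to be treated, and has a prescribed symbol
   modulo Q; reciprocity turns this into (t/P) = (t/Q) and the chosen (Q/P). *)
pose P0 := chinese (4 * Y') Q Q rho.
have e1 : P0 = Q %[mod 4 * Y'] by exact: chinese_modl.
have e2 : P0 = rho %[mod Q] by exact: chinese_modr.
have c1 : coprime P0 (4 * Y') by rewrite -coprime_modl e1 coprime_modl coprime_sym.
have lP : legendre P0%:Z Q = legendre rho%:Z Q by apply: leg_cong => //; rewrite -eqz_mod_dvd !modz_nat e2.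
have c2 : coprime P0 Q.
  rewrite coprime_sym prime_coprime // -[(Q %| P0)%N]/(Q%:Z %| P0%:Z)%Z -leg0 lP hr /sg.
  by case: sig {hr}; case: (_ && _).
have cPY : coprime P0 Y by rewrite eY coprimeMr coprimeXr // andbT; move: c1; rewrite coprimeMr => /andP[].
have d12 d : (d %| Y)%N -> coprime P0 d by move=> dY; exact: coprime_dvdr dY cPY.
have P00 : (0 < P0)%N by rewrite lt0n; apply: contraTneq c2 => ->; rewrite /coprime gcd0n neq_ltn prime_gt1 ?orbT.
have oP : odd P0.
  by have : coprime P0 2 by [apply: d12; rewrite /Y !dvdn_mulr]; rewrite coprimen2.
have oL := plist_oddp oP; have LE := plist_prod P00.
have [u [uu us hu]] := reduce_list oL.
have uP p : p \in u -> [/\ prime p, (3 <= p)%N & (p %| P0)%N].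
  move=> pu; have /allP/(_ _ (us _ pu))/andP[pp p3] := oL; split=> //.
  by rewrite -LE mem_dvd_lprod // us.
have pcop p d : p \in u -> (d %| Y * Q)%N -> ~~ (p %| d)%N || (d == 0)%N.
  move=> pu dY; have [pp _ dP] := uP p pu; have [->|d0] := posnP d; first by rewrite orbT.
  rewrite -prime_coprime // (coprime_dvdl dP) //; apply: (coprime_dvdr dY); by rewrite coprimeMr cPY.
have ucop d : (d %| Y * Q)%N -> coprime d (lprod u).
  move=> dY; rewrite coprime_sym; have : {subset u <= u} by [].
  elim: {1 3}u => [|p l IH] H; first by rewrite /lprod big_nil coprime1n.
  rewrite lprod_cons coprimeMl IH ?andbT => [|x xl]; last by apply: H; rewrite inE xl orbT.
  have pu := H p (mem_head _ _); have [pp _ dP] := uP p pu; apply: (coprime_dvdl dP); apply: (coprime_dvdr dY).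
  by rewrite coprimeMr cPY.
have mod4 : P0 = Q %[mod 4] by rewrite -(@modn_dvdm (4 * Y') P0) ?e1 ?modn_dvdm // dvdn_mulr.
exists u; split.
- by rewrite /= pQ Q3 /=; apply/allP => p /uP[-> ->].
- rewrite /= uu andbT; apply/negP => /uP[_ _ d]; move: c2; rewrite coprime_sym prime_coprime // d //.
- rewrite /= Q5; apply/allP => p pu; have [pp p3 dP] := uP p pu.
  have : ~~ (p %| 12)%N by have := pcop p 12 pu; rewrite /Y orbF; apply; rewrite !dvdn_mulr.
  by clear uP pcop pu dP; case: p pp p3 => [|[|[|[|[|p]]]]].
- rewrite lprod_cons Euclid_dvdM // dvdn_prime2 // (negbTE lQ) /= -prime_coprime //; apply: ucop.
  by rewrite /Y dvdn_mulr // dvdn_mulr // dvdn_mulr // dvdn_mull.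
have cQu : coprime Q (lprod u) by apply: ucop; rewrite dvdn_mull.
split.
- by apply: ucop; rewrite /Y dvdn_mulr // dvdn_mulr // dvdn_mull.
- rewrite hu ?LE 1?coprime_sym // -{1}(_ : lprod [:: Q] = Q); last by rewrite /lprod big_seq1.
  rewrite (recip_list R) //=; first last.
  + move=> q qL; rewrite inE; apply/eqP => e; move: c2; rewrite coprime_sym prime_coprime // -e -LE mem_dvd_lprod //.
  + by rewrite pQ Q3.
  rewrite LE /chi big_seq1 /lprod big_seq1 lP hr (sg_mod _ mod4) mulrC -mulrA sg2 mulr1 //.
move=> t ot tW ctQ; have t0 : (0 < t)%N by case: t ot {tW ctQ}.
have tY : (t %| Y)%N by rewrite /Y dvdn_mull.
have tY' : (t %| Y')%N by move: tY; rewrite eY Gauss_dvdl // coprimeXr.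
have ctP : coprime t P0 by rewrite coprime_sym; exact: d12.
have ol := plist_oddp ot; have le := plist_prod t0.
rewrite hu ?LE // -{1}le (recip_list R) //; last first.
  move=> q qL; apply/negP => qt; have /allP/(_ _ qL)/andP[pq _] := oL.
  have : ~~ (q %| gcdn t P0)%N by rewrite (eqP ctP) dvdn1 neq_ltn prime_gt1 ?orbT.
  by rewrite dvdn_gcd -{1}le -LE !mem_dvd_lprod.
rewrite le LE (sg_mod _ mod4) (@chi_cong _ P0%:Z Q%:Z) //; last first.
  by rewrite le -eqz_mod_dvd !modz_nat -(@modn_dvdm (4 * Y') P0) ?e1 ?modn_dvdm // dvdn_mull.
rewrite -{3}le (recip1 R pQ Q3 ol) ?le //.
by apply/negP => qt; move: ctQ; rewrite coprime_sym prime_coprime // -{1}le mem_dvd_lprod.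
Qed.
Variable ell : nat.
Hypothesis pell : prime ell.
Hypothesis ell5 : (5 <= ell)%N.
Local Notation O := (@in_Oell R ell).
Local Notation I := (@I_ R ell).
Variables (k2 r : int) (a : nat -> C).
Hypothesis cf : cusp_form ell k2 r a.
Variables w1 r1 : int.
Hypotheses (ew1 : k2 - r = 4 * w1) (er1 : r + 1 = 2 * r1).
Variable W : nat.
Hypotheses (W0 : (0 < W)%N) (ao : forall n, ~ I (a n) -> odd n)
  (fin : forall n, ~ I (a n) -> exists t f : nat, n = (t * f ^ 2)%N /\ (t %| W)%N).
Variable Q : nat.
Hypotheses (pQ : prime Q) (lQ : (ell %| Q.+1)%N).
Lemma Q_facts : [/\ (5 <= Q)%N, (3 <= Q)%N, ~~ (ell %| Q)%N, ~~ (ell %| Q.-1)%N & ell != Q].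
Proof.
have Q1 := prime_gt1 pQ.
have lQ1 : ~~ (ell %| Q)%N by apply/negP => h; have := dvdn_sub lQ h; rewrite subSnn dvdn1; clear -ell5; lia.
have Q4 : (4 <= Q)%N by have := dvdn_leq (ltn0Sn Q) lQ; clear -ell5; lia.
have Q5 : (5 <= Q)%N by rewrite ltn_neqAle Q4 andbT; apply: contraTneq pQ => <-.
split=> //; first by apply: leq_trans Q5.
- apply/negP => h; have := dvdn_sub lQ h; rewrite -{1}(prednK (ltnW Q1)) -addn2 addKn => /dvdn_leq; clear -ell5; lia.
by apply: contra lQ1 => /eqP->.
Qed.
Local Notation l := ((legendre (-1) Q)%:~R : C).
(** [ek] is k - 1/2, [lr] is the value of (-1/Q)^(k - 1/2), and [Kc] is the inverse of the constant
    in [hecke_relation]. *)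
Definition ek : int := 2 * w1 + r1 - 1.
Definition lr : C := l ^ (1 + r1).
Definition Kc : C := Q%:R ^ ek * (chi12 Q)%:~R * lr.
Let QC : (Q%:R : C) != 0. Proof. by rewrite pnatr_eq0 -lt0n prime_gt0. Qed.
Let l2 : l ^+ 2 = 1.
Proof.
have [_ Q3 _ _ _] := Q_facts; rewrite -rmorphXn /= leg2 // dvdzE /= dvdn1 neq_ltn prime_gt1 ?orbT //.
Qed.
Let l0 : l != 0. Proof. by apply: contra_eq_neq l2 => ->; rewrite expr0n /= eq_sym oner_eq0. Qed.
Let y2 : ((chi12 Q)%:~R : C) ^+ 2 = 1.
Proof.
have [Q5 Q3 _ _ _] := Q_facts; rewrite -rmorphXn /= chi12_sq //.
by have := @M_cop12 [:: Q]; rewrite /lprod big_seq1 /= pQ Q5; apply.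
Qed.
Lemma lz2 (e : int) : (l ^ e) ^+ 2 = 1.
Proof. by rewrite -[LHS]/((l ^ e) ^ 2%:Z) exprzAC -[l ^ 2%:Z]/(l ^+ 2) l2 exp1rz. Qed.
Lemma O_Kc : O Kc.
Proof.
have [_ _ lQ1 _ _] := Q_facts; apply: OM => //; [apply: OM => //; [exact: O_natz|exact: O_int]|].
by apply: (@O_rootn _ _ pell _ 2) => //; rewrite lz2; exact: O1.
Qed.
(** On the support n = t f^2 with t dividing W, so the symbol modulo QP is 0 or (t/Q)(t/P) = (t/Q)^2
    = 1, never -1, and [hecke_relation] applies. *)
Lemma admissible (sig : bool) (n : nat) : (0 < n)%N -> exists s, [/\ coprime n (lprod s), oddp s, chi s Q%:Z = (-1) ^+ sig,
   (forall t : nat, odd t -> (t %| W)%N -> coprime t Q -> chi s t%:Z = legendre t%:Z Q) &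
   forall n1, coprime n1 (lprod s) -> I (Kc * (chi s n1%:Z)%:~R * a n1 - a (Q ^ 2 * n1)%N)].
Proof.
move=> n0; have [Q5 Q3 lQ1 lQ2 nl] := Q_facts.
have [s [oS uS S5 lS [cn cQ ct]]] := choose_twist sig pQ Q5 pell nl W0 n0.
have os : oddp s by have := oS; rewrite /= => /andP[].
exists s; split=> // n1 cn1.
have van (m : nat) : chi (Q :: s) m%:Z = -1 -> I (a m).
  move=> em; apply: contrapT => na; have [t [f [mE tW]]] := fin na; have om := ao na.
  have : chi (Q :: s) m%:Z != 0 by rewrite em.
  rewrite chi0 // mE absz_nat coprimeMl => /andP[ct1 cf1]; have cf2 : coprime f (lprod (Q :: s)) by move: cf1; rewrite coprime_pexpl.
  have ot : odd t by move: om; rewrite mE oddM => /andP[].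
  move: em; rewrite mE PoszM chiM // -[(f ^ 2)%N%:Z]/(f%:Z ^+ 2) chi_sqr // mulr1 chi_cons ct //; last first.
    by move: ct1; rewrite lprod_cons coprimeMr => /andP[].
  rewrite -expr2 leg2 //; move: ct1; rewrite lprod_cons coprimeMr => /andP[c _].
  by rewrite dvdzE /= -prime_coprime // coprime_sym.
have := IMl pell O_Kc (hecke_relation pell ell5 cf ew1 er1 oS uS S5 lS cn1 lQ2 van); apply: I_eq.
have KK : Kc * (Q%:R ^ (- (2 * w1) - r) * (chi12 Q)%:~R * l * (l * Q%:R) ^ r1) = 1.
  rewrite /Kc /lr expfzMl [l ^ (1 + r1)]expfzDr // expr1z (_ : - (2 * w1) - r = - ek - r1); last by rewrite /ek; clear -er1; lia.
  rewrite [Q%:R ^ (- ek - r1)]expfzDr //.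
  have f1 : Q%:R ^ ek * Q%:R ^ (- ek) = 1 :> C by rewrite -expfzDr // subrr expr0z.
  have f2 : Q%:R ^ r1 * Q%:R ^ (- r1) = 1 :> C by rewrite -expfzDr // subrr expr0z.
  have f3 := lz2 r1; move: f1 f2 f3 l2 y2.
  move: l (l ^ r1) (Q%:R ^ ek) (Q%:R ^ (- ek)) (Q%:R ^ r1) (Q%:R ^ (- r1)) ((chi12 Q)%:~R) => x1 x2 x3 x4 x5 x6 x7 f1 f2 f3 f4 f5.
  transitivity ((x3 * x4) * (x5 * x6) * x2 ^+ 2 * x1 ^+ 2 * x7 ^+ 2); first by ring.
  by rewrite f1 f2 f3 f4 f5 !mulr1.
by rewrite mulrBr; congr (_ - _); [rewrite mulrA|rewrite mulrA KK mul1r].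
Qed.
(** If Q does not divide n in the support, chi(n) = (n/Q) and the first two terms combine to a
    multiple of Q + 1. If Q^2 divides n, the relations for n and n/Q^2 are chained. If Q divides n
    once, the two choices of (Q/P) force a(Q^2 n) to vanish. *)
Lemma Top_zero : congf ell (Top Q k2 a) (fun _ => 0).
Proof.
move=> n; rewrite conglE; have [Q5 Q3 lQ1 lQ2 nl] := Q_facts; rewrite /Top.
have [->|n0] := posnP n.
  have a0 : a 0%N = 0 by case: cf.
  by rewrite muln0 div0n dvdn0 a0 !mulr0 !addr0; exact: I0.
have ke : k2 - 1 = 2 * ek by rewrite /ek; clear -ew1 er1; lia.
have -> : psqrt (Q%:R : C) ^ (k2 - 3) = Q%:R ^ (ek - 1).
  have -> : k2 - 3 = 2%:Z * (ek - 1) by clear -ke; lia.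
  by rewrite -exprz_exp -[_ ^ 2%:Z]/(_ ^+ 2) psqrt2.
have -> : psqrt l ^ (k2 - 1) = lr.
  rewrite ke -exprz_exp -[_ ^ 2]/(_ ^+ 2) psqrt2 /lr (_ : ek = 1 + r1 + 2%:Z * (w1 - 1)); last by rewrite /ek; clear; lia.
  by rewrite expfzDr // -exprz_exp -[l ^ 2%:Z]/(l ^+ 2) l2 exp1rz mulr1.
have OQ e : O (Q%:R ^ e) by exact: O_natz.
have Ol : O lr by apply: (@O_rootn _ _ pell _ 2) => //; rewrite lz2; exact: O1.
have aO := a_O cf; have IQ : I (Q%:R + 1) by rewrite natr1; apply: I_nat.
have [dQ|nQ] := boolP (Q %| n)%N.
  have -> : legendre (12 * n%:Z) Q = 0 by apply/eqP; rewrite leg0 dvdz_mull.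
  rewrite mulr0 mul0r addr0; have [d2|n2] := boolP (Q ^ 2 %| n)%N.
    have [s [cn os _ _ rel]] := admissible false n0.
    have [m nE] : exists m, n = (Q ^ 2 * m)%N by exists (n %/ Q ^ 2)%N; rewrite mulnC divnK.
    rewrite {2}nE mulKn ?expn_gt0 ?prime_gt0 //.
    have [cQ cm] : coprime Q (lprod s) /\ coprime m (lprod s).
      by move: cn; rewrite nE coprimeMl coprime_pexpl // => /andP[].
    have h1 := rel n cn; have h2 := rel m cm.
    have ec : chi s n%:Z = chi s m%:Z by rewrite nE PoszM chiM // (@chi_sqr s Q%:Z) // mul1r.
    rewrite -nE ec in h1 h2; have c2 : ((chi s m%:Z)%:~R : C) ^+ 2 = 1 by rewrite -rmorphXn /= chi2.
    (* The signs square to 1, so Kc^2 is Q times the coefficient of the last term of the operator,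
       and Q + 1 vanishes modulo [ell]. *)
    have K2 : Kc ^+ 2 = Q%:R ^ (k2 - 2) * Q%:R.
      rewrite /Kc !exprMn y2 lz2 !mulr1 -[_ ^+ 2]/((Q%:R ^ ek) ^ 2%:Z) exprz_exp mulrC -ke -{3}(expr1z (Q%:R : C)) -expfzDr //.
      by congr (_ ^ _); clear; lia.
    have := ID pell (ID pell (IN pell h1) (IN pell (IMl pell (OM pell O_Kc (O_int R pell (chi s m%:Z))) h2))) (IMr pell IQ (OM pell (OQ (k2 - 2)) (aO m))).
    apply: I_eq; move: K2 c2; move: ((chi s m%:Z)%:~R : C) Kc (a m) (a n) (a (Q ^ 2 * n)%N) (Q%:R ^ (k2 - 2)) => x1 x2 x3 x4 x5 x6 K2 c2.
    transitivity (x5 - x2 ^+ 2 * x1 ^+ 2 * x3 + (x6 * Q%:R + x6) * x3); first by ring.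
    by rewrite K2 c2; ring.
  rewrite mulr0 addr0; have [Ia|na] := pselect (I (a n)).
    have [s [cn os _ _ rel]] := admissible false n0.
    have := ID pell (IN pell (rel n cn)) (IMl pell (OM pell O_Kc (O_int R pell (chi s n%:Z))) Ia).
    by apply: I_eq; rewrite opprB addrNK.
  have [t [f [nE tW]]] := fin na; have on := ao na.
  have nf : ~~ (Q %| f)%N by apply: contra n2 => df; rewrite nE dvdn_mull // dvdn_exp2r.
  have dt : (Q %| t)%N by move: dQ; rewrite nE Euclid_dvdM // Euclid_dvdX // (negbTE nf) orbF.
  have [t' tE] : exists t', t = (Q * t')%N by exists (t %/ Q)%N; rewrite mulnC divnK.
  have ct' : coprime t' Q.
    rewrite coprime_sym prime_coprime //; apply: contra n2 => d; rewrite nE tE -mulnA -mulnn dvdn_pmul2l ?prime_gt0 //.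
    by rewrite dvdn_mulr.
  have ot : odd t' by move: on; rewrite nE tE !oddM => /andP[/andP[]].
  have tW' : (t' %| W)%N by apply: dvdn_trans tW; rewrite tE dvdn_mull.
  (* Both signs of (Q/P) are available; adding the two relations leaves twice a(Q^2 n). *)
  have E (sig : bool) : I ((-1) ^+ sig * (Kc * (legendre t'%:Z Q)%:~R * a n) - a (Q ^ 2 * n)%N).
    have [s [cn os cQ ct rel]] := admissible sig n0.
    have := rel n cn; apply: I_eq; congr (_ - _).
    have -> : chi s n%:Z = (-1) ^+ sig * legendre t'%:Z Q.
      have cfs : coprime f (lprod s) by move: cn; rewrite nE coprimeMl coprime_pexpl // => /andP[].
      by rewrite nE tE (PoszM (Q * t')%N (f ^ 2)%N) (PoszM Q t') -[(f ^ 2)%N%:Z]/(f%:Z ^+ 2) chiM // (@chi_sqr s f%:Z) // mulr1 chiM // cQ ct.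
    by rewrite intrM rmorphXn rmorphN1; ring.
  have E1 := E true; have E0 := E false.
  apply: (@I_cancel _ _ pell 2); first by apply/negP => /dvdn_leq; clear -ell5; lia.
  by have := IN pell (ID pell E0 E1); apply: I_eq; rewrite expr0 expr1; ring.
have -> : (Q ^ 2 %| n)%N = false by apply/negbTE; apply: contra nQ; apply: dvdn_trans; exact: dvdn_exp.
rewrite mulr0 addr0 legM // chi12_leg // intrM.
have [Ia|na] := pselect (I (a n)).
  have [s [cn os _ _ rel]] := admissible false n0.
  apply: ID => //; last first.
    by apply: IMl => //; apply: OM => //; [apply: OM|rewrite -intrM; exact: O_int].
  have := ID pell (IN pell (rel n cn)) (IMl pell (OM pell O_Kc (O_int R pell (chi s n%:Z))) Ia).
  by apply: I_eq; rewrite opprB addrNK.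
have [t [f [nE tW]]] := fin na; have on := ao na.
have [s [cn os cQ ct rel]] := admissible false n0.
have cnQ : coprime n Q by rewrite coprime_sym prime_coprime.
have E : chi s n%:Z = legendre n%:Z Q.
  have [cfs cfQ] : coprime f (lprod s) /\ coprime f Q.
    by move: cn cnQ; rewrite nE ![coprime (t * _) _]coprimeMl !(@coprime_pexpl 2) // => /andP[_ ->] /andP[_ ->].
  rewrite nE (PoszM t (f ^ 2)%N) -[(f ^ 2)%N%:Z]/(f%:Z ^+ 2) chiM // legM // (@chi_sqr s f%:Z) // (leg_sq pQ Q3) ?mulr1; last by rewrite dvdzE /= -prime_coprime // coprime_sym.
  apply: ct => //; first by move: on; rewrite nE oddM => /andP[].
  by move: cnQ; rewrite nE coprimeMl => /andP[].
have := ID pell (IN pell (rel n cn)) (IMr pell IQ (OM pell (OM pell (OM pell (OQ (ek - 1)) Ol) (O_int R pell (chi12 Q * legendre n%:Z Q))) (aO n))).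
apply: I_eq; rewrite E intrM /Kc -{1}(subrK 1 ek) expfzDr // expr1z.
move: (Q%:R ^ (ek - 1)) => x; ring.
Qed.
End HeckeZero.

(** * A Selberg-type sieve in a residue class *)

Section Sieve.
Variable R : realType.
Local Notation C := (R[i]).
Lemma mean_mul (p q : nat) (F G : int -> R) : (0 < p)%N -> (0 < q)%N -> coprime p q ->
  (forall x, F (x + p%:Z) = F x) -> (forall x, G (x + q%:Z) = G x) ->
  \sum_(j < p * q) F j%:Z * G j%:Z = (\sum_(x < p) F x%:Z) * (\sum_(x < q) G x%:Z).
Proof.
move=> p0 q0 cp hF hG; apply: (@complexI R).
have := @crt_em R p q (fun x => (F x)%:C%C) (fun x => (G x)%:C%C) 0 p0 q0 cp (fun x => congr1 _ (hF x)) (fun x => congr1 _ (hG x)).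
have e0 (M : nat) (j : int) : em R M (j * 0) = 1 by rewrite mulr0 /em mul0r ee0.
rewrite (eq_bigr (fun j : 'I_(p * q) => (F j%:Z * G j%:Z)%:C%C)) => [|j _]; last by rewrite e0 mulr1 rmorphM.
rewrite (eq_bigr (fun y : 'I_p => (F (q%:Z * y%:Z))%:C%C)) => [|j _]; last by rewrite e0 mulr1.
rewrite [X in _ * X](eq_bigr (fun y : 'I_q => (G (p%:Z * y%:Z))%:C%C)) => [|j _]; last by rewrite e0 mulr1.
rewrite rmorph_sum rmorphM !rmorph_sum => ->; congr (_ * _).
  by apply: (@period_mul C (fun x => (F x)%:C%C)) => //; [rewrite coprime_sym|move=> x; rewrite hF].
by apply: (@period_mul C (fun x => (G x)%:C%C)) => // x; rewrite hG.
Qed.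
Lemma period_sum (q K : nat) (g : int -> R) : (0 < q)%N -> (forall x, g (x + q%:Z) = g x) -> (forall x, `|g x| <= 1) ->
  `|\sum_(k < K) g k%:Z - K%:R * (q%:R^-1 * \sum_(k < q) g k%:Z)| <= 2 * q%:R.
Proof.
move=> q0 hg g1; have qR : (q%:R : R) != 0 by rewrite pnatr_eq0 -lt0n.
have bd (n : nat) (t : int) : `|\sum_(k < n) g (k%:Z + t)| <= n%:R.
  apply: le_trans (ler_norm_sum _ _ _) _; apply: le_trans (ler_sum _ (fun i _ => g1 _)) _.
  by rewrite sumr_const card_ord.
set s := \sum_(k < q) g k%:Z.
elim: (K %/ q)%N {-2}K (leqnn (K %/ q)%N) => [|n IH] {}K.
  move=> Kq0; have Kq : (K < q)%N by rewrite -[q]mul1n -ltn_divLR.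
  apply: le_trans (ler_normB _ _) _.
  have h1 := bd K 0; rewrite (eq_bigr (fun k : 'I_K => g k%:Z)) in h1; last by move=> k _; rewrite addr0.
  have h2 : `|K%:R * (q%:R^-1 * s)| <= q%:R.
    have := bd q 0; rewrite (eq_bigr (fun k : 'I_q => g k%:Z)); last by move=> k _; rewrite addr0.
    rewrite -/s => h; rewrite mulrA normrM ger0_norm ?divr_ge0 // mulrAC ler_pdivrMr ?ltr0n // ler_pM // ler_nat ltnW //.
  by have : (K%:R : R) <= q%:R; [rewrite ler_nat ltnW|move: h1 h2; lra].
move=> Kn; have [Kq|qK] := ltnP K q.
  by apply: IH; rewrite divn_small.
have -> : K = (q + (K - q))%N by rewrite subnKC.
have -> : \sum_(k < q + (K - q)) g k%:Z = s + \sum_(k < K - q) g k%:Z.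
  rewrite big_split_ord /=; congr (_ + _); apply: eq_bigr => k _; rewrite PoszD addrC hg //.
rewrite natrD mulrDl mulrA divff // mul1r opprD addrACA subrr add0r; apply: IH.
by move: Kn; rewrite -{1}(subnK qK) divnDr // divnn q0 addn1.
Qed.
Variables (B : nat) (u : int).
(** Normalised to have mean 0 and mean square 1/(p-1) over a period, for p prime to B; its products
    over squarefree d are then orthogonal. At an integer not divisible by p it takes the value
    1/(p-1). *)
Definition hs (p : nat) (k : int) : R := if (p%:Z %| u + B%:Z * k)%Z then -1 else p.-1%:R^-1.
Lemma hs_per p k : hs p (k + p%:Z) = hs p k.
Proof.
rewrite /hs; congr (if _ then _ else _); rewrite mulrDr addrA.
by apply/idP/idP => h; [rewrite -(rpredDr _ (dvdz_mull B%:Z (dvdzz p)))|rewrite rpredD // dvdz_mull].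
Qed.
Lemma hs_norm p k : prime p -> `|hs p k| <= 1.
Proof.
move=> pp; have p1 := prime_gt1 pp; rewrite /hs; case: ifP => _; first by rewrite normrN1.
have p0 : (0 < p.-1)%N by rewrite -subn1 subn_gt0.
by rewrite ger0_norm ?invr_ge0 // invf_le1 ?ltr0n // ler1n.
Qed.
Lemma hs_sums p : prime p -> coprime p B -> \sum_(k < p) hs p k%:Z = 0 /\ \sum_(k < p) hs p k%:Z ^+ 2 = p%:R / p.-1%:R.
Proof.
move=> pp cB; have p1 := prime_gt1 pp; have p0 := prime_gt0 pp; have cB' : coprime `|B%:Z| p by rewrite coprime_sym.
have pR : (p.-1%:R : R) != 0 by rewrite pnatr_eq0 -lt0n -subn1 subn_gt0.
have key (w : bool -> R) : \sum_(k < p) w (p%:Z %| u + B%:Z * k%:Z)%Z = w true + p.-1%:R * w false.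
  have per x : w (p%:Z %| u + (x + p%:Z))%Z = w (p%:Z %| u + x)%Z.
    by congr w; rewrite addrA; apply/idP/idP => h; [rewrite -(rpredDr _ (dvdzz p))|rewrite rpredD].
  rewrite (@period_mul R (fun x => w (p%:Z %| u + x)%Z) p B%:Z p0 cB' per).
  have pz : (p%:Z != 0)%R by rewrite -lt0n.
  have lt : (absz (- u %% p)%Z < p)%N by rewrite -ltz_nat gez0_abs ?modz_ge0 // ltz_pmod.
  have E (x : 'I_p) : (p%:Z %| u + x%:Z)%Z = (x == Ordinal lt).
    rewrite addrC -{1}(opprK u) -eqz_mod_dvd modz_nat (modn_small (ltn_ord x)) -(inj_eq val_inj) /=.
    by rewrite -eqz_nat gez0_abs ?modz_ge0.
  rewrite (bigD1 (Ordinal lt)) // (E (Ordinal lt)) eqxx; congr (_ + _).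
  rewrite (eq_bigr (fun=> w false)); last by move=> x nx; rewrite E (negbTE nx).
  by rewrite sumr_const cardC1 card_ord mulr_natl.
have h1 := key (fun b => if b then -1 else p.-1%:R^-1); have h2 := key (fun b => (if b then -1 else p.-1%:R^-1) ^+ 2).
have pE : (p%:R : R) = p.-1%:R + 1 by rewrite natr1 prednK.
rewrite /hs h1 h2; split; first by rewrite divff // addNr.
by rewrite pE; field.
Qed.
Implicit Types (ps : seq nat) (D : nat).
(** Sums over the squarefree d <= D built from [ps]: [FF] adds the products of [hs], [AA] adds
    1/phi(d), [SS] adds d. The recursion separates the d divisible by the head of the list. *)
Fixpoint FF ps D (k : int) : R := if ps is p :: l then FF l D k + hs p k * FF l (D %/ p) k else (0 < D)%:R.
Fixpoint AA ps D : R := if ps is p :: l then AA l D + p.-1%:R^-1 * AA l (D %/ p) else (0 < D)%:R.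
Fixpoint SS ps D : nat := if ps is p :: l then (SS l D + p * SS l (D %/ p))%N else (0 < D)%N.
Lemma FF_AA ps D k : all (fun p => ~~ (p%:Z %| u + B%:Z * k)%Z) ps -> FF ps D k = AA ps D.
Proof. by elim: ps D => //= p l IH D /andP[np al]; rewrite !IH // /hs (negbTE np). Qed.
Lemma minn_div D D' p : (minn D D' %/ p = minn (D %/ p) (D' %/ p))%N.
Proof. by case: (leqP D D') => h; rewrite ?(minn_idPl (leq_div2r p h)) ?(minn_idPr (leq_div2r p (ltnW h))). Qed.
(** Second moment of [FF]. The periodic g and the two cut-offs are what induction requires: removing
    p multiplies g by [hs p] or its square and divides cut-offs by p. Mean zero kills the main terms
    of the cross products, and the diagonal builds up [AA]. *)
Lemma moment ps D D' K (q : nat) (g : int -> R) : (0 < q)%N -> (forall x, g (x + q%:Z) = g x) -> (forall x, `|g x| <= 1) ->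
  uniq ps -> all (fun p => [&& prime p, coprime p B & coprime p q]) ps ->
  `|\sum_(k < K) g k%:Z * FF ps D k%:Z * FF ps D' k%:Z - K%:R * (q%:R^-1 * \sum_(k < q) g k%:Z) * AA ps (minn D D')|
   <= 2 * q%:R * ((SS ps D)%:R * (SS ps D')%:R).
Proof.
elim: ps D D' q g => [|p l IH] D D' q g q0 hg g1 /=.
  move=> _ _; rewrite (eq_bigr (fun k : 'I_K => g k%:Z * ((0 < D) && (0 < D'))%N%:R)) => [|k _]; last by rewrite -mulrA -natrM mulnb.
  rewrite -mulr_suml -[(0 < D)%N%:R * _]natrM mulnb leq_min; case: (_ && _); last by rewrite !mulr0n !mulr0 subrr normr0.
  by rewrite !mulr1n !mulr1; exact: period_sum.
case/andP=> pl ul /andP[/and3P[pp cB cq] al]; have p0 := prime_gt0 pp; have p1 := prime_gt1 pp.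
have qp0 : (0 < p * q)%N by rewrite muln_gt0 p0.
have al' : all (fun p0 => [&& prime p0, coprime p0 B & coprime p0 (p * q)]) l.
  apply/allP => x xl; have /and3P[px cx cxq] := allP al _ xl; rewrite px cx coprimeMr cxq andbT /=.
  by rewrite prime_coprime // dvdn_prime2 //; apply: contraNneq pl => <-.
have al1 : all (fun p => [&& prime p, coprime p B & coprime p q]) l by [].
pose g1' x := g x * hs p x; pose g2 x := g x * hs p x ^+ 2.
have per x : g (x + (p * q)%N%:Z) = g x.
  have H (n : nat) y : g (y + n%:Z * q%:Z) = g y by elim: n => [|n IHn]; rewrite ?mul0r ?addr0 // intS mulrDl mul1r [_%:Z + _ * _]addrC addrA hg.
  by rewrite PoszM H.
have perh x : hs p (x + (p * q)%N%:Z) = hs p x.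
  have H (n : nat) y : hs p (y + n%:Z * p%:Z) = hs p y by elim: n => [|n IHn]; rewrite ?mul0r ?addr0 // intS mulrDl mul1r [_%:Z + _ * _]addrC addrA hs_per.
  by rewrite mulnC PoszM H.
have pg1 x : g1' (x + (p * q)%N%:Z) = g1' x by rewrite /g1' per perh.
have pg2 x : g2 (x + (p * q)%N%:Z) = g2 x by rewrite /g2 per perh.
have ng1 x : `|g1' x| <= 1 by rewrite /g1' normrM mulr_ile1 // hs_norm.
have ng2 x : `|g2 x| <= 1 by rewrite /g2 normrM normrX mulr_ile1 ?exprn_ile1 // hs_norm.
have [s1 s2] := hs_sums pp cB.
have m1 : \sum_(k < p * q) g1' k%:Z = 0.
  rewrite (eq_bigr (fun k : 'I_(p * q) => hs p k%:Z * g k%:Z)) => [|k _]; last by rewrite mulrC.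
  by rewrite (mean_mul p0 q0 cq (hs_per p) hg) s1 mul0r.
have m2 : \sum_(k < p * q) g2 k%:Z = p%:R / p.-1%:R * \sum_(k < q) g k%:Z.
  rewrite (eq_bigr (fun k : 'I_(p * q) => hs p k%:Z ^+ 2 * g k%:Z)) => [|k _]; last by rewrite mulrC.
  by rewrite (mean_mul (F := fun x => hs p x ^+ 2) p0 q0 cq (fun x => congr1 (fun y => y ^+ 2) (hs_per p x)) hg) s2.
have E0 := IH D D' q g q0 hg g1 ul al1; have E1 := IH (D %/ p)%N D' (p * q)%N g1' qp0 pg1 ng1 ul al'.
have E2 := IH D (D' %/ p)%N (p * q)%N g1' qp0 pg1 ng1 ul al'; have E3 := IH (D %/ p)%N (D' %/ p)%N (p * q)%N g2 qp0 pg2 ng2 ul al'.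
rewrite m1 !mulr0 !mul0r subr0 in E1 E2; rewrite m2 -minn_div in E3.
rewrite (eq_bigr (fun k : 'I_K => g k%:Z * FF l D k%:Z * FF l D' k%:Z + (g1' k%:Z * FF l (D %/ p) k%:Z * FF l D' k%:Z +
  (g1' k%:Z * FF l D k%:Z * FF l (D' %/ p) k%:Z + g2 k%:Z * FF l (D %/ p) k%:Z * FF l (D' %/ p) k%:Z)))) => [|k _]; last by rewrite /g1' /g2; ring.
rewrite !big_split /=; move: E0 E1 E2 E3.
have qR : (q%:R : R) != 0 by rewrite pnatr_eq0 -lt0n.
have pR : (p%:R : R) != 0 by rewrite pnatr_eq0 -lt0n.
have pR1 : (p.-1%:R : R) != 0 by rewrite pnatr_eq0 -lt0n -subn1 subn_gt0.
have -> : (p * q)%N%:R^-1 * (p%:R / p.-1%:R * \sum_(k < q) g k%:Z) = p.-1%:R^-1 * (q%:R^-1 * \sum_(k < q) g k%:Z) :> R.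
  by rewrite natrM; field; rewrite qR pR pR1.
rewrite !natrD !natrM.
move: (\sum_(i < K) _) (\sum_(i < K) _) (\sum_(i < K) _) (\sum_(i < K) _) => x3 x2 x1 x0.
move: (q%:R^-1 * _) (AA l _) (AA l _) (p.-1%:R^-1) => mu A2 A1 pi.
move: (ler0n R (SS l D)) (ler0n R (SS l D')) (ler0n R (SS l (D %/ p))) (ler0n R (SS l (D' %/ p))) (ler0n R q).
have : (1 : R) <= p%:R by rewrite ler1n.
move: (SS l D)%:R (SS l D')%:R (SS l (D %/ p))%:R (SS l (D' %/ p))%:R (q%:R : R) (p%:R : R) => a b c d Q P P1 a0 b0 c0 d0 Q0 h0 h1 h2 h3.
apply: (@le_trans _ _ (2 * Q * (a * b) + 2 * (P * Q) * (c * b) + 2 * (P * Q) * (a * d) + 2 * (P * Q) * (c * d))).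
  have -> : x0 + (x1 + (x2 + x3)) - K%:R * mu * (A1 + pi * A2) = (x0 - K%:R * mu * A1) + x1 + x2 + (x3 - K%:R * (pi * mu) * A2) by ring.
  apply: le_trans (ler_normD _ _) _; apply: lerD; last exact: h3.
  apply: le_trans (ler_normD _ _) _; apply: lerD; last by move: h2; rewrite subr0.
  by apply: le_trans (ler_normD _ _) _; apply: lerD; [exact: h0|exact: h1].
have -> : 2 * Q * ((a + P * c) * (b + P * d)) = 2 * Q * (a * b) + 2 * (P * Q) * (c * b) + 2 * (P * Q) * (a * d) + 2 * (P * Q) * (c * d) * P by ring.
have P0 : 0 <= P := le_trans ler01 P1.
by rewrite lerD2l ler_peMr // !mulr_ge0.
Qed.
End Sieve.

(** * Size of the sieve sums *)

Section SieveBounds.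
Variable R : realType.
Local Notation AA := (@AA R).
Implicit Types (ps l : seq nat) (D : nat).
(** The divisors counted by [SS]; they are distinct and at most D, whence SS <= D^2. *)
Fixpoint sqf ps D : seq nat := if ps is p :: l then sqf l D ++ map (muln p) (sqf l (D %/ p)) else nseq (0 < D) 1%N.
Lemma SS_sqf ps D : SS ps D = \sum_(d <- sqf ps D) d.
Proof.
elim: ps D => [|p l IH] D /=; first by case: D => [|D]; rewrite ?big_nil ?big_seq1.
by rewrite big_cat big_map -big_distrr /= !IH.
Qed.
Lemma sqf_le ps D d : all prime ps -> d \in sqf ps D -> (0 < d <= D)%N /\ forall p, prime p -> p \notin ps -> coprime p d.
Proof.
elim: ps D d => [|p l IH] D d /=.
  by move=> _; case: D => //= D; rewrite inE => /eqP->; split=> // p _ _; rewrite coprimen1.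
case/andP=> pp al; rewrite mem_cat => /orP[/(IH _ _ al)[h1 h2]|/mapP[e /(IH _ _ al)[/andP[h0 h1] h2] ->]].
  by split=> // q pq; rewrite inE negb_or => /andP[_ nq]; exact: h2.
split; first by rewrite muln_gt0 prime_gt0 // h0 mulnC -leq_divRL // prime_gt0.
move=> q pq; rewrite inE negb_or => /andP[ne nq]; rewrite coprimeMr h2 // andbT prime_coprime // dvdn_prime2 //.
Qed.
Lemma sqf_uniq ps D : all prime ps -> uniq ps -> uniq (sqf ps D).
Proof.
elim: ps D => [|p l IH] D /=; first by case: D.
case/andP=> pp al /andP[pl ul]; rewrite cat_uniq !IH // map_inj_uniq ?IH //; last first.
  by move=> x y /eqP; rewrite eqn_pmul2l ?prime_gt0 // => /eqP.
rewrite andbT /=; apply/hasPn => x /mapP[e _ ->]; apply/negP => /(sqf_le al)[_ /(_ p pp pl)].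
by rewrite coprimeMr prime_coprime // dvdnn.
Qed.
Lemma SS_le ps D : all prime ps -> uniq ps -> (SS ps D <= D * D)%N.
Proof.
move=> al ul; rewrite SS_sqf.
apply: (@leq_trans (\sum_(d <- sqf ps D) D)%N).
  by rewrite !big_seq; apply: leq_sum => d /(sqf_le al)[/andP[]].
rewrite big_const_seq count_predT iter_addn_0 leq_mul2l; apply/orP; right.
rewrite -[X in (_ <= X)%N](size_iota 1 D); apply: uniq_leq_size; first exact: sqf_uniq.
by move=> d /(sqf_le al)[]; rewrite mem_iota add1n ltnS.
Qed.
Lemma AA_ge0 ps D : 0 <= AA ps D.
Proof. by elim: ps D => [|p l IH] D /=; rewrite ?ler0n // addr_ge0 ?mulr_ge0 ?invr_ge0 ?IH. Qed.
Lemma AA_mono ps D D' : (D <= D')%N -> AA ps D <= AA ps D'.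
Proof.
elim: ps D D' => [|p l IH] D D' h /=; first by rewrite ler_nat; case: D h => // D; case: D'.
by rewrite lerD ?IH // ler_wpM2l ?invr_ge0 // IH // leq_div2r.
Qed.
Lemma AA_ge1 ps D : (0 < D)%N -> 1 <= AA ps D.
Proof. by elim: ps D => [|p l IH] D h /=; rewrite ?h // ler_wpDr ?IH // mulr_ge0 ?invr_ge0 ?AA_ge0. Qed.
Definition sm ps (n : nat) := (0 < n)%N && all (mem ps) (primes n).
Definition Hs ps D : R := \sum_(n < D.+1 | sm ps n) n%:R^-1.
Lemma Hs0 ps : Hs ps 0 = 0. Proof. by rewrite /Hs big1 // => -[[|n] h]. Qed.
Lemma Hs_step p l D : prime p -> Hs (p :: l) D <= Hs l D + p%:R^-1 * Hs (p :: l) (D %/ p).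
Proof.
move=> pp; have p0 := prime_gt0 pp.
rewrite {1}/Hs (bigID (fun n : 'I_D.+1 => (p %| n)%N)) /= addrC; apply: lerD.
  rewrite /Hs big_mkcond [leRHS]big_mkcond /=; apply: ler_sum => n _; case: ifP => [/andP[/andP[n0 h] np]|_]; last by case: ifP.
  have -> // : sm l n; rewrite /sm n0; apply/allP => q qn; have /allP/(_ q qn) := h; rewrite !inE => /orP[/eqP e|//].
  by move: qn np; rewrite e mem_primes => /and3P[_ _ ->].
have l1 (j : 'I_(D %/ p).+1) : (p * j < D.+1)%N by rewrite ltnS mulnC -leq_divRL // -ltnS.
have l2 (n : 'I_D.+1) : (n %/ p < (D %/ p).+1)%N by rewrite ltnS leq_div2r // -ltnS.
rewrite (reindex_onto (fun j => Ordinal (l1 j)) (fun n => Ordinal (l2 n))) /= => [|n /andP[_ d]]; last first.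
  by apply: val_inj; rewrite /= mulnC divnK.
rewrite /Hs mulr_sumr big_mkcond [leRHS]big_mkcond /=; apply: ler_sum => j _; case: ifP => [/andP[/andP[/andP[j0 h] _] _]|_]; last first.
  by case: ifP => // _; rewrite mulr_ge0 ?invr_ge0.
move: j0; rewrite muln_gt0 => /andP[_ j0].
have -> : sm (p :: l) j.
  rewrite /sm j0; apply/allP => q; rewrite mem_primes => /and3P[pq _ dq]; have /allP/(_ q) := h; apply.
  by rewrite mem_primes pq muln_gt0 p0 j0 dvdn_mull.
by rewrite natrM invfM.
Qed.
(** The powers of p contribute 1/p + 1/p^2 + ... = 1/(p-1), the weight of p in [AA]. *)
Lemma Hs_alpha c p l l' : 0 <= c -> prime p -> (forall D, Hs l' D <= c * AA l D) -> forall D, Hs (p :: l') D <= c * AA (p :: l) D.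
Proof.
move=> c0 pp H D; have p1 := prime_gt1 pp; elim: D {-2}D (leqnn D) => [|n IH] D Dn.
  move: Dn; rewrite leqn0 => /eqP->; rewrite Hs0.
  by rewrite mulr_ge0 // (AA_ge0 (p :: l)).
have [->|D0] := posnP D; first by apply: IH.
apply: le_trans (Hs_step _ _ pp) _; have ltD : (D %/ p <= n)%N by rewrite -ltnS (leq_trans (ltn_Pdiv p1 D0)).
have h2 := IH _ ltD; rewrite /= in h2 *.
have h3 := AA_mono l (leq_div (D %/ p) p); have pE : (p%:R : R) = p.-1%:R + 1 by rewrite natr1 prednK // ltnW.
have q0 : (0 : R) < p.-1%:R by rewrite ltr0n -subn1 subn_gt0.
apply: (@le_trans _ _ (c * AA l D + p%:R^-1 * (c * ((1 + p.-1%:R^-1) * AA l (D %/ p))))).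
  apply: lerD => //; rewrite ler_wpM2l ?invr_ge0 //; apply: le_trans h2 _; rewrite ler_wpM2l // mulrDl mul1r lerD2l ler_wpM2l // invr_ge0 ltW //.
rewrite pE mulrDr lerD2l; move: (AA l (D %/ p)) p.-1%:R q0 => A q q0; rewrite le_eqVlt; apply/orP; left; apply/eqP.
by field; rewrite gt_eqF // gt_eqF // ltr_wpDr.
Qed.
(** A prime outside the sieve costs a factor b/(b-1); over the primes of B this amounts to
    B/phi(B). *)
Lemma Hs_beta c b l l' : 0 <= c -> prime b -> (forall D, Hs l' D <= c * AA l D) ->
  forall D, Hs (b :: l') D <= b%:R / b.-1%:R * c * AA l D.
Proof.
move=> c0 pp H D; have p1 := prime_gt1 pp; elim: D {-2}D (leqnn D) => [|n IH] D Dn.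
  move: Dn; rewrite leqn0 => /eqP->; rewrite Hs0.
  by rewrite mulr_ge0 ?AA_ge0 // mulr_ge0 // divr_ge0.
have [->|D0] := posnP D; first by apply: IH.
apply: le_trans (Hs_step _ _ pp) _; have ltD : (D %/ b <= n)%N by rewrite -ltnS (leq_trans (ltn_Pdiv p1 D0)).
have h2 := IH _ ltD.
have h3 := AA_mono l (leq_div D b); have pE : (b%:R : R) = b.-1%:R + 1 by rewrite natr1 prednK // ltnW.
have q0 : (0 : R) < b.-1%:R by rewrite ltr0n -subn1 subn_gt0.
apply: (@le_trans _ _ (c * AA l D + b%:R^-1 * (b%:R / b.-1%:R * c * AA l D))).
  by apply: lerD => //; rewrite ler_wpM2l ?invr_ge0 //; apply: le_trans h2 _; rewrite ler_wpM2l // mulr_ge0 // divr_ge0.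
rewrite pE; move: (AA l D) b.-1%:R q0 => A q q0; rewrite le_eqVlt; apply/orP; left; apply/eqP.
by field; rewrite gt_eqF // gt_eqF // ltr_wpDr.
Qed.
Lemma Hs_bound bs ps D : all prime bs -> all prime ps ->
  Hs (bs ++ ps) D <= (\prod_(b <- bs) (b%:R / b.-1%:R)) * AA ps D.
Proof.
move=> ab ap; have p0 (s : seq nat) : 0 <= \prod_(b <- s) (b%:R / b.-1%:R) :> R.
  by apply: prodr_ge0 => b _; rewrite divr_ge0.
elim: bs ab D => [|b bs IH] /=; last first.
  by case/andP=> pb /IH H D; rewrite big_cons; apply: Hs_beta.
move=> _; rewrite big_nil; elim: ps ap => [|p l IH] /=; last by case/andP=> pp al; exact: Hs_alpha ler01 pp (IH al).
move=> _ D; rewrite mul1r /Hs; case: D => [|D]; first by rewrite -/(Hs [::] 0) Hs0.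
rewrite (bigD1 (inord 1)) /= ?inordK // big1 ?invr1 ?addr0 // => n /andP[/andP[n0 h] n1].
have : primes n == [::] by case: (primes n) h.
rewrite primes_eq0 => n2; case/eqP: n1; apply: val_inj; rewrite /= inordK //; move: n0 n2; case: (nat_of_ord n) => [|[|]] //.
Qed.
Lemma Hs_ln ps D : (forall p, prime p -> (p <= D)%N -> p \in ps) -> ln D.+1%:R <= Hs ps D.
Proof.
move=> H; have -> : Hs ps D = \sum_(i < D) i.+1%:R^-1.
  rewrite /Hs big_mkcond big_ord_recl /= add0r; apply: eq_bigr => i _; have -> // : sm ps (bump 0 i).
  rewrite /sm; apply/allP => p; rewrite mem_primes => /and3P[pp _ /dvdn_leq pi]; apply: H => //.
  by apply: leq_trans (pi _) _ => //; rewrite /bump add1n.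
elim: D {H} => [|D IH]; first by rewrite big_ord0 ln1.
rewrite big_ord_recr /=.
have -> : (D.+2%:R : R) = D.+1%:R * (1 + D.+1%:R^-1) by rewrite mulrDr mulr1 divff ?gt_eqF // natr1.
have i0 : (0 : R) < D.+1%:R^-1 by rewrite invr_gt0.
have -> : ln (D.+1%:R * (1 + D.+1%:R^-1)) = ln D.+1%:R + ln (1 + D.+1%:R^-1) :> R by apply: lnM; rewrite posrE // addr_gt0.
by apply: lerD => //; apply: le_ln1Dx; apply: lt_trans i0; rewrite ltrN10.
Qed.
End SieveBounds.

(** * Chebyshev's lower bound for the number of primes *)

Definition npr (X : nat) : nat := (\sum_(p < X.+1 | prime p) 1)%N.
Lemma bin_ge n : (2 ^ n <= 'C(n.*2, n))%N.
Proof.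
elim: n => // n IH; rewrite doubleS !binS expnS mul2n -addnn.
apply: leq_add; apply: leq_trans IH _; first by rewrite leq_addl.
by case: n => [|n] //; rewrite [X in (_ <= X)%N]binS leq_addr.
Qed.
(** In Legendre's formula each power p^k up to 2n contributes at most 1 to the exponent, and larger
    powers contribute nothing. *)
Lemma logn_bin p n : prime p -> (0 < n)%N -> (p ^ logn p 'C(n.*2, n) <= n.*2)%N.
Proof.
move=> pp n0; have p1 := prime_gt1 pp; have m0 : (0 < n.*2)%N by rewrite double_gt0.
apply: leq_trans (trunc_logP p1 m0); rewrite leq_exp2l //.
have bn : (n <= n.*2)%N by rewrite -addnn leq_addr.
have E : logn p (n.*2)`! = (logn p 'C(n.*2, n) + (logn p n`!).*2)%N.
  rewrite -(bin_fact bn) -addnn addnK !lognM ?muln_gt0 ?fact_gt0 ?bin_gt0 // ?leq_addr //.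
  by rewrite (addnn (logn p n`!)).
rewrite !logn_fact // in E.
have E2 : (\sum_(1 <= k < n.+1) n %/ p ^ k = \sum_(1 <= k < n.*2.+1) n %/ p ^ k)%N.
  rewrite [RHS](@big_cat_nat _ _ _ n.+1) //= [X in (_ + X)%N]big_nat_cond [X in (_ + X)%N]big1 ?addn0 // => k /andP[/andP[nk _] _].
  by rewrite divn_small // (leq_trans nk) // ltnW // ltn_expl.
rewrite E2 in E; set t := trunc_log p _.
have term k : (n.*2 %/ p ^ k <= (n %/ p ^ k).*2 + (k <= t))%N.
  have [kt|kt] := leqP k t.
    have q0 : (0 < p ^ k)%N by rewrite expn_gt0 ltnW.
    rewrite -ltnS ltn_divLR //; have := ltn_pmod n q0; have := divn_eq n (p ^ k).
    by move: (p ^ k)%N (n %/ p ^ k)%N (n %% p ^ k)%N => q x y; rewrite -!muln2 addn1; clear; nia.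
  rewrite divn_small //; apply: contraLR kt; rewrite -!leqNgt; exact: trunc_log_max.
have : (\sum_(1 <= k < n.*2.+1) n.*2 %/ p ^ k <= (\sum_(1 <= k < n.*2.+1) n %/ p ^ k).*2 + t)%N.
  apply: leq_trans (leq_sum _ (fun k _ => term k)) _; rewrite big_split /= leq_add //.
    by rewrite -[leqRHS]muln2 big_distrl /=; apply: leq_sum => k _; rewrite muln2.
  have -> : (\sum_(1 <= i < n.*2.+1) (i <= t) = size [seq i <- index_iota 1 n.*2.+1 | i <= t])%N.
    by rewrite -sum1_size big_filter [RHS]big_mkcond; apply: eq_bigr => i _; case: (i <= t)%N.
  rewrite -(size_iota 1 t); apply: uniq_leq_size; first by rewrite filter_uniq // iota_uniq.
  by move=> x; rewrite size_iota mem_filter mem_index_iota mem_iota => /andP[xt /andP[x1 _]]; rewrite x1 add1n ltnS.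
by rewrite E; clear; lia.
Qed.
(** The central binomial coefficient is at least 2^n and is a product, over primes up to 2n, of
    prime powers at most 2n. *)
Lemma cheb n : (0 < n)%N -> (2 ^ n <= n.*2 ^ npr n.*2)%N.
Proof.
move=> n0; apply: leq_trans (bin_ge n) _; set m := 'C(_, _).
have m0 : (0 < m)%N by rewrite bin_gt0 -addnn leq_addr.
rewrite (prod_prime_decomp m0) prime_decompE big_map /=.
apply: (@leq_trans (\prod_(p <- primes m) n.*2)%N).
  by rewrite !big_seq; apply: leq_prod => p; rewrite mem_primes => /andP[pp _]; exact: logn_bin.
rewrite big_const_seq count_predT iter_muln_1 leq_exp2l; last by case: n n0 {m m0} => // n _; rewrite doubleS.
have -> : npr n.*2 = size [seq p <- iota 0 n.*2.+1 | prime p].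
  by rewrite /npr -(big_mkord prime (fun=> 1%N)) -big_filter sum1_size /index_iota subn0.
apply: uniq_leq_size; first exact: primes_uniq.
move=> p; rewrite mem_primes mem_filter mem_iota add0n ltnS => /and3P[pp _ d]; rewrite pp /=.
have : (p %| (n.*2)`!)%N by apply: dvdn_trans d _; rewrite -(@bin_fact n.*2 n) ?dvdn_mulr // -addnn leq_addr.
rewrite -[X in (X)`!]/(n.*2); elim: (n.*2) => [|k IH]; first by rewrite fact0 dvdn1; move=> /eqP e; move: pp; rewrite e.
by rewrite factS Euclid_dvdM // => /orP[/dvdn_leq->//|/IH h]; rewrite (leq_trans h).
Qed.

(** * Residue classes with prescribed quadratic symbols *)

Section Units.
Variable R : realType.
(** The symbol (n/m) rewritten by reciprocity, so that it visibly depends on m modulo 4n only. *)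
Definition psi (n m : nat) : int := sg m n * chi (plist n) m%:Z.
Lemma psi_leg n q : odd n -> prime q -> (3 <= q)%N -> ~~ (q %| n)%N -> legendre n%:Z q = psi n q.
Proof.
move=> on pq q3 nq; have n0 : (0 < n)%N by case: n on {nq}.
have := recip1 R pq q3 (plist_oddp on) _; rewrite plist_prod // => -> //.
by apply: contra nq => /mem_dvd_lprod; rewrite plist_prod.
Qed.
Lemma psi_mod n m m' : odd n -> m = m' %[mod 4 * n] -> psi n m = psi n m'.
Proof.
move=> on e; have n0 : (0 < n)%N by case: n on {e}.
rewrite /psi (@sg_mod m m') ?(@chi_cong _ m%:Z m'%:Z) ?plist_oddp //.
- rewrite plist_prod // -eqz_mod_dvd !modz_nat -(@modn_dvdm (4 * n) m) ?e ?modn_dvdm // dvdn_mull //.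
by rewrite -(@modn_dvdm (4 * n) m) ?e ?modn_dvdm // dvdn_mulr.
Qed.
Lemma psiM n x y : odd n -> odd x -> odd y -> psi n (x * y) = psi n x * psi n y.
Proof. by move=> on ox oy; rewrite /psi sgM // PoszM chiM ?plist_oddp //; ring. Qed.
Lemma logn_lprod p s : prime p -> all prime s -> logn p (lprod s) = count_mem p s.
Proof.
move=> pp; elim: s => [|q s IH] /=; first by rewrite /lprod big_nil logn1.
case/andP=> pq ps; have h := IH ps; have q0 := prime_gt0 pq; have s0 := M_gt0 ps.
by rewrite lprod_cons lognM // h logn_prime // eq_sym.
Qed.
(** Each entry owns a prime, of odd multiplicity in it, that divides no later entry; this makes the
    conditions on the symbols independent. *)
Fixpoint good (l : seq nat) : Prop := if l is n :: l' then
  [/\ odd n, good l' & exists p, [/\ prime p, odd (logn p n) & all (fun n' => ~~ (p %| n')%N) l']] else True.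
Lemma good_odd l : good l -> all odd l.
Proof. by elim: l => //= n l IH [-> /IH-> _]. Qed.
Variables (B : nat) (eps : int).
Hypotheses (B0 : (0 < B)%N) (e0 : eps != 0).
Definition UU (l : seq nat) : {set 'I_B} := [set x : 'I_B | coprime x B & all (fun n => psi n x == eps) l].
(** Multiplication by a unit w with psi n w = -1 and psi n' w = 1 on the rest of the list injects
    the classes for n :: l into those classes for l where the condition at n fails. *)
Lemma UU_half n l : good (n :: l) -> all (fun n' => (4 * n' %| B)%N) (n :: l) -> (2 * #|UU (n :: l)| <= #|UU l|)%N.
Proof.
move=> [on gl [p [pp op np]]] /= /andP[dn dl]; have ol := good_odd gl.
have pn : (p %| n)%N.
  have : p \in primes n by rewrite -logn_gt0; case: (logn p n) op.
  by rewrite mem_primes => /and3P[].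
have p3 : (3 <= p)%N.
  have := prime_gt1 pp; rewrite leq_eqVlt => /orP[/eqP e|//]; move: pn on; rewrite -e dvdn2 => /negbTE->//.
have pB : (p %| B)%N by apply: dvdn_trans dn; rewrite dvdn_mull.
have [B' cB eB] := pfactor_coprime pp B0; set e := logn p B in eB.
have e_gt0 : (0 < e)%N by rewrite logn_gt0 mem_primes pp B0.
have [v hv] := nonresidue pp p3.
have [y hy] : exists y : nat, legendre y%:Z p = -1.
  exists (absz (v %% p)%Z); rewrite -hv; apply: leg_cong => //; rewrite gez0_abs ?modz_ge0 //; last by rewrite -lt0n prime_gt0.
  by rewrite -eqz_mod_dvd modz_mod.
have cpe : coprime B' (p ^ e) by rewrite coprimeXr // coprime_sym.
(* w is 1 modulo the part of B prime to p and a nonresidue modulo p, so only numbers containing p to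
   an odd power see it. *)
pose w := chinese B' (p ^ e) 1 y.
have w1 : w = 1 %[mod B'] by exact: chinese_modl.
have w2 : w = y %[mod p ^ e] by exact: chinese_modr.
have w2' : w = y %[mod p] by rewrite -(@modn_dvdm (p ^ e) w) ?w2 ?modn_dvdm // dvdn_exp.
have lw : legendre w%:Z p = -1 by rewrite -hy; apply: leg_cong => //; rewrite -eqz_mod_dvd !modz_nat w2'.
have wB' d : (d %| B)%N -> coprime p d -> w = 1 %[mod d].
  move=> dB cd; have : (d %| B')%N by move: dB; rewrite eB Gauss_dvdl // coprimeXr // coprime_sym.
  by move=> dB'; rewrite -(@modn_dvdm B' w) ?w1 ?modn_dvdm.
have cw : coprime w B.
  rewrite eB coprimeMr coprimeXr ?andbT; last first.
    by rewrite coprime_sym prime_coprime // -[(p %| w)%N]/(p%:Z %| w%:Z)%Z -leg0 lw.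
  by rewrite -coprime_modl w1 coprime_modl coprime1n.
have d2 : (2 %| B)%N by apply: dvdn_trans dn; exact: (dvdn_mulr n (isT : 2 %| 4)%N).
have oc x : coprime x B -> odd x by move=> cx; rewrite -coprimen2; exact: coprime_dvdr d2 cx.
have w4 : w = 1 %[mod 4].
  apply: wB'; first by apply: dvdn_trans dn; rewrite dvdn_mulr.
  by rewrite (_ : 4 = 2 ^ 2)%N // coprimeXr // prime_coprime //; apply/negP => /dvdn_leq; clear -p3; lia.
have sgw m : sg w m = 1 by rewrite /sg w4.
have chw m : odd m -> (m %| B)%N -> psi m w = (-1) ^+ (logn p m).
  move=> om mB; have m0 : (0 < m)%N by case: m om {mB}.
  rewrite /psi sgw mul1r -{2}(plist_prod m0) logn_lprod ?oddp_prime ?plist_oddp //.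
  have : all (fun q => [&& prime q, 3 <= q & q %| m])%N (plist m).
    apply/allP => q qm; have /andP[-> ->] := allP (plist_oddp om) _ qm.
    by rewrite -[X in (_ %| X)%N](plist_prod m0) mem_dvd_lprod.
  elim: (plist m) => [|q s IH] /=; first by rewrite /chi big_nil.
  case/andP=> /and3P[pq q3 qm] /IH h; rewrite chi_cons h exprD; congr (_ * _); case: eqP => [->|/eqP ne]; first by rewrite lw.
  rewrite expr0 (@leg_cong q pq _ 1) ?leg1 //; last first.
    rewrite -eqz_mod_dvd -[(1 : int)]/(1%N%:Z) !modz_nat wB' ?(dvdn_trans qm) // prime_coprime // dvdn_prime2 // eq_sym //.
have pw n' : n' \in l -> psi n' w = 1.
  move=> nl; have /allP/(_ _ nl) np' := np; rewrite chw ?(allP ol) //; last by apply: dvdn_trans (allP dl _ nl); rewrite dvdn_mull.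
  have n'0 : (0 < n')%N by have := allP ol _ nl; case: (n').
  by have -> : logn p n' = 0%N by apply/eqP; rewrite -leqn0 leqNgt logn_gt0 mem_primes pp n'0 (negbTE np').
have pnw : psi n w = -1 by rewrite chw // ?(dvdn_trans _ dn) ?dvdn_mull // -signr_odd op.
pose h (x : 'I_B) : 'I_B := Ordinal (ltn_pmod (x * w) B0).
have hi : injective h.
  move=> x y' /(congr1 val)/= exy; apply: val_inj; apply/eqP => /=.
  have : (B%:Z %| (x%:Z - y'%:Z) * w%:Z)%Z by rewrite mulrBl -!PoszM -eqz_mod_dvd !modz_nat exy.
  rewrite Gauss_dvdzl; last by rewrite /coprimez /gcdz /= gcdnC.
  by rewrite -eqz_mod_dvd !modz_nat !modn_small.
have hpsi m x : odd m -> (4 * m %| B)%N -> coprime x B -> psi m ((x * w) %% B) = psi m x * psi m w.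
  move=> om mB cx; have ox := oc _ cx; have ow := oc _ cw; rewrite -psiM //; apply: psi_mod => //; rewrite modn_dvdm //.
have hs1 : h @: UU (n :: l) \subset UU l :\: UU (n :: l).
  apply/fintype.subsetP => z /finset.imsetP[x]; rewrite !inE /= => /andP[cx /andP[/eqP ex al] ->].
  have cz : coprime ((x * w) %% B) B by rewrite coprime_modl coprimeMl cx.
  rewrite cz hpsi // pnw ex mulrN1 /= (_ : (- eps == eps) = false) /=; last by apply/negbTE; move: e0; clear; lia.
  by apply/allP => m ml; rewrite hpsi ?(allP ol) ?(allP dl) // pw // mulr1 (allP al).
have hs2 : UU (n :: l) \subset UU l by apply/fintype.subsetP => x; rewrite !inE /= => /and3P[-> _ ->].
rewrite mul2n -addnn -{1}(card_imset _ hi) (leq_trans (leq_add (subset_leq_card hs1) (leqnn _))) //.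
by rewrite cardsD (finset.setIidPr hs2) subnK // subset_leq_card.
Qed.
Lemma UU_card l : good l -> all (fun n' => (4 * n' %| B)%N) l -> (2 ^ size l * #|UU l| <= totient B)%N.
Proof.
elim: l => [|n l IH] gl dl.
  rewrite mul1n totient_count_coprime big_mkord -sum1_card [leqRHS](eq_bigr (fun x : 'I_B => if coprime x B then 1%N else 0%N)).
    by rewrite -big_mkcond /= leq_eqVlt; apply/orP; left; apply/eqP; apply: eq_bigl => x; rewrite inE andbT.
  by move=> x _; rewrite coprime_sym; case: (coprime _ _).
have [_ gl' _] := gl; have /andP[_ dl'] := dl.
by apply: leq_trans (IH gl' dl'); rewrite /= expnS -mulnA mulnCA leq_mul2l UU_half ?orbT.
Qed.
End Units.

(** * Upper density of S from the sieve and Chebyshev *)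

Section Density.
Variable R : realType.
Lemma totient_ratio (B : nat) : (0 < B)%N ->
  (totient B)%:R * \prod_(b <- primes B) (b%:R / b.-1%:R) = B%:R :> R.
Proof.
move=> B0; rewrite totientE // natr_prod -big_split /= {3}(prod_prime_decomp B0) prime_decompE big_map natr_prod.
rewrite !big_seq; apply: eq_bigr => p; rewrite mem_primes => /and3P[pp _ d].
have l0 : (0 < logn p B)%N by rewrite logn_gt0 mem_primes pp B0.
have p0 : (p.-1%:R : R) != 0 by rewrite pnatr_eq0 -lt0n -subn1 subn_gt0 prime_gt1.
by rewrite /= -{2}(prednK l0) expnS !natrM; field.
Qed.
(** A prime u + B k > D is divisible by no p <= D, so [FF] equals [AA] there; comparing with the
    second moment gives the bound after division by AA^2. *)
Lemma residue_count (B u D K : nat) ps : (0 < D)%N -> uniq ps -> all (fun p => [&& prime p, coprime p B & p <= D])%N ps ->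
  #|[set k : 'I_K | prime (u + B * k) && (D < u + B * k)%N]|%:R <= K%:R / AA R ps D + 2 * D%:R ^+ 4.
Proof.
move=> D0 us al; set T := [set k | _]; set A := AA R ps D; have A1 : 1 <= A by exact: AA_ge1.
have ap : all prime ps by apply: sub_all al => p /and3P[].
have al' : all (fun p => [&& prime p, coprime p B & coprime p 1]) ps by apply: sub_all al => p /and3P[-> -> _]; rewrite coprimen1.
have := @moment R B u%:Z ps D D K 1 (fun=> 1) isT (fun=> erefl) (fun=> _) us al'.
rewrite normr1 lexx => /(_ (fun=> isT)); rewrite big_ord1 invr1 !mulr1 minnn -/A => M.
have SSD : (SS ps D)%:R * (SS ps D)%:R <= D%:R ^+ 4 :> R.
  rewrite -natrM -natrX ler_nat; apply: leq_trans (leq_mul (SS_le D ap us) (SS_le D ap us)) _.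
  by rewrite !expnS expn0 muln1 !mulnA.
have lb : #|T|%:R * A ^+ 2 <= \sum_(k < K) 1 * FF R B u%:Z ps D k%:Z * FF R B u%:Z ps D k%:Z.
  rewrite -sum1_card natr_sum mulr_suml big_mkcond /=; apply: ler_sum => k _; rewrite !mul1r.
  case: ifP => [|_]; last by rewrite -expr2 sqr_ge0.
  rewrite inE => /andP[pm Dm]; rewrite FF_AA -?expr2 //; apply: sub_all al => p /and3P[pp _ pD].
  rewrite -PoszM -PoszD dvdzE /= dvdn_prime2 //; apply: contraTneq pD => ->; rewrite -ltnNge.
  exact: Dm.
have ub : #|T|%:R * A ^+ 2 <= K%:R * A + 2 * D%:R ^+ 4.
  have := le_trans (ler_norm _) M; move: lb SSD; move: (\sum_(k < K) _) => x; lra.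
have A0 : 0 < A by apply: lt_le_trans A1.
rewrite -(ler_pM2r (exprn_gt0 2 A0)); apply: le_trans ub _; rewrite [leRHS]mulrDl; apply: lerD.
  by rewrite expr2 mulrA divfK // gt_eqF.
by rewrite ler_peMr // exprn_ege1.
Qed.
Variables (S : nat -> bool) (eps : int) (l : seq nat).
Local Notation B := (4 * lprod l)%N.
Hypotheses (e0 : eps != 0) (gl : good l).
Hypothesis HS : forall m, prime m -> S m -> (B < m)%N -> all (fun n : nat => legendre n%:Z m == eps) l.
Let B0 : (0 < B)%N.
Proof.
rewrite muln_gt0 /=; have := good_odd gl; elim: l => [|n s IH] /=; first by rewrite /lprod big_nil.
by case/andP=> on /IH h; rewrite lprod_cons muln_gt0 h andbT; case: n on.
Qed.
Let dB : all (fun n => (4 * n %| B)%N) l.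
Proof. by apply/allP => n nl; rewrite dvdn_pmul2l // mem_dvd_lprod. Qed.
Definition cnt X : nat := (\sum_(m < X.+1 | prime m && S m) 1)%N.
(** Up to D + B the count is trivial. Larger elements of S lie in at most phi(B)/2^j classes, j
    being the length of l, and each class is handled by [residue_count]. *)
Lemma count_bound X D : (0 < D)%N ->
  (cnt X)%:R <= (D + B).+1%:R + (X + B)%:R / (2 ^+ size l * ln D.+1%:R) + 2 * B%:R * D%:R ^+ 4 :> R.
Proof.
move=> D0; pose K := (X %/ B).+1.
pose ps := [seq p <- iota 0 D.+1 | prime p && coprime p B].
have ups : uniq ps by rewrite filter_uniq // iota_uniq.
have aps : all (fun p => [&& prime p, coprime p B & p <= D])%N ps.
  by apply/allP => p; rewrite mem_filter mem_iota add0n ltnS => /andP[/andP[-> ->]].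
set A := AA R ps D; have A1 : 1 <= A by exact: AA_ge1.
have A0 : 0 < A by apply: lt_le_trans A1.
(* The loss B/phi(B) caused by not sieving with the primes of B is balanced by there being only
   phi(B) classes. *)
have lam : ln D.+1%:R * (totient B)%:R <= B%:R * A :> R.
  rewrite -(totient_ratio B0) mulrC -mulrA ler_wpM2l //.
  apply: le_trans (Hs_bound R D (_ : all prime (primes B)) (_ : all prime ps)); last 2 first.
  - by apply/allP => p; rewrite mem_primes => /andP[].
  - by apply: sub_all aps => p /and3P[].
  apply: Hs_ln => p pp pD; rewrite mem_cat mem_primes pp B0 mem_filter mem_iota add0n ltnS pD pp andbT /=.
  by rewrite leq0n andbT prime_coprime // orbN.
pose T := [set m : 'I_X.+1 | prime m && S m].
have cE : cnt X = #|T| by rewrite /cnt -sum1_card; apply: eq_bigl => m; rewrite inE.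
pose T1 := [set m : 'I_X.+1 | (m <= D + B)%N]; pose T2 := [set m in T | (D + B < m)%N].
have sT : T \subset T1 :|: T2.
  by apply/fintype.subsetP => m; rewrite !inE => ->; case: leqP.
have c1 : (#|T1| <= (D + B).+1)%N.
  have l1 (m : 'I_X.+1) : (minn m (D + B) < (D + B).+1)%N by rewrite ltnS geq_minr.
  rewrite -[leqRHS]card_ord -(@card_in_imset _ _ (fun m => Ordinal (l1 m))) ?max_card // => x y; rewrite !inE => hx hy /(congr1 val)/=.
  by rewrite !(minn_idPl _) // => h; apply: val_inj.
pose U := UU B eps l.
pose G (u : 'I_B) := [set k : 'I_K | prime (u + B * k) && (D < u + B * k)%N].
have c2 : (#|T2| <= \sum_(u in U) #|G u|)%N.
  have l1 (m : 'I_X.+1) : (m %% B < B)%N by rewrite ltn_mod.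
  have l2 (m : 'I_X.+1) : (m %/ B < K)%N by rewrite ltnS leq_div2r // -ltnS.
  pose h (m : 'I_X.+1) := (Ordinal (l1 m), Ordinal (l2 m)).
  have hi : injective h by move=> x y [/= h1 h2]; apply: val_inj; rewrite /= (divn_eq x B) h1 h2 -divn_eq.
  rewrite -(card_imset _ hi); have -> : (\sum_(u in U) #|G u| = #|[set z : 'I_B * 'I_K | (z.1 \in U) && (z.2 \in G z.1)]|)%N.
    rewrite -sum1_card (eq_bigr (fun u => \sum_(k in G u) 1)%N) => [|u _]; last by rewrite sum1_card.
    by rewrite pair_big_dep /=; apply: eq_bigl => z; rewrite [RHS]inE.
  apply: subset_leq_card; apply/fintype.subsetP => z /finset.imsetP[m]; rewrite !inE => /andP[/andP[pm Sm] Dm] ->.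
  have mE : (m %% B + B * (m %/ B))%N = m by rewrite addnC mulnC -divn_eq.
  rewrite /h /= mE pm (leq_ltn_trans (leq_addr B D) Dm) !andbT.
  have Bm : (B < m)%N by apply: leq_ltn_trans Dm; rewrite leq_addl.
  have nd d : (d %| B)%N -> ~~ (m %| d)%N by move=> dd; apply/negP => hd; have := dvdn_leq B0 (dvdn_trans hd dd); rewrite leqNgt Bm.
  rewrite coprime_modl prime_coprime // nd //=; apply/allP => n nl.
  have on := allP (good_odd gl) _ nl; have /eqP <- := allP (HS pm Sm Bm) _ nl; apply/eqP.
  rewrite (psi_leg R) //; last by apply: nd; apply: dvdn_trans (allP dB _ nl); rewrite dvdn_mull.
    by apply: psi_mod => //; rewrite modn_dvdm // (allP dB).
  by apply: leq_trans Bm; have := B0; clear; lia.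
have cU : (2 ^ size l * #|U| <= totient B)%N by apply: UU_card.
have c3 : (\sum_(u in U) #|G u|)%N%:R <= #|U|%:R * (K%:R / A + 2 * D%:R ^+ 4) :> R.
  rewrite natr_sum mulr_natl -sumr_const; apply: ler_sum => u _; exact: residue_count.
have c4 : (cnt X)%:R <= (D + B).+1%:R + #|U|%:R * (K%:R / A + 2 * D%:R ^+ 4) :> R.
  apply: le_trans (lerD (_ : #|T1|%:R <= _) c3); last by rewrite ler_nat.
  rewrite -natrD ler_nat cE; apply: leq_trans (subset_leq_card sT) _.
  by apply: leq_trans (leq_add (leqnn _) c2); rewrite cardsU leq_subr.
apply: le_trans c4 _; rewrite -addrA lerD2l mulrDr; apply: lerD.
  have la0 : 0 < ln D.+1%:R :> R by rewrite ln_gt0 // ltr1n ltnS.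
  have U2 : 2 ^+ size l * #|U|%:R <= (totient B)%:R :> R by rewrite -natrX -natrM ler_nat.
  have KB : K%:R * B%:R <= (X + B)%:R :> R by rewrite -natrM ler_nat /K mulSn addnC leq_add2r leq_trunc_div.
  rewrite ler_pdivlMr ?mulr_gt0 // (_ : _ * _ * _ = K%:R * ((2 ^+ size l * #|U|%:R) * ln D.+1%:R) / A); last by ring.
  rewrite ler_pdivrMr //.
  apply: le_trans (_ : K%:R * (B%:R * A) <= _); last by rewrite mulrA ler_wpM2r // ltW.
  by rewrite ler_wpM2l //; apply: le_trans lam; rewrite mulrC ler_wpM2l // ltW.
rewrite mulrA ler_wpM2r ?exprn_ge0 // mulrC ler_wpM2l // ler_nat.
apply: leq_trans (max_card _) _; by rewrite card_ord.
Qed.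
End Density.

Lemma root_floor k X : (0 < k)%N -> exists D, (D ^ k <= X < D.+1 ^ k)%N.
Proof.
move=> k0; elim: X => [|X [D /andP[h1 h2]]]; first by exists 0%N; rewrite exp0n // exp1n.
have [h|h] := leqP (D.+1 ^ k) X.+1; last by exists D; rewrite h (leq_trans h1).
by exists D.+1; rewrite h; have := ltn_exp2r D.+1 D.+2 k0; rewrite ltnSn; exact: leq_ltn_trans.
Qed.
Section DensityZero.
Variable R : realType.
(** Stated with ln (D + 1) to match [count_bound]: ln X <= 6 ln (D + 1) and X <= 3 floor(X/2) give
    the constant 18. *)
Lemma cheb_real X D : (2 <= X)%N -> (X < D.+1 ^ 6)%N -> X%:R * ln 2 <= 18 * ln D.+1%:R * (npr X)%:R :> R.
Proof.
move=> X2 XD; pose n := X./2; have n0 : (0 < n)%N by rewrite /n; case: X X2 {XD n} => [|[|X]].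
have X0 : (0 < X)%N by apply: leq_trans X2.
have nX : (n.*2 <= X)%N by rewrite /n; clear; lia.
have X3 : (X <= 3 * n)%N by rewrite /n; clear -X2; lia.
have h : (2 ^ n <= X ^ npr X)%N.
  have mono : (npr n.*2 <= npr X)%N.
    by rewrite /npr -!(big_mkord prime (fun=> 1%N)) [leqRHS](@big_cat_nat _ _ _ n.*2.+1) //= leq_addr.
  apply: leq_trans (cheb n0) _; apply: (@leq_trans (X ^ npr n.*2)%N); last by rewrite leq_pexp2l.
  by case: (npr n.*2) => [|e]; rewrite ?expn0 // leq_exp2r.
have lnh : n%:R * ln 2 <= (npr X)%:R * ln X%:R :> R.
  rewrite !mulr_natl -!lnXn ?ltr0n // -!natrX ler_ln ?posrE ?ltr0n ?expn_gt0 ?X0 //.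
  by rewrite ler_nat.
have lnX : ln X%:R <= 6 * ln D.+1%:R :> R.
  rewrite mulr_natl -lnXn ?ltr0n // -natrX ler_ln ?posrE ?ltr0n ?expn_gt0 //; by rewrite ler_nat ltnW.
have l2 : 0 <= ln 2 :> R by rewrite ln_ge0 // ler1n.
have : X%:R <= 3 * n%:R :> R by rewrite -natrM ler_nat.
move=> hX; apply: (@le_trans _ _ (3 * n%:R * ln 2)); first by rewrite ler_wpM2r.
apply: (@le_trans _ _ (3 * ((npr X)%:R * (6 * ln D.+1%:R)))); last by rewrite le_eqVlt; apply/orP; left; apply/eqP; ring.
by rewrite -mulrA ler_wpM2l // (le_trans lnh) // ler_wpM2l.
Qed.
Variables (S : nat -> bool) (eps : int).
Hypothesis e0 : eps != 0.
Hypothesis H : forall j, exists l, [/\ size l = j, good l &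
  forall m, prime m -> S m -> (4 * lprod l < m)%N -> all (fun n : nat => legendre n%:Z m == eps) l].
(** The main term of [count_bound] over Chebyshev's bound is a constant times 2^-j, so j is chosen
    first; the list, B and finally X follow. *)
Lemma ratio_small (e : R) : 0 < e -> exists N, forall X, (N <= X)%N -> (cnt S X)%:R / (npr X)%:R <= e.
Proof.
move=> ep; have l2 : 0 < ln 2 :> R by rewrite ln_gt0 // ltr1n.
pose c : R := 18 / ln 2; have c0 : 0 < c by rewrite divr_gt0.
have [j hj] : exists j, 2 * c / 2 ^+ j <= e / 2.
  have [j hj] : exists j : nat, 4 * c / e < j%:R by eexists; exact: truncnS_gt.
  exists j; have : (j%:R : R) <= 2 ^+ j by rewrite -natrX ler_nat ltnW // ltn_expl.
  rewrite ler_pdivrMr ?exprn_gt0 //; move: hj; rewrite ltr_pdivrMr //; move: (2 ^+ j) (j%:R : R) => x y; nra.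
have [l [sl gl HS]] := H j; set B := (4 * lprod l)%N in HS.
have [D0 hD0] : exists D0 : nat, c * (2 + 3 * B%:R) * 2 / e < D0%:R by eexists; exact: truncnS_gt.
exists (maxn 2 (maxn B (D0.+1 ^ 6))) => X; rewrite !geq_max => /and3P[X2 XB XD].
(* D is about X^(1/6): with ln (D + 1) <= D, the sieve error D^4 costs at most a constant times D^5,
   which is small against X. *)
have [D /andP[D1 D2]] := @root_floor 6 X isT.
have DD : (D0 < D)%N by rewrite -ltnS -(ltn_exp2r _ _ (isT : 0 < 6)%N); exact: leq_ltn_trans XD D2.
have Dp : (0 < D)%N by apply: leq_ltn_trans DD.
have ch := cheb_real X2 D2; have cb := @count_bound R S eps l e0 gl HS X D Dp; rewrite sl in cb.
have X0 : 0 < X%:R :> R by rewrite ltr0n (leq_trans _ X2).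
set la := ln D.+1%:R in ch cb.
have la0 : 0 < la by rewrite ln_gt0 // ltr1n ltnS.
have laD : la <= D%:R by have := @le_ln1Dx R D%:R; rewrite nat1r; apply; rewrite (lt_le_trans (_ : -1 < 0)) // ltrN10.
have np0 : 0 < (npr X)%:R :> R.
  rewrite ltr0n lt0n; apply: contraTneq ch => ->; rewrite mulr0 -ltNge mulr_gt0 //.
rewrite ler_pdivrMr //.
have key : X%:R * (cnt S X)%:R <= e * la^-1 * (ln 2 / 18) * X%:R ^+ 2.
  have Dr : 1 <= D%:R :> R by rewrite ler1n.
  have XD6 : D%:R ^+ 6 <= X%:R :> R by rewrite -natrX ler_nat.
  have BX : B%:R <= X%:R :> R by rewrite ler_nat.
  rewrite expr2 mulrCA ler_wpM2l ?(ltW X0) //; apply: le_trans cb _; rewrite -/B.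
  have -> : e / la * (ln 2 / 18) * X%:R = e * X%:R / (c * la) by rewrite /c; field; rewrite !gt_eqF.
  have E1 : (D + B).+1%:R = D%:R + B%:R + 1 :> R by rewrite -natr1 natrD.
  have cl0 : 0 < c * la := mulr_gt0 c0 la0.
  rewrite E1 (natrD _ X) ler_pdivlMr //.
  have t1 : (X%:R + B%:R) / (2 ^+ j * la) * (c * la) <= e / 2 * X%:R.
    have -> : (X%:R + B%:R) / (2 ^+ j * la) * (c * la) = (X%:R + B%:R) * (c / 2 ^+ j) by field; rewrite !gt_eqF.
    apply: le_trans (_ : X%:R * (2 * c / 2 ^+ j) <= _); last by rewrite mulrC ler_wpM2r // ltW.
    have : 0 <= c / 2 ^+ j by rewrite divr_ge0 // ltW.
    rewrite -[2 * c / _]mulrA; move: (c / 2 ^+ j) => y; nra.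
  have t2 : (D%:R + B%:R + 1 + 2 * B%:R * D%:R ^+ 4) * (c * la) <= e / 2 * X%:R.
    apply: (@le_trans _ _ (((2 + 3 * B%:R) * D%:R ^+ 4) * (c * D%:R))).
      have D4 : D%:R <= D%:R ^+ 4 :> R by rewrite -{1}(expr1 (D%:R : R)) ler_weXn2l.
      have D4' : 1 <= D%:R ^+ 4 :> R by rewrite exprn_ege1.
      have B1 : 0 <= B%:R :> R by [].
      have h1 : c * la <= c * D%:R by rewrite ler_pM2l.
      have h2 : D%:R + B%:R + 1 + 2 * B%:R * D%:R ^+ 4 <= (2 + 3 * B%:R) * D%:R ^+ 4 :> R.
        by move: (D%:R ^+ 4) D4 D4' => y D4 D4'; nra.
      apply: le_trans (_ : (2 + 3 * B%:R) * D%:R ^+ 4 * (c * la) <= _); first by rewrite ler_wpM2r // ltW.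
      by rewrite ler_wpM2l // mulr_ge0 ?exprn_ge0 ?addr_ge0 // mulr_ge0.
    apply: le_trans (_ : e / 2 * D%:R ^+ 6 <= _); last by rewrite ler_wpM2l // divr_ge0 // ltW.
    have -> : (2 + 3 * B%:R) * D%:R ^+ 4 * (c * D%:R) = (c * (2 + 3 * B%:R)) * D%:R ^+ 5 by ring.
    have -> : e / 2 * D%:R ^+ 6 = (e / 2 * D%:R) * D%:R ^+ 5 by ring.
    rewrite ler_wpM2r ?exprn_ge0 //; move: hD0; rewrite ltr_pdivrMr //.
    have : D0%:R <= D%:R :> R by rewrite ler_nat ltnW.
    move: (c * (2 + 3 * B%:R)) (D0%:R : R) (D%:R : R) => x y z; nra.
  move: t1 t2; move: ((X%:R + B%:R) / _) (D%:R ^+ 4) => y z; nra.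
have : (cnt S X)%:R <= e / la * (ln 2 / 18) * X%:R.
  by rewrite -(ler_pM2l X0); apply: le_trans key _; rewrite expr2 mulrCA.
move=> h; apply: le_trans h _; rewrite -!mulrA ler_wpM2l ?(ltW ep) //.
have -> : la^-1 * (ln 2 * (18^-1 * X%:R)) = X%:R * ln 2 / (18 * la) by field; rewrite gt_eqF.
by rewrite ler_pdivrMr ?mulr_gt0 // [leRHS]mulrC.
Qed.
End DensityZero.

(** * Sparse supports and the conclusion *)

(** Peel off the smallest prime factor: an odd exponent puts one copy of it, a divisor of W, into t
    and the rest into f. *)
Lemma square_part (W n : nat) : (0 < W)%N -> (0 < n)%N -> (forall p, prime p -> ~~ (p %| W)%N -> ~~ odd (logn p n)) ->
  exists t f : nat, n = (t * f ^ 2)%N /\ (t %| W)%N.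
Proof.
move=> W0; elim: n {-2}n (leqnn n) => [|k IH] n nk n0 H; first by move: n0; rewrite ltnNge nk.
have [n1|n1] := leqP n 1; first by exists 1%N, 1%N; split; [move: n0 n1; clear; lia|exact: dvd1n].
have pp := pdiv_prime n1; set p := pdiv n in pp; have [m cm en] := pfactor_coprime pp n0.
set e := logn p n in en; have e0 : (0 < e)%N by rewrite logn_gt0 mem_primes pp n0 pdiv_dvd.
have m0 : (0 < m)%N by move: n0; rewrite {1}en muln_gt0 => /andP[].
have mn : (m < n)%N by rewrite {1}en ltn_Pmulr // -(exp1n e) ltn_exp2r // prime_gt1.
have [|q pq nq|t [f [mE tW]]] := IH m _ m0.
- by rewrite -ltnS (leq_trans mn).
- have [qp|ne] := eqVneq q p; first by have -> : logn q m = 0%N by [rewrite qp; apply: logn_coprime].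
  have := H q pq nq; have pe0 : (0 < p ^ e)%N by rewrite expn_gt0 prime_gt0.
  rewrite en (lognM q m0 pe0) lognX (logn_prime q pp) (negbTE ne) muln0 addn0.
  by [].
have [h he] : exists h, e = (odd e + h * 2)%N by exists e./2; rewrite muln2 odd_double_half.
case oe : (odd e) he => he.
  have pW : (p %| W)%N by apply: contraT => nW; have := H p pp nW; rewrite -/e oe.
  exists (p * t)%N, (f * p ^ h)%N; split.
    transitivity (t * f ^ 2 * p ^ e)%N; first by rewrite {1}en mE.
    rewrite he add1n (expnS p) (expnM p) expnMn; move: (f ^ 2)%N ((p ^ h) ^ 2)%N (p : nat) => x y q.
    by rewrite mulnACA [(t * q)%N]mulnC.
  rewrite Gauss_dvd ?pW ?tW //; apply: (coprime_dvdr _ cm); by rewrite mE dvdn_mulr.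
exists t, (f * p ^ h)%N; split=> //.
by transitivity (t * f ^ 2 * p ^ e)%N; [rewrite {1}en mE|rewrite he add0n (expnM p) expnMn mulnA].
Qed.
(** The pair (t, f) determines n, with t <= W and f at most the square root of X. For X >= 2 the
    factor 1/ln 2 in K pays for the logarithm. *)
Lemma square_count (R : realType) (W : nat) (P : nat -> bool) : (0 < W)%N ->
  (forall n, P n -> exists t f : nat, n = (t * f ^ 2)%N /\ (t %| W)%N) ->
  exists (K : R) (X0 : nat), 0 < K /\ forall X : nat, (X0 <= X)%N ->
    ((\sum_(n < X.+1 | P n) 1)%N%:R : R) <= K * Num.sqrt X%:R * ln X%:R.
Proof.
move=> W0 H; have l2 : 0 < ln 2 :> R by rewrite ln_gt0 // ltr1n.
exists (2 * W.+1%:R / ln 2), 2%N; split; first by rewrite divr_gt0 // mulr_gt0.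
move=> X X2; have [Y /andP[Y1 Y2]] := @root_floor 2 X isT.
have c : (\sum_(n < X.+1 | P n) 1 <= W.+1 * Y.+1)%N.
  rewrite sum1_card -[W.+1]card_ord -[Y.+1]card_ord -card_prod.
  pose h (z : 'I_W.+1 * 'I_Y.+1) : 'I_X.+1 := inord (z.1 * z.2 ^ 2).
  rewrite -cardsT; apply: leq_trans (leq_imset_card h _); apply: subset_leq_card; apply/fintype.subsetP => n Pn.
  have [t [f [nE tW]]] := H n Pn; have nX := ltn_ord n.
  have tW' : (t < W.+1)%N by rewrite ltnS dvdn_leq.
  have t0 : (0 < t)%N by rewrite (dvdn_gt0 W0).
  have fY : (f < Y.+1)%N.
    rewrite -(ltn_exp2r _ _ (isT : 0 < 2)%N); apply: leq_ltn_trans Y2; rewrite -ltnS; apply: leq_ltn_trans nX.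
    by rewrite nE leq_pmull.
  apply/finset.imsetP; exists (Ordinal tW', Ordinal fY); first by rewrite inE.
  by apply: val_inj; rewrite /h /= -nE inordK.
have s1 : 1 <= Num.sqrt X%:R :> R by rewrite -[leLHS]sqrtr1 ler_sqrt // ler1n ltnW.
have sY : Y%:R <= Num.sqrt X%:R :> R.
  by rewrite -(ger0_norm (ler0n R Y)) -sqrtr_sqr ler_sqrt // -natrX ler_nat.
have lX : ln 2 <= ln X%:R :> R by rewrite ler_ln ?posrE ?ltr0n ?(leq_trans _ X2) // ler_nat.
apply: (@le_trans _ _ (W.+1 * Y.+1)%N%:R); first by rewrite ler_nat.
apply: (@le_trans _ _ (W.+1%:R * (2 * Num.sqrt X%:R))).
  by rewrite natrM ler_wpM2l // -natr1; move: s1 sY; lra.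
have -> : 2 * W.+1%:R / ln 2 * Num.sqrt X%:R * ln X%:R = W.+1%:R * (2 * Num.sqrt X%:R) * (ln X%:R / ln 2) :> R.
  by field; rewrite gt_eqF.
by rewrite ler_peMr ?ler_pdivlMr ?mul1r // !mulr_ge0 // sqrtr_ge0.
Qed.

Theorem theorem4p1 (R : realType) (ell : nat) (r k2 : int) (a : nat -> R[i])
    (eps : int) :
  prime ell -> (5 <= ell)%N -> coprime `|r|%N 24 ->
  cusp_form ell k2 r a ->
  ~ congf ell a (fun _ => 0) ->
  (eps = 1 \/ eps = -1) ->
  let S : nat -> Prop := fun p =>
    [/\ prime p,
        (exists c : R[i], [/\ in_Oell ell c, ~ congl ell c 0 &
            congf ell (Uop p a) (fun n => c * Vop p a n)]) &
        congf ell a (fun n => (if legendre n%:Z p == eps then a n else 0)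
                              + (if (p ^ 2 %| n)%N then a n else 0))] in
  density_zero R S \/
  ((exists (K : R) (X0 : nat), 0 < K /\
      forall X : nat, (X0 <= X)%N ->
        ((\sum_(n < X.+1 | `[< ~ congl ell (a n) 0%R >]) 1)%N%:R : R)
          <= K * Num.sqrt (X%:R) * ln (X%:R)) /\
   (forall Q : nat, prime Q -> (ell %| Q.+1)%N ->
      congf ell (Top Q k2 a) (fun _ => 0))).
Proof.
move=> pell ell5 cr cf nz heps S.
have nI n : congl ell (a n) 0 = I_ ell (a n) by exact: conglE.
have [n0 hn0] : exists n, ~ I_ ell (a n).
  by apply: contrapT => h; apply: nz => n; rewrite nI; apply: contrapT => h'; apply: h; exists n.
have anz : exists n, a n != 0.
  by exists n0; apply/eqP => e; apply: hn0; rewrite e; exact: I0.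
have a0 : a 0%N = 0 by case: cf.
have npos n : ~ I_ ell (a n) -> (0 < n)%N.
  by move=> h; rewrite lt0n; apply/eqP => e; apply: h; rewrite e a0; exact: I0.
have [w1 ew1] := weight4 cf anz.
have or : odd `|r|.
  by have : coprime `|r| 2 by [exact: coprime_dvdr (isT : 2 %| 24)%N cr]; rewrite coprimen2.
have [r1 er1] : exists r1, r + 1 = 2 * r1.
  by exists ((r + 1) %/ 2)%Z; clear -or; lia.
have ao n : ~ I_ ell (a n) -> odd n.
  move=> h; have an : a n != 0 by apply/eqP => e; apply: h; rewrite e; exact: I0.
  by have /dvdzP[x hx] := a_supp pell cf ew1 an; clear -or hx; lia.
have e0 : eps != 0 by case: heps => ->.
(* W is divisible by every prime that occurs to an odd power in some n of the support; such a W
   exists exactly when the squarefree kernels form a finite set. *)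
have [[W [W0 hW]]|inf] := pselect (exists W : nat, (0 < W)%N /\ forall n, ~ I_ ell (a n) ->
    forall p, prime p -> ~~ (p %| W)%N -> ~~ odd (logn p n)).
  right; have fin n : ~ I_ ell (a n) -> exists t f : nat, n = (t * f ^ 2)%N /\ (t %| W)%N.
    by move=> h; apply: square_part => //; [exact: npos|exact: hW].
  split; last by move=> Q pQ lQ; exact: (Top_zero pell ell5 cf ew1 er1 W0 ao fin pQ lQ).
  apply: (square_count R W0 (P := fun n => `[< ~ congl ell (a n) 0 >])) => n /asboolP; rewrite nI; exact: fin.
left; apply/cvgr0Pnorm_le => e ep.
have [|N hN] := @ratio_small R (fun p => `[< S p >]) eps e0 _ e ep; last first.
  by exists N => // X /= NX; rewrite ger0_norm ?divr_ge0 //; exact: hN.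
have ex (j : nat) : exists l, [/\ size l = j, good l & forall n, n \in l -> ~ I_ ell (a n)].
  elim: j => [|j [l [sl gl al]]]; first by exists [::].
  have l0 : (0 < lprod l)%N.
    have : forall n, n \in l -> (0 < n)%N by move=> n /al; exact: npos.
    elim: (l) => [|n s IH] h; first by rewrite /lprod big_nil.
    by rewrite lprod_cons muln_gt0 h ?mem_head // IH // => m ms; apply: h; rewrite inE ms orbT.
  (* If the list could not be extended, the product of its entries would serve as W. *)
  apply: contrapT => H; apply: inf; exists (lprod l); split=> // n na p pp np; apply/negP => on; apply: H.
  exists (n :: l); split; first by rewrite /= sl.
    split; [exact: ao|by []|exists p; split=> //; apply/allP => m ml].
    by apply: contra np => /dvdn_trans; apply; exact: mem_dvd_lprod.
  by move=> m; rewrite inE => /orP[/eqP->|/al].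
move=> j; have [l [sl gl al]] := ex j; exists l; split=> // m pm /asboolP[_ _ Sm] lm; apply/allP => n nl.
have na := al n nl; have np := npos n na.
have nm : (n < m)%N.
  apply: leq_ltn_trans lm; apply: leq_trans (leq_pmull _ (isT : 0 < 4)%N); apply: dvdn_leq; last exact: mem_dvd_lprod.
  elim: (l) al => [|x s IH] h; first by rewrite /lprod big_nil.
  by rewrite lprod_cons muln_gt0 (npos _ (h x (mem_head _ _))) IH // => y ys; apply: h; rewrite inE ys orbT.
(* As m > n, m^2 does not divide n, and condition (ii) at n leaves a(n) = 0 modulo [ell] unless
   (n/m) = eps. *)
apply/negP => /negP ne; apply: na; have := Sm n; rewrite (negbTE ne).
have -> : (m ^ 2 %| n)%N = false.
  apply/negbTE/negP => /(dvdn_leq np); apply/negP; rewrite -ltnNge (leq_trans nm) // -{1}(expn1 m) leq_pexp2l //.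
  exact: prime_gt0.
by rewrite addr0 nI.
Qed.
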